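(* Let $T$ be an A2 tiling of a convex set $C\subset\mathbb R^2$ (i.e. $[T]=C$ is convex). Then $C$ is either the whole plane, or a half-plane, or a quadrant. Moreover: (a) Every A2 tiling of the entire plane is either an infinite supertile, or a disjoint union of two A2 tilings of half-planes; in the second case these two tilings of half-planes are mirror images of each other under reflection in the line that separates the half-planes. (b) Every A2 tiling of a half-plane is either an infinite supertile, or a disjoint union of two A2 tilings of quadrants; in the second case these two tilings of quadrants are mirror images of each other under reflection in the line that separates the quadrants. (c) For every real $d>0$ there are, up to congruence, exactly three different A2 $d$-tilings of a quadrant, and all of them are infinite supertiles.
   Context: **Tiles.** Let $\psi=\sqrt{(\sqrt5-1)/2}$, so $\psi^4+\psi^2=1$. Let $B$ be the closed hexagonal region with consecutive vertices $(0,0),(\psi,0),(\psi,\psi^2),(\psi^3,\psi^2),(\psi^3,1),(0,1)$. A tile (Golden Bee) of size $d>0$ is any set $f(B)$, where $f$ is a similarity of the plane (orientation-reversing ones allowed) with ratio $d$; its longest side has length $d$. Since $B$ has no nontrivial symmetry, $f$ is determined by the tile. $B$ is the union of two interior-disjoint tiles: $G_0$ (size $\psi$) with vertices $(0,0),(\psi,0),(\psi,\psi^2),(\psi^5,\psi^2),(\psi^5,\psi^4),(0,\psi^4)$ and $F_0$ (size $\psi^2$) with vertices $(0,\psi^4),(\psi^5,\psi^4),(\psi^5,\psi^2),(\psi^3,\psi^2),(\psi^3,1),(0,1)$. For a tile $H=f(B)$, the son of $H$ is $f(G_0)$ and the daughter of $H$ is $f(F_0)$. **Tilings and substitution.** Large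 $d$-tiles are tiles of size $d$, small $d$-tiles are tiles of size $\psi d$; a $d$-tile is a large or small $d$-tile. A $d$-tiling is a non-empty set of $d$-tiles with pairwise disjoint interiors; a tiling is a $d$-tiling for some $d$. $[T]$ is the union of the tiles of $T$; $T$ is a tiling of the set $[T]$. For a $d$-tiling $T$, $\sigma T$ is the $d\psi$-tiling obtained by replacing each large $d$-tile by its son and daughter and keeping small $d$-tiles. Half-planes and quadrants are closed; a quadrant is a region bounded by two orthogonal rays with common origin (a $90^\circ$ angle). Tilings $T,S$ are congruent if $T=\{f(H): H\in S\}$ for some isometry $f$ of the plane (reflections allowed). **Supertiles.** For $n\ge0$, a $d$-supertile of level $n$ is $\sigma^n(\{H\})$, where $\{H\}$ is the $d/\psi^n$-tiling consisting of one tile $H$ of size $d/\psi^n$. A $d$-supertile of level $-1$ consists of a single small $d$-tile. An infinite $d$-supertile is a union of an infinite chain $T_0\subset T_1\subset T_2\subset\cdots$ of $d$-supertiles such that for all $n$ the tile $[T_n]$ is the son or the daughter of the tile $[T_{n+1}]$. An infinite supertile is an infinite $d$-supertile for some $d$. **Arrow rule.** Boundaries of $d$-tiles are divided into directed segments with colors in $\{3,4,5,6\}$ (color $i$ has length $d\psi^i$). Below, $P\to Q: i$ means the segment directed from $P$ to $Q$ with color $i$, given for $B$ and carried to the tile $f(B)$ by $f$. Large $d$-tile ($f$ of ratio $d$): $(0,0)\to(0,\psi^4):4$; $(0,2\psi^4)\to(0,\psi^4):4$; $(0,1)\to(0,2\psi^4):6$; $(\psi,0)\to(\psi^3,0):5$;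 $(\psi^3,0)\to(0,0):3$; $(\psi,\psi^2)\to(\psi,\psi^4):6$; $(\psi,\psi^4)\to(\psi,0):4$; $(\psi^3,\psi^2)\to(\psi,\psi^2):5$; $(\psi^3,1)\to(\psi^3,\psi^2):4$; $(0,1)\to(\psi^3,1):3$. Small $d$-tile ($f$ of ratio $d\psi$): $(0,0)\to(0,\psi^4):5$; $(0,\psi^4)\to(0,1):3$; $(\psi,0)\to(\psi^3,0):6$; $(\psi^3,0)\to(0,0):4$; $(\psi,0)\to(\psi,\psi^2):3$; $(\psi^3,\psi^2)\to(\psi,\psi^2):6$; $(\psi^3,1)\to(\psi^3,\psi^2):5$; $(0,1)\to(\psi^3,1):4$. A $d$-tiling satisfies the Arrow rule if, whenever a segment $e$ of one tile and a segment $e'$ of another tile have more than one common point, they coincide as segments and have the same color and the same direction. An A2 ($d$-)tiling is a ($d$-)tiling that satisfies the Arrow rule. *)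

(* Defs.v *)
From mathcomp Require Import all_boot all_order all_algebra.
From mathcomp Require Import all_classical all_reals all_analysis.

Set Implicit Arguments.
Unset Strict Implicit.
Unset Printing Implicit Defensive.

Import Order.TTheory GRing.Theory Num.Theory.
Import numFieldNormedType.Exports.

Local Open Scope classical_set_scope.
Local Open Scope ring_scope.

(* The product norm on [plane R] is the sup norm: the library's topology and
   linear structure are used below, but every metric notion goes through [edist]. *)
Definition plane (R : realType) := (R^o * R^o)%type.

Definition psi (R : realType) : R := Num.sqrt ((Num.sqrt 5 - 1) / 2).

Section Geometry.
Variable R : realType.
Implicit Types (f : plane R -> plane R) (p q n u v : plane R) (A : set (plane R)).

Definition dot p q : R := p.1 * q.1 + p.2 * q.2.

Definition edist p q : R := Num.sqrt (dot (p - q) (p - q)).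

Definition similarity (r : R) f : Prop :=
  0 < r /\ forall p q, edist (f p) (f q) = r * edist p q.

Definition isometry f : Prop := forall p q, edist (f p) (f q) = edist p q.

Definition segment p q : set (plane R) :=
  [set x | exists2 t : R, 0 <= t <= 1 & x = p + t *: (q - p)].

Definition half_plane A : Prop :=
  exists n (c : R), n != 0 /\ A = [set p | c <= dot n p].

Definition quadrant A : Prop :=
  exists o u v, [/\ u != 0, v != 0, dot u v = 0 &
    A = [set p | exists s t : R, [/\ 0 <= s, 0 <= t & p = o + s *: u + t *: v]]].

(* Reflection in the line [dot n p = c], for [n != 0]. *)
Definition reflection n (c : R) p : plane R :=
  p - (2 * (dot n p - c) / dot n n) *: n.

End Geometry.

Section Tiles.
Variable R : realType.
Local Notation psi := (psi R).
Implicit Types (d : R) (H K : set (plane R)).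

Definition rect (x0 x1 y0 y1 : R) : set (plane R) :=
  [set p | x0 <= p.1 <= x1 /\ y0 <= p.2 <= y1].

(* The L-shaped hexagon with vertices (0,0), (psi,0), (psi,psi^2),
   (psi^3,psi^2), (psi^3,1), (0,1), cut into two overlapping rectangles. *)
Definition bee : set (plane R) :=
  rect 0 psi 0 (psi ^+ 2) `|` rect 0 (psi ^+ 3) 0 1.

(* The hexagon with vertices (0,0), (psi,0), (psi,psi^2), (psi^5,psi^2),
   (psi^5,psi^4), (0,psi^4). *)
Definition bee_son : set (plane R) :=
  rect 0 psi 0 (psi ^+ 4) `|` rect (psi ^+ 5) psi 0 (psi ^+ 2).

(* The hexagon with vertices (0,psi^4), (psi^5,psi^4), (psi^5,psi^2),
   (psi^3,psi^2), (psi^3,1), (0,1). *)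
Definition bee_daughter : set (plane R) :=
  rect 0 (psi ^+ 5) (psi ^+ 4) 1 `|` rect 0 (psi ^+ 3) (psi ^+ 2) 1.

Definition is_tile d H : Prop := exists2 f, similarity d f & H = f @` bee.

Definition is_son K H : Prop :=
  exists d f, [/\ similarity d f, H = f @` bee & K = f @` bee_son].

Definition is_daughter K H : Prop :=
  exists d f, [/\ similarity d f, H = f @` bee & K = f @` bee_daughter].

Definition large_tile d H : Prop := is_tile d H.
Definition small_tile d H : Prop := is_tile (psi * d) H.

End Tiles.

(* A tiling is a set of tiles, each tile being a set of points. *)
Definition tileset (R : realType) := set (set (plane R)).

Section Tilings.
Variable R : realType.
Local Notation psi := (psi R).
Implicit Types (d : R) (T S : tileset R).

Definition d_tiling d T : Prop :=
  [/\ 0 < d, T !=set0,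
      forall H, T H -> large_tile d H \/ small_tile d H &
      forall H K, T H -> T K -> H <> K -> H° `&` K° = set0].

Definition covered T : set (plane R) := \bigcup_(H in T) H.

Definition image_tiling (f : plane R -> plane R) T : tileset R :=
  [set f @` H | H in T].

Definition congruent T S : Prop :=
  exists2 f, isometry f & T = image_tiling f S.

Definition substitution d T : tileset R :=
  [set K | (T K /\ small_tile d K) \/
           exists H, [/\ T H, large_tile d H & is_son K H \/ is_daughter K H]].

(* Each substitution turns a d-tiling into a (d * psi)-tiling, so the scale
   parameter changes along the iteration. *)
Fixpoint iter_substitution (n : nat) d T : tileset R :=
  if n is m.+1 then iter_substitution m (d * psi) (substitution d T) else T.

(* The first disjunct is level -1, the second one level n. *)
Definition supertile d T : Prop :=
  (exists2 H, small_tile d H & T = [set H]) \/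
  (exists n H, is_tile (d / psi ^+ n) H /\
               T = iter_substitution n (d / psi ^+ n) [set H]).

Definition infinite_d_supertile d T : Prop :=
  0 < d /\
  exists C : nat -> tileset R,
    [/\ forall n, supertile d (C n),
        forall n, C n `<=` C n.+1,
        forall n, is_son (covered (C n)) (covered (C n.+1)) \/
                  is_daughter (covered (C n)) (covered (C n.+1)) &
        T = \bigcup_n C n].

Definition infinite_supertile T : Prop := exists d, infinite_d_supertile d T.

End Tilings.

Section ArrowRule.
Variable R : realType.
Local Notation psi := (psi R).

(* A coloured directed segment: ((source, target), colour). *)
Definition arrow := ((plane R * plane R) * nat)%type.

Definition mk_arrow (x y x' y' : R) (i : nat) : arrow :=
  (((x, y) : plane R, (x', y') : plane R), i).

Definition large_arrows : seq arrow :=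
  [:: mk_arrow 0           0               0           (psi ^+ 4)     4;
      mk_arrow 0           (2 * psi ^+ 4)  0           (psi ^+ 4)     4;
      mk_arrow 0           1               0           (2 * psi ^+ 4) 6;
      mk_arrow psi         0               (psi ^+ 3)  0              5;
      mk_arrow (psi ^+ 3)  0               0           0              3;
      mk_arrow psi         (psi ^+ 2)      psi         (psi ^+ 4)     6;
      mk_arrow psi         (psi ^+ 4)      psi         0              4;
      mk_arrow (psi ^+ 3)  (psi ^+ 2)      psi         (psi ^+ 2)     5;
      mk_arrow (psi ^+ 3)  1               (psi ^+ 3)  (psi ^+ 2)     4;
      mk_arrow 0           1               (psi ^+ 3)  1              3].

Definition small_arrows : seq arrow :=
  [:: mk_arrow 0           0               0           (psi ^+ 4)     5;
      mk_arrow 0           (psi ^+ 4)      0           1              3;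
      mk_arrow psi         0               (psi ^+ 3)  0              6;
      mk_arrow (psi ^+ 3)  0               0           0              4;
      mk_arrow psi         0               psi         (psi ^+ 2)     3;
      mk_arrow (psi ^+ 3)  (psi ^+ 2)      psi         (psi ^+ 2)     6;
      mk_arrow (psi ^+ 3)  1               (psi ^+ 3)  (psi ^+ 2)     5;
      mk_arrow 0           1               (psi ^+ 3)  1              4].

Definition map_arrow (f : plane R -> plane R) (e : arrow) : arrow :=
  ((f e.1.1, f e.1.2), e.2).

Definition arrow_segment (e : arrow) : set (plane R) := segment e.1.1 e.1.2.

(* [e] is one of the arrows on the boundary of the d-tile [H]. *)
Definition tile_arrow (d : R) (H : set (plane R)) (e : arrow) : Prop :=
  (exists f, [/\ similarity d f, H = f @` @bee R &
     exists2 a, a \in large_arrows & e = map_arrow f a]) \/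
  (exists f, [/\ similarity (psi * d) f, H = f @` @bee R &
     exists2 a, a \in small_arrows & e = map_arrow f a]).

(* Equality of arrows means same source, same target and same colour. *)
Definition arrow_rule (d : R) (T : tileset R) : Prop :=
  forall H H' e e', T H -> T H' -> H <> H' ->
    tile_arrow d H e -> tile_arrow d H' e' ->
    (exists p q, p <> q /\
       (arrow_segment e `&` arrow_segment e') p /\
       (arrow_segment e `&` arrow_segment e') q) ->
    e = e'.

Definition A2_d_tiling (d : R) (T : tileset R) : Prop :=
  d_tiling d T /\ arrow_rule d T.

Definition A2_tiling (T : tileset R) : Prop := exists d, A2_d_tiling d T.

End ArrowRule.

Section Decompositions.
Variable R : realType.
Implicit Types (T : tileset R) (P : set (plane R) -> Prop).

(* [T] is the disjoint union of the A2 tilings [T1] and [T2] of two regions of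
   the kind described by [P]. *)
Definition A2_decomposition P T T1 T2 : Prop :=
  [/\ A2_tiling T1 /\ P (covered T1),
      A2_tiling T2 /\ P (covered T2),
      T1 `&` T2 = set0 &
      T = T1 `|` T2].

(* The regions covered by [T1] and [T2] lie on different sides of some line, and
   the reflection in that line exchanges the two tilings. *)
Definition mirror_images T1 T2 : Prop :=
  exists (n : plane R) (c : R),
    [/\ n != 0,
        covered T1 `<=` [set p | c <= dot n p],
        covered T2 `<=` [set p | dot n p <= c] &
        T2 = image_tiling (reflection n c) T1].

End Decompositions.

(* Main.v *)
Require Import Defs.
From mathcomp Require Import all_boot all_order all_algebra.
From mathcomp Require Import all_classical all_reals all_analysis.
From mathcomp Require Import ring lra zify.
Import Order.TTheory GRing.Theory Num.Theory.
Import numFieldNormedType.Exports.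
Local Open Scope classical_set_scope.
Local Open Scope ring_scope.

Set Implicit Arguments.
Unset Strict Implicit.
Unset Printing Implicit Defensive.

(* In an A2 tiling of a convex set, only the son of one and the same larger tile can fill the
   notch of a small tile. Hence the tiling is the substitution of a tiling of the next
   level, which is again A2: a coarse arrow of colour [i > 3] is a fine one of colour [i - 1],
   and a coarse arrow of colour 3 splits into fine ones of colours 6 and 4. Iterating, every
   flag, i.e. germ of a curve [h (t, t ^+ 2)] in the region, lies in a chain of supertiles. If
   the flag stays on the boundary of all of them, it runs along a sequence of arrows that a
   finite automaton describes, and the union of the chain is a half-plane or a quadrant; if no
   flag does so, the union is the plane. Along a line between two such unions the colours force
   both automata to make the same moves, whence the mirror symmetry. At the apex of a
   quadrant the corner tile runs through a cycle of length three as the level grows, and its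
   three phases are the three tilings of (c). *)

(** A tile determines its similarity frame, so tiles are replaced by frames, and the relations
    between tiles of different levels become products of frames. The germ is a parabola and not a
    ray because a parabola meets a line in at most two points: a flag is eventually inside or
    eventually outside a given tile, and a flag along a side records which side of it is meant. The
    obstacle in climbing one level is that fine arrows do not determine coarse ones: a coarse arrow
    of colour 5 and the part at the source of one of colour 3 both turn into a fine arrow of colour
    4. Convexity removes this ambiguity by forcing a tile into the right angle left free at the
    splitting point. One tiling may need several chains; their unions partition its tiles, and since
    each of them contains a quadrant, convexity leaves few ways to put them together. The mirror
    argument needs that no coarse tile crosses the separating line, which holds because the cut
    between son and daughter is a broken line. Existence in (c) rests on the converse passage:
    substitution preserves the arrow rule. *)

(** * Rational bounds for the powers of [psi] *)

Section Psi.
Variable R : realType.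
Local Notation p := (psi R).

Lemma ltr_of_sqr (a b : R) : 0 <= b -> a ^+ 2 < b ^+ 2 -> a < b.
Proof.
move=> b0 h; rewrite ltNge; apply/negP => ba.
by move: h; rewrite ltNge ler_sqr ?ba // nnegrE // (le_trans b0).
Qed.

Lemma sqrt5_bounds : 11/5 < (Num.sqrt 5 : R) < 9/4.
Proof.
have h : (Num.sqrt 5 : R) ^+ 2 = 5 by rewrite sqr_sqrtr.
apply/andP; split; apply: ltr_of_sqr; rewrite ?sqrtr_ge0 ?h; lra.
Qed.

Lemma psi_sqr : p ^+ 2 = (Num.sqrt 5 - 1) / 2.
Proof. by rewrite sqr_sqrtr //; have := sqrt5_bounds => /andP[? ?]; lra. Qed.

Lemma psi4 : p ^+ 4 = 1 - p ^+ 2.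
Proof.
have -> : p ^+ 4 = (p ^+ 2) ^+ 2 by rewrite -exprM.
have h : (Num.sqrt 5 : R) ^+ 2 = 5 by rewrite sqr_sqrtr.
by rewrite psi_sqr; field: h.
Qed.

Lemma psi_gt0 : 0 < p.
Proof. by rewrite sqrtr_gt0; have := sqrt5_bounds => /andP[? ?]; lra. Qed.

(** With these enclosures and the last equation, comparisons between coordinates of vertices become
    linear problems in [p], [p ^+ 2] and [p ^+ 3]. *)
Lemma psi_bounds : [/\ 3/4 < p < 4/5, 3/5 < p ^+ 2 < 5/8,
  9/20 < p ^+ 3 < 1/2 & p ^+ 4 = 1 - p ^+ 2].
Proof.
have h0 := psi_gt0.
have h2 : 3/5 < p ^+ 2 < 5/8.
  by rewrite psi_sqr; have := sqrt5_bounds => /andP[? ?]; apply/andP; split; lra.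
have h1 : 3/4 < p < 4/5.
  move: h2 => /andP[? ?].
  by apply/andP; split; apply: ltr_of_sqr; try lra.
split; rewrite ?psi4; try lra.
have -> : p ^+ 3 = p * p ^+ 2 by ring.
move: h1 h2 => /andP[? ?] /andP[? ?].
have k1 : 3/4 * (3/5) < p * p ^+ 2 by apply: ltr_pM; lra.
have k2 : p * p ^+ 2 < 4/5 * (5/8) by apply: ltr_pM; lra.
by apply/andP; split; lra.
Qed.
End Psi.

(* Affine maps of the plane; column vectors [(ux, uy)] and [(vx, vy)]. *)
Record frame (R : realType) := Frame {ox : R; oy : R; ux : R; uy : R; vx : R; vy : R}.
Arguments Frame {R}.

Local Notation edist := Defs.edist.

(** * Similarities of the plane as affine frames *)

Section Frames.
Variable R : realType.
Implicit Types (f g h : frame R) (q : plane R) (r : R).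

Definition app f q : plane R :=
  (ox f + ux f * q.1 + vx f * q.2, oy f + uy f * q.1 + vy f * q.2).

Definition fmul f g : frame R :=
  Frame (ox f + ux f * ox g + vx f * oy g) (oy f + uy f * ox g + vy f * oy g)
        (ux f * ux g + vx f * uy g) (uy f * ux g + vy f * uy g)
        (ux f * vx g + vx f * vy g) (uy f * vx g + vy f * vy g).

Definition fone : frame R := Frame 0 0 1 0 0 1.

(** The linear part is the transpose divided by the squared ratio, which inverts the linear part of
    a similarity. *)
Definition finv f : frame R :=
  let n := ux f ^+ 2 + uy f ^+ 2 in
  Frame (- (ux f * ox f + uy f * oy f) / n) (- (vx f * ox f + vy f * oy f) / n)
        (ux f / n) (vx f / n) (uy f / n) (vy f / n).

Definition fr r f : Prop :=
  [/\ 0 < r, ux f ^+ 2 + uy f ^+ 2 = r ^+ 2, vx f ^+ 2 + vy f ^+ 2 = r ^+ 2 &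
      ux f * vx f + uy f * vy f = 0].

Local Notation "f ** g" := (fmul f g) (at level 40, left associativity).

Lemma fmulA f g h : f ** (g ** h) = f ** g ** h.
Proof. by congr Frame => /=; ring. Qed.

Lemma fmul1f f : fone ** f = f.
Proof. by case: f => *; congr Frame => /=; ring. Qed.

Lemma fmulf1 f : f ** fone = f.
Proof. by case: f => *; congr Frame => /=; ring. Qed.

Lemma app_mul f g q : app (f ** g) q = app f (app g q).
Proof. by congr pair => /=; ring. Qed.

Lemma app_one q : app fone q = q.
Proof. by case: q => x y; congr pair => /=; ring. Qed.

(** With [k] the determinant, the second column is [k / r ^+ 2] times the first one turned by a
    right angle, and [k ^+ 2 = r ^+ 2 * r ^+ 2]. The two signs of [k] are the two orientations. *)
Lemma fr_orient r f : fr r f ->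
  (vx f = - uy f /\ vy f = ux f) \/ (vx f = uy f /\ vy f = - ux f).
Proof.
case=> r0 hu hv huv; set a := ux f in hu huv *; set b := uy f in hu huv *.
set c := vx f in hv huv *; set d := vy f in hv huv *.
have r2 : r ^+ 2 != 0 by rewrite expf_neq0 // gt_eqF.
set k := a * d - b * c.
have hbd : b * d = - (a * c) by lra.
have hc : c * r ^+ 2 = - k * b by rewrite -hu /k; ring: hbd.
have hd : d * r ^+ 2 = k * a by rewrite -hu /k; ring: hbd.
have : (k - r ^+ 2) * (k + r ^+ 2) = 0.
  have -> : (k - r ^+ 2) * (k + r ^+ 2) = k ^+ 2 - r ^+ 2 * r ^+ 2 by ring.
  by rewrite -{1}hu -hv /k; ring: hbd.
move/eqP; rewrite mulf_eq0 => /orP[] /eqP h; [left|right].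
  by split; apply: (mulIf r2); rewrite ?hc ?hd (_ : k = r ^+ 2); [ring|lra|ring|lra].
by split; apply: (mulIf r2); rewrite ?hc ?hd (_ : k = - r ^+ 2); [ring|lra|ring|lra].
Qed.

Lemma finvK r f : fr r f -> finv f ** f = fone.
Proof.
move=> hf; have [r0 hu hv huv] := hf.
have n2 : ux f ^+ 2 + uy f ^+ 2 != 0 by rewrite hu expf_neq0 // gt_eqF.
by rewrite /fmul /finv /=; case: (fr_orient hf) => -[-> ->]; congr Frame => /=; field.
Qed.

Lemma finvKr r f : fr r f -> f ** finv f = fone.
Proof.
move=> hf; have [r0 hu hv huv] := hf.
have n2 : ux f ^+ 2 + uy f ^+ 2 != 0 by rewrite hu expf_neq0 // gt_eqF.
by rewrite /fmul /finv /=; case: (fr_orient hf) => -[-> ->]; congr Frame => /=; field.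
Qed.

Lemma fr_mul r s f g : fr r f -> fr s g -> fr (r * s) (f ** g).
Proof.
case=> r0 hu hv huv [s0 ku kv kuv].
have E a b c d : (ux f * a + vx f * b) * (ux f * c + vx f * d) +
   (uy f * a + vy f * b) * (uy f * c + vy f * d) = r ^+ 2 * (a * c + b * d).
  transitivity ((ux f ^+ 2 + uy f ^+ 2) * (a * c) + (vx f ^+ 2 + vy f ^+ 2) * (b * d) +
    (ux f * vx f + uy f * vy f) * (a * d + b * c)); first ring.
  by rewrite hu hv huv; ring.
by split; rewrite /= ?mulr_gt0 // ?expr2 E -?expr2 ?ku ?kv ?kuv; ring.
Qed.

Lemma fr_inv r f : fr r f -> fr r^-1 (finv f).
Proof.
move=> hf; have [r0 hu hv huv] := hf.
have n2 : ux f ^+ 2 + uy f ^+ 2 != 0 by rewrite hu expf_neq0 // gt_eqF.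
split; rewrite /finv /= ?invr_gt0 // ?exprVn -?hu.
all: by case: (fr_orient hf) => -[e1 e2]; rewrite ?e1 ?e2; field.
Qed.

Lemma fr_one : fr 1 fone.
Proof. by split; rewrite /= ?ltr01 //; ring. Qed.

Lemma fmulVf r f g : fr r f -> finv f ** (f ** g) = g.
Proof. by move=> hf; rewrite fmulA (finvK hf) fmul1f. Qed.

Lemma fmulfV r f g : fr r f -> f ** (finv f ** g) = g.
Proof. by move=> hf; rewrite fmulA (finvKr hf) fmul1f. Qed.

Lemma fmulfI r f g h : fr r f -> f ** g = f ** h -> g = h.
Proof. by move=> hf e; rewrite -(fmulVf g hf) e (fmulVf _ hf). Qed.

Lemma fmulIf r f g h : fr r h -> f ** h = g ** h -> f = g.
Proof.
by move=> hh e; rewrite -(fmulf1 f) -(finvKr hh) fmulA e -fmulA (finvKr hh) fmulf1.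
Qed.

Lemma appVf r f q : fr r f -> app (finv f) (app f q) = q.
Proof. by move=> hf; rewrite -app_mul (finvK hf) app_one. Qed.

Lemma appfV r f q : fr r f -> app f (app (finv f) q) = q.
Proof. by move=> hf; rewrite -app_mul (finvKr hf) app_one. Qed.

Lemma app_inj r f : fr r f -> injective (app f).
Proof. by move=> hf x y e; rewrite -(appVf x hf) e (appVf _ hf). Qed.

Lemma fr_unique r s f : fr r f -> fr s f -> r = s.
Proof.
case=> r0 h _ _ [s0 k _ _]; apply/eqP.
by rewrite -(eqrXn2 (n := 2)) ?(ltW r0) ?(ltW s0) // -h -k.
Qed.

Lemma edist_frame r f q q' : fr r f -> edist (app f q) (app f q') = r * edist q q'.
Proof.
case=> r0 hu hv huv; rewrite /edist.
have -> : dot (app f q - app f q') (app f q - app f q') = r ^+ 2 * dot (q - q') (q - q').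
  rewrite /dot /=; set a := q.1 - q'.1; set b := q.2 - q'.2.
  transitivity ((ux f ^+ 2 + uy f ^+ 2) * a ^+ 2 + (vx f ^+ 2 + vy f ^+ 2) * b ^+ 2 +
    2 * (ux f * vx f + uy f * vy f) * (a * b)); first by rewrite /a /b; ring.
  by rewrite hu hv huv; ring.
by rewrite sqrtrM ?sqr_ge0 // sqrtr_sqr ger0_norm // ltW.
Qed.

Lemma similarity_frame r f : fr r f -> similarity r (app f).
Proof. by move=> hf; split=> [|q q']; [case: hf | apply: edist_frame]. Qed.

Lemma dot_edist q q' : dot (q - q') (q - q') = edist q q' ^+ 2.
Proof. by rewrite sqr_sqrtr // /dot addr_ge0 // -expr2 sqr_ge0. Qed.

(** The images of the origin and of the two unit points fix [g]. The distances of [f q] from these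
    three images give, by polarization, its inner products with the columns of [g], which form an
    orthogonal basis. *)
Lemma frame_similarity r (f : plane R -> plane R) : similarity r f ->
  exists g, fr r g /\ f = app g.
Proof.
case=> r0 hf.
have hd q q' : dot (f q - f q') (f q - f q') = r ^+ 2 * dot (q - q') (q - q').
  by rewrite !dot_edist hf exprMn.
have E q q' : dot (f q - f q') (f q - f q') =
  ((f q).1 - (f q').1) ^+ 2 + ((f q).2 - (f q').2) ^+ 2 by rewrite /dot /=; ring.
pose o : plane R := (0, 0); pose e : plane R := (1, 0); pose i : plane R := (0, 1).
pose a := (f e).1 - (f o).1; pose b := (f e).2 - (f o).2.
pose c := (f i).1 - (f o).1; pose d := (f i).2 - (f o).2.
pose g := Frame (f o).1 (f o).2 a b c d.
have h1 : a ^+ 2 + b ^+ 2 = r ^+ 2 by rewrite -E hd /dot /=; ring.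
have h2 : c ^+ 2 + d ^+ 2 = r ^+ 2 by rewrite -E hd /dot /=; ring.
have h3 : a * c + b * d = 0.
  have := hd e i; rewrite E /dot /=.
  have -> : (f e).1 - (f i).1 = a - c by rewrite /a /c; ring.
  have -> : (f e).2 - (f i).2 = b - d by rewrite /b /d; ring.
  lra.
have hg : fr r g by split.
exists g; split=> //; apply/funext => q.
pose s := (f q).1 - (f o).1; pose t := (f q).2 - (f o).2.
have k0 : s ^+ 2 + t ^+ 2 = r ^+ 2 * (q.1 ^+ 2 + q.2 ^+ 2).
  by rewrite -E hd /dot /=; ring.
have k1 : (s - a) ^+ 2 + (t - b) ^+ 2 = r ^+ 2 * ((q.1 - 1) ^+ 2 + q.2 ^+ 2).
  have := hd q e; rewrite E /dot /=.
  have -> : (f q).1 - (f e).1 = s - a by rewrite /s /a; ring.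
  have -> : (f q).2 - (f e).2 = t - b by rewrite /t /b; ring.
  by move->; ring.
have k2 : (s - c) ^+ 2 + (t - d) ^+ 2 = r ^+ 2 * (q.1 ^+ 2 + (q.2 - 1) ^+ 2).
  have := hd q i; rewrite E /dot /=.
  have -> : (f q).1 - (f i).1 = s - c by rewrite /s /c; ring.
  have -> : (f q).2 - (f i).2 = t - d by rewrite /t /d; ring.
  by move->; ring.
have m1 : s * a + t * b = r ^+ 2 * q.1 by lra.
have m2 : s * c + t * d = r ^+ 2 * q.2 by lra.
have r2 : r ^+ 2 != 0 by rewrite expf_neq0 // gt_eqF.
have [S T] : s = a * q.1 + c * q.2 /\ t = b * q.1 + d * q.2.
  have := fr_orient hg; rewrite /= => -[] [E1 E2]; rewrite E1 E2 in m2 *.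
    split; apply: (mulfI r2); rewrite -{1}h1.
      transitivity (a * (s * a + t * b) + - b * (s * - b + t * a)); first ring.
      by rewrite m1 m2; ring.
    transitivity (b * (s * a + t * b) + a * (s * - b + t * a)); first ring.
    by rewrite m1 m2; ring.
  split; apply: (mulfI r2); rewrite -{1}h1.
    transitivity (a * (s * a + t * b) + b * (s * b + t * - a)); first ring.
    by rewrite m1 m2; ring.
  transitivity (b * (s * a + t * b) + - a * (s * b + t * - a)); first ring.
  by rewrite m1 m2; ring.
rewrite [LHS]surjective_pairing /app /= -addrA -S -addrA -T /s /t.
by congr pair; ring.
Qed.
End Frames.

Local Notation "f ** g" := (fmul f g) (at level 40, left associativity).

(** * Topology and rigidity of the bee and of tiles *)

Section Bee.
Variable R : realType.
Local Notation p := (psi R).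
Implicit Types (f g h : frame R) (q z w : plane R) (r : R) (U : set (plane R)).

Lemma open_boxP U q : open U -> U q -> exists2 e : R, 0 < e &
  forall q', `|q.1 - q'.1| < e -> `|q.2 - q'.2| < e -> U q'.
Proof.
move=> oU Uq; have : nbhs q U by exact: open_nbhs_nbhs.
by move/nbhs_ballP => [e e0 he]; exists e => // q' h1 h2; apply: he.
Qed.

Lemma continuous_app f : continuous (app f).
Proof.
move=> q.
have h (a b c : R) : (fun x : plane R => a + b * x.1 + c * x.2) x @[x --> q] --> a + b * q.1 + c * q.2.
  apply: cvgD; first apply: cvgD; first exact: cvg_cst.
    by apply: cvgM; [exact: cvg_cst | exact: cvg_fst].
  by apply: cvgM; [exact: cvg_cst | exact: cvg_snd].
exact: (cvg_pair (h _ _ _) (h _ _ _)).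
Qed.

(** The interior of the bee: the two rectangles overlap, so their open versions lose no interior
    point along a seam. *)
Definition sbee : set (plane R) := [set q | (0 < q.1 < p /\ 0 < q.2 < p ^+ 2) \/
  (0 < q.1 < p ^+ 3 /\ 0 < q.2 < 1)].

Lemma sbee_bee q : sbee q -> bee q.
Proof. by case=> -[/andP[? ?] /andP[? ?]]; [left|right]; rewrite /rect /=; lra. Qed.

Definition tile f : set (plane R) := app f @` @bee R.
Definition stile f : set (plane R) := [set q | sbee (app (finv f) q)].

Lemma tileP r f q : fr r f -> tile f q <-> bee (app (finv f) q).
Proof.
move=> hf; split=> [[z hz <-]|h]; first by rewrite (appVf _ hf).
by exists (app (finv f) q) => //; rewrite (appfV _ hf).
Qed.

Lemma tile_app r f z : fr r f -> tile f (app f z) <-> bee z.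
Proof. by move=> hf; rewrite (tileP _ hf) (appVf _ hf). Qed.

Lemma stile_app r f z : fr r f -> stile f (app f z) <-> sbee z.
Proof. by move=> hf; rewrite /stile /= (appVf _ hf). Qed.

Lemma stile_tile r f q : fr r f -> stile f q -> tile f q.
Proof. by move=> hf h; rewrite (tileP _ hf); apply: sbee_bee. Qed.

Lemma open_stile f : open (stile f).
Proof.
have o1 (c : R) : open [set q : plane R | q.1 < c].
  by apply: (@open_comp _ _ fst [set x | x < c]); [move=> ? _; exact: cvg_fst | exact: open_lt].
have o2 (c : R) : open [set q : plane R | c < q.1].
  by apply: (@open_comp _ _ fst [set x | c < x]); [move=> ? _; exact: cvg_fst | exact: open_gt].
have o3 (c : R) : open [set q : plane R | q.2 < c].
  by apply: (@open_comp _ _ snd [set x | x < c]); [move=> ? _; exact: cvg_snd | exact: open_lt].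
have o4 (c : R) : open [set q : plane R | c < q.2].
  by apply: (@open_comp _ _ snd [set x | c < x]); [move=> ? _; exact: cvg_snd | exact: open_gt].
apply: (@open_comp _ _ (app (finv f)) sbee); first by move=> ? _; exact: continuous_app.
rewrite (_ : sbee = (([set q | 0 < q.1] `&` [set q | q.1 < p]) `&`
  ([set q | 0 < q.2] `&` [set q | q.2 < p ^+ 2])) `|` (([set q | 0 < q.1] `&` [set q | q.1 < p ^+ 3]) `&`
  ([set q | 0 < q.2] `&` [set q | q.2 < 1]))).
  by apply: openU; apply: openI; apply: openI.
apply/seteqP; split=> q.
  by case=> -[/andP[? ?] /andP[? ?]]; [left|right].
by case=> -[[? ?] [? ?]]; [left|right]; split; apply/andP; split.
Qed.

Lemma bee_segment_center z : bee z -> exists c, sbee c /\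
  forall t, 0 < t <= 1 -> sbee (z.1 + t * (c.1 - z.1), z.2 + t * (c.2 - z.2)).
Proof.
have [/andP[a1 a2] /andP[b1 b2] /andP[c1 c2] _] := psi_bounds R.
case=> -[/andP[? ?] /andP[? ?]].
  exists (p / 2, p ^+ 2 / 2); split; first by left; rewrite /=; split; lra.
  by move=> t ht; left; rewrite /=; split; apply/andP; split; nra.
exists (p ^+ 3 / 2, 1 / 2); split; first by right; rewrite /=; split; lra.
by move=> t ht; right; rewrite /=; split; apply/andP; split; nra.
Qed.

(** A small contraction towards the centre of the rectangle that contains the point moves it into
    the open rectangle and keeps it in [U]. *)
Lemma tile_regular r f U q : fr r f -> open U -> U q -> tile f q ->
  exists q', U q' /\ stile f q'.
Proof.
move=> hf oU Uq [z hz e]; have [c [hc hs]] := bee_segment_center hz.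
have oV : open (app f @^-1` U).
  by apply: open_comp => // ? _; exact: continuous_app.
have Vz : (app f @^-1` U) z by rewrite /= e.
have [d d0 hd] := open_boxP oV Vz.
pose m := 1 + `|c.1 - z.1| + `|c.2 - z.2|.
have m1 : 1 <= m by rewrite /m -addrA lerDl addr_ge0.
have m0 : 0 < m by lra.
pose t := Num.min 1 (d / (2 * m)).
have t0 : 0 < t by rewrite lt_min ltr01 divr_gt0 // mulr_gt0.
have tm : t * m <= d / 2.
  have : t <= d / (2 * m) by rewrite ge_min lexx orbT.
  by rewrite ler_pdivlMr ?mulr_gt0 //; lra.
have t1 : t <= 1 by rewrite ge_min lexx.
pose z' : plane R := (z.1 + t * (c.1 - z.1), z.2 + t * (c.2 - z.2)).
exists (app f z'); split; last by rewrite (stile_app _ hf); apply: hs; rewrite t0.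
have n1 := normr_ge0 (c.1 - z.1); have n2 := normr_ge0 (c.2 - z.2).
apply: hd; rewrite /z' /= opprD addrA subrr add0r normrN normrM (gtr0_norm t0); rewrite /m in tm; nra.
Qed.

Definition ov f g := exists q, stile f q /\ stile g q.

(** A point of the closed tile [f] is a limit of its interior points, and some of these remain in
    the open set [stile g]. *)
Lemma ov_tile r f g q : fr r f -> tile f q -> stile g q -> ov f g.
Proof.
move=> hf hq hg; have [q' [? ?]] := tile_regular hf (open_stile (f := g)) hg hq.
by exists q'.
Qed.

Lemma interior_tile_ov r s f g : fr r f -> fr s g ->
  ((tile f)° `&` (tile g)° = set0) <-> ~ ov f g.
Proof.
move=> hf hg.
have sub k t : fr t k -> stile k `<=` (tile k)°.
  by move=> hk; rewrite -open_subsetE; [move=> ? /(stile_tile hk) | exact: open_stile].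
split=> [e [q [h1 h2]]|h].
  have : ((tile f)° `&` (tile g)°) q.
    by split; [exact: (sub _ _ hf q h1) | exact: (sub _ _ hg q h2)].
  by rewrite e.
apply/seteqP; split=> // q [h1 h2]; apply: h.
have [q1 [[h3 h4] h5]] := tile_regular hf (openI (open_interior _) (open_interior _))
  (conj h1 h2) (interior_subset h1).
have [q2 [h6 h7]] := tile_regular hg (open_stile (f := f)) h5 (interior_subset h4).
by exists q2.
Qed.

(** The equality case is what matters: it makes the pair of corners [(0, 1)] and [(p, 0)] a metric
    invariant of the bee. *)
Lemma bee_diam z w : bee z -> bee w ->
  (z.1 - w.1) ^+ 2 + (z.2 - w.2) ^+ 2 <= 1 + p ^+ 2 /\
  ((z.1 - w.1) ^+ 2 + (z.2 - w.2) ^+ 2 = 1 + p ^+ 2 ->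
   (z = (0, 1) /\ w = (p, 0)) \/ (z = (p, 0) /\ w = (0, 1))).
Proof.
have [/andP[a1 a2] /andP[b1 b2] /andP[c1 c2] e4] := psi_bounds R.
have sq (a b x : R) : - a <= x -> x <= b -> a <= b -> x ^+ 2 <= b ^+ 2.
  by move=> h1 h2 h3; rewrite -subr_ge0 subr_sqr mulr_ge0 //; lra.
have p6 : (p ^+ 3) ^+ 2 = 2 * p ^+ 2 - 1 by ring: e4.
have p4 : (p ^+ 2) ^+ 2 = 1 - p ^+ 2 by rewrite -e4 -exprM.
have far x y : rect 0 p 0 (p ^+ 2) x -> rect 0 (p ^+ 3) 0 1 y ->
    (x.1 - y.1) ^+ 2 + (x.2 - y.2) ^+ 2 <= 1 + p ^+ 2 /\
  ((x.1 - y.1) ^+ 2 + (x.2 - y.2) ^+ 2 = 1 + p ^+ 2 -> x = (p, 0) /\ y = (0, 1)).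
  case: x y => x1 x2 [y1 y2] /= -[/= /andP[? ?] /andP[? ?]] [/= /andP[? ?] /andP[? ?]].
  have h1 : (x1 - y1) ^+ 2 <= p ^+ 2 by apply: (sq (p ^+ 3)); clear a2 b1 b2 c1 e4 p4 p6; lra.
  have h2 : (x2 - y2) ^+ 2 <= 1 by rewrite -(sqrrN (x2 - y2)) -(expr1n R 2); apply: (sq (p ^+ 2));
      clear a1 a2 b1 c1 c2 e4 h1 p4 p6; lra.
  split; first lra.
  move=> e; have {}h1 : (p - (x1 - y1)) * (p + (x1 - y1)) = 0 by clear a1 a2 b1 b2 c1 c2 e4 p4 p6; lra.
  have {}h2 : (1 - (y2 - x2)) * (1 + (y2 - x2)) = 0 by clear a1 a2 b1 b2 c1 c2 e4 h2 p4 p6; lra.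
  have k1 : x1 - y1 = p.
    by move/eqP: h1; rewrite mulf_eq0 => /orP[] /eqP ?; clear a2 b1 b2 c1 e e4 h2 p4 p6; lra.
  have k2 : y2 - x2 = 1.
    by move/eqP: h2; rewrite mulf_eq0 => /orP[] /eqP ?; clear a1 a2 b1 c1 c2 e e4 h1 k1 p4 p6; lra.
  by split; congr pair; clear a1 a2 b1 b2 c1 c2 e e4 h1 h2 p4 p6; lra.
have cls (b c : R) x y : rect 0 b 0 c x -> rect 0 b 0 c y ->
    (x.1 - y.1) ^+ 2 + (x.2 - y.2) ^+ 2 <= b ^+ 2 + c ^+ 2.
  case: x y => x1 x2 [y1 y2] /= -[/= /andP[? ?] /andP[? ?]] [/= /andP[? ?] /andP[? ?]].
  by apply: lerD; [apply: (sq b) | apply: (sq c)]; clear a1 a2 b1 b2 c1 c2 e4 p4 p6; lra.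
case=> hz [] hw.
- by have := cls _ _ _ _ hz hw; rewrite p4 => h; split=> [|?]; [|exfalso]; clear a1 a2 b2 c1 c2 e4 p4 p6; lra.
- by have [h1 h2] := far _ _ hz hw; split=> // e; right; apply: h2.
- have [h1 h2] := far _ _ hw hz; rewrite -(opprB w.1) -(opprB w.2) !sqrrN.
  by split=> // e; left; have [] := h2 e.
- by have := cls _ _ _ _ hz hw; rewrite p6 expr1n => h; split=> [|?]; [|exfalso]; clear a1 a2 b1 c1 c2 e4 p4 p6; lra.
Qed.

(** Comparing diameters both ways gives ratio 1, so the two ends of the diameter are fixed or
    exchanged. With two orientations this leaves four candidates, and all but the identity move the
    corner [(0, 0)] out of the bee. *)
Lemma bee_rigid r h : fr r h -> app h @` @bee R = @bee R -> h = fone R.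
Proof.
move=> hh e; have [r0 hu hv huv] := hh.
have [/andP[a1 a2] /andP[b1 b2] /andP[c1 c2] e4] := psi_bounds R.
have imb z : bee z -> bee (app h z) by move=> hz; rewrite -e; exists z.
have b0 : bee ((0, 1) : plane R) by right; split; rewrite /=; clear a1 a2 b1 b2 c2 e e4 hu huv hv r0; lra.
have bB : bee ((p, 0) : plane R) by left; split; rewrite /=; clear a2 b2 c1 c2 e e4 hu huv hv r0; lra.
have bA : bee ((0, 0) : plane R) by left; split; rewrite /=; clear a2 b2 c1 c2 e e4 hu huv hv r0; lra.
have D z w : ((app h z).1 - (app h w).1) ^+ 2 + ((app h z).2 - (app h w).2) ^+ 2 =
    r ^+ 2 * ((z.1 - w.1) ^+ 2 + (z.2 - w.2) ^+ 2).
  rewrite /app /=; transitivity ((ux h ^+ 2 + uy h ^+ 2) * (z.1 - w.1) ^+ 2 +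
   (vx h ^+ 2 + vy h ^+ 2) * (z.2 - w.2) ^+ 2 +
   2 * (ux h * vx h + uy h * vy h) * ((z.1 - w.1) * (z.2 - w.2))); first ring.
  by rewrite hu hv huv; ring.
have D1 := D (0, 1) (p, 0); rewrite [X in _ * X](_ : _ = 1 + p ^+ 2) in D1; last by rewrite /=; ring.
have r1 : r ^+ 2 = 1.
  have [l1 _] := bee_diam (imb _ b0) (imb _ bB); rewrite D1 in l1.
  have [z hz ez] : (app h @` @bee R) (0, 1) by rewrite e.
  have [w hw ew] : (app h @` @bee R) (p, 0) by rewrite e.
  have [l2 _] := bee_diam hz hw.
  have := D z w; rewrite ez ew /= => k.
  by have : r ^+ 2 * (1 + p ^+ 2 - ((z.1 - w.1) ^+ 2 + (z.2 - w.2) ^+ 2)) = r ^+ 2 * (1 + p ^+ 2) - (1 + p ^+ 2); nra.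
rewrite r1 mul1r in D1; rewrite r1 in hu hv.
have [_ /(_ D1)] := bee_diam (imb _ b0) (imb _ bB).
have := imb _ bA; rewrite /app /= !mulr0 !mulr1 !addr0 => hA.
clear e; have p4 : p * p ^+ 3 = 1 - p ^+ 2 by rewrite -e4; ring.
case: (fr_orient hh) => -[e1 e2]; case=> -[[k1 k2] [k3 k4]]; rewrite e1 e2 in k1 k2.
- have q1 : 1 - ux h = - p * uy h by clear a1 a2 b1 b2 c1 c2 e1 e2 e4 hu huv hv k1 k3 p4 r0 r1; lra.
  have q2 : uy h = p * (1 - ux h) by clear a1 a2 b1 b2 c1 c2 e1 e2 e4 hu huv hv k2 k4 p4 q1 r0 r1; lra.
  have q3 : (1 + p ^+ 2) * uy h = 0 by rewrite mulrDl mul1r {1}q2 q1; ring.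
  have q4 : uy h = 0 by move/eqP: q3; rewrite mulf_eq0 => /orP[] /eqP ?;
      clear a1 a2 b2 c1 c2 e1 e2 e4 hu huv hv k1 k2 k3 k4 p4 q1 q2 r0 r1; lra.
  have q5 : ux h = 1 by rewrite q4 in q1; clear a1 a2 b1 b2 c1 c2 e1 e2 e4 hu huv hv k1 k2 k3 k4 p4 q2 q3 q4 r0 r1; lra.
  case: h e1 e2 q4 q5 k1 k2 {D D1 hh hu hv huv imb hA k3 k4 q1 q2 q3} => /= *; congr Frame;
      clear a1 a2 b1 b2 c1 c2 e4 p4 r0 r1; lra.
- exfalso; have q1 : ux h = p * uy h - 1 by clear a1 a2 b1 b2 c1 c2 e1 e2 e4 hu huv hv k1 k3 p4 r0 r1; lra.
  have q2 : uy h = - p * (1 + ux h) by clear a1 a2 b1 b2 c1 c2 e1 e2 e4 hu huv hv k2 k4 p4 q1 r0 r1; lra.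
  have q3 : (1 + p ^+ 2) * uy h = 0 by rewrite mulrDl mul1r {1}q2 q1; ring.
  have q4 : uy h = 0 by move/eqP: q3; rewrite mulf_eq0 => /orP[] /eqP ?;
      clear a1 a2 b2 c1 c2 e1 e2 e4 hu huv hv k1 k2 k3 k4 p4 q1 q2 r0 r1; lra.
  rewrite q4 in q1 k3 k4 k1 k2.
  by move: hA => [] [/= /andP[? ?] /andP[? ?]]; clear a2 b1 c1 e1 e2 e4 hu huv hv k2 k3 p4 q1 q2 q3 q4 r0 r1; lra.
- exfalso; have q1 : 1 + ux h = - p * uy h by clear a1 a2 b1 b2 c1 c2 e1 e2 e4 hu huv hv k1 k3 p4 r0 r1; lra.
  have q2 : uy h = - p * (1 - ux h) by clear a1 a2 b1 b2 c1 c2 e1 e2 e4 hu huv hv k2 k4 p4 q1 r0 r1; lra.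
  have q3 : (1 + p ^+ 2) * ux h = p ^+ 2 - 1 by have := q1; rewrite q2;
      clear a1 a2 b1 b2 c1 c2 e1 e2 e4 hu huv hv k1 k2 k3 k4 p4 q1 q2 r0 r1; lra.
  have q4 : ux h = 1 - 2 * p ^+ 2.
    have : p ^+ 2 * ((1 + p ^+ 2) * ux h) = p ^+ 2 * (p ^+ 2 - 1) by rewrite q3.
    have -> : p ^+ 2 * ((1 + p ^+ 2) * ux h) = (p ^+ 2 + p ^+ 4) * ux h by ring.
    have -> : p ^+ 2 * (p ^+ 2 - 1) = p ^+ 4 - p ^+ 2 by ring.
    by rewrite e4; clear a1 a2 b1 b2 c1 c2 e1 e2 e4 hu huv hv k1 k2 k3 k4 p4 q1 q2 q3 r0 r1; lra.
  have : ox h = 2 * p ^+ 3 by rewrite q4 in q2; rewrite q2 in k1;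
      clear a1 a2 b1 b2 c1 c2 e1 e2 e4 hu huv hv k2 k3 k4 p4 q1 q2 q3 q4 r0 r1; lra.
  by move: hA => [] [/= /andP[? ?] /andP[? ?]]; clear a1 a2 b1 c2 e1 e2 e4 hu huv hv k1 k3 k4 p4 q1 q2 q3 r0 r1; lra.
- exfalso; have q1 : ux h = 1 - p * uy h by clear a1 a2 b1 b2 c1 c2 e1 e2 e4 hu huv hv k1 k3 p4 r0 r1; lra.
  have q2 : uy h = p * (1 + ux h) by clear a1 a2 b1 b2 c1 c2 e1 e2 e4 hu huv hv k2 k4 p4 q1 r0 r1; lra.
  have q3 : (1 + p ^+ 2) * ux h = 1 - p ^+ 2 by have := q1; rewrite q2;
      clear a1 a2 b1 b2 c1 c2 e1 e2 e4 hu huv hv k1 k2 k3 k4 p4 q1 q2 r0 r1; lra.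
  have q4 : ux h = 2 * p ^+ 2 - 1.
    have : p ^+ 2 * ((1 + p ^+ 2) * ux h) = p ^+ 2 * (1 - p ^+ 2) by rewrite q3.
    have -> : p ^+ 2 * ((1 + p ^+ 2) * ux h) = (p ^+ 2 + p ^+ 4) * ux h by ring.
    have -> : p ^+ 2 * (1 - p ^+ 2) = p ^+ 2 - p ^+ 4 by ring.
    by rewrite e4; clear a1 a2 b1 b2 c1 c2 e1 e2 e4 hu huv hv k1 k2 k3 k4 p4 q1 q2 q3 r0 r1; lra.
  have : ox h = - (2 * p ^+ 3 - p) by rewrite q4 in k3;
      clear a1 a2 b1 b2 c1 c2 e1 e2 e4 hu huv hv k1 k2 k4 p4 q1 q2 q3 q4 r0 r1; lra.
  by move: hA => [] [/= /andP[? ?] /andP[? ?]]; clear a1 b1 b2 c2 e1 e2 e4 hu huv hv k1 k2 k3 k4 p4 q1 q2 q3 q4 r0 r1; lra.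
Qed.

Lemma tile_inj r s f g : fr r f -> fr s g -> tile f = tile g -> f = g.
Proof.
move=> hf hg e; suff : finv g ** f = fone R.
  by move=> E; rewrite -(fmulfV f hg) E fmulf1.
apply: (bee_rigid (fr_mul (fr_inv hg) hf)); apply/seteqP; split=> q.
  move=> [z hz <-]; rewrite app_mul; apply/(tileP _ hg); rewrite -e.
  by apply/(tile_app _ hf).
move=> hq; have : tile f (app g q) by rewrite e; apply/(tile_app _ hg).
by move=> [z hz ez]; exists z; rewrite // app_mul ez (appVf _ hg).
Qed.
End Bee.

(** * Flags: germs of parabolas and the tiles that they enter *)

Section Germs.
Variable R : realType.
Local Notation p := (psi R).
Implicit Types (f g h : frame R) (q z w : plane R) (r : R).

(** Positivity of [a * t + b * t ^+ 2] for all small [t > 0]. *)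
Definition lexpos (a b : R) : bool := (0 < a) || ((a == 0) && (0 < b)).

(** The points [x] from which a small step, upwards if [s] and downwards otherwise, ends inside the
    open interval. *)
Definition inq (s : bool) (lo hi x : R) : bool :=
  if s then lo <= x < hi else lo < x <= hi.

Lemma near0_small (e : R) : 0 < e -> \forall t \near (0 : R)^'+, 0 < t /\ t < e.
Proof.
move=> e0; near=> t; split; first by near: t; exact: nbhs_right_gt.
by near: t; exact: nbhs_right_lt.
Unshelve. all: by end_near. Qed.

Lemma lexpos_near (a b e : R) : 0 < e -> lexpos a b ->
  \forall t \near (0 : R)^'+, 0 < a * t + b * t ^+ 2 /\ a * t + b * t ^+ 2 < e.
Proof.
move=> e0 hab; pose m := 1 + `|a| + `|b|.
have a0 := normr_ge0 a; have b0 := normr_ge0 b.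
have m0 : 0 < m by rewrite /m; lra.
pose c := if 0 < a then Num.min 1 (a / m) else 1.
have c0 : 0 < c by rewrite /c; case: ifP => // a1; rewrite lt_min ltr01 divr_gt0.
have c1 : c <= 1 by rewrite /c; case: ifP => // _; rewrite ge_min lexx.
have k0 : 0 < Num.min c (e / m) by rewrite lt_min c0 divr_gt0.
apply: filterS (near0_small k0) => t [t0]; rewrite lt_min => /andP[tc te].
have {}te : t * m < e by rewrite -ltr_pdivlMr.
have t2 : t ^+ 2 <= t by rewrite expr2 ler_piMl ?(ltW t0) //; lra.
have h1 : a * t <= `|a| * t by rewrite ler_wpM2r ?(ltW t0) // ler_norm.
have h2 : b * t ^+ 2 <= `|b| * t.
  by apply: (le_trans (y := `|b| * t ^+ 2)); [rewrite ler_wpM2r ?sqr_ge0 ?ler_norm | rewrite ler_wpM2l].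
split; last by rewrite /m in te; lra.
case/orP: hab => [a1|/andP[/eqP -> b1]].
  have h3 : t * m < a.
    by move: tc; rewrite /c a1 lt_min => /andP[_]; rewrite ltr_pdivlMr.
  have h4 : - b <= `|b| by rewrite -normrN ler_norm.
  have -> : a * t + b * t ^+ 2 = t * (a + b * t) by ring.
  rewrite pmulr_rgt0 //.
  have : - b * t <= `|b| * t by rewrite ler_wpM2r // ltW.
  rewrite /m in h3; have := mulr_ge0 a0 (ltW t0); lra.
by rewrite mul0r add0r mulr_gt0 // exprn_gt0.
Qed.

Lemma lexneg (a b : R) : (a != 0) || (b != 0) -> ~~ lexpos a b -> lexpos (- a) (- b).
Proof.
rewrite /lexpos !oppr_gt0 oppr_eq0 negb_or negb_and -!leNgt => h /andP[h1 h2].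
case: (ltrgtP a 0) h1 h2 h => //= _ _; by case: (ltrgtP b 0).
Qed.

Lemma inq_near (lo hi x a b : R) : (a != 0) || (b != 0) ->
  if inq (lexpos a b) lo hi x
  then \forall t \near (0 : R)^'+, lo < x + a * t + b * t ^+ 2 < hi
  else \forall t \near (0 : R)^'+, ~~ (lo <= x + a * t + b * t ^+ 2 <= hi).
Proof.
move=> hab.
have up (e : R) : lexpos a b -> 0 < e -> \forall t \near (0 : R)^'+, 0 < a * t + b * t ^+ 2 < e.
  by move=> h e0; apply: filterS (lexpos_near e0 h) => t [? ?]; apply/andP.
have dn (e : R) : ~~ lexpos a b -> 0 < e -> \forall t \near (0 : R)^'+, - e < a * t + b * t ^+ 2 < 0.
  move=> h e0; apply: filterS (lexpos_near e0 (lexneg hab h)) => t.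
  by rewrite !mulNr -opprD => -[? ?]; apply/andP; split; lra.
rewrite /inq; case: ifP; case: (boolP (lexpos a b)) => hl.
- move=> /andP[h1 h2]; have e0 : 0 < hi - x by lra.
  by apply: filterS (up _ hl e0) => t /andP[? ?]; apply/andP; split; lra.
- move=> /andP[h1 h2]; have e0 : 0 < x - lo by lra.
  by apply: filterS (dn _ hl e0) => t /andP[? ?]; apply/andP; split; lra.
- move/negbT; rewrite negb_and -ltNge -leNgt => /orP[h|h].
    have e0 : 0 < lo - x by lra.
    by apply: filterS (up _ hl e0) => t /andP[? ?]; apply/negP => /andP[? ?]; lra.
  by apply: filterS (up _ hl ltr01) => t /andP[? ?]; apply/negP => /andP[? ?]; lra.
- move/negbT; rewrite negb_and -ltNge -leNgt => /orP[h|h].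
    by apply: filterS (dn _ hl ltr01) => t /andP[? ?]; apply/negP => /andP[? ?]; lra.
  have e0 : 0 < x - hi by lra.
  by apply: filterS (dn _ hl e0) => t /andP[? ?]; apply/negP => /andP[? ?]; lra.
Qed.

(* The bee contains a small right angle at [z]; [s1], [s2] are the signs of its sides. *)
Definition germ (s1 s2 : bool) (z1 z2 : R) : bool :=
  (inq s1 0 p z1 && inq s2 0 (p ^+ 2) z2) || (inq s1 0 (p ^+ 3) z1 && inq s2 0 1 z2).

(* [frame h] as a flag: the germ at [h (0, 0)] of the curve [h (t, t ^+ 2)]. *)
Definition hdir h : bool := germ (lexpos (ux h) (vx h)) (lexpos (uy h) (vy h)) (ox h) (oy h).

Lemma fr_neq0 r h : fr r h -> ((ux h != 0) || (vx h != 0)) /\ ((uy h != 0) || (vy h != 0)).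
Proof.
move=> hh; have [r0 hu hv huv] := hh.
have k : ~~ ((ux h == 0) && (uy h == 0)).
  by apply/negP => /andP[/eqP e1 /eqP e2]; move: hu; rewrite e1 e2 expr0n addr0 => /esym/eqP; rewrite expf_eq0 /= gt_eqF.
rewrite negb_and in k.
by case: (fr_orient hh) => -[-> ->]; rewrite ?oppr_eq0 k orbC k.
Qed.

Lemma hdir_near r h : fr r h ->
  if hdir h then \forall t \near (0 : R)^'+, sbee (app h (t, t ^+ 2))
  else \forall t \near (0 : R)^'+, ~ bee (app h (t, t ^+ 2)).
Proof.
move=> hh; have [hx hy] := fr_neq0 hh; rewrite /hdir /germ.
have X c := inq_near 0 c (ox h) hx; have Y c := inq_near 0 c (oy h) hy.
case: ifP => [/orP[] /andP[h1 h2]|/negbT].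
- have := X p; have := Y (p ^+ 2); rewrite h1 h2 => k2 k1.
  by near=> t; left; split; near: t; [exact: k1 | exact: k2].
- have := X (p ^+ 3); have := Y 1; rewrite h1 h2 => k2 k1.
  by near=> t; right; split; near: t; [exact: k1 | exact: k2].
rewrite negb_or !negb_and => /andP[h1 h2].
have k1 : \forall t \near (0 : R)^'+, ~ rect 0 p 0 (p ^+ 2) (app h (t, t ^+ 2)).
  case/orP: h1 => /negbTE h1; [have := X p | have := Y (p ^+ 2)]; rewrite h1.
    by move=> k; near=> t => -[k1 _]; move: k1; apply/negP; near: t; exact: k.
  by move=> k; near=> t => -[_ k1]; move: k1; apply/negP; near: t; exact: k.
have k2 : \forall t \near (0 : R)^'+, ~ rect 0 (p ^+ 3) 0 1 (app h (t, t ^+ 2)).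
  case/orP: h2 => /negbTE h2; [have := X (p ^+ 3) | have := Y 1]; rewrite h2.
    by move=> k; near=> t => -[k3 _]; move: k3; apply/negP; near: t; exact: k.
  by move=> k; near=> t => -[_ k3]; move: k3; apply/negP; near: t; exact: k.
by near=> t => -[]; near: t; [exact: k1 | exact: k2].
Unshelve. all: by end_near. Qed.

Definition D f h : bool := hdir (finv f ** h).

(** There is no third case, because the parabola cannot run inside the boundary of a tile; a
    straight germ could. *)
Lemma D_near r s f h : fr r f -> fr s h ->
  if D f h then \forall t \near (0 : R)^'+, stile f (app h (t, t ^+ 2))
  else \forall t \near (0 : R)^'+, ~ tile f (app h (t, t ^+ 2)).
Proof.
move=> hf hh; have := hdir_near (fr_mul (fr_inv hf) hh); rewrite /D.
case: ifP => _; first by apply: filterS => t; rewrite /stile /= app_mul.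
by apply: filterS => t k; rewrite (tileP _ hf) -app_mul.
Qed.

Lemma DP r s f h : fr r f -> fr s h ->
  D f h <-> \forall t \near (0 : R)^'+, stile f (app h (t, t ^+ 2)).
Proof.
move=> hf hh; have := D_near hf hh; case: (D f h) => // k; split=> // k'.
have [t [k1 k2]] := filter_ex (filterI k k').
by case: k1; apply: (stile_tile hf).
Qed.

Lemma DtileP r s f h : fr r f -> fr s h ->
  D f h <-> \forall t \near (0 : R)^'+, tile f (app h (t, t ^+ 2)).
Proof.
move=> hf hh; split=> [/(DP hf hh)|k].
  by apply: filterS => t; apply: (stile_tile hf).
have := D_near hf hh; case: (D f h) => // k'.
by have [t [k1 k2]] := filter_ex (filterI k k').
Qed.

Lemma D_ov r s t f g h : fr r f -> fr s g -> fr t h -> D f h -> D g h -> ov f g.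
Proof.
move=> hf hg hh /(DP hf hh) k1 /(DP hg hh) k2.
by have [x [x1 x2]] := filter_ex (filterI k1 k2); exists (app h (x, x ^+ 2)).
Qed.

Lemma app_shift f z w : app f z =
  ((app f w).1 + (ux f * (z.1 - w.1) + vx f * (z.2 - w.2)),
   (app f w).2 + (uy f * (z.1 - w.1) + vy f * (z.2 - w.2))).
Proof. by congr pair => /=; ring. Qed.

Lemma fr_le r h : fr r h -> [/\ `|ux h| <= r, `|uy h| <= r, `|vx h| <= r & `|vy h| <= r].
Proof.
case=> r0 hu hv _.
have k (a b : R) : a ^+ 2 + b ^+ 2 = r ^+ 2 -> `|a| <= r /\ `|b| <= r.
  move=> e; rewrite -!(ler_sqr (y := r)) ?nnegrE ?normr_ge0 ?(ltW r0) // !real_normK ?num_real //.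
  by have := sqr_ge0 a; have := sqr_ge0 b; split; lra.
by have [? ?] := k _ _ hu; have [? ?] := k _ _ hv.
Qed.

(** Sizes and disjoint interiors, without arrows: what the local arguments need of a tiling. *)
Definition locfam (d : R) (F : set (frame R)) : Prop :=
  [/\ 0 < d, forall f, F f -> fr d f \/ fr (p * d) f &
      forall f g, F f -> F g -> ov f g -> f = g].

(* A fine enough lattice meets the interior of every tile. *)
Lemma local_finite d F q (M : R) : locfam d F -> exists N (e : 'I_N * 'I_N -> frame R),
  forall f q', F f -> tile f q' -> `|q'.1 - q.1| <= M -> `|q'.2 - q.2| <= M ->
  exists i, f = e i.
Proof.
move=> [d0 Fs Fd]; have [/andP[a1 a2] /andP[b1 b2] /andP[c1 c2] e4] := psi_bounds R.
(* The centre of a tile is within [2 * d] of all its points. With mesh [eta], some lattice point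
   differs from the centre by at most [1 / 8] in each coordinate of the tile, hence is interior to
   it. *)
pose L := M + 2 * d; pose eta := p * d / 16.
have eta0 : 0 < eta by rewrite /eta divr_gt0 // mulr_gt0 //; lra.
pose pt (i : nat) (x : R) := x - L + i%:R * eta.
pose N := (Num.truncn (2 * L / eta)).+1.
have lat (x y : R) : `|y - x| <= L -> exists i : 'I_N, 0 <= y - pt i x < eta.
  rewrite ler_norml => /andP[h1 h2].
  have z0 : 0 <= (y - x + L) / eta by rewrite divr_ge0 ?(ltW eta0) //; lra.
  have [/andP[i1 i2]] := truncn_itv z0.
  set i := Num.truncn _ in i1 i2 *.
  have iN : (i < N)%N.
    rewrite -(ltr_nat R) (le_lt_trans i1) //.
    have z1 : 0 <= 2 * L / eta by rewrite divr_ge0 ?(ltW eta0) //; clear a1 a2 b1 b2 c1 c2 d0 e4 eta0 i1 i2 z0; lra.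
    have [/andP[_ i3]] := truncn_itv z1; apply: le_lt_trans i3.
    by rewrite ler_pM2r ?invr_gt0 //; clear a1 a2 b1 b2 c1 c2 d0 e4 eta0 h1 i1 i2 z0 z1; lra.
  exists (Ordinal iN); rewrite /pt /=.
  rewrite ler_pdivlMr // in i1; rewrite ltr_pdivrMr // -natr1 in i2.
  by apply/andP; split; clear a1 a2 b1 b2 c1 c2 d0 e4 eta0 h1 h2 z0; lra.
pose P (ij : 'I_N * 'I_N) f := F f /\ stile f (pt ij.1 q.1, pt ij.2 q.2).
(* Disjoint interiors allow at most one tile per lattice point; the value [fone R] at a lattice
   point interior to no tile is arbitrary. *)
pose e ij := if pselect (exists f, P ij f) is left h then sval (cid h) else fone R.
exists N, e => f q' Ff fq' h1 h2.
have [r [hf r1 r2]] : exists r, [/\ fr r f, p * d <= r & r <= d].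
  by case: (Fs _ Ff) => hf; [exists d | exists (p * d)]; split => //; nra.
have r0 : 0 < r by case: hf.
pose z : plane R := (p ^+ 3 / 2, 1 / 2); pose c := app f z.
have [w hw ew] := fq'.
have dist : `|c.1 - q'.1| <= 2 * d /\ `|c.2 - q'.2| <= 2 * d.
  have [n1 n2 n3 n4] := fr_le hf.
  have w1 : `|z.1 - w.1| <= 1 by rewrite ler_norml /z /=; case: hw => -[/andP[? ?] /andP[? ?]];
      clear a1 b1 b2 d0 e e4 eta0 ew h1 h2 n1 n2 n3 n4 r0 r1 r2; lra.
  have w2 : `|z.2 - w.2| <= 1 by rewrite ler_norml /z /=; case: hw => -[/andP[? ?] /andP[? ?]];
      clear a1 a2 b1 c1 c2 d0 e e4 eta0 ew h1 h2 n1 n2 n3 n4 r0 r1 r2 w1; lra.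
  have B (a b : R) : `|a| <= r -> `|b| <= r -> `|a * (z.1 - w.1) + b * (z.2 - w.2)| <= 2 * d.
    move=> ka kb; apply: (le_trans (ler_normD _ _)); rewrite !normrM.
    have : `|a| * `|z.1 - w.1| <= r * 1 by apply: ler_pM.
    have : `|b| * `|z.2 - w.2| <= r * 1 by apply: ler_pM.
    clear a1 a2 b1 b2 c1 c2 d0 e e4 eta0 ew h1 h2 ka kb n1 n2 n3 n4 r0 r1 w1 w2; lra.
  rewrite -ew /c /app /=; split.
    by rewrite [X in `|X|](_ : _ = ux f * (z.1 - w.1) + vx f * (z.2 - w.2)); [apply: B | rewrite /z /=; ring].
  by rewrite [X in `|X|](_ : _ = uy f * (z.1 - w.1) + vy f * (z.2 - w.2)); [apply: B | rewrite /z /=; ring].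
have cq : `|c.1 - q.1| <= L /\ `|c.2 - q.2| <= L.
  by case: dist => k1 k2; rewrite /L; split;
    [have := ler_normD (c.1 - q'.1) (q'.1 - q.1) | have := ler_normD (c.2 - q'.2) (q'.2 - q.2)];
    rewrite addrA subrK; clear a1 a2 b1 b2 c1 c2 d0 e e4 eta0 ew r0 r1 r2; lra.
have [i hi] := lat q.1 c.1 cq.1; have [j hj] := lat q.2 c.2 cq.2.
have Pf : P (i, j) f.
  split=> //; rewrite /stile /=.
  set v : plane R := (pt i q.1, pt j q.2).
  have [n1 n2 n3 n4] := fr_le (fr_inv hf).
  have B (a b : R) : `|a| <= r^-1 -> `|b| <= r^-1 -> `|a * (v.1 - c.1) + b * (v.2 - c.2)| <= 1 / 8.
    move=> ka kb; apply: (le_trans (ler_normD _ _)); rewrite !normrM.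
    have v1 : `|v.1 - c.1| <= eta by rewrite -[v.1]/(pt i q.1) ler_norml; move/andP: hi => [? ?];
        clear a1 a2 b1 b2 c1 c2 cq d0 e e4 eta0 ew h1 h2 hj ka kb n1 n2 n3 n4 r0 r1 r2; lra.
    have v2 : `|v.2 - c.2| <= eta by rewrite -[v.2]/(pt j q.2) ler_norml; move/andP: hj => [? ?];
        clear a1 a2 b1 b2 c1 c2 cq d0 e e4 eta0 ew h1 h2 ka kb n1 n2 n3 n4 r0 r1 r2 v1; lra.
    have k1 : `|a| * `|v.1 - c.1| <= r^-1 * eta by apply: ler_pM.
    have k2 : `|b| * `|v.2 - c.2| <= r^-1 * eta by apply: ler_pM.
    have k3 : r^-1 * eta <= 1 / 16.
      by rewrite mulrC ler_pdivrMr // /eta;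
          clear a1 a2 b1 b2 c1 c2 cq d0 e e4 eta0 ew h1 h2 hj k1 k2 ka kb n1 n2 n3 n4 r0 r2 v1 v2; lra.
    clear a1 a2 b1 b2 c1 c2 cq d0 e e4 eta0 ew h1 h2 hj ka kb n1 n2 n3 n4 r0 r1 r2 v1 v2; lra.
  have E : app (finv f) v = (z.1 + (ux (finv f) * (v.1 - c.1) + vx (finv f) * (v.2 - c.2)),
    z.2 + (uy (finv f) * (v.1 - c.1) + vy (finv f) * (v.2 - c.2))).
    by rewrite (app_shift _ v c) {1 4}/c (appVf z hf).
  rewrite E; have := B _ _ n1 n3; have := B _ _ n2 n4; rewrite !ler_norml.
  move: (ux (finv f) * _ + _) (uy (finv f) * _ + _) => X Y /andP[? ?] /andP[? ?].
  by right; rewrite /z; split => /=; clear a1 a2 b1 b2 c2 cq d0 e e4 eta0 ew h1 h2 hj n1 n2 n3 n4 r0 r1 r2; lra.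
exists (i, j); rewrite /e; case: pselect => [h|[]]; last by exists f.
by case: (cid h) => g [Fg hg] /=; apply: Fd => //; exists (pt i q.1, pt j q.2); case: Pf.
Qed.

(* Only finitely many tiles matter near the base point of the flag. *)
Lemma fill d F r h : locfam d F -> fr r h ->
  (\forall t \near (0 : R)^'+, exists2 f, F f & tile f (app h (t, t ^+ 2))) ->
  exists2 f, F f & D f h.
Proof.
move=> LF hh hc; apply: contrapT => nD.
have [d0 Fs Fd] := LF.
have [N [e he]] := local_finite (ox h, oy h) (2 * r) LF.
have r0 : 0 < r by case: hh.
have k1 : \forall t \near (0 : R)^'+, forall i, F (e i) -> ~ tile (e i) (app h (t, t ^+ 2)).
  apply: filter_forall => i.
  have [Fi|nFi] := pselect (F (e i)); last exact: nearW.
  have [s hs] : exists s, fr s (e i) by case: (Fs _ Fi) => ?; [exists d | exists (p * d)].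
  have := D_near hs hh; case: ifP => [Di|_]; first by case: nD; exists (e i).
  by apply: filterS.
have k2 := near0_small (ltr01 : (0 : R) < 1).
have [t [[[f Ff hf] kt] [t0 t1]]] := filter_ex (filterI (filterI hc k1) k2).
have [n1 n2 n3 n4] := fr_le hh.
have t2 : `|t ^+ 2| <= 1 by rewrite ger0_norm ?sqr_ge0 // expr_le1 // ltW.
have t3 : `|t| <= 1 by rewrite gtr0_norm // ltW.
have B (a b : R) : `|a| <= r -> `|b| <= r -> `|a * t + b * t ^+ 2| <= 2 * r.
  move=> ka kb; apply: (le_trans (ler_normD _ _)); rewrite (normrM a) (normrM b).
  have : `|a| * `|t| <= r * 1 by apply: ler_pM.
  have : `|b| * `|t ^+ 2| <= r * 1 by apply: ler_pM.
  clear d0 ka kb kt n1 n2 n3 n4 r0 t0 t1 t2 t3; lra.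
have [] := he f _ Ff hf.
- by rewrite /app /= [X in `|X|](_ : _ = ux h * t + vx h * t ^+ 2); [apply: B | ring].
- by rewrite /app /= [X in `|X|](_ : _ = uy h * t + vy h * t ^+ 2); [apply: B | ring].
by move=> i ei; apply: (kt i); rewrite -ei.
Qed.
End Germs.

(** * Son and daughter, arrows along a flag, corners of the bee *)

Section Arrows.
Variable R : realType.
Local Notation p := (psi R).
Implicit Types (f g h : frame R) (q z w : plane R) (r d : R) (F : set (frame R)) (C : set (plane R)).
Implicit Types (e : arrow R).

(** [sig] and [del] carry the bee to its son and its daughter: a quarter turn with ratio [p], and a
    reflection with ratio [p ^+ 2]. *)
Definition sig : frame R := Frame p 0 0 p (- p) 0.
Definition del : frame R := Frame 0 1 (p ^+ 2) 0 0 (- p ^+ 2).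

Lemma fr_sig : fr p sig.
Proof. by split; rewrite /= ?psi_gt0 //; ring. Qed.

Lemma fr_del : fr (p ^+ 2) del.
Proof. by split; rewrite /= ?exprn_gt0 ?psi_gt0 //; ring. Qed.

Lemma app_sig_son : app sig @` @bee R = @bee_son R.
Proof.
have [/andP[a1 a2] /andP[b1 b2] /andP[c1 c2] e4] := psi_bounds R.
have e5 : p ^+ 5 = p - p ^+ 3 by ring: e4.
have [p1 p2] : 0 <= p /\ 0 <= p ^-1 by rewrite invr_ge0; lra.
apply/seteqP; split=> [q [z hz <-]|q].
  case: hz => -[/andP[h1 h2] /andP[h3 h4]]; [right|left]; split; rewrite /= ?e5.
  - have := ler_wpM2l p1 h3; have := ler_wpM2l p1 h4; lra.
  - have := ler_wpM2l p1 h1; have := ler_wpM2l p1 h2; lra.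
  - have := ler_wpM2l p1 h3; have := ler_wpM2l p1 h4; lra.
  - have := ler_wpM2l p1 h1; have := ler_wpM2l p1 h2; lra.
have p0 : p != 0 by rewrite gt_eqF //; lra.
move=> hq; exists (q.2 / p, 1 - q.1 / p); last first.
  by case: q hq => x y _; rewrite /app /=; congr pair; field.
case: hq => -[/andP[h1 h2] /andP[h3 h4]]; [right|left]; rewrite ?e5 in h1; split => /=.
all: rewrite ?subr_ge0 ?lerBlDl -?lerBlDr ?divr_ge0 ?ler_pdivrMr ?ler_pdivlMr /=; clear a1 a2 b1 b2 c1 c2 e4 e5 p2; lra.
Qed.

Lemma app_del_daughter : app del @` @bee R = @bee_daughter R.
Proof.
have [/andP[a1 a2] /andP[b1 b2] /andP[c1 c2] e4] := psi_bounds R.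
have e5 : p ^+ 5 = p ^+ 2 * p ^+ 3 by ring.
have p1 : 0 <= p ^+ 2 by lra.
apply/seteqP; split=> [q [z hz <-]|q].
  case: hz => -[/andP[h1 h2] /andP[h3 h4]]; [right|left]; split; rewrite /= ?e5.
  - have := ler_wpM2l p1 h1; have := ler_wpM2l p1 h2; lra.
  - have := ler_wpM2l p1 h3; have := ler_wpM2l p1 h4; lra.
  - have := ler_wpM2l p1 h1; have := ler_wpM2l p1 h2; lra.
  - have := ler_wpM2l p1 h3; have := ler_wpM2l p1 h4; lra.
have p0 : p ^+ 2 != 0 by rewrite gt_eqF //; lra.
move=> hq; exists (q.1 / p ^+ 2, (1 - q.2) / p ^+ 2); last first.
  by case: q hq => x y _; rewrite /app /=; congr pair; field; move: p0; rewrite expf_eq0.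
case: hq => -[/andP[h1 h2] /andP[h3 h4]]; [right|left]; rewrite ?e5 in h2; split => /=.
all: rewrite ?divr_ge0 ?ler_pdivrMr ?ler_pdivlMr /=; clear a1 a2 b1 b2 c1 c2 e5; lra.
Qed.

Lemma bee_split q : bee q <-> bee_son q \/ bee_daughter q.
Proof.
have [/andP[a1 a2] /andP[b1 b2] /andP[c1 c2] e4] := psi_bounds R.
have e5 : p ^+ 5 = p - p ^+ 3 by ring: e4.
rewrite /bee /bee_son /bee_daughter /rect /setU /= e4 e5; split.
  by move=> h; case: (leP q.2 (1 - p ^+ 2)) => k1; case: (leP q.2 (p ^+ 2)) => k2; case: (leP q.1 (p - p ^+ 3)) => k3;
      clear a2 b1 c1 e4 e5; lra.
by move=> h; case: (leP q.2 (p ^+ 2)) => k2; case: (leP q.1 (p ^+ 3)) => k3; clear e4 e5; lra.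
Qed.

Lemma tile_split r f q : fr r f -> tile f q <-> tile (f ** sig) q \/ tile (f ** del) q.
Proof.
move=> hf; rewrite (tileP _ hf) bee_split -app_sig_son -app_del_daughter /tile.
split=> [[] [z hz e]|[] [z hz <-]].
- by left; exists z; rewrite // app_mul e (appfV _ hf).
- by right; exists z; rewrite // app_mul e (appfV _ hf).
- by left; exists z; rewrite // app_mul (appVf _ hf).
- by right; exists z; rewrite // app_mul (appVf _ hf).
Qed.

Lemma sbee_sig z : sbee z -> sbee (app sig z).
Proof.
have [/andP[a1 a2] /andP[b1 b2] /andP[c1 c2] e4] := psi_bounds R.
have p1 : 0 < p by lra.
have M (a b : R) : a < b -> p * a < p * b by rewrite ltr_pM2l.
by case=> -[/andP[h1 h2] /andP[h3 h4]]; left; move: (M _ _ h1) (M _ _ h2) (M _ _ h3) (M _ _ h4);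
  split; rewrite /=; clear a2 b2 c1 h1 h2 h3 h4 p1; lra.
Qed.

Lemma sbee_del z : sbee z -> sbee (app del z).
Proof.
have [/andP[a1 a2] /andP[b1 b2] /andP[c1 c2] e4] := psi_bounds R.
have p1 : 0 < p ^+ 2 by lra.
have e5 : p ^+ 2 * p ^+ 3 = p - p ^+ 3 by ring: e4.
have M (a b : R) : a < b -> p ^+ 2 * a < p ^+ 2 * b by rewrite ltr_pM2l.
by case=> -[/andP[h1 h2] /andP[h3 h4]]; right; move: (M _ _ h1) (M _ _ h2) (M _ _ h3) (M _ _ h4);
  split; rewrite /=; clear a1 b1 c2 h1 h2 p1; lra.
Qed.

Lemma stile_sig r f q : fr r f -> stile (f ** sig) q -> stile f q.
Proof.
move=> hf h; have hs := fr_mul hf fr_sig.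
by rewrite -(appfV q hs) app_mul (stile_app _ hf); apply: sbee_sig.
Qed.

Lemma stile_del r f q : fr r f -> stile (f ** del) q -> stile f q.
Proof.
move=> hf h; have hs := fr_mul hf fr_del.
by rewrite -(appfV q hs) app_mul (stile_app _ hf); apply: sbee_del.
Qed.

Lemma son_daughter_disj r f : fr r f -> ~ ov (f ** sig) (f ** del).
Proof.
move=> hf [q []]; rewrite /stile /=.
have hs := fr_mul hf fr_sig; have hd := fr_mul hf fr_del.
set a := app _ q; set b := app _ q => ha hb.
have : app (f ** sig) a = app (f ** del) b by rewrite /a /b (appfV _ hs) (appfV _ hd).
rewrite !app_mul => /(app_inj hf) E; clearbody a b.
have e1 := congr1 fst E; have e2 := congr1 snd E; rewrite /= in e1 e2.
have [/andP[a1 a2] /andP[b1 b2] /andP[c1 c2] e4] := psi_bounds R.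
have p1 : 0 < p by lra.
have p2 : 0 < p ^+ 2 by lra.
have M (x y : R) : x < y -> p * x < p * y by rewrite ltr_pM2l.
have M2 (x y : R) : x < y -> p ^+ 2 * x < p ^+ 2 * y by rewrite ltr_pM2l.
have e5 : p ^+ 2 * p ^+ 3 = p - p ^+ 3 by ring: e4.
clear E; by case: ha => -[/andP[/M h1 /M h2] /andP[/M h3 /M h4]]; case: hb => -[/andP[/M2 k1 /M2 k2] /andP[/M2 k3 /M2 k4]];
    clear a1 a2 b2 c1 c2 h1 h3 k1 k3 p1 p2; lra.
Qed.

(* [tile_inj] makes [f] determined by [tile f]. *)
Definition farr d f e : Prop :=
  (fr d f /\ exists2 a, a \in large_arrows R & e = map_arrow (app f) a) \/
  (fr (p * d) f /\ exists2 a, a \in small_arrows R & e = map_arrow (app f) a).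

Definition overlap e e' : Prop := exists q q', q <> q' /\
  (arrow_segment e `&` arrow_segment e') q /\ (arrow_segment e `&` arrow_segment e') q'.

Definition arrF d F : Prop := forall f g e e', F f -> F g -> f <> g ->
  farr d f e -> farr d g e' -> overlap e e' -> e = e'.

Definition A2F d F C : Prop := [/\ locfam d F, arrF d F, (exists f, F f) &
  forall q, C q <-> exists2 f, F f & tile f q].

Lemma segment_app f z w q : segment z w q -> segment (app f z) (app f w) (app f q).
Proof.
move=> [t ht ->]; exists t => //; rewrite /app.
by congr pair => /=; rewrite /GRing.scale /=; ring.
Qed.

Definition pt0 : plane R := (0, 0).
Definition ptx (l : R) : plane R := (l, 0).

(** An arrow on the first axis of the flag with one end at its base point: it leaves this point if
    [io] and enters it otherwise. *)
Definition mkray f (l : R) (io : bool) (c : nat) : arrow R :=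
  if io then ((app f pt0, app f (ptx l)), c) else ((app f (ptx l), app f pt0), c).

Definition ray d f h (io : bool) (c : nat) : Prop :=
  exists2 l : R, 0 < l & farr d f (mkray h l io c).

Lemma mkray_seg f (l : R) io c (x : R) : 0 <= x <= l -> 0 < l -> arrow_segment (mkray f l io c) (app f (ptx x)).
Proof.
move=> /andP[h1 h2] l0; have ln : l != 0 by rewrite gt_eqF.
rewrite /arrow_segment /mkray; case: io => /=; apply: segment_app.
  exists (x / l); first by rewrite divr_ge0 ?ler_pdivrMr ?(ltW l0) ?mul1r.
  by congr pair; rewrite /= /GRing.scale /=; field.
have xl : 0 <= x / l <= 1 by rewrite divr_ge0 ?ler_pdivrMr ?(ltW l0) ?mul1r.
exists (1 - x / l); first lra.
by congr pair; rewrite /= /GRing.scale /=; field.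
Qed.

(** Two arrows that begin along the same ray share a segment, so the arrow rule makes them equal,
    and with them their colours and the direction at the base point. *)
Lemma ray_match d F f g h r io io' c c' : arrF d F -> F f -> F g -> f <> g -> fr r h ->
  ray d f h io c -> ray d g h io' c' -> io = io' /\ c = c'.
Proof.
move=> HA Ff Fg fg hh [l l0 hl] [l' l0' hl'].
have E : mkray h l io c = mkray h l' io' c'.
  have m1 : 0 < Num.min l l' by rewrite lt_min l0 l0'.
  apply: (HA _ _ _ _ Ff Fg fg hl hl'); exists (app h pt0), (app h (ptx (Num.min l l'))); split.
    by move/(app_inj hh) => /(congr1 fst) /= e; have := m1; rewrite -e ltxx.
  have m0 : 0 <= Num.min l l' by rewrite le_min !ltW.
  have S (k x : R) io0 c0 : 0 <= x <= k -> 0 < k -> arrow_segment (mkray h k io0 c0) (app h (ptx x)).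
    exact: mkray_seg.
  split; split.
  - by apply: (S _ 0) => //; rewrite lexx ltW.
  - by apply: (S _ 0) => //; rewrite lexx ltW.
  - by apply: S => //; rewrite m0 ge_min lexx.
  - by apply: S => //; rewrite m0 ge_min lexx orbT.
have E2 : c = c' by have := congr1 snd E; rewrite /mkray; case: (io); case: (io').
have Z (x : R) : 0 < x -> app h pt0 <> app h (ptx x).
  by move=> x0 /(app_inj hh) /(congr1 fst) /= e; move: x0; rewrite -e ltxx.
case: io {hl} E; case: io' {hl'} => E; split=> //.
  by have : app h pt0 = app h (ptx l') := congr1 (fun e => e.1.1) E; move/(Z _ l0').
by have : app h pt0 = app h (ptx l) := esym (congr1 (fun e => e.1.1) E); move/(Z _ l0).
Qed.

(** Right multiplication by the three mirrors moves a flag to the other right angles at its base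
    point; [swap] exchanges its two axes. *)
Definition mirY : frame R := Frame 0 0 1 0 0 (-1).
Definition mirX : frame R := Frame 0 0 (-1) 0 0 1.
Definition mirXY : frame R := Frame 0 0 (-1) 0 0 (-1).
Definition swap : frame R := Frame 0 0 0 1 1 0.

Lemma fr_mirY : fr 1 mirY. Proof. by split; rewrite /= ?ltr01 //; ring. Qed.
Lemma fr_mirX : fr 1 mirX. Proof. by split; rewrite /= ?ltr01 //; ring. Qed.
Lemma fr_mirXY : fr 1 mirXY. Proof. by split; rewrite /= ?ltr01 //; ring. Qed.
Lemma fr_swap : fr 1 swap. Proof. by split; rewrite /= ?ltr01 //; ring. Qed.

(** The five convex corners; the sixth vertex of the hexagon is the notch. [csx] and [csy] say
    whether the bee lies in the positive direction of each coordinate. *)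
Inductive corner := cA | cB | cC | cE | cF.
Definition cx c : R := match c with cA => 0 | cB => p | cC => p | cE => p ^+ 3 | cF => 0 end.
Definition cy c : R := match c with cA => 0 | cB => 0 | cC => p ^+ 2 | cE => 1 | cF => 1 end.
Definition csx c : bool := match c with cA | cF => true | _ => false end.
Definition csy c : bool := match c with cA | cB => true | _ => false end.
Definition sgb (b : bool) : R := if b then 1 else -1.

(** The flag of scale [k] at the corner [c] that points into the bee, along the horizontal side if
    [st] and along the vertical one otherwise. *)
Definition cframe (st : bool) c (k : R) : frame R :=
  if st then Frame (cx c) (cy c) (k * sgb (csx c)) 0 0 (k * sgb (csy c))
  else Frame (cx c) (cy c) 0 (k * sgb (csy c)) (k * sgb (csx c)) 0.

Lemma lexpos0 (b : R) : lexpos 0 b = (0 < b).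
Proof. by rewrite /lexpos ltxx eqxx. Qed.

Lemma lexposn0 (a b : R) : a != 0 -> lexpos a b = (0 < a).
Proof. by rewrite /lexpos => /negbTE ->; rewrite orbF. Qed.

(** If the first axis of the flag is parallel to no side, the signs of [ux] and [uy] alone decide
    which side of each line the germ takes, and [mirY] does not change them. *)
Lemma aligned_form r h : fr r h -> hdir h -> ~~ hdir (h ** mirY) ->
  exists st s1 s2, h = if st then Frame (ox h) (oy h) (r * sgb s1) 0 0 (r * sgb s2)
    else Frame (ox h) (oy h) 0 (r * sgb s2) (r * sgb s1) 0.
Proof.
move=> hh; have [r0 hu hv huv] := hh.
rewrite /hdir /= !mulr0 !addr0 !mulr1 !mulrN1 !add0r => h1 h2.
have sq (x : R) : x ^+ 2 = r ^+ 2 -> exists s, x = r * sgb s.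
  move/eqP; rewrite eqf_sqr => /orP[] /eqP ->; [exists true|exists false]; rewrite /sgb; lra.
have [/eqP e|/eqP e] : (ux h == 0) \/ (uy h == 0).
- case: eqP => /eqP n1; first by left.
  case: eqP => /eqP n2; first by right.
  by move: h2; rewrite (lexposn0 _ n1) (lexposn0 _ n2) -(lexposn0 (vx h) n1) -(lexposn0 (vy h) n2) h1.
- have [s2 es2] : exists s, uy h = r * sgb s by apply: sq; rewrite -hu e; ring.
  have ey : vy h = 0 by case: (fr_orient hh) => -[_ ->]; rewrite e ?oppr0.
  have [s1 es1] : exists s, vx h = r * sgb s by apply: sq; rewrite -hv ey; ring.
  by exists false, s1, s2; case: h e ey es1 es2 {hh hu hv huv h1 h2} => ? ? ? ? ? ? /= -> -> -> ->.
- have [s1 es1] : exists s, ux h = r * sgb s by apply: sq; rewrite -hu e; ring.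
  have ey : vx h = 0 by case: (fr_orient hh) => -[-> _]; rewrite e ?oppr0.
  have [s2 es2] : exists s, vy h = r * sgb s by apply: sq; rewrite -hv ey; ring.
  by exists true, s1, s2; case: h e ey es1 es2 {hh hu hv huv h1 h2} => ? ? ? ? ? ? /= -> -> -> ->.
Qed.

Lemma sgb_gt0 r b : 0 < r -> (0 < r * sgb b) = b.
Proof. by move=> r0; rewrite pmulr_rgt0 //; case: b; rewrite /sgb ?ltr01 // oppr_gt0 ltr10. Qed.

Lemma sgbN r b : - (r * sgb b) = r * sgb (~~ b).
Proof. by case: b; rewrite /sgb /=; ring. Qed.

Lemma sgb_neq0 r b : 0 < r -> r * sgb b != 0.
Proof. by move=> r0; apply: mulf_neq0; [rewrite gt_eqF | case: b; rewrite /sgb ?oppr_eq0 oner_eq0]. Qed.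

Lemma unique_germ s1 s2 x y : germ s1 s2 x y -> ~~ germ (~~ s1) s2 x y -> ~~ germ s1 (~~ s2) x y ->
  ~~ germ (~~ s1) (~~ s2) x y -> exists c, [/\ x = cx c, y = cy c, s1 = csx c & s2 = csy c].
Proof.
have [/andP[a1 a2] /andP[b1 b2] /andP[c1 c2] e4] := psi_bounds R.
rewrite /germ /inq; case: s1; case: s2 => /= h1 h2 h3 h4.
- by exists cA; split => //=; clear a1 a2 b1 b2 c1 c2 e4 h4; lra.
- by exists cF; split => //=; clear a1 a2 b1 c2 e4 h4; lra.
- by exists cB; split => //=; clear a2 b2 c1 e4 h4; lra.
- by case: (leP y (p ^+ 2)) => k; [exists cC | exists cE]; split => //=; clear a1 a2 b1 c1 c2 e4 h4; lra.
Qed.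

(** Only at a convex corner does the bee occupy exactly one of the four right angles at a point. *)
Lemma corner_form r h : fr r h -> hdir h -> ~~ hdir (h ** mirY) -> ~~ hdir (h ** mirX) ->
  ~~ hdir (h ** mirXY) -> exists st c, h = cframe st c r.
Proof.
move=> hh h1 h2 h3 h4; have [r0 _ _ _] := hh.
have [st [s1 [s2 e]]] := aligned_form hh h1 h2; exists st.
move: h1 h2 h3 h4; rewrite {}e; move: (ox h) (oy h) => x y {h hh}.
rewrite /hdir; case: st => /=; rewrite !(mulr0, mul0r, addr0, mulr1, mulrN1, add0r) ?lexpos0 ?(lexposn0 _ (sgb_neq0 _ r0)) ?sgbN ?oppr0
  ?lexpos0 ?(lexposn0 _ (sgb_neq0 _ r0)) !sgb_gt0 // => h1 h2 h3 h4.
  have [c [-> -> -> ->]] := unique_germ h1 h3 h2 h4; by exists c.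
have [c [-> -> -> ->]] := unique_germ h1 h2 h3 h4; by exists c.
Qed.
End Arrows.

(** * Filling the notch of a small tile *)

Section Notch.
Variable R : realType.
Local Notation p := (psi R).
Local Notation sig := (sig R).
Local Notation del := (del R).
Implicit Types (f g h : frame R) (q z w : plane R) (r d : R) (F : set (frame R)) (C : set (plane R)).
Implicit Types (e : arrow R).

(* [io] tells whether the arrow at the corner points away from it; [hz] selects
   the horizontal side of the corner. *)
Definition corner_ray (large hz : bool) (c : corner) : bool * nat :=
  match large, hz, c with
  | true, false, cA => (true, 4) | true, true, cA => (false, 3)
  | true, true, cB => (true, 5) | true, false, cB => (false, 4)
  | true, false, cC => (true, 6) | true, true, cC => (false, 5)
  | true, false, cE => (true, 4) | true, true, cE => (false, 3)
  | true, false, cF => (true, 6) | true, true, cF => (true, 3)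
  | false, false, cA => (true, 5) | false, true, cA => (false, 4)
  | false, true, cB => (true, 6) | false, false, cB => (true, 3)
  | false, false, cC => (false, 3) | false, true, cC => (false, 6)
  | false, false, cE => (true, 5) | false, true, cE => (false, 4)
  | false, false, cF => (false, 3) | false, true, cF => (true, 4)
  end%N.

Definition arrows (large : bool) : seq (arrow R) :=
  if large then large_arrows R else small_arrows R.

Definition tsize (large : bool) d : R := if large then d else p * d.

Lemma farrP d f e : farr d f e <->
  exists large, fr (tsize large d) f /\ exists2 a, a \in arrows large & e = map_arrow (app f) a.
Proof.
split=> [[] [hf ha]|[] [] [hf ha]].
- by exists true.
- by exists false.
- by left.
- by right.
Qed.

Definition darrow : arrow R := mk_arrow 0 0 0 0 0.

Lemma farr_nth d f large i : fr (tsize large d) f -> (i < size (arrows large))%N ->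
  farr d f (map_arrow (app f) (nth darrow (arrows large) i)).
Proof.
by move=> hf hi; apply/farrP; exists large; split=> //; exists (nth darrow (arrows large) i); rewrite ?mem_nth.
Qed.

Lemma farr_nthP d f e : farr d f e -> exists large i, [/\ fr (tsize large d) f,
  (i < size (arrows large))%N & e = map_arrow (app f) (nth darrow (arrows large) i)].
Proof.
move/farrP => [large [hf [a /(nthP darrow) [i hi <-] ->]]]; by exists large, i.
Qed.

Lemma map_arrow_mul f g e : map_arrow (app (f ** g)) e = map_arrow (app f) (map_arrow (app g) e).
Proof. by rewrite /map_arrow /= !app_mul. Qed.

Lemma ray_nth d f h large i l io c : fr (tsize large d) f -> (i < size (arrows large))%N -> 0 < l ->
  nth darrow (arrows large) i = mkray h l io c -> ray d f (f ** h) io c.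
Proof.
move=> hf hi l0 e; exists l => //.
have := farr_nth hf hi; rewrite e /mkray; case: (io) => /=.
  by rewrite /map_arrow /= !app_mul.
by rewrite /map_arrow /= !app_mul.
Qed.

Lemma corner_rayP d f large st c (k : R) : 0 < k -> fr (tsize large d) f ->
  ray d f (f ** cframe st c k) (corner_ray large st c).1 (corner_ray large st c).2.
Proof.
move=> k0 hf; have [/andP[a1 a2] /andP[b1 b2] /andP[c1 c2] e4] := psi_bounds R.
have kn : k != 0 by rewrite gt_eqF.
pose P i (l : R) := [/\ 0 < l, (i < size (arrows large))%N & nth darrow (arrows large) i =
  mkray (cframe st c k) (l / k) (corner_ray large st c).1 (corner_ray large st c).2].
suff [i [l [l0 hi e]]] : exists i l, P i l.
  by apply: (ray_nth hf hi _ e); rewrite divr_gt0.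
pose A i (l : R) : P i l -> exists i l, P i l := fun H => ex_intro _ i (ex_intro _ l H).
Local Ltac corner_case A kn i l := apply: (A i l); split; [lra | by [] |
  rewrite /mkray /mk_arrow /app /cframe /sgb /=; congr (((_, _), (_, _)), _); by field; rewrite ?kn].
case: large {hf} @P @A; case: st; case: c => P A.
- corner_case A kn 4%N (p ^+ 3).
- corner_case A kn 3%N (p - p ^+ 3).
- corner_case A kn 7%N (p - p ^+ 3).
- corner_case A kn 9%N (p ^+ 3).
- corner_case A kn 9%N (p ^+ 3).
- corner_case A kn 0%N (p ^+ 4).
- corner_case A kn 6%N (p ^+ 4).
- corner_case A kn 5%N (p ^+ 2 - p ^+ 4).
- corner_case A kn 8%N (1 - p ^+ 2).
- corner_case A kn 2%N (1 - 2 * p ^+ 4).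
- corner_case A kn 3%N (p ^+ 3).
- corner_case A kn 2%N (p - p ^+ 3).
- corner_case A kn 5%N (p - p ^+ 3).
- corner_case A kn 7%N (p ^+ 3).
- corner_case A kn 7%N (p ^+ 3).
- corner_case A kn 0%N (p ^+ 4).
- corner_case A kn 4%N (p ^+ 2).
- corner_case A kn 4%N (p ^+ 2).
- corner_case A kn 6%N (1 - p ^+ 2).
- corner_case A kn 1%N (1 - p ^+ 4).
Qed.


Definition convexC C : Prop := forall a b, C a -> C b -> forall t : R, 0 <= t <= 1 ->
  C (a.1 + t * (b.1 - a.1), a.2 + t * (b.2 - a.2)).

(** The three points span a triangle in [C]. In it, [s = t / l] and [u = t ^+ 2 / l'] are the
    barycentric weights of the point of the curve, and [s + u <= 1] for small [t]. *)
Lemma convex_flag C h (l l' : R) : convexC C -> 0 < l -> 0 < l' -> C (app h (pt0 R)) ->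
  C (app h (l, 0)) -> C (app h (0, l')) -> \forall t \near (0 : R)^'+, C (app h (t, t ^+ 2)).
Proof.
move=> cvC l0 l0' h0 h1 h2.
have e0 : 0 < Num.min 1 (Num.min l l' / 2) by rewrite lt_min ltr01 divr_gt0 // lt_min l0.
apply: filterS (near0_small e0) => t [t0]; rewrite !lt_min => /andP[t1].
rewrite ltr_pdivlMr // lt_min => /andP[t2 t3].
have t4 : t ^+ 2 <= t by rewrite expr2 ler_piMl // ltW.
have t5 : 0 < t ^+ 2 by rewrite exprn_gt0.
pose s := t / l; pose u := t ^+ 2 / l'.
have s0 : 0 < s by rewrite divr_gt0.
have u0 : 0 < u by rewrite divr_gt0.
have s1 : s <= 1 / 2 by rewrite ler_pdivrMr //; lra.
have u1 : u <= 1 / 2 by rewrite ler_pdivrMr //; lra.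
have su : 0 < s + u by lra.
have k1 : 0 <= u / (s + u) <= 1.
  by rewrite divr_ge0 ?(ltW u0) ?(ltW su) //= ler_pdivrMr // mul1r; lra.
have k2 : 0 <= s + u <= 1 by lra.
have   := cvC _ _ h0 (cvC _ _ h1 h2 _ k1) _ k2; congr C.
have n1 : s + u != 0 by rewrite gt_eqF.
have -> : t = s * l by rewrite /s; field; rewrite gt_eqF.
have -> : (s * l) ^+ 2 = u * l'.
  by rewrite /u /s; field; rewrite !gt_eqF.
clearbody s u; rewrite /app /=; congr pair; field; exact: n1.
Qed.

Lemma fr_tsize d F f : locfam d F -> F f -> exists large, fr (tsize large d) f.
Proof. by case=> _ Fs _ /Fs [?|?]; [exists true | exists false]. Qed.

(** Some tile is entered by a flag inside [C]. The condition on the mirrored flags, which the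
    neighbouring tiles supply in the applications, puts a convex corner of that tile at the base
    point. *)
Lemma corner_fill d F C r h : locfam d F -> (forall q, C q -> exists2 f, F f & tile f q) -> fr r h ->
  (\forall t \near (0 : R)^'+, C (app h (t, t ^+ 2))) ->
  (forall g m, F g -> D g h -> m = mirX R \/ m = mirY R \/ m = mirXY R -> ~~ D g (h ** m)) ->
  exists g large st c k, [/\ F g, fr (tsize large d) g, 0 < k, g ** cframe st c k = h &
    D g h /\ k = (tsize large d)^-1 * r].
Proof.
move=> LF cov hh hC hm.
have [|g Fg Dg] := fill LF hh; first by apply: filterS hC => t /cov.
have [large hg] := fr_tsize LF Fg.
have hk := fr_mul (fr_inv hg) hh.
have [st [c e]] : exists st c, finv g ** h = cframe st c ((tsize large d)^-1 * r).
  apply: (corner_form hk) => //; rewrite -fmulA; apply: (hm g) => //; tauto.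
exists g, large, st, c, ((tsize large d)^-1 * r); split=> //; first by case: hk.
by rewrite -e (fmulfV _ hg).
Qed.

(** The flag at the reentrant vertex, pointing into the missing right angle. *)
Definition notch_frame : frame R := Frame (p ^+ 3) (p ^+ 2) 1 0 0 1.

Lemma fr_notch : fr 1 notch_frame.
Proof. by split; rewrite /= ?ltr01 //; ring. Qed.

Lemma lexpos10 (b : R) : lexpos 1 b = true.
Proof. by rewrite /lexpos ltr01. Qed.

Lemma lexposN10 (b : R) : lexpos (-1) b = false.
Proof. by rewrite /lexpos oppr_gt0 ltr10 oppr_eq0 oner_eq0. Qed.

Lemma hdir_notch : [/\ ~~ hdir notch_frame, hdir (notch_frame ** mirX R),
  hdir (notch_frame ** mirY R) & hdir (notch_frame ** mirXY R)].
Proof.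
have [/andP[a1 a2] /andP[b1 b2] /andP[c1 c2] e4] := psi_bounds R.
rewrite /hdir /= !(mulr0, mul0r, addr0, add0r, mulr1, mul1r) !(lexpos10, lexposN10, lexpos0).
rewrite ltr01 oppr_gt0 ltr10 /germ /inq; split; clear a2 e4; lra.
Qed.

(** The son of the tile whose daughter is [f]. *)
Definition sib f : frame R := f ** (finv del ** sig).

(** Convexity puts the missing right angle into [C] near its vertex, so a tile has a convex corner
    there. Of the two sides of the small tile at the notch one leaves with colour 6 and the other
    enters with colour 5. Corner C of a large tile is the only corner with this pair, and this
    places the tile as the sibling. *)
Lemma notch d F C f : A2F d F C -> convexC C -> F f -> fr (p * d) f -> F (sib f).
Proof.
move=> AF cvC Ff hf; have [LF HA _ cov] := AF; have [d0 Fs Fd] := LF.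
have [/andP[a1 a2] /andP[b1 b2] /andP[c1 c2] e4] := psi_bounds R.
pose h := f ** notch_frame; have hh := fr_mul hf fr_notch.
have inC z : bee z -> C (app f z) by move=> hz; apply/cov; exists f; rewrite // (tile_app _ hf).
have [n0 n1 n2 n3] := hdir_notch.
have Dm m : D f (h ** m) = hdir (notch_frame ** m) by rewrite /D /h -fmulA (fmulVf _ hf).
have D0 : D f h = hdir notch_frame by rewrite /D /h (fmulVf _ hf).
have hC : \forall t \near (0 : R)^'+, C (app h (t, t ^+ 2)).
  apply: (convex_flag (l := p - p ^+ 3) (l' := 1 - p ^+ 2) cvC); rewrite ?app_mul; try lra.
  - by apply: inC; left; split; rewrite /=; lra.
  - by apply: inC; left; split; rewrite /=; lra.
  - by apply: inC; right; split; rewrite /=; lra.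
have [|g [large [st [c [k [Fg hg k0 e [Dg ek]]]]]]] := corner_fill LF (fun q => (cov q).1) hh hC.
  move=> g m Fg Dg hm; apply/negP => Dgm.
  have [large hg] := fr_tsize LF Fg.
  have [s hs] : exists s, fr s (h ** m).
    by exists (p * d * 1 * 1); apply: fr_mul; rewrite //; case: hm => [->|[]->];
      [exact: fr_mirX | exact: fr_mirY | exact: fr_mirXY].
  have fm : D f (h ** m) by rewrite Dm; case: hm => [->|[]->].
  have fg : f = g by apply: Fd => //; exact: (D_ov hf hg hs).
  by move: Dg; rewrite -fg D0 (negbTE n0).
rewrite -/h in e Dg.
have fg : f <> g by move=> E; move: Dg; rewrite -E D0 (negbTE n0).
have Rg st' : h ** (if st' then fone R else swap R) = g ** cframe (if st' then st else ~~ st) c k.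
  case: st'; first by rewrite fmulf1.
  by rewrite -e -fmulA; congr (_ ** _); case: (st) => /=; congr Frame => /=; ring.
have hs st' : fr (p * d * 1 * 1) (h ** (if st' then fone R else swap R)).
  by apply: fr_mul => //; case: st'; [exact: fr_one | exact: fr_swap].
have gray st' : ray d g (h ** (if st' then fone R else swap R))
    (corner_ray large (if st' then st else ~~ st) c).1 (corner_ray large (if st' then st else ~~ st) c).2.
  by rewrite Rg; apply: corner_rayP.
have fray1 : ray d f (h ** (if true then fone R else swap R)) true 6.
  rewrite fmulf1; apply: (ray_nth (large := false) (i := 5%N) (l := p - p ^+ 3)) => //; first
      (clear a2 b1 b2 c1 cov d0 e e4 ek gray hs inC k0 n1 n2 n3; lra).
  by rewrite /mkray /mk_arrow /app /=; congr (((_, _), (_, _)), _); ring.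
have fray2 : ray d f (h ** (if false then fone R else swap R)) false 5.
  rewrite -fmulA; apply: (ray_nth (large := false) (i := 6%N) (l := 1 - p ^+ 2)) => //; first
      (clear a1 a2 b1 c1 c2 cov d0 e e4 ek gray hs inC k0 n1 n2 n3; lra).
  by rewrite /mkray /mk_arrow /app /=; congr (((_, _), (_, _)), _); ring.
have := ray_match HA Ff Fg fg (hs false) fray2 (gray false).
have := ray_match HA Ff Fg fg (hs true) fray1 (gray true).
(* Of the twenty combinations the two matching conditions leave only corner C of a large tile with
   [st = false]. *)
move: hg ek e {gray Rg}; case: large; case: st; case: c => hg ek e [] //= _ _ [] // _ _.
suff -> : sib f = g by [].
have hck : fr k (cframe false cC k) by split; rewrite //= /sgb; ring.
apply: (fmulIf hck); rewrite e /sib /h -!fmulA; congr (_ ** _).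
apply: (fmulfI (fr_del R)); rewrite (fmulfV _ (fr_del R)).
have {}ek : k = p.
  by rewrite ek /tsize; field; rewrite gt_eqF.
rewrite ek /sgb; congr Frame => /=; ring: e4.
Qed.
End Notch.

(** * Composition to the next coarser level and the arrow rule there *)

Section Composition.
Variable R : realType.
Local Notation p := (psi R).
Local Notation sig := (sig R).
Local Notation del := (del R).
Local Notation darrow := (darrow R).
Local Notation arrows := (arrows R).
Implicit Types (f g h : frame R) (q z w : plane R) (r d : R) (F : set (frame R)) (C : set (plane R)).
Implicit Types (e : arrow R).

(* A small tile of one level is a large tile of the next finer one: this is [Ksame]. *)
Inductive kidk := Ksame | Ksig | Kdel.
Definition kfr k : frame R := match k with Ksame => fone R | Ksig => sig | Kdel => del end.
Definition klarge k : bool := match k with Kdel => false | _ => true end.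
Definition kok (large : bool) k : bool :=
  match k with Ksame => ~~ large | _ => large end.

Lemma psi_neq0 : p != 0.
Proof. by rewrite gt_eqF // psi_gt0. Qed.

Lemma fr_kfr k : exists r, fr r (kfr k).
Proof. by case: k; [exists 1; exact: fr_one | exists p; exact: fr_sig | exists (p ^+ 2); exact: fr_del]. Qed.

Lemma fr_kid d f large k : fr (tsize large (d / p)) f -> kok large k ->
  fr (tsize (klarge k) d) (f ** kfr k).
Proof.
have p0 := psi_neq0.
case: k; case: large => // hf _ /=.
- by rewrite fmulf1; move: hf; rewrite /tsize mulrC divfK.
- by rewrite -(divfK p0 d); apply: fr_mul => //; exact: fr_sig.
- have -> : p * d = d / p * p ^+ 2 by field.
  by apply: fr_mul => //; exact: fr_del.
Qed.

Lemma tsize_inj large large' d f : 0 < d -> fr (tsize large d) f -> fr (tsize large' d) f -> large = large'.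
Proof.
have [/andP[a1 a2] _ _ _] := psi_bounds R.
move=> d0 h h'; have := fr_unique h h'.
by case: large {h}; case: large' {h'} => // e; exfalso; rewrite /= in e; nra.
Qed.

Lemma kid_tile large d f q : fr (tsize large d) f -> tile f q -> exists2 k, kok large k & tile (f ** kfr k) q.
Proof.
case: large => /= hf.
  by move/(tile_split _ hf) => -[h|h]; [exists Ksig | exists Kdel].
by exists Ksame; rewrite // fmulf1.
Qed.

Lemma kid_stile r f k q : fr r f -> stile (f ** kfr k) q -> stile f q.
Proof.
by case: k => /= hf; [rewrite fmulf1 | apply: (stile_sig hf) | apply: (stile_del hf)].
Qed.

Lemma kid_sub r f k q : fr r f -> tile (f ** kfr k) q -> tile f q.
Proof.
move=> hf; case: k => /=; first by rewrite fmulf1.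
  by move=> h; apply/(tile_split _ hf); left.
by move=> h; apply/(tile_split _ hf); right.
Qed.

(* The inverse of [substitution]: the frames of the tiles of size [d / p] obtained
   by merging every small tile with its sibling, and of the remaining large tiles. *)
Definition compose d F : set (frame R) := [set f | exists large, [/\ fr (tsize large (d / p)) f,
  forall k, kok large k -> F (f ** kfr k) & large = false -> ~ F (f ** (finv sig ** del))]].

Section Step.
Variables (d : R) (F : set (frame R)) (C : set (plane R)).
Hypotheses (AF : A2F d F C) (cvC : convexC C).

Let d0 : 0 < d. Proof. by case: AF => -[]. Qed.
Let d'0 : 0 < d / p. Proof. by rewrite divr_gt0 // psi_gt0. Qed.

(** A small tile has its sibling by [notch]. A large tile is a son if the matching daughter is
    present, and otherwise it persists as a small tile of the coarser level. *)
Lemma compose_parent g : F g -> exists f large k, [/\ compose d F f, fr (tsize large (d / p)) f,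
  kok large k & g = f ** kfr k].
Proof.
move=> Fg; have [LF HA _ cov] := AF; have p0 := psi_neq0; have [lg hg] := fr_tsize LF Fg.
have hs := fr_sig R; have hd := fr_del R.
case: lg hg => /= hg; last first.
  exists (g ** finv del), true, Kdel.
  have hf : fr (d / p) (g ** finv del).
    by rewrite (_ : d / p = p * d * (p ^+ 2)^-1); [apply: fr_mul; rewrite // ; exact: fr_inv | field].
  have E : g = g ** finv del ** del by rewrite -fmulA (finvK hd) fmulf1.
  split=> //; exists true; split=> // -[] //= _; last by rewrite -E.
  by rewrite -fmulA; apply: (notch AF cvC Fg hg).
have [h|h] := pselect (F (g ** (finv sig ** del))).
  exists (g ** finv sig), true, Ksig.
  have hf : fr (d / p) (g ** finv sig) by apply: fr_mul => //; exact: fr_inv.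
  have E : g = g ** finv sig ** sig by rewrite -fmulA (finvK hs) fmulf1.
  by split=> //; exists true; split=> // -[] //= _; rewrite -?E // -fmulA.
exists g, false, Ksame; rewrite fmulf1.
have hf : fr (tsize false (d / p)) g by rewrite /tsize mulrC divfK.
by split=> //; exists false; split=> // -[] //= _; rewrite fmulf1.
Qed.

(** The only possible ambiguity is a fine large tile read both as a son and as persisting; the last
    clause of [compose] excludes it. *)
Lemma compose_kid_inj f g large large' k k' : compose d F f -> compose d F g ->
  fr (tsize large (d / p)) f -> fr (tsize large' (d / p)) g -> kok large k -> kok large' k' ->
  f ** kfr k = g ** kfr k' -> f = g.
Proof.
have hs := fr_sig R; have hd := fr_del R; have p0 := psi_neq0.
have W k1 k2 f1 g1 l1 l2 : fr (tsize l1 (d / p)) f1 -> fr (tsize l2 (d / p)) g1 -> kok l1 k1 -> kok l2 k2 ->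
    f1 ** kfr k1 = g1 ** kfr k2 -> klarge k1 = klarge k2.
  move=> h1 h2 o1 o2 e; have := fr_kid h1 o1; rewrite e => h3.
  exact: (tsize_inj d0 h3 (fr_kid h2 o2)).
have N f1 g1 : compose d F f1 -> compose d F g1 -> fr (tsize false (d / p)) f1 -> fr (tsize true (d / p)) g1 ->
    f1 = g1 ** sig -> False.
  move=> [l1 [h1 _ n1]] [l2 [h2 n2 _]] hf hg e.
  have e1 := tsize_inj d'0 hf h1; have e2 := tsize_inj d'0 hg h2; subst l1 l2.
  by apply: (n1 erefl); rewrite e -fmulA (fmulfV _ hs); exact: (n2 Kdel).
move=> cf cg hf hg ok ok' e; have := W _ _ _ _ _ _ hf hg ok ok' e.
case: k ok e; case: k' ok'; case: large hf; case: large' hg => // hg hf _ _ /=; rewrite ?fmulf1 => e _ //.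
- by case: (N f g).
- by case: (N g f).
- exact: (fmulIf hs e).
- exact: (fmulIf hd e).
Qed.

Lemma compose_locfam : locfam (d / p) (compose d F).
Proof.
have [LF _ _ _] := AF; have [_ _ Fd] := LF; have p0 := psi_neq0.
split=> // [f [[] [hf _ _]]|f g cf cg [q [qf qg]]]; [by left | by right |].
have [l1 [h1 n1 _]] := cf; have [l2 [h2 n2 _]] := cg.
have [k ok tk] := kid_tile h1 (stile_tile h1 qf).
have hk := fr_kid h1 ok.
have [q1 [g1 k1]] := tile_regular hk (open_stile (f := g)) qg tk.
have [k' ok' tk'] := kid_tile h2 (stile_tile h2 g1).
have hk' := fr_kid h2 ok'.
apply: (compose_kid_inj cf cg h1 h2 ok ok'); apply: Fd; [exact: n1 | exact: n2 |].
have [q2 [? ?]] := tile_regular hk' (open_stile (f := f ** kfr k)) k1 tk'.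
by exists q2.
Qed.

Lemma compose_cover q : C q <-> exists2 f, compose d F f & tile f q.
Proof.
have [_ _ _ cov] := AF; rewrite cov; split=> [[g Fg hq]|[f [l [hf hk _]] hq]].
  have [f [l [k [cf hf ok e]]]] := compose_parent Fg; exists f => //.
  by apply: (kid_sub (k := k) hf); rewrite -e.
have [k ok tk] := kid_tile hf hq; exists (f ** kfr k) => //; exact: hk.
Qed.
End Step.

(** A coarse arrow of colour 3 has length [d * p ^+ 2 = d * p ^+ 6 + d * p ^+ 4]. The splitting
    point cuts off the share [p ^+ 4] at the target, and [dec] reverses both parts. For the other
    colours the number merely drops by one, because the coarse unit is [d / p]. *)
Definition midpt q z : plane R := (z.1 + p ^+ 4 * (q.1 - z.1), z.2 + p ^+ 4 * (q.2 - z.2)).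
Definition dec e : seq (arrow R) :=
  if e.2 == 3%N then [:: ((e.1.2, midpt e.1.1 e.1.2), 6%N); ((midpt e.1.1 e.1.2, e.1.1), 4%N)]
  else [:: (e.1, e.2.-1)].

(** The parts of the coarse arrow [i], each given by the child that carries it and its index among
    the arrows of that child. *)
Definition dtab (large : bool) (i : nat) : seq (kidk * nat) :=
  if large then
    nth [::] [:: [:: (Ksig, 9)]; [:: (Kdel, 1)]; [:: (Kdel, 0)]; [:: (Ksig, 0)]; [:: (Ksig, 2); (Ksig, 1)];
      [:: (Ksig, 3)]; [:: (Ksig, 4)]; [:: (Ksig, 6)]; [:: (Kdel, 4)]; [:: (Kdel, 2); (Kdel, 3)]] i
  else
    nth [::] [:: [:: (Ksame, 0)]; [:: (Ksame, 2); (Ksame, 1)]; [:: (Ksame, 3)]; [:: (Ksame, 4)];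
      [:: (Ksame, 5); (Ksame, 6)]; [:: (Ksame, 7)]; [:: (Ksame, 8)]; [:: (Ksame, 9)]] i.

Definition karrow (kj : kidk * nat) : arrow R :=
  map_arrow (app (kfr kj.1)) (nth darrow (arrows (klarge kj.1)) kj.2).

Lemma app_mid f q z : app f (midpt q z) = midpt (app f q) (app f z).
Proof. by congr pair => /=; ring. Qed.

Lemma dec_map f e : dec (map_arrow (app f) e) = map (map_arrow (app f)) (dec e).
Proof. by rewrite /dec /=; case: ifP => _ //=; rewrite /map_arrow /= -app_mid. Qed.

Lemma dec_table large i : (i < size (arrows large))%N ->
  dec (nth darrow (arrows large) i) = map karrow (dtab large i) /\
  all (fun kj => kok large kj.1 && (kj.2 < size (arrows (klarge kj.1)))%N) (dtab large i).
Proof.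
have e4 := psi4 R.
case: large; do 10?[case: i => [|i]] => //= _; split=> //;
 rewrite /dec /mk_arrow /karrow /= /map_arrow /midpt /app /=;
 do ?[congr cons]; congr (((_, _), (_, _)), _); ring: e4.
Qed.

Lemma dec_kid d f large i b : fr (tsize large (d / p)) f -> (i < size (arrows large))%N ->
  b \in dec (map_arrow (app f) (nth darrow (arrows large) i)) ->
  exists2 k, kok large k & farr d (f ** kfr k) b.
Proof.
move=> hf hi; have [E A] := dec_table hi.
rewrite dec_map E -map_comp => /(nthP darrow) [j]; rewrite size_map => hj.
rewrite (nth_map (Ksame, 0%N)) // => <-.
have := all_nthP (Ksame, 0%N) A _ hj; case: (nth _ _ _) => k l /= /andP[ok hl].
by exists k; rewrite // /karrow -map_arrow_mul /=; exact: (farr_nth (fr_kid hf ok) hl).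
Qed.

Lemma segment_conv z w (a b q : plane R) (l : R) : segment z w a -> segment z w b -> 0 <= l <= 1 ->
  q = (a.1 + l * (b.1 - a.1), a.2 + l * (b.2 - a.2)) -> segment z w q.
Proof.
move=> [s /andP[s0 s1] ->] [t /andP[t0 t1] ->] /andP[l0 l1] ->.
exists (s + l * (t - s)); last by congr pair => /=; rewrite /GRing.scale /=; ring.
by apply/andP; split; nra.
Qed.

Lemma overlap_sym e e' : overlap e e' -> overlap e' e.
Proof. by move=> [q [q' [h [[? ?] [? ?]]]]]; exists q, q'. Qed.

(** If the two common points lie on different parts of [e], then the splitting point is common too,
    and it differs from at least one of them. *)
Lemma overlap_dec e e' : overlap e e' -> exists2 b, b \in dec e & overlap b e'.
Proof.
have [/andP[a1 a2] /andP[b1 b2] _ e4] := psi_bounds R.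
move: e => [[P Q] c] [x [y [xy [[h1 h2] [h3 h4]]]]].
rewrite /dec /=; case: ifP => _; last first.
  by exists ((P, Q), c.-1); rewrite ?inE //; exists x, y.
set M := midpt P Q.
have EM : M = P + (1 - p ^+ 4) *: (Q - P).
  by rewrite /M /midpt; congr pair; rewrite /= /GRing.scale /=; ring.
have lo z t : z = P + t *: (Q - P) -> 0 <= t -> t <= 1 - p ^+ 4 -> segment M P z.
  move=> -> t0 t1; exists (1 - t / (1 - p ^+ 4)).
    rewrite e4; have k : 0 < 1 - (1 - p ^+ 2) by lra.
    have : 0 <= t / (1 - (1 - p ^+ 2)) by rewrite divr_ge0 // ltW.
    have : t / (1 - (1 - p ^+ 2)) <= 1 by rewrite ler_pdivrMr // mul1r -e4.
    lra.
  by rewrite EM; congr pair; rewrite /= /GRing.scale /=; field; rewrite e4; clear a1 a2 b2 e4 t0 t1; lra.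
have hi z t : z = P + t *: (Q - P) -> t <= 1 -> 1 - p ^+ 4 <= t -> segment Q M z.
  move=> -> t0 t1; exists ((1 - t) / p ^+ 4).
    by rewrite divr_ge0 ?ler_pdivrMr /=; rewrite ?e4 ?mul1r; clear a1 a2 b1; lra.
  by rewrite EM; congr pair; rewrite /= /GRing.scale /=; field; exact: psi_neq0.
pose b1' : arrow R := ((Q, M), 6%N); pose b2' : arrow R := ((M, P), 4%N).
have S2 z w : z <> w -> segment M P z -> segment M P w -> arrow_segment e' z -> arrow_segment e' w ->
    exists2 b, b \in [:: b1'; b2'] & overlap b e'.
  by move=> n *; exists b2'; rewrite ?inE ?eqxx ?orbT //; exists z, w.
have S1 z w : z <> w -> segment Q M z -> segment Q M w -> arrow_segment e' z -> arrow_segment e' w ->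
    exists2 b, b \in [:: b1'; b2'] & overlap b e'.
  by move=> n *; exists b1'; rewrite ?inE ?eqxx ?orbT //; exists z, w.
case: h1 => t /andP[t0 t1] ex; case: h3 => s /andP[s0 s1] ey; rewrite /= in ex ey.
have MP : segment M P M by exists 0; rewrite ?lexx ?ler01 // scale0r addr0.
have QM : segment Q M M by exists 1; rewrite ?lexx ?ler01 // scale1r addrC subrK.
have cross z w t' s' : z <> w -> z = P + t' *: (Q - P) -> w = P + s' *: (Q - P) -> 0 <= t' -> s' <= 1 ->
    t' < 1 - p ^+ 4 -> 1 - p ^+ 4 < s' -> arrow_segment e' z -> arrow_segment e' w ->
    exists2 b, b \in [:: b1'; b2'] & overlap b e'.
  move=> n ez ew t0' s1' ht hs kz kw.
  have kM : arrow_segment e' M.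
    apply: (segment_conv kz kw (l := ((1 - p ^+ 4) - t') / (s' - t'))).
      by rewrite divr_ge0 ?ler_pdivrMr /=; clear a1 a2 b1 b2 e4 ew ex ey ez s0 s1 s1' t0 t0' t1; lra.
    rewrite EM ez ew; congr pair; rewrite /= /GRing.scale /=; field; rewrite gt_eqF //;
        clear a1 a2 b1 b2 e4 ew ex ey ez s0 s1 s1' t0 t0' t1; lra.
  have [e1|n1] := pselect (z = M).
    by apply: (S1 w M) => //; [rewrite -e1; exact: nesym | apply: (hi _ s') => //;
        (clear a1 a2 b1 b2 e1 e4 ew ex ey ez ht s0 s1 s1' t0 t0' t1; lra)].
  by apply: (S2 z M) => //; apply: (lo _ t') => //; clear a1 a2 b1 b2 e4 ew ex ey ez hs s0 s1 s1' t0 t0' t1; lra.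
case: (leP t (1 - p ^+ 4)) => ht; case: (leP s (1 - p ^+ 4)) => hs.
- by apply: (S2 x y) => //; [apply: (lo _ t) | apply: (lo _ s)].
- case: (ltgtP t (1 - p ^+ 4)) ht => // ht _; first exact: (cross x y t s).
  by apply: (S1 x y) => //; [apply: (hi _ t) => //; rewrite ht | apply: (hi _ s) => //; rewrite ltW].
- case: (ltgtP s (1 - p ^+ 4)) hs => // hs _; first by apply: (cross y x s t) => //; exact: nesym.
  by apply: (S1 x y) => //; [apply: (hi _ t) => //; rewrite ltW | apply: (hi _ s) => //; rewrite hs].
- by apply: (S1 x y) => //; [apply: (hi _ t) | apply: (hi _ s)] => //; rewrite ltW.
Qed.

Lemma overlap_dec2 e e' : overlap e e' ->
  exists b b', [/\ b \in dec e, b' \in dec e' & overlap b b'].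
Proof.
move=> /overlap_dec [b hb /overlap_sym /overlap_dec [b' hb' /overlap_sym ho]].
by exists b, b'.
Qed.

Lemma arrow_colour large i : (i < size (arrows large))%N -> (2 < (nth darrow (arrows large) i).2 < 7)%N.
Proof. by case: large; do 10?[case: i => [|i]]. Qed.

(** There is no colour 7, so a fine colour 6 can only come from colour 3, and either part of a
    colour-3 arrow determines the arrow. A fine colour 4 comes from colour 3 or from colour 5; this
    is the ambiguity of the last two cases. *)
Lemma dec_eq e e' b : (2 < e.2 < 7)%N -> (2 < e'.2 < 7)%N -> b \in dec e -> b \in dec e' ->
  [\/ e = e', [/\ e.2 = 3%N, e'.2 = 5%N & e'.1 = (midpt e.1.1 e.1.2, e.1.1)] |
  [/\ e'.2 = 3%N, e.2 = 5%N & e.1 = (midpt e'.1.1 e'.1.2, e'.1.1)]].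
Proof.
have [/andP[a1 a2] /andP[b1 b2] _ e4] := psi_bounds R.
have M6 P Q P' Q' : (Q, midpt P Q) = (Q', midpt P' Q') -> (P, Q) = (P', Q').
  case: P Q P' Q' => P1 P2 [Q1 Q2] [P1' P2'] [Q1' Q2'] [-> ->]; rewrite /midpt /= => h1 h2.
  have n : p ^+ 4 != 0 by rewrite gt_eqF // e4; lra.
  congr ((_, _), _); apply: (mulfI n); lra.
have M4 P Q P' Q' : (midpt P Q, P) = (midpt P' Q', P') -> (P, Q) = (P', Q').
  case: P Q P' Q' => P1 P2 [Q1 Q2] [P1' P2'] [Q1' Q2']; rewrite /midpt /= => -[h1 h2 k1 k2].
  move: h1 h2; rewrite k1 k2 => h1 h2.
  have n : 1 - p ^+ 4 != 0 by rewrite gt_eqF // e4; lra.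
  congr (_, (_, _)); apply: (mulfI n); clear a1 a2 b1 b2 e4 k1 k2 n; lra.
case: e e' => [[P Q] c] [[P' Q'] c'] /= hc hc'; rewrite /dec /=.
case: eqP => [->|n]; case: eqP => [->|n']; rewrite !inE.
- move=> /orP[] /eqP -> /orP[] /eqP // [] *.
  + by constructor 1; congr (_, _); apply: M6; congr pair => //; congr pair.
  + by constructor 1; congr (_, _); apply: M4; congr pair => //; congr pair.
- move=> /orP[] /eqP -> /eqP // [] *; subst.
  + by exfalso; lia.
  + by constructor 2; split=> //; lia.
- move=> /eqP -> /orP[] /eqP // [] *; subst.
  + by exfalso; lia.
  + by constructor 3; split=> //; lia.
- move=> /eqP -> /eqP [] *; subst; constructor 1; congr (_, _); lia.
Qed.

(** The direction and colour, after splitting, of the part of an arrow that touches the base point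
    of its ray. *)
Definition decray (io : bool) (c : nat) : bool * nat :=
  if c == 3%N then (if io then (false, 4%N) else (true, 6%N)) else (io, c.-1).

Lemma decray_in (l : R) h io c : 0 < l -> exists2 l' : R, 0 < l' &
  mkray h l' (decray io c).1 (decray io c).2 \in dec (mkray h l io c).
Proof.
have [/andP[a1 a2] /andP[b1 b2] _ e4] := psi_bounds R.
move=> l0; rewrite /decray /dec /mkray; case: io => /=; case: eqP => _ /=.
- exists (l * (1 - p ^+ 4)); first by rewrite mulr_gt0 // e4; lra.
  rewrite inE [X in _ || X]inE; apply/orP; right; apply/eqP; congr ((_, _), _).
  by rewrite -app_mid; congr app; congr pair => /=; ring.
- by exists l; rewrite // inE.
- exists (l * p ^+ 4); first by rewrite mulr_gt0 // e4; lra.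
  rewrite inE; apply/orP; left; apply/eqP; congr ((_, _), _).
  by rewrite -app_mid; congr app; congr pair => /=; ring.
- by exists l; rewrite // inE.
Qed.

Lemma lexpos_pos (a b : R) : 0 < a -> lexpos a b = true.
Proof. by rewrite /lexpos => ->. Qed.

Lemma lexpos_neg (a b : R) : a < 0 -> lexpos a b = false.
Proof. by move=> h; rewrite /lexpos ltNge (ltW h) /= lt_eqF. Qed.

(* A colour-3 arrow, seen from the point where it splits. *)
Lemma colour3_frame large i : (i < size (arrows large))%N -> (nth darrow (arrows large) i).2 = 3%N ->
  exists n (l m : R), [/\ 0 < l, 0 < m & [/\ fr 1 n, (nth darrow (arrows large) i).1.1 = app n (ptx (- l)),
     (nth darrow (arrows large) i).1.2 = app n (ptx m),
     midpt (nth darrow (arrows large) i).1.1 (nth darrow (arrows large) i).1.2 = app n (pt0 R) &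
   [/\ ~~ hdir n, ~~ hdir (n ** mirX R), hdir (n ** mirY R) & hdir (n ** mirXY R)]]].
Proof.
have [/andP[a1 a2] /andP[b1 b2] /andP[c1 c2] e4] := psi_bounds R.
have fr1 (a b c k x y : R) : a ^+ 2 + c ^+ 2 = 1 -> b ^+ 2 + k ^+ 2 = 1 -> a * b + c * k = 0 -> fr 1 (Frame x y a c b k).
  by move=> ? ? ?; split; rewrite /= ?ltr01 ?expr1n.
have e7 : p ^+ 4 * p ^+ 3 = 2 * p ^+ 3 - p by ring: e4.
have e6 : p ^+ 4 * p ^+ 2 = 2 * p ^+ 2 - 1 by ring: e4.
have e8 : p ^+ 4 * (1 - p ^+ 4) = 2 * p ^+ 2 - 1 by ring: e4.
Local Ltac c3 n l m fr1 := exists n, l, m; split; [lra | lra |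
  split; [by apply: fr1; ring | by rewrite /app /=; congr pair; ring |
    by rewrite /app /=; congr pair; ring | by rewrite /app /midpt /=; congr pair; ring |
   rewrite /hdir /= !(mulr0, mul0r, addr0, add0r, mulr1, mul1r, mulN1r, mulrN1, opprK, oppr0)
    !(lexpos10, lexposN10, lexpos0) ?ltr01 ?oppr_gt0 ?ltr10 /germ /inq; split; lra]].
case: large; do 10?[case: i => [|i]] => //= _ _.
- c3 (Frame (p ^+ 4 * p ^+ 3) 0 (-1) 0 0 (-1)) (p ^+ 3 - p ^+ 4 * p ^+ 3) (p ^+ 4 * p ^+ 3) fr1.
- c3 (Frame (p ^+ 3 - p ^+ 4 * p ^+ 3) 1 1 0 0 1) (p ^+ 3 - p ^+ 4 * p ^+ 3) (p ^+ 4 * p ^+ 3) fr1.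
- c3 (Frame 0 (1 - p ^+ 4 * (1 - p ^+ 4)) 0 1 (-1) 0) (1 - p ^+ 4 - p ^+ 4 * (1 - p ^+ 4)) (p ^+ 4 * (1 - p ^+ 4)) fr1.
- c3 (Frame p (p ^+ 2 - p ^+ 4 * p ^+ 2) 0 1 1 0) (p ^+ 2 - p ^+ 4 * p ^+ 2) (p ^+ 4 * p ^+ 2) fr1.
Qed.

(** The base point of [h] is the tail of the arrow. In the first two cases the tile occupies a right
    angle below the axis, where the tile of the colour-3 arrow will be. In the third the tail is a
    convex corner whose other side goes up the second axis, so that the right angle of [h] is left
    free. *)
Lemma colour5_frame large i r h (l : R) : (i < size (arrows large))%N -> (nth darrow (arrows large) i).2 = 5%N ->
  fr r h -> 0 < l -> (nth darrow (arrows large) i).1 = (app h (pt0 R), app h (ptx (- l))) ->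
  [\/ hdir (h ** mirY R), hdir (h ** mirXY R) |
   [/\ hdir (h ** mirX R), ~~ hdir h & exists2 l' : R, 0 < l' & bee (app h (0, l'))]].
Proof.
have [/andP[a1 a2] /andP[b1 b2] /andP[c1 c2] e4] := psi_bounds R.
move=> hi hc hh l0 e; have [r0 _ _ _] := hh; have ho := fr_orient hh.
have e1 := congr1 (fun u => u.1.1) e; have e2 := congr1 (fun u => u.1.2) e.
have e3 := congr1 (fun u => u.2.1) e; have e5 := congr1 (fun u => u.2.2) e.
case: h ho e1 e2 e3 e5 {e hh} => x y a b c k /= ho e1 e2 e3 e5.
have ln : l != 0 by rewrite gt_eqF.
have Z u : u * l = 0 -> u = 0 by move=> h; apply: (mulIf ln); rewrite h mul0r.
have P u : 0 < u * l -> 0 < u by rewrite pmulr_lgt0.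
have Q u : 0 < u -> [/\ forall w : R, lexpos u w = true, forall w : R, lexpos (- u) w = false,
  (0 < u) = true & (0 < - u) = false].
  move=> u0; split=> [w|w||] //; [exact: lexpos_pos | by apply: lexpos_neg; rewrite oppr_lt0 |].
  by rewrite oppr_gt0 ltNge ltW.
Local Ltac c5 l1 l2 l3 l4 := rewrite /hdir /= ?(mulr0, mul0r, addr0, add0r, mulr1, mul1r, mulN1r, mulrN1, opprK, oppr0)
    ?(l1, l2, lexpos0, l3, l4) /germ /inq.
move: hc e1 e2 e3 e5; case: large hi; do 10?[case: i => [|i]] => //= _ _ e1 e2 e3 e5.
- have b0 : b = 0 by apply: Z; lra.
  have a0 : 0 < a by apply: P; clear a2 b0 b1 b2 c1 e2 e4 e5 ho l0 ln r0; lra.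
  have [l1 l2 l3 l4] := Q _ a0; have -> : x = p by clear a0 a1 a2 b0 b1 b2 c1 c2 e2 e3 e4 e5 ho l0 l1 l2 l3 l4 ln r0; lra.
  have -> : y = 0 by clear a0 a1 a2 b0 b1 b2 c1 c2 e1 e3 e4 e5 ho l0 l1 l2 l3 l4 ln r0; lra.
  rewrite b0 in ho *; case: ho => -[-> ->].
    constructor 3; split; [c5 l1 l2 l3 l4; clear -a1 b1 c2; lra | c5 l1 l2 l3 l4; clear -a1 b1 c2; lra |].
    exists (p ^+ 3 / 2 / (a)); first by rewrite divr_gt0 // divr_gt0 ?ltr0n // exprn_gt0 // psi_gt0.
    have -> : app (Frame p 0 a 0 (- 0) a) (0, p ^+ 3 / 2 / a) = (p, p ^+ 3 / 2).
      by rewrite /app /=; congr pair; field; rewrite ?gt_eqF.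
    by left; split; rewrite /=; clear -a1 a2 b1 b2 c1 c2 e4; lra.
  by constructor 2; c5 l1 l2 l3 l4; clear -a1 b1; lra.
- have b0 : b = 0 by apply: Z; lra.
  have a0 : 0 < - a by apply: P; clear a2 b0 b1 b2 c1 e2 e4 e5 ho l0 ln r0; lra.
  have [l1 l2 l3 l4] := Q _ a0; have -> : x = p ^+ 3 by
      clear a0 a1 a2 b0 b1 b2 c1 c2 e2 e3 e4 e5 ho l0 l1 l2 l3 l4 ln r0; lra.
  have -> : y = p ^+ 2 by clear a0 a1 a2 b0 b1 b2 c1 c2 e1 e3 e4 e5 ho l0 l1 l2 l3 l4 ln r0; lra.
  rewrite opprK in l2 l4.
  rewrite b0 in ho *; case: ho => -[-> ->].
    by constructor 1; c5 l1 l2 l3 l4; clear -b1 b2 c1; lra.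
  by constructor 2; c5 l1 l2 l3 l4; clear -a1 b1 c1 c2; lra.
- have b0 : a = 0 by apply: Z; clear a1 a2 b1 b2 c1 c2 e2 e4 e5 ho l0 ln r0; lra.
  have a0 : 0 < - b by apply: P; clear a1 a2 b0 b1 c1 c2 e1 e3 ho l0 ln r0; lra.
  have [l1 l2 l3 l4] := Q _ a0; have -> : x = 0 by clear a0 a1 a2 b0 b1 b2 c1 c2 e2 e3 e4 e5 ho l0 l1 l2 l3 l4 ln r0; lra.
  have -> : y = 0 by clear a0 a1 a2 b0 b1 b2 c1 c2 e1 e3 e4 e5 ho l0 l1 l2 l3 l4 ln r0; lra.
  rewrite opprK in l2 l4.
  rewrite b0 in ho *; case: ho => -[-> ->].
    constructor 3; split; [c5 l1 l2 l3 l4; clear -c1; lra | c5 l1 l2 l3 l4; clear -c1; lra |].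
    exists (p ^+ 3 / 2 / (- b)); first by rewrite divr_gt0 // divr_gt0 ?ltr0n // exprn_gt0 // psi_gt0.
    have -> : app (Frame 0 0 0 b (- b) 0) (0, p ^+ 3 / 2 / - b) = (p ^+ 3 / 2, 0).
      by rewrite /app /=; congr pair; field; rewrite -oppr_eq0 ?gt_eqF.
    by left; split; rewrite /=; clear -a1 a2 b1 b2 c1 c2 e4; lra.
  by constructor 2; c5 l1 l2 l3 l4; clear -c1; lra.
- have b0 : a = 0 by apply: Z; clear a1 a2 b1 b2 c1 c2 e2 e4 e5 ho l0 ln r0; lra.
  have a0 : 0 < b by apply: P; clear a1 a2 b0 b1 c1 c2 e1 e3 e4 ho l0 ln r0; lra.
  have [l1 l2 l3 l4] := Q _ a0; have -> : x = p ^+ 3 by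
      clear a0 a1 a2 b0 b1 b2 c1 c2 e2 e3 e4 e5 ho l0 l1 l2 l3 l4 ln r0; lra.
  have -> : y = 1 by clear a0 a1 a2 b0 b1 b2 c1 c2 e1 e3 e4 e5 ho l0 l1 l2 l3 l4 ln r0; lra.
  rewrite b0 in ho *; case: ho => -[-> ->].
    constructor 3; split; [c5 l1 l2 l3 l4; clear -b2 c1; lra | c5 l1 l2 l3 l4; clear -b2 c1; lra |].
    exists (p ^+ 3 / 2 / (b)); first by rewrite divr_gt0 // divr_gt0 ?ltr0n // exprn_gt0 // psi_gt0.
    have -> : app (Frame (p ^+ 3) 1 0 b (- b) 0) (0, p ^+ 3 / 2 / b) = (p ^+ 3 / 2, 1).
      by rewrite /app /=; congr pair; field; rewrite ?gt_eqF.
    by right; split; rewrite /=; clear -a1 a2 b1 b2 c1 c2 e4; lra.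
  by constructor 2; c5 l1 l2 l3 l4; clear -c1; lra.
Qed.

Lemma arrow_bee large i : (i < size (arrows large))%N ->
  bee (nth darrow (arrows large) i).1.1 /\ bee (nth darrow (arrows large) i).1.2.
Proof.
have [/andP[a1 a2] /andP[b1 b2] /andP[c1 c2] e4] := psi_bounds R.
by case: large; do 10?[case: i => [|i]] => //= _; split; rewrite /bee /rect /setU /=; clear a2 c2; lra.
Qed.

(* The tail [M] of an arrow of colour 5 on the side of [f2] cannot lie inside an
   arrow of colour 3 of [f1]: the free right angle at [M] would be filled by the
   corner of a tile with an incoming arrow that splits into one of colour 6. *)
Lemma no_half_match d F C f1 f2 large1 large2 i1 i2 : A2F d F C -> convexC C ->
  compose d F f1 -> compose d F f2 -> f1 <> f2 ->
  fr (tsize large1 (d / p)) f1 -> fr (tsize large2 (d / p)) f2 ->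
  (i1 < size (arrows large1))%N -> (i2 < size (arrows large2))%N ->
  let e1 := map_arrow (app f1) (nth darrow (arrows large1) i1) in
  let e2 := map_arrow (app f2) (nth darrow (arrows large2) i2) in
  e1.2 = 3%N -> e2.2 = 5%N -> e2.1 <> (midpt e1.1.1 e1.1.2, e1.1.1).
Proof.
move=> AF cvC cf1 cf2 f12 h1 h2 hi1 hi2 e1 e2 col1 col2 e21.
have [LF HA _ cov] := AF; have [_ _ Fd] := compose_locfam AF.
have cover' := compose_cover AF cvC.
have [/andP[a1 a2] /andP[b1 b2] /andP[c1 c2] e4] := psi_bounds R.
have p0 := psi_neq0.
have [n1 [l [m [l0 m0 [hn1 nP nQ nM [H00 H10 H01 H11]]]]]] := colour3_frame hi1 col1.
pose h := f1 ** n1; have hh := fr_mul h1 hn1.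
have D1 n : D f1 (h ** n) = hdir (n1 ** n) by rewrite /D /h -fmulA (fmulVf _ h1).
have D10 : D f1 h = hdir n1 by rewrite /D /h (fmulVf _ h1).
pose h' := finv f2 ** h; have hh' := fr_mul (fr_inv h2) hh.
have D2 n : D f2 (h ** n) = hdir (h' ** n) by rewrite /D /h' fmulA.
have hm n : n = mirX R \/ n = mirY R \/ n = mirXY R -> exists r, fr r (h ** n).
  move=> hn; exists (tsize large1 (d / p) * 1 * 1); apply: fr_mul => //.
  by case: hn => [->|[]->]; [exact: fr_mirX | exact: fr_mirY | exact: fr_mirXY].
have eh' : (nth darrow (arrows large2) i2).1 = (app h' (pt0 R), app h' (ptx (- l))).
  move: e21; rewrite /e1 /e2 /= -app_mid nM nP -!app_mul -/h => e.
  have ea : app f2 _ = app h (pt0 R) := congr1 fst e; have eb : app f2 _ = app h (ptx (- l)) := congr1 snd e. 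
  rewrite [LHS]surjective_pairing /h' !(app_mul (finv f2) h) -ea -eb.
  by rewrite !(appVf _ h2).
have f1D n : n = mirY R \/ n = mirXY R -> D f1 (h ** n) by rewrite D1; case=> ->.
have N g n : compose d F g -> n = mirY R \/ n = mirXY R -> D g (h ** n) -> g = f1.
  move=> cg hn Dg; have [lg [hg _ _]] := cg.
  have [r hr] := hm n (or_intror hn).
  by apply: Fd => //; apply: (D_ov hg h1 hr Dg); apply: f1D.
have [] := colour5_frame hi2 col2 hh' l0 eh'.
- by rewrite -D2 => k; apply: f12; rewrite (N f2 _ cf2 _ k) //; left.
- by rewrite -D2 => k; apply: f12; rewrite (N f2 _ cf2 _ k) //; right.
rewrite -D2 => -[k1 k2 [l' l0' bl']].
(* The legs of the free right angle are the rest of the colour-3 arrow and a side of [f2]; both are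
   in [C], so convexity fills the angle. *)
have hC : \forall t \near (0 : R)^'+, C (app h (t, t ^+ 2)).
  have C1 z : bee z -> C (app f1 z) by move=> hz; apply/cover'; exists f1; rewrite // (tile_app _ h1).
  have [bP bQ] := arrow_bee hi1.
  apply: (convex_flag cvC m0 l0').
  - rewrite /h app_mul -nM app_mid; apply: (cvC _ _ (C1 _ bQ) (C1 _ bP)).
    by rewrite e4; clear a1 a2 c1 c2 col1 col2 cov cover' e21 e4 eh' f1D hi1 hi2 hm k1 k2 l0 l0' m0 nM nP nQ p0; lra.
  - by rewrite /h app_mul -[(m, 0)]/(ptx m) -nQ; apply: C1.
  - apply/cover'; exists f2 => //.
    by rewrite -(appfV (app h (0, l')) h2) -(app_mul (finv f2) h) (tile_app _ h2).
have [|g [large [st [c [k [cg hg k0 e [Dg ek]]]]]]] := corner_fill (compose_locfam AF) (fun q => (cover' q).1) hh hC.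
  move=> g n cg Dg hn; apply/negP => Dgn.
  have [lg [hg _ _]] := cg.
  have [r hr] := hm n hn.
  case: hn => [en|hn].
    have E : g = f2 by apply: Fd => //; apply: (D_ov hg h2 hr Dgn); rewrite en.
    by move: Dg; rewrite E /D (negbTE k2).
  by move: Dg; rewrite (N _ _ cg hn Dgn) D10 (negbTE H00).
have fg : f1 <> g by move=> E; move: Dg; rewrite -E D10 (negbTE H00).
have [x x0 ray_g] := corner_rayP st c k0 hg; rewrite e in ray_g.
have [x' x0' hdec] := decray_in h (corner_ray large st c).1 (corner_ray large st c).2 x0.
have [lg [j [hlg hj ej]]] := farr_nthP ray_g.
rewrite ej in hdec; have [kg okg ag] := dec_kid hlg hj hdec.
have : mkray h m false 6 \in dec e1.
  rewrite /dec col1 /= inE; apply/orP; left; apply/eqP; rewrite /mkray.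
  by congr ((_, _), _); rewrite /e1 /= -?app_mid ?nM ?nQ -app_mul.
move=> hdec1; have [kf okf af] := dec_kid h1 hi1 hdec1.
have Fkf : F (f1 ** kfr kf).
  by have [l1 [hl1 n _]] := cf1; apply: n; rewrite (tsize_inj _ hl1 h1) // divr_gt0 ?psi_gt0 //; case: LF.
have Fkg : F (g ** kfr kg).
  by have [l1 [hl1 n _]] := cg; apply: n; rewrite (tsize_inj _ hl1 hlg) // divr_gt0 ?psi_gt0 //; case: LF.
have nk : f1 ** kfr kf <> g ** kfr kg.
  by move=> E; apply: fg; exact: (compose_kid_inj AF cf1 cg h1 hlg okf okg E).
have [] := ray_match HA Fkf Fkg nk hh (ex_intro2 _ _ m m0 af) (ex_intro2 _ _ x' x0' ag).
(* [decray] never yields an entering arrow of colour 6: an entering colour 3 becomes a leaving 6,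
   and the other colours drop to at most 5. *)
by case: (large); case: (st); case: (c).
Qed.

(** Overlapping coarse arrows have overlapping parts, which are equal by the fine arrow rule. By
    [dec_eq] the coarse arrows are then equal or form the mismatch of colours 3 and 5 excluded by
    [no_half_match]. *)
Lemma compose_arrows d F C : A2F d F C -> convexC C -> arrF (d / p) (compose d F).
Proof.
move=> AF cvC f g e e' cf cg fg hf hg ho.
have [LF HA _ cov] := AF.
have [l1 [i1 [h1 hi1 ee]]] := farr_nthP hf; have [l2 [i2 [h2 hi2 ee']]] := farr_nthP hg.
have [b [b' [hb hb' hob]]] := overlap_dec2 ho.
rewrite ee in hb; rewrite ee' in hb'.
have [k okk ak] := dec_kid h1 hi1 hb; have [k' okk' ak'] := dec_kid h2 hi2 hb'.
have d'0 : 0 < d / p by rewrite divr_gt0 ?psi_gt0 //; case: LF.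
have Fk : F (f ** kfr k).
  by have [l [hl n _]] := cf; apply: n; rewrite (tsize_inj d'0 hl h1).
have Fk' : F (g ** kfr k').
  by have [l [hl n _]] := cg; apply: n; rewrite (tsize_inj d'0 hl h2).
have nk : f ** kfr k <> g ** kfr k'.
  by move=> E; apply: fg; exact: (compose_kid_inj AF cf cg h1 h2 okk okk' E).
have E := HA _ _ _ _ Fk Fk' nk ak ak' hob.
rewrite -E in hb'.
have [||//|[c1 c2 c3]|[c1 c2 c3]] := dec_eq _ _ hb hb'; rewrite ?ee ?ee' //.
- by have := arrow_colour hi1.
- by have := arrow_colour hi2.
- by have := no_half_match AF cvC cf cg fg h1 h2 hi1 hi2 c1 c2 c3.
- by have := no_half_match AF cvC cg cf (nesym fg) h2 h1 hi2 hi1 c1 c2 c3.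
Qed.

Lemma compose_A2F d F C : A2F d F C -> convexC C -> A2F (d / p) (compose d F) C.
Proof.
move=> AF cvC; split; [exact: (compose_locfam AF) | exact: (compose_arrows AF cvC) | | exact: (compose_cover AF cvC)].
have [_ _ [f Ff] _] := AF.
by have [g [l [k [cg _ _ _]]]] := compose_parent AF cvC Ff; exists g.
Qed.
End Composition.

(** * Passage between sets of tiles and sets of frames *)

Section Translation.
Variable R : realType.
Local Notation p := (psi R).
Implicit Types (f g h : frame R) (q : plane R) (r d : R) (F : set (frame R)) (T : tileset R).

Definition tset F : tileset R := @tile R @` F.

Lemma is_tileP r (H : set (plane R)) : is_tile r H <-> exists2 f, fr r f & H = tile f.
Proof.
split=> [[f hf ->]|[f hf ->]].
  by have [g [hg e]] := frame_similarity hf; exists g; rewrite // e.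
by exists (app f) => //; apply: similarity_frame.
Qed.

Lemma is_tile_frame r s f : fr s f -> is_tile r (tile f) -> fr r f.
Proof. by move=> hf /is_tileP [g hg /(tile_inj hf hg) ->]. Qed.

Lemma son_tile f : app f @` @bee_son R = tile (f ** sig R).
Proof.
rewrite -app_sig_son /tile; apply/seteqP; split=> q.
  by move=> [_ [z hz <-] <-]; exists z; rewrite // app_mul.
by move=> [z hz <-]; exists (app (sig R) z); rewrite ?app_mul //; exists z.
Qed.

Lemma daughter_tile f : app f @` @bee_daughter R = tile (f ** del R).
Proof.
rewrite -app_del_daughter /tile; apply/seteqP; split=> q.
  by move=> [_ [z hz <-] <-]; exists z; rewrite // app_mul.
by move=> [z hz <-]; exists (app (del R) z); rewrite ?app_mul //; exists z.
Qed.

Lemma is_sonP r f K : fr r f -> is_son K (tile f) <-> K = tile (f ** sig R).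
Proof.
move=> hf; split=> [[s [g [hg e ->]]]|->]; last first.
  by exists r, (app f); split; [exact: similarity_frame | | rewrite son_tile].
have [g' [hg' eg]] := frame_similarity hg; rewrite eg in e *.
by rewrite son_tile (tile_inj hf hg' e).
Qed.

Lemma is_daughterP r f K : fr r f -> is_daughter K (tile f) <-> K = tile (f ** del R).
Proof.
move=> hf; split=> [[s [g [hg e ->]]]|->]; last first.
  by exists r, (app f); split; [exact: similarity_frame | | rewrite daughter_tile].
have [g' [hg' eg]] := frame_similarity hg; rewrite eg in e *.
by rewrite daughter_tile (tile_inj hf hg' e).
Qed.

Lemma tile_arrowP r d f e : fr r f -> tile_arrow d (tile f) e <-> farr d f e.
Proof.
move=> hf; split=> -[].
- move=> [g [hg e1 ha]]; have [g' [hg' eg]] := frame_similarity hg; rewrite eg in e1 ha.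
  by left; rewrite (tile_inj hf hg' e1).
- move=> [g [hg e1 ha]]; have [g' [hg' eg]] := frame_similarity hg; rewrite eg in e1 ha.
  by right; rewrite (tile_inj hf hg' e1).
- by move=> [hd ha]; left; exists (app f); split=> //; exact: similarity_frame.
- by move=> [hd ha]; right; exists (app f); split=> //; exact: similarity_frame.
Qed.

Definition frames d T : set (frame R) := [set f | (fr d f \/ fr (p * d) f) /\ T (tile f)].

Lemma A2_frames d T : A2_d_tiling d T -> A2F d (frames d T) (covered T) /\ T = tset (frames d T).
Proof.
move=> [[d0 [H0 TH0] Ts Td] TA].
have ET : T = tset (frames d T).
  apply/seteqP; split=> [H TH|_ [f [_ Tf] <-]] //.
  by have [/is_tileP [f hf e]|/is_tileP [f hf e]] := Ts _ TH; exists f; rewrite -?e //; split;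
    rewrite -?e //; [left | right].
have Fr f : frames d T f -> exists r, fr r f by case=> -[?|?] _; [exists d | exists (p * d)].
split=> //; split.
- split=> // [f [] //|f g Ff Fg ho].
  have [r hr] := Fr _ Ff; have [s hs] := Fr _ Fg.
  apply: (tile_inj hr hs); apply: contrapT => ne.
  by have := Td _ _ Ff.2 Fg.2 ne; apply/(interior_tile_ov hr hs).
- move=> f g e e' Ff Fg fg he he' ho.
  have [r hr] := Fr _ Ff; have [s hs] := Fr _ Fg.
  apply: (TA _ _ _ _ Ff.2 Fg.2) => //.
  + by move=> e1; apply: fg; exact: (tile_inj hr hs e1).
  + exact/(tile_arrowP d e hr).
  + exact/(tile_arrowP d e' hs).
- by move: TH0; rewrite {1}ET => -[f Ff _]; exists f.
- move=> q; split=> [[H TH hq]|[f [_ Tf] hq]]; last by exists (tile f).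
  by move: TH hq; rewrite {1}ET => -[f Ff <-]; exists f.
Qed.

Lemma frames_A2 d F C : A2F d F C -> A2_d_tiling d (tset F) /\ covered (tset F) = C.
Proof.
move=> [[d0 Fs Fd] HA [f0 Ff0] cov].
have Fr f : F f -> exists r, fr r f by move=> /Fs [?|?]; [exists d | exists (p * d)].
split.
  split; first split=> //; first by exists (tile f0), f0.
  - by move=> _ [f /Fs [h|h] <-]; [left | right]; apply/is_tileP; exists f.
  - move=> _ _ [f Ff <-] [g Fg <-] ne.
    have [r hr] := Fr _ Ff; have [s hs] := Fr _ Fg.
    by apply/(interior_tile_ov hr hs) => ho; apply: ne; rewrite (Fd _ _ Ff Fg ho).
  move=> _ _ e e' [f Ff <-] [g Fg <-] ne; have [r hr] := Fr _ Ff; have [s hs] := Fr _ Fg.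
  move=> /(tile_arrowP d e hr) he /(tile_arrowP d e' hs) he' ho.
  by apply: (HA _ _ _ _ Ff Fg _ he he' ho) => e1; apply: ne; rewrite e1.
apply/seteqP; split=> q; first by move=> [_ [f Ff <-] hq]; apply/cov; exists f.
by move=> /cov [f Ff hq]; exists (tile f) => //; exists f.
Qed.
End Translation.

(** * The hierarchy of levels and iterated substitution *)

Section Levels.
Variable R : realType.
Local Notation p := (psi R).
Implicit Types (f g h : frame R) (q : plane R) (r : R).

Definition part f g : Prop := (forall q, stile f q -> stile g q) /\ (forall q, tile f q -> tile g q).

Lemma part_refl f : part f f. Proof. by []. Qed.

Lemma part_trans f g h : part f g -> part g h -> part f h.
Proof. by move=> [a b] [c k]; split=> q ?; [apply/c/a | apply/k/b]. Qed.

Lemma part_kid r f k : fr r f -> part (f ** kfr R k) f.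
Proof. by move=> hf; split=> q; [apply: (kid_stile hf) | apply: (kid_sub hf)]. Qed.

Lemma stile_nonempty r f : fr r f -> exists q, stile f q.
Proof.
move=> hf; have [/andP[a1 a2] /andP[b1 b2] _ _] := psi_bounds R.
exists (app f (p / 2, p ^+ 2 / 2)); rewrite (stile_app _ hf); left; split; rewrite /=; lra.
Qed.

Lemma D_part r s t f g h : fr r f -> fr s g -> fr t h -> part f g -> D f h -> D g h.
Proof.
move=> hf hg hh [fg _] /(DP hf hh) k; apply/(DP hg hh); apply: filterS k => x; exact: fg.
Qed.

Fixpoint lev (d : R) (F : set (frame R)) (n : nat) : set (frame R) :=
  if n is m.+1 then compose (d / p ^+ m) (lev d F m) else F.

Variables (d : R) (F : set (frame R)) (C : set (plane R)).
Hypotheses (AF : A2F d F C) (cvC : convexC C).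
Local Notation L := (lev d F).

Lemma dpS n : d / p ^+ n.+1 = d / p ^+ n / p.
Proof. by rewrite exprSr invfM mulrA. Qed.

Lemma dpM n : d / p ^+ n.+1 * p = d / p ^+ n.
Proof. by rewrite dpS divfK // psi_neq0. Qed.

Lemma lev_A2F n : A2F (d / p ^+ n) (L n) C.
Proof.
elim: n => [|n IH]; first by rewrite expr0 divr1.
by rewrite dpS; exact: compose_A2F.
Qed.

Lemma lev_pos n : 0 < d / p ^+ n.
Proof. by have [[]] := lev_A2F n. Qed.

Lemma lev_size n f : L n f -> exists large, fr (tsize large (d / p ^+ n)) f.
Proof. by have [LF _ _ _] := lev_A2F n; exact: fr_tsize. Qed.

Lemma lev_fr n f : L n f -> exists r, fr r f.
Proof. by move=> /lev_size [l h]; exists (tsize l (d / p ^+ n)). Qed.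

Lemma lev_eq n f g : L n f -> L n g -> ov f g -> f = g.
Proof. by have [[_ _ Fd] _ _ _] := lev_A2F n; exact: Fd. Qed.

Lemma lev_cover n q : C q <-> exists2 f, L n f & tile f q.
Proof. by have [_ _ _ cov] := lev_A2F n; exact: cov. Qed.

Lemma lev_kid n f large k : L n.+1 f -> fr (tsize large (d / p ^+ n.+1)) f -> kok large k -> L n (f ** kfr R k).
Proof.
move=> [l [hl hk _]] h ok; apply: hk; rewrite -dpS in hl.
by rewrite (tsize_inj (lev_pos n.+1) hl h).
Qed.

Definition kid_at n g f : Prop := exists large k, [/\ L n.+1 f, fr (tsize large (d / p ^+ n.+1)) f,
  kok large k & g = f ** kfr R k].

Lemma lev_parent n g : L n g -> exists f, kid_at n g f.
Proof.
move=> Lg; have [f [l [k [cf hf ok e]]]] := compose_parent (lev_A2F n) cvC Lg.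
by exists f, l, k; split=> //; rewrite dpS.
Qed.

Lemma kid_at_part n g f : kid_at n g f -> part g f.
Proof. by move=> [l [k [_ hf _ ->]]]; apply: (part_kid (r := tsize l (d / p ^+ n.+1))). Qed.

Lemma anc_ex n f : F f -> exists2 g, L n g & part f g.
Proof.
move=> Ff; elim: n => [|n [g Lg fg]]; first by exists f.
have [h hh] := lev_parent Lg; exists h; first by have [l [k []]] := hh.
exact: part_trans fg (kid_at_part hh).
Qed.

Lemma part_uniq n r f g h : fr r f -> L n g -> L n h -> part f g -> part f h -> g = h.
Proof.
move=> hf Lg Lh [fg _] [fh _]; have [q hq] := stile_nonempty hf.
by apply: (lev_eq Lg Lh); exists q; split; [exact: fg | exact: fh].
Qed.

Lemma desc_ex n g q : L n g -> tile g q -> exists f, [/\ F f, part f g & tile f q].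
Proof.
elim: n g => [g Lg hq|n IH g Lg hq]; first by exists g.
have [l hl] := lev_size Lg; have [k ok tk] := kid_tile hl hq.
have [f [Ff fg hf]] := IH _ (lev_kid Lg hl ok) tk.
by exists f; split=> //; exact: (part_trans fg (part_kid k hl)).
Qed.

Lemma substitution_frames n (G : set (frame R)) : G `<=` L n.+1 ->
  substitution (d / p ^+ n.+1) (tset G) = tset [set h | L n h /\ exists2 g, G g & part h g].
Proof.
move=> GL; apply/seteqP; split=> K.
  case=> [[[g Gg <-] sm]|[_ [[g Gg <-] lg]]]; have [r hr] := lev_fr (GL _ Gg).
    have hs : fr (tsize false (d / p ^+ n.+1)) g by exact: (is_tile_frame hr sm).
    exists g => //; split; last by exists g.
    by rewrite -[g]fmulf1; exact: (lev_kid (k := Ksame) (GL _ Gg) hs).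
  have hs : fr (tsize true (d / p ^+ n.+1)) g by exact: (is_tile_frame hr lg).
  case=> [/(is_sonP _ hr)|/(is_daughterP _ hr)] ->.
    exists (g ** sig R) => //; split; first exact: (lev_kid (k := Ksig) (GL _ Gg) hs).
    by exists g => //; exact: (part_kid Ksig hs).
  exists (g ** del R) => //; split; first exact: (lev_kid (k := Kdel) (GL _ Gg) hs).
  by exists g => //; exact: (part_kid Kdel hs).
move=> [h [Lh [g Gg [hg _]]] <-].
have [s hs] := lev_fr Lh; have [q hq] := stile_nonempty hs.
have [l hl] := lev_size (GL _ Gg).
have [k ok tk] := kid_tile hl (stile_tile hl (hg _ hq)).
have hk := fr_kid (d := d / p ^+ n) _ ok; rewrite -dpS in hk.
have -> : h = g ** kfr R k.
  by apply: (lev_eq Lh (lev_kid (GL _ Gg) hl ok)); have [q' [? ?]] := ov_tile (hk _ hl) tk hq; exists q'.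
case: k ok {tk hk}; case: l hl => //= hl _.
- by left; split; [exists g; rewrite // fmulf1 | apply/is_tileP; exists g; rewrite // fmulf1].
- right; exists (tile g); split; [by exists g | by apply/is_tileP; exists g |].
  by left; apply/(is_sonP _ hl).
- right; exists (tile g); split; [by exists g | by apply/is_tileP; exists g |].
  by right; apply/(is_daughterP _ hl).
Qed.

(** Every tile of [F] has exactly one ancestor on each level, so subdividing [G] level by level
    neither loses a tile nor adds one. *)
Lemma iter_frames n (G : set (frame R)) : G `<=` L n ->
  iter_substitution n (d / p ^+ n) (tset G) = tset [set f | F f /\ exists2 g, G g & part f g].
Proof.
elim: n G => [G GL|n IH G GL] /=.
  congr tset; apply/seteqP; split=> [f Gf|f [Ff [g Gg fg]]]; first by split; [exact: GL | exists f].
  have [r hr] := @lev_fr 0 _ Ff.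
  by rewrite (@part_uniq 0 r f f g hr Ff (GL _ Gg) (part_refl f) fg).
rewrite dpM (substitution_frames GL) IH; last by move=> f [].
congr tset; apply/seteqP; split=> f.
  move=> [Ff [h [Lh [g Gg hg]] fh]]; split=> //; exists g => //; exact: part_trans fh hg.
move=> [Ff [g Gg fg]]; split=> //.
have [h Lh fh] := anc_ex n Ff; exists h => //; split=> //; exists g => //.
have [g' [l [k [Lg' hg' ok e]]]] := lev_parent Lh.
have [r hr] := @lev_fr 0 _ Ff.
have hg'2 : part h g' by rewrite e; exact: (part_kid k hg').
by rewrite -(part_uniq hr Lg' (GL _ Gg) (part_trans fh hg'2) fg).
Qed.
End Levels.

(** * Chains of nested supertiles and their unions *)

Section Chains.
Variable R : realType.
Local Notation p := (psi R).
Implicit Types (f g h : frame R) (q : plane R) (r : R) (G : nat -> frame R).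
Variables (d : R) (F : set (frame R)) (C : set (plane R)).
Hypotheses (AF : A2F d F C) (cvC : convexC C).
Local Notation L := (lev d F).

Definition inside h : Prop := \forall t \near (0 : R)^'+, C (app h (t, t ^+ 2)).

Definition chain h G : Prop := forall n, L n (G n) /\ D (G n) h.

Lemma chain_ex r h : fr r h -> inside h -> exists G, chain h G.
Proof.
move=> hh hi; have : forall n, exists g, L n g /\ D g h.
  move=> n; have [LF _ _ _] := lev_A2F AF cvC n.
  have [|g Lg Dg] := fill LF hh; last by exists g.
  by apply: filterS hi => t /(lev_cover AF cvC n).
by move=> /choice [G hG]; exists G.
Qed.

Lemma flag_uniq n r h f g : fr r h -> L n f -> L n g -> D f h -> D g h -> f = g.
Proof.
move=> hh Lf Lg Df Dg; have [s hs] := lev_fr AF cvC Lf; have [t ht] := lev_fr AF cvC Lg.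
by apply: (lev_eq AF cvC Lf Lg); exact: (D_ov hs ht hh).
Qed.

Variables (r : R) (h : frame R) (G : nat -> frame R).
Hypotheses (hh : fr r h) (hG : chain h G).

(** The parent of [G n] contains it, hence is entered by the flag too, and only one tile of a level
    is. *)
Lemma chain_kid n : kid_at d F n (G n) (G n.+1).
Proof.
have [Ln Dn] := hG n; have [LS DS] := hG n.+1.
have [f hf] := lev_parent AF cvC Ln; have [l [k [Lf fl _ _]]] := hf.
have [s hs] := lev_fr AF cvC Ln.
suff -> : G n.+1 = f by [].
by apply: (flag_uniq hh LS Lf DS); apply: (D_part hs fl hh (kid_at_part hf) Dn).
Qed.

Lemma chain_part m n : (m <= n)%N -> part (G m) (G n).
Proof.
elim: n => [|n IH]; first by rewrite leqn0 => /eqP ->.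
rewrite leq_eqVlt => /orP[/eqP -> //|]; rewrite ltnS => /IH h1.
exact: part_trans h1 (kid_at_part (chain_kid n)).
Qed.

Definition inW G f : Prop := exists n, part f (G n).
Definition W G : set (plane R) := [set q | exists n, tile (G n) q].

Lemma inW_tile f q : inW G f -> tile f q -> W G q.
Proof. by move=> [n [_ hn]] hq; exists n; apply: hn. Qed.

Lemma W_stile f q : F f -> stile f q -> W G q -> inW G f.
Proof.
move=> Ff hf [n hq]; exists n; have [g Lg fg] := anc_ex AF cvC n Ff.
have [Ln _] := hG n; have [s hs] := lev_fr AF cvC Ln.
suff -> : G n = g by [].
by apply: (lev_eq AF cvC Ln Lg); apply: (ov_tile hs hq); apply: fg.1.
Qed.

Lemma W_desc q : W G q -> exists f, [/\ F f, inW G f & tile f q].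
Proof.
move=> [n hq]; have [f [Ff fg hf]] := desc_ex AF cvC (hG n).1 hq.
by exists f; split=> //; exists n.
Qed.

Lemma W_sub q : W G q -> C q.
Proof. by move=> [n hq]; apply/(lev_cover AF cvC n); exists (G n) => //; exact: (hG n).1. Qed.

Lemma chain_large n : fr (d / p ^+ n) (G n) -> exists m (w : bool), [/\ (n < m)%N, fr (d / p ^+ m) (G m) &
  G n = G m ** (if w then sig R else del R)].
Proof.
move=> hn; have [l [k [L1 f1 ok e]]] := chain_kid n.
have hk := fr_kid (d := d / p ^+ n) _ ok; rewrite -dpS in hk; have {}hk := hk _ f1.
rewrite -e in hk; have kl := tsize_inj (lev_pos AF cvC n) (large := true) hn hk.
case: k ok e kl {hk} => //; case: l f1 => // f1 _ e _; last by exists n.+1, true.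
rewrite /= fmulf1 in e.
have [l' [k' [L2 f2 ok' e']]] := chain_kid n.+1.
have hk := fr_kid (d := d / p ^+ n.+1) _ ok'; rewrite -dpS in hk; have {}hk := hk _ f2.
rewrite -e' in hk; have kl := tsize_inj (lev_pos AF cvC n.+1) f1 hk.
case: k' ok' e' kl {hk} => //; case: l' f2 => // f2 _ e' _.
by exists n.+2, false; split; rewrite // e e'.
Qed.

Lemma chain_first : exists n, fr (d / p ^+ n) (G n).
Proof.
have [l [k [L1 f1 ok e]]] := chain_kid 0.
case: l f1 ok => f1 ok; first by exists 1%N.
exists 0%N; have := fr_kid (d := d / p ^+ 0) (f := G 1%N) (large := false) (k := k); rewrite -dpS.
by move=> /(_ f1 ok); rewrite -e; case: k ok e.
Qed.

Lemma chain_seq : exists (ns : nat -> nat) (w : nat -> bool), forall k,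
  [/\ (k <= ns k)%N, fr (d / p ^+ ns k) (G (ns k)) &
   G (ns k) = G (ns k.+1) ** (if w k then sig R else del R)].
Proof.
pose P n m := fr (d / p ^+ n) (G n) -> (n < m)%N /\ fr (d / p ^+ m) (G m) /\
  exists w : bool, G n = G m ** (if w then sig R else del R).
have : forall n, exists m, P n m.
  move=> n; have [hn|nn] := pselect (fr (d / p ^+ n) (G n)); last by exists 0%N => /nn.
  by have [m [w [? ? ?]]] := chain_large hn; exists m; do 2?split => //; exists w.
move=> /choice [nx hnx]; have [n0 hn0] := chain_first.
pose ns k := iter k nx n0.
have hns k : fr (d / p ^+ ns k) (G (ns k)) by elim: k => //= k IH; have [_ []] := hnx _ IH.
have : forall k, exists w : bool, G (ns k) = G (ns k.+1) ** (if w then sig R else del R).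
  by move=> k; have [_ []] := hnx _ (hns k).
move=> /choice [w hw]; exists ns, w => k; split=> //.
by elim: k => // k IH; have [lt _] := hnx _ (hns k); exact: (leq_ltn_trans IH lt).
Qed.

Lemma infinite_of_chain : (forall f, F f -> inW G f) -> infinite_supertile (tset F).
Proof.
move=> all; have [ns [w hns]] := chain_seq.
have [[d0 _ _] _ _ _] := AF.
exists d; split=> //.
pose S k := [set f | F f /\ part f (G (ns k))].
exists (fun k => tset (S k)).
have sub k : part (G (ns k)) (G (ns k.+1)).
  have [_ _ e] := hns k; have [_ f1 _] := hns k.+1; rewrite e.
  by case: (w k); [exact: (part_kid Ksig f1) | exact: (part_kid Kdel f1)].
have cov k : covered (tset (S k)) = tile (G (ns k)).
  apply/seteqP; split=> q; first by move=> [_ [f [Ff fg] <-] hq]; apply: fg.2.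
  move=> hq; have [f [Ff fg hf]] := desc_ex AF cvC (hG (ns k)).1 hq.
  by exists (tile f) => //; exists f.
split.
- move=> k; right; exists (ns k), (tile (G (ns k))).
  have [_ hk _] := hns k; split; first by apply/is_tileP; exists (G (ns k)).
  have -> : [set tile (G (ns k))] = tset [set G (ns k)].
    by rewrite /tset image_set1.
  rewrite (iter_frames AF cvC); last by move=> _ ->; exact: (hG (ns k)).1.
  congr tset; apply/seteqP; split=> f [Ff fg]; split=> //; first by exists (G (ns k)).
  by have [g -> ?] := fg.
- by move=> k _ [f [Ff fg] <-]; exists f => //; split=> //; exact: part_trans fg (sub k).
- move=> k; rewrite !cov; have [_ hk _] := hns k.+1; have [_ _ e] := hns k.
  by case: (w k) e => e; [left; apply/(is_sonP _ hk) | right; apply/(is_daughterP _ hk)]; rewrite e.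
- apply/seteqP; split=> [_ [f Ff <-]|_ [k _ [f [Ff _] <-]]]; last by exists f.
  have [n fn] := all _ Ff; exists n => //; exists f => //; split=> //.
  by apply: part_trans fn (chain_part _); have [] := hns n.
Qed.
End Chains.

(** * Chains that share a tile *)

Section TwoChains.
Variable R : realType.
Implicit Types (f g h : frame R) (G : nat -> frame R).
Variables (d : R) (F : set (frame R)) (C : set (plane R)).
Hypotheses (AF : A2F d F C) (cvC : convexC C).

(** From some level on both chains consist of the unique ancestors of [f], so they agree there. *)
Lemma inW_W_eq r r' h h' G G' f : fr r h -> fr r' h' -> chain d F h G -> chain d F h' G' -> F f ->
  inW G f -> inW G' f -> W G = W G'.
Proof.
move=> hh hh' hG hG' Ff [m fm] [n fn].
have [s hs] := @lev_fr _ _ _ _ AF cvC 0 _ Ff.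
pose N := maxn m n.
have E k : (N <= k)%N -> G k = G' k.
  move=> Nk; apply: (part_uniq AF cvC hs (hG k).1 (hG' k).1).
    by apply: part_trans fm (chain_part AF cvC hh hG _); apply: leq_trans Nk; exact: leq_maxl.
  by apply: part_trans fn (chain_part AF cvC hh' hG' _); apply: leq_trans Nk; exact: leq_maxr.
apply/seteqP; split=> q [k hk]; exists (maxn N k).
  by rewrite -E ?leq_maxl //; apply: (chain_part AF cvC hh hG (leq_maxr _ _)).2 hk.
by rewrite E ?leq_maxl //; apply: (chain_part AF cvC hh' hG' (leq_maxr _ _)).2 hk.
Qed.
End TwoChains.

(** * Flags along a side and the automaton of arrows *)

Section Side.
Variable R : realType.
Local Notation p := (psi R).
Local Notation sig := (sig R).
Local Notation del := (del R).
Local Notation darrow := (darrow R).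
Local Notation arrows := (arrows R).
Implicit Types (f g h : frame R) (q : plane R) (r : R).

Definition between (x y : R) : bool := (x <= 0 < y) || (y <= 0 < x).

(** The arrow covers the first axis of the flag just after its base point, in either direction. *)
Definition onarrow (large : bool) (i : nat) h : Prop := (i < size (arrows large))%N /\
  exists x y : R, [/\ between x y, (nth darrow (arrows large) i).1.1 = app h (ptx x) &
    (nth darrow (arrows large) i).1.2 = app h (ptx y)].

(* The flag [h] runs along a side of the bee, which lies on its upper side. *)
Definition bdry h : Prop := hdir h /\ ~~ hdir (h ** mirY R).

Lemma between_inq (s : bool) (k a b x : R) : 0 < k -> inq s a b x ->
  between ((a - x) / (k * sgb R s)) ((b - x) / (k * sgb R s)) /\
  between ((b - x) / (k * sgb R s)) ((a - x) / (k * sgb R s)).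
Proof.
move=> k0; have K (u : R) : u / (k * sgb R s) = u * sgb R s / k.
  by case: s; rewrite /sgb; field; rewrite gt_eqF.
rewrite !K /between !ler_pdivrMr // !ltr_pdivlMr // /inq /sgb.
by case: s K => _ h; split; lra.
Qed.

Lemma onarrow_hor large i a b c (y x k k2 : R) s : (i < size (arrows large))%N ->
  nth darrow (arrows large) i = (((a, y), (b, y)), c) -> 0 < k -> inq s a b x || inq s b a x ->
  onarrow large i (Frame x y (k * sgb R s) 0 0 k2).
Proof.
move=> hi e k0 hx; split=> //; exists ((a - x) / (k * sgb R s)), ((b - x) / (k * sgb R s)).
have n0 : k * sgb R s != 0 by apply: sgb_neq0.
rewrite e; split; first by case/orP: hx => /(between_inq k0) [].
  by rewrite /app /ptx /=; move: (k * _) n0 => m n0; congr pair; field.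
by rewrite /app /ptx /=; move: (k * _) n0 => m n0; congr pair; field.
Qed.

Lemma onarrow_ver large i a b c (y x k k2 : R) s : (i < size (arrows large))%N ->
  nth darrow (arrows large) i = (((x, a), (x, b)), c) -> 0 < k -> inq s a b y || inq s b a y ->
  onarrow large i (Frame x y 0 (k * sgb R s) k2 0).
Proof.
move=> hi e k0 hx; split=> //; exists ((a - y) / (k * sgb R s)), ((b - y) / (k * sgb R s)).
have n0 : k * sgb R s != 0 by apply: sgb_neq0.
rewrite e; split; first by case/orP: hx => /(between_inq k0) [].
  by rewrite /app /ptx /=; move: (k * _) n0 => m n0; congr pair; field.
by rewrite /app /ptx /=; move: (k * _) n0 => m n0; congr pair; field.
Qed.

Lemma onarrow_ex large r h : fr r h -> bdry h -> exists i, onarrow large i h.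
Proof.
have [/andP[a1 a2] /andP[b1 b2] /andP[c1 c2] e4] := psi_bounds R.
move=> hh [h1 h2]; have [r0 _ _ _] := hh.
have [st [s1 [s2 e]]] := aligned_form hh h1 h2.
move: h1 h2; rewrite {}e; move: (ox h) (oy h) => x y {h hh}.
rewrite /hdir; case: st => /=; rewrite !(mulr0, mul0r, addr0, mulr1, mulrN1, add0r) ?lexpos0 ?(lexposn0 _ (sgb_neq0 _ r0)) ?sgbN ?oppr0
  ?lexpos0 ?(lexposn0 _ (sgb_neq0 _ r0)) !sgb_gt0 //.
  case: s2 => h1 h2.
    have y0 : y = 0 by move: h1 h2; rewrite /germ /inq /=; clear -a1 a2 b1 b2 c1 c2 e4; case: (s1);
        clear a1 a2 b1 b2 c1 c2 e4; lra.
    rewrite y0; have : inq s1 0 (p ^+ 3) x || inq s1 (p ^+ 3) p x.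
      by move: h1 h2; rewrite /germ /inq /=; clear -a1 a2 b1 b2 c1 c2 e4; case: (s1); clear a1 a2 b1 b2 c1 c2 e4; lra.
    case/orP => hx; case: large.
    - by exists 4%N; apply: onarrow_hor; rewrite //= ?hx ?orbT.
    - by exists 3%N; apply: onarrow_hor; rewrite //= ?hx ?orbT.
    - by exists 3%N; apply: onarrow_hor; rewrite //= ?hx ?orbT.
    - by exists 2%N; apply: onarrow_hor; rewrite //= ?hx ?orbT.
  have : (y = 1 /\ inq s1 0 (p ^+ 3) x) \/ (y = p ^+ 2 /\ inq s1 (p ^+ 3) p x).
    have [ey|ny] := eqVneq y 1; [left; split=> //|right].
      by move: h1 h2; rewrite ey /germ /inq /=; clear -a1 a2 b1 b2 c1 c2 e4; case: (s1); clear a1 a2 b1 c1 c2 e4; lra.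
    have {}ny : y < 1 \/ 1 < y by case: (ltgtP y 1) ny => // _ _; [left | right].
    by move: h1 h2; rewrite /germ /inq /=; clear -a1 a2 b1 b2 c1 c2 e4 ny; case: (s1); split; clear a1 a2 b1 c1 c2 e4; lra.
  case=> -[-> hx]; case: large.
  - by exists 9%N; apply: onarrow_hor; rewrite //= ?hx ?orbT.
  - by exists 7%N; apply: onarrow_hor; rewrite //= ?hx ?orbT.
  - by exists 7%N; apply: onarrow_hor; rewrite //= ?hx ?orbT.
  - by exists 5%N; apply: onarrow_hor; rewrite //= ?hx ?orbT.
case: s1 => h1 h2.
  have x0 : x = 0 by move: h1 h2; rewrite /germ /inq /=; clear -a1 a2 b1 b2 c1 c2 e4; case: (s2);
      clear a1 a2 b1 b2 c1 c2 e4; lra.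
  rewrite x0; have hy : inq s2 0 1 y.
    by move: h1 h2; rewrite /germ /inq /=; clear -a1 a2 b1 b2 c1 c2 e4; case: (s2); clear a1 a2 b1 c1 c2 e4; lra.
  case: large.
    have : inq s2 0 (p ^+ 4) y || inq s2 (p ^+ 4) (2 * p ^+ 4) y || inq s2 (2 * p ^+ 4) 1 y.
      by move: hy; rewrite /inq; clear -a1 a2 b1 b2 c1 c2 e4; case: (s2); clear a1 a2 b1 b2 c1 c2 e4; lra.
    case/orP => [/orP[]|] {}hy.
    - by exists 0%N; apply: onarrow_ver; rewrite //= ?hy ?orbT.
    - by exists 1%N; apply: onarrow_ver; rewrite //= ?hy ?orbT.
    - by exists 2%N; apply: onarrow_ver; rewrite //= ?hy ?orbT.
  have : inq s2 0 (p ^+ 4) y || inq s2 (p ^+ 4) 1 y.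
    by move: hy; rewrite /inq; clear -a1 a2 b1 b2 c1 c2 e4; case: (s2); clear a1 a2 b1 b2 c1 c2 e4; lra.
  case/orP => {}hy.
  - by exists 0%N; apply: onarrow_ver; rewrite //= ?hy ?orbT.
  - by exists 1%N; apply: onarrow_ver; rewrite //= ?hy ?orbT.
have : (x = p /\ inq s2 0 (p ^+ 2) y) \/ (x = p ^+ 3 /\ inq s2 (p ^+ 2) 1 y).
  have [ex|nx] := eqVneq x p; [left; split=> //|right].
    by move: h1 h2; rewrite ex /germ /inq /=; clear -a1 a2 b1 b2 c1 c2 e4; case: (s2); clear a2 b1 b2 c1 e4; lra.
  have {}nx : x < p \/ p < x by case: (ltgtP x p) nx => // _ _; [left | right].
  by move: h1 h2; rewrite /germ /inq /=; clear -a1 a2 b1 b2 c1 c2 e4 nx; case: (s2); split; clear a2 b1 b2 c1 e4; lra.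
case=> -[-> hy]; case: large.
- have : inq s2 0 (p ^+ 4) y || inq s2 (p ^+ 4) (p ^+ 2) y.
    by move: hy; rewrite /inq; clear -a1 a2 b1 b2 c1 c2 e4; case: (s2); clear a1 a2 b1 b2 c1 c2 e4; lra.
  case/orP => {}hy; first by exists 6%N; apply: onarrow_ver; rewrite //= ?hy ?orbT.
  by exists 5%N; apply: onarrow_ver; rewrite //= ?hy ?orbT.
- by exists 4%N; apply: onarrow_ver; rewrite //= ?hy ?orbT.
- by exists 8%N; apply: onarrow_ver; rewrite //= ?hy ?orbT.
- by exists 6%N; apply: onarrow_ver; rewrite //= ?hy ?orbT.
Qed.

Lemma onarrow_horP large i a b c y h r : nth darrow (arrows large) i = (((a, y), (b, y)), c) ->
  onarrow large i h -> fr r h -> [/\ uy h = 0, oy h = y, vx h = 0, ux h != 0 &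
   inq (0 < ux h) a b (ox h) || inq (0 < ux h) b a (ox h)].
Proof.
move=> e [_ [x1 [x2 [hb k1 k2]]]] hh; rewrite e in k1 k2.
have e1 := congr1 fst k1; have e2 := congr1 snd k1; have e3 := congr1 fst k2; have e5 := congr1 snd k2.
rewrite /= !mulr0 !addr0 in e1 e2 e3 e5.
have n12 : x1 - x2 != 0 by move: hb; rewrite /between subr_eq0 => hb; apply/eqP; lra.
have u0 : uy h = 0 by apply: (mulIf n12); lra.
have v0 : vx h = 0 by case: (fr_orient hh) => -[-> _]; rewrite u0 ?oppr0.
have [r0 hu _ _] := hh.
have n0 : ux h != 0.
  by apply/eqP => z; move: hu; rewrite z u0 expr0n addr0 => /esym/eqP; rewrite expf_eq0 /= gt_eqF.
split=> //; first by rewrite e2 u0 mul0r addr0.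
have ea : ox h = a - ux h * x1 by lra.
have eb : b = a + ux h * (x2 - x1) by lra.
rewrite /inq; case: (ltrgtP (ux h) 0) n0 => // s _.
  by move: hb; rewrite /between => /orP[] /andP[? ?]; apply/orP; [right | left]; apply/andP; split; nra.
by move: hb; rewrite /between => /orP[] /andP[? ?]; apply/orP; [left | right]; apply/andP; split; nra.
Qed.

Lemma onarrow_verP large i a b c x h r : nth darrow (arrows large) i = (((x, a), (x, b)), c) ->
  onarrow large i h -> fr r h -> [/\ ux h = 0, ox h = x, vy h = 0, uy h != 0 &
   inq (0 < uy h) a b (oy h) || inq (0 < uy h) b a (oy h)].
Proof.
move=> e [_ [x1 [x2 [hb k1 k2]]]] hh; rewrite e in k1 k2.
have e1 := congr1 fst k1; have e2 := congr1 snd k1; have e3 := congr1 fst k2; have e5 := congr1 snd k2.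
rewrite /= !mulr0 !addr0 in e1 e2 e3 e5.
have n12 : x1 - x2 != 0 by move: hb; rewrite /between subr_eq0 => hb; apply/eqP; lra.
have u0 : ux h = 0 by apply: (mulIf n12); lra.
have v0 : vy h = 0 by case: (fr_orient hh) => -[_ ->]; rewrite u0 ?oppr0.
have [r0 hu _ _] := hh.
have n0 : uy h != 0.
  by apply/eqP => z; move: hu; rewrite z u0 expr0n addr0 => /esym/eqP; rewrite expf_eq0 /= gt_eqF.
split=> //; first by rewrite e1 u0 mul0r addr0.
have ea : oy h = a - uy h * x1 by lra.
have eb : b = a + uy h * (x2 - x1) by lra.
rewrite /inq; case: (ltrgtP (uy h) 0) n0 => // s _.
  by move: hb; rewrite /between => /orP[] /andP[? ?]; apply/orP; [right | left]; apply/andP; split; nra.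
by move: hb; rewrite /between => /orP[] /andP[? ?]; apply/orP; [left | right]; apply/andP; split; nra.
Qed.

Lemma onarrow_up large j l k i h : (l < size (dtab large j))%N ->
  nth (Ksame, 0%N) (dtab large j) l = (k, i) -> (j < size (arrows large))%N ->
  onarrow (klarge k) i h -> onarrow large j (kfr R k ** h).
Proof.
have [/andP[a1 a2] /andP[b1 b2] /andP[c1 c2] e4] := psi_bounds R.
move=> hl el hj [hi [x [y [hb e1 e2]]]]; split=> //.
have [E _] := dec_table hj.
have : karrow R (k, i) \in dec (nth darrow (arrows large) j).
  by rewrite E -el -(nth_map _ darrow) // mem_nth // size_map.
have {}e1 : (karrow R (k, i)).1.1 = app (kfr R k ** h) (ptx x) by rewrite app_mul -e1.
have {}e2 : (karrow R (k, i)).1.2 = app (kfr R k ** h) (ptx y) by rewrite app_mul -e2.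
move: (karrow R (k, i)) (kfr R k ** h) e1 e2 => b f e1 e2.
move: (nth darrow (arrows large) j) => [[P Q] c]; rewrite /dec /=.
have n4 : p ^+ 4 != 0 by rewrite gt_eqF // e4; lra.
have n4' : 1 - p ^+ 4 != 0 by rewrite gt_eqF // e4; lra.
case: ifP => _; last by rewrite inE => /eqP eb; exists x, y; rewrite eb /= in e1 e2 *.
rewrite !inE => /orP[] /eqP eb; rewrite eb /= in e1 e2.
- exists (x + (y - x) / p ^+ 4), x; split=> //.
    have m0 : 0 < p ^+ 4 by rewrite e4; lra.
    clear e1 e2 eb; move: hb; rewrite /between => /orP[] /andP[h1 h2]; apply/orP; [right | left]; apply/andP; split=> //.
      have : (y - x) / p ^+ 4 >= y - x by rewrite ler_pdivlMr // e4; nra.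
      by lra.
    have : (y - x) / p ^+ 4 <= y - x by rewrite ler_pdivrMr // e4; nra.
    by lra.
  move: e1 e2; case: P {eb} => P1 P2; case: Q => Q1 Q2; rewrite /midpt /app /ptx /= => -[-> ->] [q1 q2].
  have q3 : p ^+ 4 * P1 = (ox f + ux f * y + vx f * 0) - (1 - p ^+ 4) * (ox f + ux f * x + vx f * 0) by rewrite -q1; ring.
  have q5 : p ^+ 4 * P2 = (oy f + uy f * y + vy f * 0) - (1 - p ^+ 4) * (oy f + uy f * x + vy f * 0) by rewrite -q2; ring.
  move: (p ^+ 4) n4 n4' q3 q5 => m n4 n4' q3 q5 {q1 q2}.
  congr pair; apply: (mulfI n4); [rewrite q3 | rewrite q5]; by field.
- exists y, ((x - p ^+ 4 * y) / (1 - p ^+ 4)); split=> //.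
    have E2 : x = (1 - p ^+ 4) * ((x - p ^+ 4 * y) / (1 - p ^+ 4)) + p ^+ 4 * y by field.
    move: ((x - p ^+ 4 * y) / _) E2 => z E2; clear e1 e2 eb.
    have m0 : 0 < p ^+ 4 by rewrite e4; lra.
    have m1 : 0 < 1 - p ^+ 4 by rewrite e4; clear a1 a2 b2 c1 c2 e4 el hb hj hl m0 n4 n4'; lra.
    move: (p ^+ 4) m0 m1 E2 => m m0 m1 E2; move: hb; rewrite /between => /orP[] /andP[h1 h2].
      by apply/orP; right; apply/andP; split=> //; rewrite -(pmulr_rle0 _ m1); nra.
    by apply/orP; left; apply/andP; split=> //; rewrite -(pmulr_rgt0 _ m1); nra.
  move: e1 e2; case: P {eb} => P1 P2; case: Q => Q1 Q2; rewrite /midpt /app /ptx /= => -[q1 q2] [q3 q4].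
  rewrite q3 q4 in q1 q2; congr pair; apply: (mulfI n4').
    have -> : (1 - p ^+ 4) * Q1 = (ox f + ux f * x + vx f * 0) - p ^+ 4 * (ox f + ux f * y + vx f * 0) by rewrite -q1; ring.
    by field.
  have -> : (1 - p ^+ 4) * Q2 = (oy f + uy f * x + vy f * 0) - p ^+ 4 * (oy f + uy f * y + vy f * 0) by rewrite -q2; ring.
  by field.
Qed.

Lemma lexpos_scale (a k b : R) : 0 < k -> a != 0 -> lexpos (k * a) b = (0 < a).
Proof. by move=> k0 a0; rewrite lexposn0 ?pmulr_rgt0 // mulf_neq0 // gt_eqF. Qed.

Lemma lexpos_scaleN (a k b : R) : 0 < k -> a != 0 -> lexpos (- k * a) b = ~~ (0 < a).
Proof.
move=> k0 a0; rewrite lexposn0 ?mulNr ?oppr_eq0; last by rewrite mulf_neq0 // gt_eqF.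
by rewrite oppr_gt0 pmulr_rlt0 // -leNgt le_eqVlt (negbTE a0).
Qed.

Local Ltac dead := rewrite /hdir /= ?(mulr0, mul0r, addr0, add0r, mulr1, mul1r, mulN1r, mulrN1, opprK, oppr0).

Lemma inq_bounds (s : bool) (a b x : R) : a <= b -> inq s a b x || inq s b a x ->
  if s then a <= x < b else a < x <= b.
Proof. by rewrite /inq; case: s => ab /orP[] //; lra. Qed.

(* Moving the flag to the other side of an arrow that is interior to the larger tile
   does not leave the larger tile. *)
Lemma dead_sig r i h : fr r h -> onarrow true i h -> i \in [:: 5; 7; 8]%N -> hdir (sig ** h ** mirY R).
Proof.
have [/andP[a1 a2] /andP[b1 b2] /andP[c1 c2] e4] := psi_bounds R.
have p0 := psi_gt0 R; have M1 (x y : R) : x <= y -> p * x <= p * y by rewrite ler_pM2l.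
have M2 (x y : R) : x < y -> p * x < p * y by rewrite ltr_pM2l.
move=> hh ho; rewrite !inE => /or3P[] /eqP ei; rewrite ei in ho.
- have E : nth darrow (arrows true) 5 = (((p, p ^+ 2), (p, p ^+ 4)), 6%N) by [].
  have [e1 e2 e3 n0 hy] := onarrow_verP E ho hh.
  dead; rewrite e1 e2 e3 ?(mulr0, mul0r, addr0, add0r) (lexpos_scaleN _ p0 n0).
  move: (lexpos _ _) hy => s'; move: (0 < uy h) (oy h) => s y; rewrite orbC => hy.
  have := inq_bounds _ hy; rewrite e4 => /(_ _) hy'; have {hy'}hy := hy' ltac:(clear a1 a2 b2 c1 c2 e1 e2 e3 e4 ei hy hy' p0; lra).
  rewrite /germ /inq; case: s hy => /andP[]; [move=> /M1 k1 /M2 k2 | move=> /M2 k1 /M1 k2];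
  by case: s' => /=; clear -a1 b1 b2 c2 k1 k2; lra.
- have E : nth darrow (arrows true) 7 = (((p ^+ 3, p ^+ 2), (p, p ^+ 2)), 5%N) by [].
  have [e1 e2 e3 n0 hx] := onarrow_horP E ho hh.
  dead; rewrite e1 e2 e3 ?(mulr0, mul0r, addr0, add0r) (lexpos_scale _ p0 n0).
  move: (lexpos _ _) hx => s'; move: (0 < ux h) (ox h) => s x hx.
  have := inq_bounds _ hx => /(_ _) hx'; have {hx'}hx := hx' ltac:(clear a2 b1 b2 c1 e1 e2 e3 e4 ei hx hx' p0; lra).
  rewrite /germ /inq; case: s hx => /andP[]; [move=> /M1 k1 /M2 k2 | move=> /M2 k1 /M1 k2];
  by case: s' => /=; clear -a1 b2 c1 c2 e4 k1 k2; lra.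
- have E : nth darrow (arrows true) 8 = (((p ^+ 3, 1), (p ^+ 3, p ^+ 2)), 4%N) by [].
  have [e1 e2 e3 n0 hy] := onarrow_verP E ho hh.
  dead; rewrite e1 e2 e3 ?(mulr0, mul0r, addr0, add0r) (lexpos_scaleN _ p0 n0).
  move: (lexpos _ _) hy => s'; move: (0 < uy h) (oy h) => s y; rewrite orbC => hy.
  have := inq_bounds _ hy => /(_ _) hy'; have {hy'}hy := hy' ltac:(clear a1 a2 b1 c1 c2 e1 e2 e3 e4 ei hy hy' p0; lra).
  rewrite /germ /inq; case: s hy => /andP[]; [move=> /M1 k1 /M2 k2 | move=> /M2 k1 /M1 k2];
  by case: s' => /=; clear -b1 b2 c1 e4 k1 k2; lra.
Qed.

Lemma dead_del r i h : fr r h -> onarrow false i h -> i \in [:: 5; 6; 7]%N -> hdir (del ** h ** mirY R).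
Proof.
have [/andP[a1 a2] /andP[b1 b2] /andP[c1 c2] e4] := psi_bounds R.
have p0 : 0 < p ^+ 2 by lra.
have M1 (x y : R) : x <= y -> p ^+ 2 * x <= p ^+ 2 * y by rewrite ler_pM2l.
have M2 (x y : R) : x < y -> p ^+ 2 * x < p ^+ 2 * y by rewrite ltr_pM2l.
have e5 : p ^+ 2 * p ^+ 3 = p - p ^+ 3 by ring: e4.
move=> hh ho; rewrite !inE => /or3P[] /eqP ei; rewrite ei in ho.
- have E : nth darrow (arrows false) 5 = (((p ^+ 3, p ^+ 2), (p, p ^+ 2)), 6%N) by [].
  have [e1 e2 e3 n0 hx] := onarrow_horP E ho hh.
  dead; rewrite e1 e2 e3 ?(mulr0, mul0r, addr0, add0r) (lexpos_scale _ p0 n0).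
  move: (lexpos _ _) hx => s'; move: (0 < ux h) (ox h) => s x hx.
  have := inq_bounds _ hx => /(_ _) hx'; have {hx'}hx := hx' ltac:(clear a2 b1 b2 c1 e1 e2 e3 e4 e5 ei hx hx' p0; lra).
  rewrite /germ /inq; case: s hx => /andP[]; [move=> /M1 k1 /M2 k2 | move=> /M2 k1 /M1 k2];
  by case: s' => /=; clear -a1 b1 b2 c2 e4 e5 k1 k2; lra.
- have E : nth darrow (arrows false) 6 = (((p ^+ 3, 1), (p ^+ 3, p ^+ 2)), 5%N) by [].
  have [e1 e2 e3 n0 hy] := onarrow_verP E ho hh.
  dead; rewrite e1 e2 e3 ?(mulr0, mul0r, addr0, add0r) (lexpos_scaleN _ p0 n0).
  move: (lexpos _ _) hy => s'; move: (0 < uy h) (oy h) => s y; rewrite orbC => hy.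
  have := inq_bounds _ hy => /(_ _) hy'; have {hy'}hy := hy' ltac:(clear a1 a2 b1 c1 c2 e1 e2 e3 e4 e5 ei hy hy' p0; lra).
  rewrite /germ /inq; case: s hy => /andP[]; [move=> /M1 k1 /M2 k2 | move=> /M2 k1 /M1 k2];
  by case: s' => /=; clear -a1 b2 c1 c2 e4 e5 k1 k2; lra.
- have E : nth darrow (arrows false) 7 = (((0, 1), (p ^+ 3, 1)), 4%N) by [].
  have [e1 e2 e3 n0 hx] := onarrow_horP E ho hh.
  dead; rewrite e1 e2 e3 ?(mulr0, mul0r, addr0, add0r) (lexpos_scale _ p0 n0).
  move: (lexpos _ _) hx => s'; move: (0 < ux h) (ox h) => s x hx.
  have := inq_bounds _ hx => /(_ _) hx'; have {hx'}hx := hx' ltac:(clear a1 a2 b1 b2 c2 e1 e2 e3 e4 e5 ei hx hx' p0; lra).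
  rewrite /germ /inq; case: s hx => /andP[]; [move=> /M1 k1 /M2 k2 | move=> /M2 k1 /M1 k2];
  by case: s' => /=; clear -b1 b2 c1 e5 k1 k2; lra.
Qed.

(* Passage from an arrow of a tile to the arrow of the next level that contains it;
   [None] if the arrow becomes interior. *)
Definition nsig (i : nat) : option nat := nth None
  [:: Some 3; Some 4; Some 4; Some 5; Some 6; None; Some 7; None; None; Some 0]%N i.
Definition ndel (i : nat) : option nat := nth None
  [:: Some 2; Some 1; Some 9; Some 9; Some 8]%N i.
Definition nsame (i : nat) : option nat := nth None
  [:: Some 0; Some 1; Some 1; Some 2; Some 3; Some 4; Some 4; Some 5; Some 6; Some 7]%N i.
Definition nkid (k : kidk) : nat -> option nat :=
  match k with Ksame => nsame | Ksig => nsig | Kdel => ndel end.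

Lemma onarrow_next r k large i h : fr r h -> kok large k -> onarrow (klarge k) i h ->
  ~~ hdir (kfr R k ** h ** mirY R) -> exists2 j, nkid k i = Some j & onarrow large j (kfr R k ** h).
Proof.
move=> hh ok ho nd.
have U l j : (l < size (dtab large j))%N -> nth (Ksame, 0%N) (dtab large j) l = (k, i) ->
  (j < size (arrows large))%N -> onarrow large j (kfr R k ** h).
  by move=> h1 h2 h3; apply: (onarrow_up h1 h2 h3 ho).
have dS : k = Ksig -> i \in [:: 5; 7; 8]%N -> False.
  by move=> ek hi; move: nd; rewrite ek /= (dead_sig hh _ hi) //; move: ho; rewrite ek.
have dD : k = Kdel -> i \in [:: 5; 6; 7]%N -> False.
  by move=> ek hi; move: nd; rewrite ek /= (dead_del hh _ hi) //; move: ho; rewrite ek.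
have hi : (i < size (arrows (klarge k)))%N by case: ho.
case: large ok U; case: k hi dS dD {ho nd} => //= hi dS dD _ U; do 10?[case: i hi U dS dD => [|i] //= hi U dS dD];
 rewrite ?/nsig ?/ndel ?/nsame /=; try (by case: (dS erefl)); try (by case: (dD erefl));
 match goal with |- exists2 j, Some ?x = _ & _ => exists x => // end;
 first [by apply: (U 0%N) | by apply: (U 1%N)].
Qed.
End Side.

(** * Growth of a chain along its boundary *)

Section BoundaryChain.
Variable R : realType.
Local Notation p := (psi R).
Local Notation sig := (sig R).
Local Notation del := (del R).
Implicit Types (f g h : frame R) (q : plane R) (r lo hi : R).

(* The boundary flag seen from a bee whose longest side lies on the boundary:
   [lo, hi] is the position of that side, measured along the flag. *)
Definition left (s : bool) lo hi : frame R :=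
  let c := (hi - lo)^-1 in
  if s then Frame 0 (- lo * c) 0 c c 0 else Frame 0 (hi * c) 0 (- c) c 0.

Lemma left_form r i h : fr r h -> bdry h -> onarrow true i h -> (i < 3)%N ->
  exists s lo hi, [/\ h = left s lo hi, lo <= 0 & 0 < hi].
Proof.
have [/andP[a1 a2] /andP[b1 b2] /andP[c1 c2] e4] := psi_bounds R.
move=> hh [h1 h2] ho i3.
have {i3 ho} [e1 e2 e3 n0 hy] : [/\ ux h = 0, ox h = 0, vy h = 0, uy h != 0 & inq (0 < uy h) 0 1 (oy h)].
  case: i i3 ho => [|[|[|//]]] _ ho.
  - have [|? ? ? ? hy] := onarrow_verP (large := true) (i := 0) (a := 0) (b := p ^+ 4) (x := 0) (c := 4) _ ho hh => //.
    by split=> //; move: hy; clear h1 h2; rewrite /inq; case: ifP; clear a1 a2 c1 c2; lra.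
  - have [|? ? ? ? hy] := onarrow_verP (large := true) (i := 1) (a := 2 * p ^+ 4) (b := p ^+ 4) (x := 0) (c := 4) _ ho hh => //.
    by split=> //; move: hy; clear h1 h2; rewrite /inq; case: ifP; clear a1 a2 c1 c2; lra.
  - have [|? ? ? ? hy] := onarrow_verP (large := true) (i := 2) (a := 1) (b := 2 * p ^+ 4) (x := 0) (c := 6) _ ho hh => //.
    by split=> //; move: hy; clear h1 h2; rewrite /inq; case: ifP; clear a1 a2 c1 c2; lra.
have [r0 hu hv _] := hh.
have v0 : 0 < vx h.
  have m0 : vx h != 0.
    by apply/eqP => z; move: hv; rewrite z e3 !expr0n addr0 => /esym/eqP; rewrite expf_eq0 /= gt_eqF.
  move: h1; rewrite /hdir e1 lexpos0 e2; case: (ltrgtP (vx h) 0) m0 => // _ _.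
  by rewrite /germ /inq; clear -a1 a2 b1 b2 c1 c2 e4; lra.
have ev : vx h = `|uy h|.
  by rewrite -(gtr0_norm v0); case: (fr_orient hh) => -[-> _]; rewrite ?normrN.
move: hh h1 h2 hu hv e1 e2 e3 n0 hy v0 ev; case: h => x y a b c d /= _ _ _ _ _ -> -> -> n0 hy v0 ->.
exists (0 < b); case: (ltrgtP b 0) n0 hy => // b0 _ hy.
  exists ((1 - y) / b), (- y / b); have E : (- y / b - (1 - y) / b)^-1 = - b.
    have -> : - y / b - (1 - y) / b = (- b)^-1 by field; rewrite lt_eqF.
    by rewrite invrK.
  rewrite /left E; split.
  - by rewrite (ltr0_norm b0) opprK; congr Frame; field; rewrite lt_eqF.
  - by rewrite ler_ndivrMr // mul0r; move: hy; rewrite /inq; lra.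
  - by rewrite ltr_ndivlMr // mul0r; move: hy; rewrite /inq; lra.
exists (- y / b), ((1 - y) / b); have E : ((1 - y) / b - - y / b)^-1 = b.
  have -> : (1 - y) / b - - y / b = b^-1 by field; rewrite gt_eqF.
  by rewrite invrK.
rewrite /left E; split.
- by rewrite (gtr0_norm b0); congr Frame; field; rewrite gt_eqF.
- by rewrite ler_pdivrMr // mul0r; move: hy; rewrite /inq; lra.
- by rewrite ltr_pdivlMr // mul0r; move: hy; rewrite /inq; lra.
Qed.

(** The long side of the daughter lies in the long side of the whole and shares the end [(0, 1)]
    with it. For the son of the daughter of the son, treated next, the long side runs from [(0, 0)]
    to [(0, p ^+ 4)], so the other end is shared. *)
Lemma left_del s lo hi : lo < hi -> del ** left s lo hi =
  if s then left false lo (lo + (hi - lo) / p ^+ 2) else left true (hi - (hi - lo) / p ^+ 2) hi.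
Proof.
move=> lh; have n0 : hi - lo != 0 by rewrite gt_eqF // subr_gt0.
have p0 : p != 0 := psi_neq0 R.
case: s; rewrite /left /fmul /=.
  have -> : lo + (hi - lo) / p ^+ 2 - lo = (hi - lo) / p ^+ 2 by ring.
  by congr Frame; field; rewrite ?n0 ?p0.
have -> : hi - (hi - (hi - lo) / p ^+ 2) = (hi - lo) / p ^+ 2 by ring.
by congr Frame; field; rewrite ?n0 ?p0.
Qed.

Lemma left_sds s lo hi : lo < hi -> sig ** (del ** (sig ** left s lo hi)) =
  if s then left false (hi - (hi - lo) / p ^+ 4) hi else left true lo (lo + (hi - lo) / p ^+ 4).
Proof.
move=> lh; have n0 : hi - lo != 0 by rewrite gt_eqF // subr_gt0.
have p0 : p != 0 := psi_neq0 R.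
case: s; rewrite /left /fmul /=.
  have -> : hi - (hi - (hi - lo) / p ^+ 4) = (hi - lo) / p ^+ 4 by ring.
  by congr Frame; field; rewrite ?n0 ?p0.
have -> : lo + (hi - lo) / p ^+ 4 - lo = (hi - lo) / p ^+ 4 by ring.
by congr Frame; field; rewrite ?n0 ?p0.
Qed.

Lemma left_bee s lo hi q : lo < hi -> bee (app (left s lo hi) q) -> 0 <= q.2 /\ lo <= q.1 <= hi.
Proof.
have [/andP[a1 a2] /andP[b1 b2] /andP[c1 c2] e4] := psi_bounds R.
move=> lh; have c0 : 0 < (hi - lo)^-1 by rewrite invr_gt0 subr_gt0.
have cE : (hi - lo)^-1 * (hi - lo) = 1 by rewrite mulVf // gt_eqF // subr_gt0.
case: q => x y; rewrite /left /bee /rect /setU /=; move: _^-1 c0 cE => c c0 cE.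
move=> hb; have [k1 k2 k3] : [/\ 0 <= c * y, 0 <= c * (x - lo) & 0 <= c * (hi - x)].
  by move: hb; case: s => /= -[] [/andP[u1 u2] /andP[u3 u4]]; split; clear a1 c1; nra.
by move: k1 k2 k3; rewrite !(pmulr_rge0 _ c0) !subr_ge0 => -> -> ->.
Qed.

Lemma bee_left s lo hi q : lo < hi -> lo <= q.1 <= hi -> 0 <= q.2 <= p ^+ 3 * (hi - lo) ->
  bee (app (left s lo hi) q).
Proof.
move=> lh /andP[h1 h2] /andP[h3 h4]; have c0 : 0 < (hi - lo)^-1 by rewrite invr_gt0 subr_gt0.
have cE : (hi - lo)^-1 * (hi - lo) = 1 by rewrite mulVf // gt_eqF // subr_gt0.
case: q h1 h2 h3 h4 => x y /=; rewrite /left /bee /rect /setU /=; move: _^-1 c0 cE => c c0 cE h1 h2 h3 h4.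
have k1 : 0 <= c * (x - lo) by rewrite (pmulr_rge0 _ c0) subr_ge0.
have k2 : 0 <= c * (hi - x) by rewrite (pmulr_rge0 _ c0) subr_ge0.
have k3 : 0 <= c * y by rewrite (pmulr_rge0 _ c0).
have k4 : 0 <= c * (p ^+ 3 * (hi - lo) - y) by rewrite (pmulr_rge0 _ c0) subr_ge0.
have k5 : c * (p ^+ 3 * (hi - lo) - y) = p ^+ 3 * (c * (hi - lo)) - c * y by ring.
rewrite k5 cE mulr1 in k4.
by right; case: s => /=; split; apply/andP; split; clear c0 h1 h2 h3 h4 k5 lh; lra.
Qed.

(** Each increase is at least [e], so a sequence that does not become constant exceeds every
    bound. *)
Lemma steps_lim (u : nat -> R) (e : R) : 0 < e ->
  (forall n, u n.+1 = u n \/ u n + e <= u n.+1) ->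
  (exists N, forall n, (N <= n)%N -> u n = u N) \/ (forall M, exists N, forall n, (N <= n)%N -> M <= u n).
Proof.
move=> e0 hu; have mono m n : (m <= n)%N -> u m <= u n.
  elim: n => [|n IH]; first by rewrite leqn0 => /eqP ->.
  rewrite leq_eqVlt => /orP[/eqP -> //|]; rewrite ltnS => /IH h.
  by apply: (le_trans h); case: (hu n); lra.
have [h|h] := pselect (exists N, forall n, (N <= n)%N -> u n = u N); [by left | right].
have nx N : exists n, u N + e <= u n.
  apply: contrapT => hn; apply: h; exists N => n; elim: n => [|n IH]; first by rewrite leqn0 => /eqP ->.
  rewrite leq_eqVlt => /orP[/eqP <- //|]; rewrite ltnS => /IH hh.
  by case: (hu n) => [-> //|k]; case: hn; exists n.+1; rewrite -hh.
have big (k : nat) : exists N, u 0%N + k%:R * e <= u N.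
  elim: k => [|k [N hN]]; first by exists 0%N; rewrite mul0r addr0.
  by have [n hn] := nx N; exists n; rewrite -natr1 mulrDl mul1r; lra.
move=> M; have [N hN] := big (Num.bound (`|(M - u 0%N) / e|)).
exists N => n /mono hn; apply: le_trans hn; apply: le_trans hN; rewrite -lerBlDl -ler_pdivrMr //.
by apply: le_trans (ler_norm _) _; apply/ltW/archi_boundP.
Qed.

Variables (H : nat -> frame R) (w : nat -> bool).
Hypotheses (HS : forall k, H k.+1 = (if w k then sig else del) ** H k)
  (H0 : exists r, fr r (H 0%N)) (Hb : forall k, bdry (H k)).

Lemma fr_seq k : exists r, fr r (H k).
Proof.
elim: k => // k [r hr]; rewrite HS; case: (w k); first by exists (p * r); apply: fr_mul => //; exact: fr_sig.
by exists (p ^+ 2 * r); apply: fr_mul => //; exact: fr_del.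
Qed.

(** One step from a large tile to a large tile: as a son, or by persisting for one level and then as
    a daughter. *)
Definition nxt (b : bool) i := if b then nsig i else obind ndel (nsame i).

(** A finite check. Arrows 0, 1, 2 form the long side: a boundary flag is on it at least once in
    four consecutive states, and from it the moves begin with a daughter or with son, daughter, son.
    Every other sequence would make the flag interior. *)
Lemma nxt_alive b1 b2 b3 b4 i j1 j2 j3 j4 : (i < 10)%N -> nxt b1 i = Some j1 -> nxt b2 j1 = Some j2 ->
  nxt b3 j2 = Some j3 -> nxt b4 j3 = Some j4 ->
  [|| i < 3, j1 < 3, j2 < 3 | j3 < 3]%N && ((i < 3)%N ==> ~~ b1 || ~~ b2 && b3).
Proof.
do 10?[case: i => [|i]] => //; case: b1 => //= _ -[<-]; case: b2 => //= -[<-];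
  case: b3 => //= -[<-]; case: b4 => //=.
Qed.

Lemma state_next k i : onarrow true i (H k) -> exists2 j, nxt (w k) i = Some j & onarrow true j (H k.+1).
Proof.
move=> ho; have [r hr] := fr_seq k; have [_ nb] := Hb k.+1; have [_ nb0] := Hb k.
move: nb; rewrite HS /nxt; case: (w k) => nb.
  by have [|j e oj] := onarrow_next (k := Ksig) (large := true) hr _ ho nb => //; exists j.
have [||j e oj] := onarrow_next (k := Ksame) (large := false) hr _ ho => //.
  by rewrite /= fmul1f.
rewrite /= fmul1f in oj.
have [|j' e' oj'] := onarrow_next (k := Kdel) (large := true) hr _ oj nb => //.
by exists j' => //=; rewrite /= in e; rewrite e.
Qed.

Lemma left_reach k : exists m i, [/\ (k <= m)%N, (i < 3)%N & onarrow true i (H m)].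
Proof.
have [r hr] := fr_seq k; have [i hi] := onarrow_ex true hr (Hb k).
have [j1 e1 o1] := state_next hi; have [j2 e2 o2] := state_next o1.
have [j3 e3 o3] := state_next o2; have [j4 e4 o4] := state_next o3.
have i10 : (i < 10)%N by case: hi.
have /andP[+ _] := nxt_alive i10 e1 e2 e3 e4.
case/or4P => h; [exists k, i | exists k.+1, j1 | exists k.+2, j2 | exists k.+3, j3]; split=> //.
- by apply/leqW/leqnSn.
- by apply/leqW/leqW/leqnSn.
Qed.

Lemma left_step k i : (i < 3)%N -> onarrow true i (H k) -> w k = false \/ [/\ w k, ~~ w k.+1 & w k.+2].
Proof.
move=> i3 hi.
have [j1 e1 o1] := state_next hi; have [j2 e2 o2] := state_next o1.
have [j3 e3 o3] := state_next o2; have [j4 e4 o4] := state_next o3.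
have i10 : (i < 10)%N by apply: (leq_trans i3).
have /andP[_] := nxt_alive i10 e1 e2 e3 e4; rewrite i3 /= => /orP[|/andP[]]; first by left; apply/negbTE.
by case: (w k) => ? ?; [right | left].
Qed.

(** The index in [H], the sense in which the flag runs along the long side, and the two ends of that
    side measured along the flag. *)
Definition lstate := (nat * bool * R * R)%type.
Definition lok (x : lstate) : Prop := let: (m, s, lo, hi) := x in
  [/\ H m = left s lo hi, lo <= 0, 0 < hi & exists2 i, (i < 3)%N & onarrow true i (H m)].
Definition lstep (x y : lstate) : Prop := let: (m, s, lo, hi) := x in let: (m', s', lo', hi') := y in
  (m < m')%N /\ ((lo' = lo /\ hi + p ^+ 2 * (hi - lo) <= hi') \/ (hi' = hi /\ lo' <= lo - p ^+ 2 * (hi - lo))).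

Lemma lstep_ex x : lok x -> exists y, lok y /\ lstep x y.
Proof.
have [/andP[a1 a2] /andP[b1 b2] /andP[c1 c2] e4] := psi_bounds R.
(* From [p ^+ 4 + p ^+ 2 = 1]: division by [p ^+ 2] prolongs the side by [p ^+ 2] times its length,
   and division by [p ^+ 4] by even more. *)
have p2 : (p ^+ 2)^-1 = 1 + p ^+ 2.
  have n2 : p ^+ 2 != 0 by rewrite gt_eqF //; lra.
  by apply: (mulfI n2); rewrite divff //; ring: e4.
have p4 : (p ^+ 4)^-1 = 1 + 2 * p ^+ 2 + p ^+ 4.
  have -> : p ^+ 4 = p ^+ 2 ^+ 2 by ring.
  by rewrite -exprVn p2; ring.
case: x => -[[m s] lo] hi [eH l0 h0 [i i3 oi]]; have lh : lo < hi by lra.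
have dl : 0 < hi - lo by lra.
have pd : 0 < p ^+ 2 * (hi - lo) by apply: mulr_gt0; clear a1 a2 b2 c1 c2 e4 eH h0 i3 l0 lh p2 p4; lra.
have [j1 f1 o1] := state_next oi; have [j2 f2 o2] := state_next o1.
have [j3 f3 o3] := state_next o2.
have K j (w1 : bool) : nxt w1 i = Some j -> ~~ w1 -> (j < 3)%N.
  by case: w1 => //; move: i3; clear; do 3?[case: i => [|i]] => // _ [<-].
have K3 (w1 w2 w3 : bool) k1 k2 k3 : nxt w1 i = Some k1 -> nxt w2 k1 = Some k2 -> nxt w3 k2 = Some k3 ->
   [/\ w1, ~~ w2 & w3] -> (k3 < 3)%N.
  move=> + + + []; case: w1; case: w2; case: w3 => // + + + _ _ _.
  by move: i3; clear; do 3?[case: i => [|i]] => //= _ [<-] //= [<-] //= [<-].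
case: (left_step i3 oi) => [w1|[w1 w2 w3]].
  have eH1 : H m.+1 = del ** left s lo hi by rewrite HS w1 eH.
  rewrite left_del // in eH1.
  exists (m.+1, ~~ s, if s then lo else hi - (hi - lo) / p ^+ 2, if s then lo + (hi - lo) / p ^+ 2 else hi).
  have j13 : (j1 < 3)%N by apply: (K j1 _ f1); rewrite w1.
  rewrite p2 in eH1 *; rewrite /lok /lstep; case: s {eH} eH1 => eH1 /=; split; split=> //; try
      (clear a1 a2 b1 b2 c1 c2 e4 p4; lra).
    by exists j1.
  by exists j1.
have eH3 : H m.+3 = sig ** (del ** (sig ** left s lo hi)).
  by rewrite !HS w3 (negbTE w2) w1 eH.
rewrite left_sds // in eH3.
exists (m.+3, ~~ s, if s then hi - (hi - lo) / p ^+ 4 else lo, if s then hi else lo + (hi - lo) / p ^+ 4).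
have j13 : (j3 < 3)%N by apply: (K3 _ _ _ j1 j2 j3 f1 f2 f3).
have lt : (m < m.+3)%N by apply/leqW/leqnSn.
have q4 : 0 < p ^+ 4 * (hi - lo) by apply: mulr_gt0; rewrite ?e4; lra.
rewrite p4 in eH3 *; rewrite /lok /lstep; case: s {eH} eH3 => eH3 /=; split; split=> //; try
    (clear a1 a2 b1 b2 c1 c2 e4 p2; lra).
  by exists j3.
by exists j3.
Qed.

Definition seqW : set (plane R) := [set q | exists k, bee (app (H k) q)].

Lemma bee_kid (b : bool) q : bee q -> bee (app (if b then sig else del) q).
Proof.
by move=> hq; apply/bee_split; case: b; [left; rewrite -app_sig_son | right; rewrite -app_del_daughter]; exists q.
Qed.

Lemma bee_seq k l q : (k <= l)%N -> bee (app (H k) q) -> bee (app (H l) q).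
Proof.
elim: l => [|l IH]; first by rewrite leqn0 => /eqP ->.
rewrite leq_eqVlt => /orP[/eqP -> //|]; rewrite ltnS => /IH h /h.
by move=> hl; rewrite HS app_mul; exact: bee_kid.
Qed.

Lemma boundary_region : seqW = [set q | 0 <= q.2] \/
  (exists2 a, a <= 0 & seqW = [set q | a <= q.1 /\ 0 <= q.2]) \/
  (exists2 b, 0 < b & seqW = [set q | q.1 <= b /\ 0 <= q.2]).
Proof.
have [/andP[a1 a2] /andP[b1 b2] /andP[c1 c2] e4] := psi_bounds R.
have [m0 [i0 [_ i03 o0]]] := left_reach 0.
have [r hr] := fr_seq m0; have [s0 [l0 [h0 [eH0 le0 lt0]]]] := left_form hr (Hb m0) o0 i03.
have : forall x, exists y, lok x -> lok y /\ lstep x y.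
  move=> x; have [ox|nx] := pselect (lok x); last by exists x => /nx.
  by have [y hy] := lstep_ex ox; exists y.
move=> /choice [nx hnx].
pose st k := iter k nx (m0, s0, l0, h0).
have ok k : lok (st k).
  by elim: k => [|k IH]; [split=> //; exists i0 | exact: (hnx _ IH).1].
pose ms k := (st k).1.1.1; pose ss k := (st k).1.1.2; pose lo k := (st k).1.2; pose hi k := (st k).2.
have okE k : [/\ H (ms k) = left (ss k) (lo k) (hi k), lo k <= 0 & 0 < hi k].
  by have := ok k; rewrite /ms /ss /lo /hi; case: (st k) => -[[m s] l] u [].
have stE k : (ms k < ms k.+1)%N /\ ((lo k.+1 = lo k /\ hi k + p ^+ 2 * (hi k - lo k) <= hi k.+1) \/
   (hi k.+1 = hi k /\ lo k.+1 <= lo k - p ^+ 2 * (hi k - lo k))).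
  have [_] := hnx _ (ok k); rewrite /ms /lo /hi -[nx (st k)]/(st k.+1).
  by case: (st k) => -[[m s] l] u; case: (st k.+1) => -[[m' s'] l'] u'.
have msge k : (k <= ms k)%N.
  by elim: k => // k IH; have [lt _] := stE k; exact: (leq_ltn_trans IH lt).
pose e := p ^+ 2 * (h0 - l0).
have e0 : 0 < e by apply: mulr_gt0; clear a1 a2 b2 c1 c2 e4 eH0; lra.
have len k : h0 - l0 <= hi k - lo k.
  elim: k => [|k IH]; first by rewrite /hi /lo.
  have : 0 <= p ^+ 2 * (hi k - lo k) by apply: mulr_ge0; clear a1 a2 b2 c1 c2 e0 e4 eH0; lra.
  by have [_ [[h1 h2]|[h1 h2]]] := stE k; clear a1 a2 b1 b2 c1 c2 e0 e4 eH0 le0 lt0; lra.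
have len2 k : e <= p ^+ 2 * (hi k - lo k) by rewrite ler_pM2l //; lra.
have mlo k l : (k <= l)%N -> lo l <= lo k.
  elim: l => [|l IH]; first by rewrite leqn0 => /eqP ->.
  rewrite leq_eqVlt => /orP[/eqP -> //|]; rewrite ltnS => /IH.
  by have := len2 l; have [_ [[h1 h2]|[h1 h2]]] := stE l; clear a1 a2 b1 b2 c1 c2 e4 eH0 le0 lt0; lra.
have mhi k l : (k <= l)%N -> hi k <= hi l.
  elim: l => [|l IH]; first by rewrite leqn0 => /eqP ->.
  rewrite leq_eqVlt => /orP[/eqP -> //|]; rewrite ltnS => /IH.
  by have := len2 l; have [_ [[h1 h2]|[h1 h2]]] := stE l; clear a1 a2 b1 b2 c1 c2 e4 eH0 le0 lt0; lra.
have Wle q : seqW q -> exists k, 0 <= q.2 /\ lo k <= q.1 <= hi k.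
  move=> [k /(bee_seq (msge k))]; have [-> l1 l2] := okE k => hq.
  by exists k; apply: left_bee hq; clear a1 a2 b1 b2 c1 c2 e0 e4 eH0 le0 lt0; lra.
have Wge q k : 0 <= q.2 -> lo k <= q.1 <= hi k -> (exists l, (k <= l)%N /\ q.2 <= p ^+ 3 * (hi l - lo l)) -> seqW q.
  move=> q0 /andP[h1 h2] [l [kl hl]]; exists (ms l); have [-> l1 l2] := okE l.
  have := mlo _ _ kl; have := mhi _ _ kl => k1 k2.
  by apply: bee_left; clear a1 a2 b1 b2 c1 c2 e0 e4 eH0 le0 lt0; lra.
have Hlo : (exists N, forall n, (N <= n)%N -> lo n = lo N) \/ (forall M, exists N, forall n, (N <= n)%N -> lo n <= M).
  have [k|[N hN]|hN] := @steps_lim (fun k => - lo k) e e0.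
  - by have := len2 k; have [_ [[-> _]|[_ h2]]] := stE k; [left | right; (clear a1 a2 b1 b2 c1 c2 e0 e4 eH0 le0 lt0; lra)].
  - by left; exists N => n /hN /oppr_inj.
  - by right=> M; have [N hN'] := hN (- M); exists N => n /hN'; rewrite lerN2.
have Hhi : (exists N, forall n, (N <= n)%N -> hi n = hi N) \/ (forall M, exists N, forall n, (N <= n)%N -> M <= hi n).
  by apply: (steps_lim e0) => k; have := len2 k; have [_ [[_ h2]|[-> _]]] := stE k; [right;
      (clear a1 a2 b1 b2 c1 c2 e0 e4 eH0 le0 lt0; lra) | left].
have p30 : 0 < p ^+ 3 by clear a1 a2 b1 b2 c2 e0 e4 eH0 le0 lt0; lra.
have big y : (forall M, exists N, forall n, (N <= n)%N -> lo n <= M) \/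
   (forall M, exists N, forall n, (N <= n)%N -> M <= hi n) -> forall k, exists l, (k <= l)%N /\ y <= p ^+ 3 * (hi l - lo l).
  move=> hb k; have [N hN] : exists N, forall n, (N <= n)%N -> y / p ^+ 3 <= hi n - lo n.
    case: hb => h; [have [N hN] := h (- (y / p ^+ 3)) | have [N hN] := h (y / p ^+ 3)];
    by exists N => n /hN; have [_ k1 k2] := okE n; clear a1 a2 b1 b2 c1 c2 e0 e4 eH0 h hN le0 lt0 p30; lra.
  exists (maxn k N); rewrite leq_maxl; split=> //.
  by have := hN _ (leq_maxr k N); rewrite ler_pdivrMr // mulrC.
case: Hlo => [[N hN]|hlo].
  case: Hhi => [[N' hN']|hhi].
    have n1 := leq_maxl N N'; have n2 := leq_maxr N N'; move: (maxn N N') n1 n2 => n n1 n2.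
    suff : e <= 0 by rewrite leNgt e0.
    have := len2 n; have := hN _ n1; have := hN _ (leqW n1); have := hN' _ n2; have := hN' _ (leqW n2).
    by have [_ [[_ h1]|[_ h1]]] := stE n; clear a1 a2 b1 b2 c1 c2 e0 e4 eH0 hN hN' le0 lt0 n1 n2 p30; lra.
  right; left; exists (lo N); first by have [] := okE N.
  apply/seteqP; split=> q /=.
    move=> /Wle [k [q0 /andP[h1 h2]]]; split=> //.
    by have := mlo _ _ (leq_maxr N k); rewrite (hN _ (leq_maxl N k));
        clear a1 a2 b1 b2 c1 c2 e0 e4 eH0 h2 hN hhi le0 lt0 p30 q0; lra.
  move=> [h1 h2]; have [K hK] := hhi q.1.
  apply: (Wge q (maxn N K)) => //; first by rewrite (hN _ (leq_maxl N K)) h1 (hK _ (leq_maxr N K)).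
  by apply: big; right.
case: Hhi => [[N hN]|hhi].
  right; right; exists (hi N); first by have [] := okE N.
  apply/seteqP; split=> q /=.
    move=> /Wle [k [q0 /andP[h1 h2]]]; split=> //.
    by have := mhi _ _ (leq_maxr N k); rewrite (hN _ (leq_maxl N k));
        clear a1 a2 b1 b2 c1 c2 e0 e4 eH0 h1 hN hlo le0 lt0 p30 q0; lra.
  move=> [h1 h2]; have [K hK] := hlo q.1.
  apply: (Wge q (maxn N K)) => //; first by rewrite (hN _ (leq_maxl N K)) h1 (hK _ (leq_maxr N K)).
  by apply: big; left.
left; apply/seteqP; split=> q /=; first by move=> /Wle [k []].
move=> h; have [K hK] := hlo q.1; have [K' hK'] := hhi q.1.
apply: (Wge q (maxn K K')) => //; first by rewrite (hK _ (leq_maxl K K')) (hK' _ (leq_maxr K K')).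
by apply: big; left.
Qed.
End BoundaryChain.

(** * Closedness of unions of tiles *)

Section Closed.
Variable R : realType.
Local Notation p := (psi R).
Implicit Types (f g h : frame R) (q : plane R) (r : R).

Lemma closed_tile r f q : fr r f -> ~ tile f q -> exists2 e : R, 0 < e &
  forall q', `|q.1 - q'.1| < e -> `|q.2 - q'.2| < e -> ~ tile f q'.
Proof.
move=> hf nq.
have cb : closed (@bee R).
  have c1 (c : R) : closed [set q : plane R | q.1 <= c].
    by apply: (@closed_comp _ _ fst [set x | x <= c]); [move=> ? _; exact: cvg_fst | exact: closed_le].
  have c2 (c : R) : closed [set q : plane R | q.2 <= c].
    by apply: (@closed_comp _ _ snd [set x | x <= c]); [move=> ? _; exact: cvg_snd | exact: closed_le].
  have c3 (c : R) : closed [set q : plane R | c <= q.1].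
    by apply: (@closed_comp _ _ fst [set x | c <= x]); [move=> ? _; exact: cvg_fst | exact: closed_ge].
  have c4 (c : R) : closed [set q : plane R | c <= q.2].
    by apply: (@closed_comp _ _ snd [set x | c <= x]); [move=> ? _; exact: cvg_snd | exact: closed_ge].
  have cr (a b c e : R) : closed (rect a b c e).
    have -> : rect a b c e = [set q : plane R | a <= q.1] `&` [set q : plane R | q.1 <= b] `&`
        ([set q : plane R | c <= q.2] `&` [set q : plane R | q.2 <= e]).
      by apply/seteqP; split=> z; rewrite /rect /=; [move=> [/andP[? ?] /andP[? ?]] | move=> [[k1 k2] [k3 k4]]; rewrite k1 k2 k3 k4].
    by do 2?apply: closedI.
  exact: closedU.
have ct : closed (tile f).
  have -> : tile f = app (finv f) @^-1` @bee R by apply/seteqP; split=> z /(tileP _ hf).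
  by apply: closed_comp cb => z _; exact: continuous_app.
have [e e0 he] := open_boxP (closed_openC ct) nq.
by exists e => // q' h1 h2; exact: he.
Qed.

(** Only finitely many tiles come within distance 1 of [q] in both coordinates. If none of them
    contains [q], closedness of each gives a box around [q] that they all avoid. *)
Lemma cover_closed d F (F' : set (frame R)) q : locfam d F -> F' `<=` F ->
  (forall e : R, 0 < e -> exists q', [/\ `|q.1 - q'.1| < e, `|q.2 - q'.2| < e & exists2 f, F' f & tile f q']) ->
  exists2 f, F' f & tile f q.
Proof.
move=> LF sF hq; apply: contrapT => nq.
have [d0 Fs Fd] := LF; have [N [en hen]] := local_finite q 1 LF.
have k1 : \forall e \near (0 : R)^'+, forall i, F' (en i) -> forall q',
    `|q.1 - q'.1| < e -> `|q.2 - q'.2| < e -> ~ tile (en i) q'.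
  apply: filter_forall => i; have [Fi|nFi] := pselect (F' (en i)); last exact: nearW.
  have [s hs] : exists s, fr s (en i) by case: (Fs _ (sF _ Fi)) => ?; [exists d | exists (p * d)].
  have [|e e0 he] := @closed_tile s (en i) q hs; first by move=> hi; case: nq; exists (en i).
  apply: filterS (near0_small e0) => x [x0 xe] _ q' h1 h2.
  by apply: he; [exact: lt_trans h1 xe | exact: lt_trans h2 xe].
have [e [k [e0 e1]]] := filter_ex (filterI k1 (near0_small (ltr01 : (0 : R) < 1))).
have [q' [h1 h2 [f Ff hf]]] := hq _ e0.
have [||i ei] := hen f q' (sF _ Ff) hf; first by rewrite distrC ltW // (lt_trans h1).
  by rewrite distrC ltW // (lt_trans h2).
by apply: (k i _ _ h1 h2); rewrite -ei.
Qed.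
End Closed.

(** * The four axis-parallel flags at a point *)

Section Germs.
Variable R : realType.
Local Notation p := (psi R).
Implicit Types (f g h : frame R) (q : plane R) (r : R).

Definition aligned h : Prop := (uy h = 0 /\ vx h = 0) \/ (ux h = 0 /\ vy h = 0).

Lemma finv_step r s f g k h : fr r f -> fr s g -> f = g ** k -> finv g ** h = k ** (finv f ** h).
Proof.
by move=> hf hg e; apply: (fmulfI hg); rewrite (fmulfV _ hg) fmulA -e (fmulfV _ hf).
Qed.

Lemma aligned_fmul g h : aligned g -> aligned h -> aligned (g ** h).
Proof.
by case=> -[g1 g2] [] [h1 h2]; [left | right | right | left]; rewrite /= ?g1 ?g2 ?h1 ?h2 !(mulr0, mul0r, addr0).
Qed.

Lemma aligned_kfr k : aligned (kfr R k).
Proof. by case: k; [left | right | left]. Qed.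

Lemma aligned_mir : [/\ aligned (mirX R), aligned (mirY R), aligned (mirXY R) & aligned (swap R)].
Proof. by split; [left | left | left | right]. Qed.

Lemma hdir_swap r h : fr r h -> aligned h -> hdir (h ** swap R) = hdir h.
Proof.
move=> hh ah; have [hx hy] := fr_neq0 hh.
rewrite /hdir /= !(mulr0, mul0r, addr0, add0r, mulr1).
by case: ah hx hy => -[-> ->]; rewrite eqxx ?orbF => x y; rewrite ?lexpos0 ?lexposn0.
Qed.

Lemma pos_opp (a : R) : a != 0 -> (0 < - a) = ~~ (0 < a).
Proof. by rewrite oppr_gt0 -leNgt lt_neqAle => ->. Qed.

Lemma hdir_all r h : fr r h -> aligned h -> hdir h -> hdir (h ** mirX R) -> hdir (h ** mirY R) ->
  hdir (h ** mirXY R) -> sbee (ox h, oy h).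
Proof.
have [/andP[a1 a2] /andP[b1 b2] /andP[c1 c2] e4] := psi_bounds R.
move=> hh ah; have [hx hy] := fr_neq0 hh.
rewrite /hdir /= !(mulr0, mul0r, addr0, add0r, mulr1, mulrN1).
suff K (s1 s2 : bool) (x y : R) : germ s1 s2 x y -> germ (~~ s1) s2 x y -> germ s1 (~~ s2) x y -> germ (~~ s1) (~~ s2) x y -> sbee (x, y).
  case: ah hx hy => -[-> ->]; rewrite eqxx ?orbF /= ?oppr0 => x y; rewrite ?lexpos0 !lexposn0 ?oppr_eq0 // ?pos_opp //.
    exact: K.
  by move=> k1 k2 k3 k4; exact: (K _ _ _ _ k1 k3 k2 k4).
by rewrite /germ /inq /sbee; case: s1; case: s2 => /=; clear a1 a2 b1 b2 c1 c2 e4 hx hy; lra.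
Qed.

Lemma hdir_some r h : fr r h -> aligned h -> bee (ox h, oy h) ->
  [|| hdir h, hdir (h ** mirX R), hdir (h ** mirY R) | hdir (h ** mirXY R)].
Proof.
have [/andP[a1 a2] /andP[b1 b2] /andP[c1 c2] e4] := psi_bounds R.
move=> hh ah; have [hx hy] := fr_neq0 hh.
rewrite /hdir /= !(mulr0, mul0r, addr0, add0r, mulr1, mulrN1).
suff K (s1 s2 : bool) (x y : R) : bee (x, y) -> [|| germ s1 s2 x y, germ (~~ s1) s2 x y, germ s1 (~~ s2) x y | germ (~~ s1) (~~ s2) x y].
  move=> hb; case: ah hx hy => -[-> ->]; rewrite eqxx ?orbF /= ?oppr0 => x y; rewrite ?lexpos0 !lexposn0 ?oppr_eq0 // ?pos_opp //.
    exact: K.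
  by have := K (0 < vx h) (0 < uy h) _ _ hb; case/or4P => ->; rewrite ?orbT.
have any (t1 t2 : bool) : germ t1 t2 x y -> [|| germ s1 s2 x y, germ (~~ s1) s2 x y, germ s1 (~~ s2) x y | germ (~~ s1) (~~ s2) x y].
  by clear; case: s1; case: s2; case: t1; case: t2 => ->; rewrite ?orbT.
move=> hb; apply: (any (if y < p ^+ 2 then x < p else x < p ^+ 3) (if x < p ^+ 3 then y < 1 else y < p ^+ 2)) => {any}.
move: hb; rewrite /germ /inq /bee /setU /rect /=; clear -a1 a2 b1 b2 c1 c2.
by case: (ltP y (p ^+ 2)) => h1; case: (ltP x (p ^+ 3)) => h2; case: (ltP y) => h3; case: (ltP x) => h4; clear a2 c2; lra.
Qed.
End Germs.

(** * Shape of the union of a chain *)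

Section Region.
Variable R : realType.
Local Notation p := (psi R).
Implicit Types (f g h : frame R) (q : plane R) (r : R) (G : nat -> frame R).
Variables (d : R) (F : set (frame R)) (C : set (plane R)).
Hypotheses (AF : A2F d F C) (cvC : convexC C).
Local Notation L := (lev d F).

Lemma D_inside n r g h : L n g -> fr r h -> D g h -> inside C h.
Proof.
move=> Lg hh Dg; have [s hs] := lev_fr AF cvC Lg.
by apply: filterS ((DtileP hs hh).1 Dg) => t ht; apply/(lev_cover AF cvC n); exists g.
Qed.

Lemma W_closed r h G q : fr r h -> chain d F h G ->
  (forall e : R, 0 < e -> exists q', [/\ `|q.1 - q'.1| < e, `|q.2 - q'.2| < e & W G q']) -> W G q.
Proof.
move=> hh hG hq; have [LF _ _ _] := AF.
have [||f [Ff fW] hf] := @cover_closed _ d F [set f | F f /\ inW G f] q LF; first by move=> f [].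
  move=> e /hq [q' [h1 h2 /(W_desc AF cvC hG) [f [Ff fW hf]]]].
  by exists q'; split=> //; exists f.
exact: inW_tile fW hf.
Qed.

(** On a segment from the region to a point outside, the supremum of the parameters in the closed
    region gives a point that is interior to no [G n]. *)
Lemma region_boundary r h G : fr r h -> chain d F h G -> W G = setT \/
  exists q, W G q /\ forall n, ~ stile (G n) q.
Proof.
move=> hh hG; have [all|/existsNP [q1 nq1]] := pselect (forall q, W G q); [by left; apply/seteqP; split | right].
have [s hs] := lev_fr AF cvC (hG 0%N).1; have [q0 hq0] := stile_nonempty hs.
have Wq0 : W G q0 by exists 0%N; apply: (stile_tile hs).
pose pt (t : R) : plane R := (q0.1 + t * (q1.1 - q0.1), q0.2 + t * (q1.2 - q0.2)).
have pt0E : pt 0 = q0 by rewrite /pt !mul0r !addr0; case: (q0).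
have pt1E : pt 1 = q1 by rewrite /pt !mul1r; case: (q1) => a b; congr pair; rewrite /=; ring.
pose m := 1 + `|q1.1 - q0.1| + `|q1.2 - q0.2|.
have m0 : 0 < m by rewrite /m; have := normr_ge0 (q1.1 - q0.1); have := normr_ge0 (q1.2 - q0.2); lra.
have dist (t t' e : R) : `|t - t'| < e / m -> 0 < e -> `|(pt t).1 - (pt t').1| < e /\ `|(pt t).2 - (pt t').2| < e.
  move=> ht e0; rewrite ltr_pdivlMr // in ht.
  have E (a b : R) : (a + t * b) - (a + t' * b) = (t - t') * b by ring.
  rewrite /pt /= !E !normrM; have t0 := normr_ge0 (t - t').
  split; apply: le_lt_trans ht; apply: ler_wpM2l => //; rewrite /m;
  have := normr_ge0 (q1.1 - q0.1); have := normr_ge0 (q1.2 - q0.2); lra.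
pose S := [set t : R | 0 <= t <= 1 /\ W G (pt t)].
have S0 : S 0 by split; [rewrite lexx ler01 | rewrite pt0E].
have hsS : has_sup S by split; [exists 0 | exists 1 => t [/andP[]]].
pose t := sup S.
have t0 : 0 <= t by apply: ub_le_sup => //; case: hsS.
have t1 : t <= 1 by apply: ge_sup; [exists 0 | move=> u [/andP[]]].
have Wt : W G (pt t).
  apply: W_closed hh hG _ => e e0.
  have [u Su ut] := sup_adherent (divr_gt0 e0 m0) hsS.
  have ut' : u <= t by apply: ub_le_sup => //; case: hsS.
  have [|h1 h2] := dist t u e _ e0; first by rewrite ger0_norm ?subr_ge0 // -/t in ut *; lra.
  by exists (pt u); split=> //; case: Su.
exists (pt t); split=> // n hn.
have [e e0 he] := open_boxP (open_stile (f := G n)) hn.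
have lt1 : t < 1.
  by rewrite lt_neqAle t1 andbT; apply/eqP => e1; apply: nq1; rewrite -pt1E -e1.
pose u := Num.min 1 (t + e / m / 2).
have em : 0 < e / m by apply: divr_gt0.
have tu : t < u by rewrite lt_min lt1 /=; lra.
have ut : u - t < e / m by rewrite ltrBlDl; apply: (@le_lt_trans _ _ (t + e / m / 2)); [rewrite ge_min lexx orbT |
    (clear e0 lt1 m0 pt0E pt1E t0 t1 tu; lra)].
have [|h1 h2] := dist t u e _ e0; first by rewrite distrC gtr0_norm // subr_gt0.
have [s' hs'] := lev_fr AF cvC (hG n).1.
have Su : S u.
  split; first by rewrite ge_min lexx andbT; clear e0 h1 h2 lt1 m0 pt0E pt1E t1 ut; lra.
  by exists n; apply: (stile_tile hs'); apply: he.
have : u <= t by apply: ub_le_sup => //; case: hsS.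
by rewrite leNgt tu.
Qed.

Lemma D_chain r s h f G m n : fr r h -> chain d F h G -> fr s f -> (m <= n)%N -> D (G m) f -> D (G n) f.
Proof.
move=> hh hG hf mn; have [a ha] := lev_fr AF cvC (hG m).1; have [b hb] := lev_fr AF cvC (hG n).1.
exact: D_part ha hb hf (chain_part AF cvC hh hG mn).
Qed.

(** The union depends only on the tail of the chain, so any flag that enters some [G n] may serve as
    base flag. *)
Lemma chain_move r s h f G n : fr r h -> chain d F h G -> fr s f -> D (G n) f ->
  exists G', [/\ chain d F f G', W G' = W G & forall k, (n <= k)%N -> G' k = G k].
Proof.
move=> hh hG hf Df; have [G' hG'] := chain_ex AF cvC hf (D_inside (hG n).1 hf Df).
have E k : (n <= k)%N -> G' k = G k.
  move=> nk; apply: (flag_uniq AF cvC hf (hG' k).1 (hG k).1 (hG' k).2).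
  exact: D_chain hh hG hf nk Df.
exists G'; split=> //; apply/seteqP; split=> q [k hk]; exists (maxn n k).
  by rewrite -E ?leq_maxl //; apply: (chain_part AF cvC hf hG' (leq_maxr _ _)).2 hk.
by rewrite E ?leq_maxl //; apply: (chain_part AF cvC hh hG (leq_maxr _ _)).2 hk.
Qed.

(** The tiles from level [n0] on have sides parallel to the axes of [h0]. If all four flags at [q]
    were entered sooner or later, [q] would be interior to some [G n]; hence an entered flag is
    adjacent to one that is never entered. When the two differ by [mirX], [swap] turns this into
    [mirY]. *)
Lemma boundary_flag r h G q : fr r h -> chain d F h G -> W G q -> (forall n, ~ stile (G n) q) ->
  exists s f, [/\ fr s f, exists n, D (G n) f & forall n, ~~ D (G n) (f ** mirY R)].
Proof.
move=> hh hG [n0 hq] nq.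
have frG n : exists s, fr s (G n) by exact: (lev_fr AF cvC (hG n).1).
have [s hs] := frG n0; pose z := app (finv (G n0)) q.
pose h0 := G n0 ** Frame z.1 z.2 1 0 0 1.
have hz : fr 1 (Frame z.1 z.2 1 0 0 1 : frame R) by split; rewrite /= ?ltr01 //; ring.
have hh0 : fr (s * 1) h0 := fr_mul hs hz.
have oh0 : (ox h0, oy h0) = q.
  have -> : (ox h0, oy h0) = app (G n0) z by [].
  exact: appfV hs.
have ofin f : (ox (finv f ** h0), oy (finv f ** h0)) = app (finv f) q by rewrite -oh0.
have al n : (n0 <= n)%N -> aligned (finv (G n) ** h0).
  elim: n => [|n IH].
    by rewrite leqn0 => /eqP e; rewrite -e (fmulVf _ hs); left.
  rewrite leq_eqVlt => /orP[/eqP <-|]; first by rewrite (fmulVf _ hs); left.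
  rewrite ltnS => /IH an; have [l [k [_ hl _ e]]] := chain_kid AF cvC hh hG n.
  have [t ht] := frG n.
  have -> : finv (G n.+1) ** h0 = kfr R k ** (finv (G n) ** h0).
    exact: finv_step ht hl e.
  exact: (aligned_fmul (aligned_kfr R k) an).
clearbody h0; have frn n : exists t, fr t (finv (G n) ** h0).
  by have [t ht] := frG n; exists (t^-1 * (s * 1)); exact: fr_mul (fr_inv ht) hh0.
pose P m := exists n, D (G n) (h0 ** m).
have [r1 r2 r3 r4] : [/\ fr 1 (mirX R), fr 1 (mirY R), fr 1 (mirXY R) & fr 1 (swap R)].
  by split; [exact: fr_mirX | exact: fr_mirY | exact: fr_mirXY | exact: fr_swap].
have mono t m k n : fr t m -> (k <= n)%N -> D (G k) (h0 ** m) -> D (G n) (h0 ** m).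
  by move=> hm; apply: D_chain hh hG (fr_mul hh0 hm).
have [a1 a2 a3 a4] := aligned_mir R.
have some : [\/ P (fone R), P (mirX R), P (mirY R) | P (mirXY R)].
  have [t ht] := frn n0; have := hdir_some ht (al n0 (leqnn _)).
  rewrite ofin -(tileP _ hs) => /(_ hq); rewrite -!fmulA.
  case/or4P => k; [apply: Or41 | apply: Or42 | apply: Or43 | apply: Or44]; exists n0 => //.
  by rewrite fmulf1.
have nall : P (fone R) -> P (mirX R) -> P (mirY R) -> P (mirXY R) -> False.
  move=> [k1 d1] [k2 d2] [k3 d3] [k4 d4]; pose N := (n0 + k1 + k2 + k3 + k4)%N.
  have [t ht] := frn N.
  have le (k : nat) : (k \in [:: n0; k1; k2; k3; k4])%N -> (k <= N)%N.
    by rewrite !inE /N => /or4P[/eqP->|/eqP->|/eqP->|/orP[/eqP->|/eqP->]]; lia.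
  apply: (nq N); have := hdir_all ht (al N (le n0 _)); rewrite ofin; apply; rewrite ?inE ?eqxx //.
  - by have := mono _ _ _ _ (fr_one R) (le k1 _) d1; rewrite !inE eqxx orbT fmulf1; apply.
  - by have := mono _ _ _ _ r1 (le k2 _) d2; rewrite !inE eqxx !orbT -fmulA; apply.
  - by have := mono _ _ _ _ r2 (le k3 _) d3; rewrite !inE eqxx !orbT -fmulA; apply.
  - by have := mono _ _ _ _ r3 (le k4 _) d4; rewrite !inE eqxx !orbT -fmulA; apply.
have toY t m m' : fr t m -> m ** mirY R = m' -> P m -> ~ P m' -> exists s f,
    [/\ fr s f, exists n, D (G n) f & forall n, ~~ D (G n) (f ** mirY R)].
  move=> hm e Pm nP; exists (s * 1 * t), (h0 ** m); split=> //; first exact: fr_mul.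
  by move=> n; apply/negP => hn; apply: nP; exists n; rewrite -e fmulA.
have sw n m t : fr t m -> aligned m -> (n0 <= n)%N -> D (G n) (h0 ** m ** swap R) = D (G n) (h0 ** m).
  move=> hm am hn; have [u hu] := frn n; rewrite /D !fmulA (hdir_swap (r := u * t)) //.
    exact: fr_mul.
  by apply: aligned_fmul => //; exact: al.
have toX t m m' : fr t m -> aligned m -> m ** mirX R = m' -> P m -> ~ P m' -> exists s f,
    [/\ fr s f, exists n, D (G n) f & forall n, ~~ D (G n) (f ** mirY R)].
  move=> hm am e [k Pm] nP; exists (s * 1 * t * 1), (h0 ** m ** swap R).
  have hm' : fr (t * 1) m' by rewrite -e; exact: fr_mul.
  have am' : aligned m' by rewrite -e; exact: aligned_fmul.
  have e' : m ** swap R ** mirY R = m' ** swap R.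
    by rewrite -e -!fmulA; congr (m ** _); congr Frame; rewrite /=; ring.
  split; first by apply: fr_mul r4; exact: fr_mul.
    exists (maxn n0 k); rewrite (sw _ _ _ hm am) ?leq_maxl //.
    exact: mono hm (leq_maxr _ _) Pm.
  move=> n; apply/negP => hn; apply: nP; exists (maxn n0 n).
  rewrite -(sw _ _ _ hm' am') ?leq_maxl //.
  have -> : h0 ** m' ** swap R = h0 ** (m ** swap R ** mirY R) by rewrite e' !fmulA.
  apply: (mono _ _ n); [by apply: fr_mul r2; exact: fr_mul hm r4 | exact: leq_maxr | by rewrite !fmulA].
have i1 := fr_one R; have al1 : aligned (fone R) by left.
have E1 : [/\ fone R ** mirX R = mirX R, fone R ** mirY R = mirY R, mirX R ** mirX R = fone R & mirX R ** mirY R = mirXY R].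
  by split; congr Frame; rewrite /=; ring.
have E2 : [/\ mirY R ** mirX R = mirXY R, mirY R ** mirY R = fone R, mirXY R ** mirX R = mirY R & mirXY R ** mirY R = mirX R].
  by split; congr Frame; rewrite /=; ring.
have [e1 e2 e3 e4] := E1; have [e5 e6 e7 e8] := E2.
have [p1|n1] := pselect (P (fone R)); have [p2|n2] := pselect (P (mirX R));
  have [p3|n3] := pselect (P (mirY R)); have [p4|n4] := pselect (P (mirXY R));
  first [ by case: (nall p1 p2 p3 p4) | exact: (toX _ _ _ i1 al1 e1 p1 n2) | exact: (toY _ _ _ i1 e2 p1 n3)
    | exact: (toX _ _ _ r1 a1 e3 p2 n1) | exact: (toY _ _ _ r1 e4 p2 n4)
    | exact: (toX _ _ _ r2 a2 e5 p3 n4) | exact: (toY _ _ _ r2 e6 p3 n1)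
    | exact: (toX _ _ _ r3 a3 e7 p4 n3) | exact: (toY _ _ _ r3 e8 p4 n2) | by case: some ].
Qed.

Lemma flag_region r h G : fr r h -> chain d F h G -> (forall n, ~~ D (G n) (h ** mirY R)) ->
  [\/ forall q, W G (app h q) <-> 0 <= q.2,
   exists2 a, a <= 0 & forall q, W G (app h q) <-> a <= q.1 /\ 0 <= q.2 |
   exists2 b, 0 < b & forall q, W G (app h q) <-> q.1 <= b /\ 0 <= q.2].
Proof.
move=> hh hG nD; have [ns [w hns]] := chain_seq AF cvC hh hG.
pose H k := finv (G (ns k)) ** h.
have frn k : fr (d / p ^+ ns k) (G (ns k)) by have [] := hns k.
have HS k : H k.+1 = (if w k then sig R else del R) ** H k.
  by have [_ _ e] := hns k; exact: finv_step (frn k) (frn k.+1) e.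
have H0 : exists r, fr r (H 0%N) by exists ((d / p ^+ ns 0%N)^-1 * r); exact: fr_mul (fr_inv (frn _)) hh.
have Hb k : bdry (H k) by split; [exact: (hG (ns k)).2 | rewrite /H -fmulA; exact: nD].
have E q : W G (app h q) <-> seqW H q.
  split=> [[n hn]|[k hk]].
    exists n; rewrite /H app_mul -(tileP _ (frn n)).
    by have [le _ _] := hns n; apply: (chain_part AF cvC hh hG le).2.
  by exists (ns k); rewrite (tileP _ (frn k)) -app_mul.
have K (A : set (plane R)) : seqW H = A -> forall q, W G (app h q) <-> A q by move=> <-.
case: (boundary_region HS H0 Hb) => [e|[[a a0 e]|[b b0 e]]]; have k := K _ e.
- exact: Or31.
- by apply: Or32; exists a.
- by apply: Or33; exists b.
Qed.

(** When the region ends at a point of the boundary line, the flag is shifted along the line to that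
    apex, and reversed if the region lies behind it. *)
Lemma W_region r h G : fr r h -> chain d F h G -> W G = setT \/
  exists s f, fr s f /\ ((forall q, W G (app f q) <-> 0 <= q.2) \/
    (forall q, W G (app f q) <-> 0 <= q.1 /\ 0 <= q.2)).
Proof.
move=> hh hG; have [|[q [Wq nq]]] := region_boundary hh hG; [by left | right].
have [s [f [hf [n Dn] nD]]] := boundary_flag hh hG Wq nq.
have [G' [hG' <- eG]] := chain_move hh hG hf Dn.
have nD' k : ~~ D (G' k) (f ** mirY R).
  apply/negP => /(D_chain hf hG' (fr_mul hf (fr_mirY R)) (leq_maxr n k)).
  by rewrite eG ?leq_maxl //; apply/negP.
case: (flag_region hf hG' nD') => [k|[a a0 k]|[b b0 k]].
- by exists s, f; split=> //; left.
- have ht : fr 1 (Frame a 0 1 0 0 1 : frame R) by split; rewrite /= ?ltr01 //; ring.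
  exists (s * 1), (f ** Frame a 0 1 0 0 1); split; first exact: fr_mul.
  right=> x; rewrite app_mul k /app /= !mul0r !mul1r !addr0 add0r.
  by rewrite lerDl.
- have ht : fr 1 (Frame b 0 (-1) 0 0 1 : frame R) by split; rewrite /= ?ltr01 //; ring.
  exists (s * 1), (f ** Frame b 0 (-1) 0 0 1); split; first exact: fr_mul.
  right=> x; rewrite app_mul k /app /= !mul0r !mul1r !addr0 add0r mulN1r.
  by rewrite gerDl oppr_le0.
Qed.
End Region.

(** * Half-planes, quadrants and convexity *)

Section ConvexSets.
Variable R : realType.
Implicit Types (f g h : frame R) (q : plane R) (A C : set (plane R)).

Definition hp f A : Prop := forall q, A (app f q) <-> 0 <= q.2.
Definition quad f A : Prop := forall q, A (app f q) <-> 0 <= q.1 /\ 0 <= q.2.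

Lemma inside_lt A h : (forall t : R, 0 < t < 1 -> A (app h (t, t ^+ 2))) -> inside A h.
Proof. by move=> k; apply: filterS (near0_small ltr01) => t [t0 t1]; apply: k; rewrite t0. Qed.

Lemma convexC_app f C : convexC C -> convexC (fun q => C (app f q)).
Proof.
move=> cv a b Ca Cb t t01; have := cv _ _ Ca Cb t t01; congr (C _).
by congr pair; rewrite /app /=; ring.
Qed.

(** A point [q] below the axis lies on the segment from a still lower point [z] of [C] to the point
    [w] of the axis. *)
Lemma convexC_unbounded C : convexC C -> (forall q, 0 <= q.2 -> C q) -> (forall M, exists2 q, C q & q.2 < M) ->
  forall q, C q.
Proof.
move=> cv up dn q; have [q0|q0] := leP 0 q.2; first exact: up.
have [z Cz zq] := dn q.2; pose t := (q.2 - z.2) / (- z.2).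
have nz : 0 < - z.2 by lra.
have tE : t * (- z.2) = q.2 - z.2 by rewrite divfK // gt_eqF.
have t0 : 0 < t by apply: divr_gt0 => //; lra.
have t1 : t < 1 by rewrite ltr_pdivrMr //; lra.
pose w : plane R := (z.1 + (q.1 - z.1) / t, 0).
have := cv _ _ Cz (up w (lexx _)) t _; have -> : 0 <= t <= 1 by rewrite !ltW.
move=> /(_ isT); congr (C _); rewrite /w /=; case: (q) tE => x y /= tE; congr pair; last lra.
by field; rewrite gt_eqF.
Qed.

(** In the coordinates of [f] neither side of the quadrant can rise, and they are not both
    horizontal, so its diagonal descends without bound. *)
Lemma quad_unbounded r s f g A (M : R) : fr r f -> fr s g -> (forall q, 0 <= q.1 -> 0 <= q.2 -> A (app g q)) ->
  (forall q, A (app f q) -> q.2 <= 0) -> exists2 q, A (app f q) & q.2 < M.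
Proof.
move=> hf hg hA neg; pose m := finv f ** g.
have hm : fr (r^-1 * s) m := fr_mul (fr_inv hf) hg.
have E q : app g q = app f (app m q) by rewrite app_mul (appfV _ hf).
have le (x y : R) : 0 <= x -> 0 <= y -> oy m + uy m * x + vy m * y <= 0.
  by move=> x0 y0; have := hA (x, y) x0 y0; rewrite E => /neg.
have lin (a b : R) : (forall x, 0 <= x -> a + b * x <= 0) -> b <= 0.
  move=> k; rewrite leNgt; apply/negP => b0.
  have h : 0 <= (`|a| + 1) / b by apply: divr_ge0; [rewrite addr_ge0 | apply: ltW].
  have := k _ h; rewrite (mulrC b) divfK ?gt_eqF //; have := ler_norm (- a); rewrite normrN; lra.
have u0 : uy m <= 0.
  by apply: (lin (oy m)) => x x0; have := le x 0 x0 (lexx _); rewrite mulr0 addr0.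
have v0 : vy m <= 0.
  by apply: (lin (oy m)) => x x0; have := le 0 x (lexx _) x0; rewrite mulr0 addr0.
have [_ n0] := fr_neq0 hm.
have s0 : uy m + vy m < 0.
  by move: n0 u0 v0; rewrite !lt_neqAle => /orP[] n; rewrite ?(negbTE n); case: (ltgtP (uy m) 0) n; case: (ltgtP (vy m) 0) => //;
      clear hA le neg; lra.
pose x := (`|oy m| + `|M| + 1) / - (uy m + vy m).
have x0 : 0 <= x by apply: divr_ge0; [rewrite !addr_ge0 | lra].
exists (app m (x, x)); first by rewrite -E; exact: hA.
have xE : x * - (uy m + vy m) = `|oy m| + `|M| + 1 by rewrite divfK // oppr_eq0 lt_eqF.
have := ler_norm (- M); have := ler_norm (oy m); rewrite normrN.
move: x xE {x0} => x; rewrite /app /=; lra.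
Qed.
End ConvexSets.

(** * How the unions of chains make up a convex set *)

Section Structure.
Variable R : realType.
Local Notation p := (psi R).
Implicit Types (f g h : frame R) (q : plane R) (r : R) (G : nat -> frame R).
Variables (d : R) (F : set (frame R)) (C : set (plane R)).
Hypotheses (AF : A2F d F C) (cvC : convexC C).
Local Notation L := (lev d F).

Lemma F_fr f : F f -> exists r, fr r f.
Proof. exact: (lev_fr (n := 0) AF cvC). Qed.

Lemma F_eq f g : F f -> F g -> ov f g -> f = g.
Proof. exact: (lev_eq (n := 0) AF cvC). Qed.

Lemma chain_of f : F f -> exists G, chain d F f G /\ inW G f.
Proof.
move=> Ff; have [r hf] := F_fr Ff.
have Df : D f f by rewrite /D (finvK hf) /hdir /germ /inq /= !lexpos0 lexposn0 ?oner_eq0 // ltr01 lexx psi_gt0 exprn_gt0 ?psi_gt0.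
have [G hG] := chain_ex AF cvC hf (D_inside (n := 0) AF cvC Ff hf Df).
by exists G; split=> //; exists 0%N; rewrite (flag_uniq (n := 0) AF cvC hf Ff (hG 0%N).1 Df (hG 0%N).2).
Qed.

Lemma inside_W r s h f G : fr r h -> chain d F h G -> fr s f -> inside (W G) f ->
  exists g, [/\ F g, inW G g & D g f].
Proof.
move=> hh hG hf hi; have [[d0 Fs Fd] _ _ _] := AF.
have LF' : locfam d [set g | F g /\ inW G g].
  by split=> // [g [/Fs]|g g' [? _] [? _]]; last exact: Fd.
have [|g [Fg gW] Dg] := fill LF' hf; last by exists g.
by apply: filterS hi => t /(W_desc AF cvC hG) [g [? ? ?]]; exists g.
Qed.

Lemma W_overlap r r' s h h' f G G' : fr r h -> chain d F h G -> fr r' h' -> chain d F h' G' -> fr s f ->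
  inside (W G) f -> inside (W G') f -> W G = W G'.
Proof.
move=> hh hG hh' hG' hf /(inside_W hh hG hf) [g [Fg gW Dg]] /(inside_W hh' hG' hf) [g' [Fg' gW' Dg']].
have [a ha] := F_fr Fg; have [b hb] := F_fr Fg'.
have e : g = g' by apply: F_eq => //; exact: D_ov ha hb hf Dg Dg'.
by rewrite -e in gW'; exact: (inW_W_eq AF cvC hh hh' hG hG' Fg gW gW').
Qed.

Lemma W_eq_inW r r' h h' G G' f : fr r h -> chain d F h G -> fr r' h' -> chain d F h' G' -> W G = W G' ->
  F f -> inW G f -> inW G' f.
Proof.
move=> hh hG hh' hG' e Ff fW; have [a ha] := F_fr Ff; have [q hq] := stile_nonempty ha.
apply: (W_stile AF cvC hG' Ff hq); rewrite -e; apply: (inW_tile fW); exact: stile_tile ha hq.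
Qed.

(** [S] is saturated: it contains every tile that shares a chain with one of its tiles. A tile
    outside [S] lies below the line, and so does the union of its chain. That union contains a
    quadrant and reaches arbitrarily low, so by convexity [C] is the plane, and the tiles outside
    [S] must cover the lower half. *)
Lemma half_union s f (S : set (frame R)) : fr s f -> S `<=` F ->
  (forall r h G g g', fr r h -> chain d F h G -> F g' -> inW G g -> inW G g' -> S g -> S g') ->
  hp f [set q | exists2 g, S g & tile g q] ->
  (S = F /\ hp f C) \/
  [/\ C = setT, exists g, F g /\ ~ S g & forall q, (exists2 g, F g /\ ~ S g & tile g (app f q)) <-> q.2 <= 0].
Proof.
move=> hf SF sat hS; have [eS|nS] := pselect (forall g, F g -> S g); [left|right].
  have E : S = F by apply/seteqP; split.
  by split=> // q; rewrite -hS E; have [_ _ _ cov] := AF; exact: cov.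
have [g [Fg Sg]] : exists g, F g /\ ~ S g.
  by move/existsNP: nS => [g /not_implyP [? ?]]; exists g.
have below g' q : F g' -> ~ S g' -> tile g' (app f q) -> q.2 <= 0.
  move=> Fg' Sg' hq; rewrite leNgt; apply/negP => q0; have [a ha] := F_fr Fg'.
  have oU : open [set z | 0 < (app (finv f) z).2].
    apply: (@open_comp _ _ (app (finv f)) [set z | 0 < z.2]); first by move=> ? _; exact: continuous_app.
    by apply: (@open_comp _ _ snd [set x : R | 0 < x]); [move=> ? _; exact: cvg_snd | exact: open_gt].
  have U0 : [set z | 0 < (app (finv f) z).2] (app f q).
    by have : 0 < (app (finv f) (app f q)).2 by rewrite (appVf _ hf).
  have [z [z0 hz]] := tile_regular ha oU U0 hq.
  have : [set q | exists2 g, S g & tile g q] (app f (app (finv f) z)) by apply/hS; rewrite ltW.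
  rewrite (appfV _ hf) => -[g2 Sg2 hz2]; have [b hb] := F_fr (SF _ Sg2).
  by apply: Sg'; rewrite -(F_eq (SF _ Sg2) Fg' (ov_tile hb hz2 hz)).
have [a ha] := F_fr Fg; have [G [hG gW]] := chain_of Fg.
have Wb q : W G (app f q) -> q.2 <= 0.
  move=> /(W_desc AF cvC hG) [g' [Fg' gW' hq]]; apply: below Fg' _ hq => Sg'.
  exact: Sg (sat _ _ _ _ _ ha hG Fg gW' gW Sg').
have Cq q : C (app f q).
  apply: (convexC_unbounded (convexC_app (f := f) cvC)) => [z /hS [g2 Sg2 hz]|M].
    by have [_ _ _ cov] := AF; apply/cov; exists g2 => //; exact: SF.
  suff [t [k [hk Wk]]] : exists t k, fr t k /\ forall q, 0 <= q.1 -> 0 <= q.2 -> W G (app k q).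
    by have [z Wz zM] := quad_unbounded M hf hk Wk Wb; exists z => //; exact: (W_sub AF cvC hG Wz).
  have [e|[t [k [hk [e|e]]]]] := W_region AF cvC ha hG.
  - by exists a, g; split=> // z _ _; rewrite e.
  - by exists t, k; split=> // z _ ?; apply/e.
  - by exists t, k; split=> // z ? ?; apply/e.
split; [|by exists g|].
  by apply/seteqP; split=> // q _; rewrite -(appfV q hf).
move=> q; split=> [[g' [Fg' Sg'] hq]|]; first exact: below hq.
have [LF _ _ cov] := AF.
have lt z : z.2 < 0 -> exists2 g, F g /\ ~ S g & tile g (app f z).
  move=> z0; have /cov [g' Fg' hg'] := Cq z; exists g' => //; split=> // Sg'.
  have : [set q | exists2 g, S g & tile g q] (app f z) by exists g'.
  by move/hS; rewrite leNgt z0.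
rewrite le_eqVlt => /orP[/eqP q0|]; last exact: lt.
(* Points of the line itself are limits of points just below it. *)
apply: (cover_closed LF) => [g' []//|e e0]; have [s0 _ _ _] := hf.
pose t := e / (2 * s); have t0 : 0 < t by apply: divr_gt0 => //; lra.
have tE : t * s = e / 2 by rewrite /t; field; rewrite gt_eqF.
exists (app f (q.1, - t)); have [_ _ h1 h2] := fr_le hf.
have B (v : R) : `|v| <= s -> `|v * t| < e.
  by move=> hv; rewrite normrM (gtr0_norm t0); have := ler_wpM2r (ltW t0) hv; lra.
split; last by apply: lt => /=; lra.
  by rewrite [X in `|X|](_ : _ = vx f * t); [apply: B | rewrite /app /= q0; ring].
by rewrite [X in `|X|](_ : _ = vy f * t); [apply: B | rewrite /app /= q0; ring].
Qed.

(* The flag along the second axis of a quadrant, on its outer side. *)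
Definition flagL : frame R := Frame 0 0 0 1 (-1) 0.

Lemma fr_flagL : fr 1 flagL. Proof. by split; rewrite /= ?ltr01 //; ring. Qed.

Lemma app_flagL f q : app (f ** flagL) (q.2, - q.1) = app f q.
Proof. by rewrite app_mul; case: q => x y; congr (app f _); congr pair; rewrite /=; ring. Qed.

Lemma app_swap f q : app (f ** swap R) q = app f (q.2, q.1).
Proof. by rewrite app_mul; congr (app f _); congr pair; rewrite /=; ring. Qed.

Lemma quad_swap f A : quad f A -> quad (f ** swap R) A.
Proof. by move=> h q; rewrite app_swap h /=; split=> -[]. Qed.

(** The segments from a point [q] beyond the side to points of the side cover the germ of the flag
    across it. *)
Lemma outside_flag s f G : fr s f -> quad f (W G) -> (forall q, W G q -> C q) -> ~ inside C (f ** flagL) ->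
  forall q, C (app f q) -> 0 <= q.1.
Proof.
move=> hf hW sub nin q Cq; rewrite leNgt; apply/negP => q0; apply: nin.
pose a : R := - q.1; pose b : R := q.2; pose e : R := a / (1 + a + `|b|).
have a0 : 0 < a by rewrite /a; lra.
have b0 := normr_ge0 b.
have e0 : 0 < e by apply: divr_gt0 => //; lra.
have eE : e * (1 + a + `|b|) = a by rewrite divfK // gt_eqF //; lra.
apply: filterS (near0_small e0) => t [t0 te].
have t1 : t * (1 + a + `|b|) < a by rewrite -[X in _ < X]eE ltr_pM2r //; lra.
have ta : 0 < t * a by apply: mulr_gt0.
have tb : 0 <= t * `|b| by apply: mulr_ge0; clear a0 e0 eE q0 t1 ta te; lra.
have tt : t < 1 by rewrite -(ltr_pM2r a0); lra.
have t2 : t ^+ 2 < t by rewrite expr2; nra.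
have t20 : 0 < t ^+ 2 by rewrite exprn_gt0.
pose l := t ^+ 2 / a.
have lE : l * a = t ^+ 2 by rewrite divfK // gt_eqF.
have l0 : 0 < l by apply: divr_gt0.
have l1 : l < 1 by rewrite ltr_pdivrMr //; clear a0 b0 e0 eE l0 lE q0 t0 t20 te tt; lra.
have lb : l * b <= t.
  rewrite /l mulrAC ler_pdivrMr // expr2 -mulrA ler_pM2l //.
  have := ler_norm b; have := ler_wpM2l (ltW t0) (ler_norm b); clear a0 b0 e0 eE l0 l1 lE q0 t0 tb te tt; lra.
(* Chosen so that the point of parameter [l] on the segment from [(0, y)] to [q] is
   [(- t ^+ 2, t)]. *)
pose y := (t - l * b) / (1 - l).
have yE : y * (1 - l) = t - l * b by rewrite divfK // gt_eqF //;
    clear a0 b0 e0 eE l0 lE lb q0 t0 t1 t2 t20 ta tb te tt; lra.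
have y0 : 0 <= y by apply: divr_ge0; clear a0 b0 e0 eE l0 lE q0 t0 t1 t2 t20 ta tb te tt yE; lra.
have Cy : C (app f (0, y)) by apply: sub; apply/hW; rewrite lexx.
have l01 : 0 <= l <= 1 by rewrite !ltW.
have K : C (app f (0 + l * (q.1 - 0), y + l * (q.2 - y))) := convexC_app (f := f) cvC Cy Cq l01.
have E1 : 0 + l * (q.1 - 0) = - t ^+ 2 by rewrite -lE /a; ring.
have E2 : y + l * (q.2 - y) = t by rewrite -/b; clear a0 b0 e0 eE l0 l01 l1 lE lb q0 t0 t1 t2 t20 ta tb te tt y0; lra.
rewrite E1 E2 in K; rewrite app_mul.
have -> // : app flagL (t, t ^+ 2) = (- t ^+ 2, t) by congr pair; rewrite /=; ring.
Qed.

Section Quadrants.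
Hypothesis NH : forall r s h f G, fr r h -> chain d F h G -> fr s f -> ~ hp f (W G).

(** The flag across the side stays on the boundary of its own chain: its mirror image lies in the
    given quadrant, so if it were entered the two unions would coincide. Since [NH] rules out
    half-planes, the new union is a quadrant with a side on the same line. *)
Lemma next_quadrant r s h f G : fr r h -> chain d F h G -> fr s f -> quad f (W G) -> inside C (f ** flagL) ->
  exists t k G', [/\ fr t k, chain d F k G' &
    (exists2 a, a <= 0 & forall q, W G' (app f q) <-> q.1 <= 0 /\ a <= q.2) \/
    (exists2 b, 0 < b & forall q, W G' (app f q) <-> q.1 <= 0 /\ q.2 <= b)].
Proof.
move=> hh hG hf hW hin; have hk : fr (s * 1) (f ** flagL) := fr_mul hf fr_flagL.
have [G' hG'] := chain_ex AF cvC hk hin; exists (s * 1), (f ** flagL), G'; split=> //.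
have hsw : fr (s * 1) (f ** swap R) := fr_mul hf (fr_swap R).
have nD n : ~~ D (G' n) (f ** flagL ** mirY R).
  apply/negP => Dn; have e : f ** flagL ** mirY R = f ** swap R.
    by rewrite -fmulA; congr (_ ** _); congr Frame; rewrite /=; ring.
  rewrite e in Dn; have [a ha] := lev_fr AF cvC (hG' n).1.
  have EW : W G = W G'.
    apply: (W_overlap hh hG hk hG' hsw); last first.
      by apply: filterS ((DtileP ha hsw).1 Dn) => t ht; exists n.
    apply: inside_lt => t /andP[t0 t1]; rewrite app_swap hW /=; split; last exact: ltW.
    by rewrite ltW // exprn_gt0.
  have [b hb] := lev_fr AF cvC (hG' 0%N).1.
  have [t [ht [t0 t1]]] := filter_ex (filterI ((DtileP hb hk).1 (hG' 0%N).2) (near0_small ltr01)).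
  have : W G (app (f ** flagL) (t, t ^+ 2)) by rewrite EW; exists 0%N.
  rewrite app_mul hW => -[h1 _]; move: h1; rewrite /app /=.
  have : 0 < t ^+ 2 by rewrite exprn_gt0.
  lra.
have E q : W G' (app f q) <-> W G' (app (f ** flagL) (q.2, - q.1)) by rewrite app_flagL.
case: (flag_region AF cvC hk hG' nD) => [k|[a a0 k]|[b b0 k]].
- by case: (NH hk hG' hk); move=> q; exact: k.
- by left; exists a => // q; rewrite E k /= oppr_ge0; split=> -[].
- by right; exists b => // q; rewrite E k /= oppr_ge0; split=> -[].
Qed.
End Quadrants.

(** Together the two quadrants are a half-plane, so [half_union] applies to the tiles of both
    chains. *)
Lemma two_classes r1 r2 h1 h2 G1 G2 s f : fr r1 h1 -> chain d F h1 G1 -> fr r2 h2 -> chain d F h2 G2 ->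
  fr s f -> quad f (W G1) -> (forall q, W G2 (app f q) <-> q.1 <= 0 /\ 0 <= q.2) ->
  (C = setT /\ exists S, [/\ S `<=` F, (exists g, S g), exists g, F g /\ ~ S g,
    hp f [set q | exists2 g, S g & tile g q] &
    forall q, (exists2 g, F g /\ ~ S g & tile g (app f q)) <-> q.2 <= 0]) \/
  (hp f C /\ forall g, F g -> inW G1 g \/ inW G2 g).
Proof.
move=> hh1 hG1 hh2 hG2 hf hW1 hW2.
pose S := [set g | F g /\ (inW G1 g \/ inW G2 g)].
have SF : S `<=` F by move=> g [].
have sat r h G g g' : fr r h -> chain d F h G -> F g' -> inW G g -> inW G g' -> S g -> S g'.
  move=> hh hG Fg' gW gW' [Fg gS]; split=> //.
  case: gS => gS; [left; have e := inW_W_eq AF cvC hh hh1 hG hG1 Fg gW gS |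
    right; have e := inW_W_eq AF cvC hh hh2 hG hG2 Fg gW gS].
    exact: (W_eq_inW hh hG hh1 hG1 e Fg' gW').
  exact: (W_eq_inW hh hG hh2 hG2 e Fg' gW').
have hS : hp f [set q | exists2 g, S g & tile g q].
  move=> q; split=> [[g [Fg [gW|gW]] hq]|q0].
  - by have /hW1 [] := inW_tile gW hq.
  - by have /hW2 [] := inW_tile gW hq.
  have [q1|/ltW q1] := leP 0 q.1.
    have /(W_desc AF cvC hG1) [g [Fg gW hq]] : W G1 (app f q) by apply/hW1.
    by exists g => //; split=> //; left.
  have /(W_desc AF cvC hG2) [g [Fg gW hq]] : W G2 (app f q) by apply/hW2.
  by exists g => //; split=> //; right.
have [[e hC]|[eC ex lo]] := half_union hf SF sat hS; [right | left].
  by split=> // g Fg; move: Fg; rewrite -{1}e => -[].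
split=> //; exists S; split=> //.
have /hS [g Sg _] : 0 <= ((0, 0) : plane R).2 by [].
by exists g.
Qed.

Definition one_class : Prop := exists r h G, [/\ fr r h, chain d F h G & forall f, F f -> inW G f].

Definition quad_pair s f : Prop := exists r1 r2 h1 h2 G1 G2,
  [/\ fr r1 h1 /\ chain d F h1 G1, fr r2 h2 /\ chain d F h2 G2, fr s f /\ hp f C,
   quad f (W G1) /\ (forall q, W G2 (app f q) <-> q.1 <= 0 /\ 0 <= q.2) &
   forall g, F g -> inW G1 g \/ inW G2 g].

Definition half_pair s f : Prop := exists S, [/\ fr s f /\ S `<=` F, (exists g, S g), exists g, F g /\ ~ S g,
    hp f [set q | exists2 g, S g & tile g q] &
    forall q, (exists2 g, F g /\ ~ S g & tile g (app f q)) <-> q.2 <= 0].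

Lemma one_classP r h G : fr r h -> chain d F h G -> (forall q, C q -> W G q) -> one_class /\ W G = C.
Proof.
move=> hh hG CW; split; last by apply/seteqP; split=> q; [exact: (W_sub AF cvC hG) | exact: CW].
exists r, h, G; split=> // f Ff; have [a ha] := F_fr Ff; have [q hq] := stile_nonempty ha.
apply: (W_stile AF cvC hG Ff hq); apply: CW; have [_ _ _ cov] := AF.
by apply/cov; exists f => //; exact: stile_tile ha hq.
Qed.

(** If some chain fills a half-plane, [half_union] decides. Otherwise the unions are quadrants or
    the plane, and across a side of a quadrant that is not on the boundary of [C] there is another
    quadrant. If no neighbour shares the apex and completes a half-plane, the neighbours across the
    two sides overlap near the apex and must coincide, which their shapes forbid. *)
Theorem structure : [\/ one_class /\ [\/ C = setT, exists s f, fr s f /\ hp f C | exists s f, fr s f /\ quad f C],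
  exists s f, quad_pair s f | C = setT /\ exists s f, half_pair s f].
Proof.
have [_ _ [f0 Ff0] _] := AF.
have [[r [s [h [f [G [hh hG hf hW]]]]]]|NH] := pselect (exists r s h f G,
    [/\ fr r h, chain d F h G, fr s f & hp f (W G)]).
  have sat r' h' G' g g' : fr r' h' -> chain d F h' G' -> F g' -> inW G' g -> inW G' g' ->
      F g /\ inW G g -> F g' /\ inW G g'.
    move=> hh' hG' Fg' gW gW' [Fg gS]; split=> //.
    by have e := inW_W_eq AF cvC hh' hh hG' hG Fg gW gS; exact: (W_eq_inW hh' hG' hh hG e Fg' gW').
  pose S := [set g | F g /\ inW G g].
  have hS : hp f [set q | exists2 g, S g & tile g q].
    move=> q; rewrite -(hW q); split=> [[g [Fg gW] hq]|/(W_desc AF cvC hG) [g [Fg gW hq]]].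
      exact: inW_tile gW hq.
    by exists g.
  have SF : S `<=` F by move=> g [].
  have [[e hC]|[eC ex lo]] := half_union hf SF sat hS.
    apply: Or31; split; last by apply: Or32; exists s, f.
    by exists r, h, G; split=> // g; rewrite -{1}e => -[].
  apply: Or33; split=> //; exists s, f, S; split=> //.
  have /hS [g Sg _] : 0 <= ((0, 0) : plane R).2 by [].
  by exists g.
have {}NH r s h f G : fr r h -> chain d F h G -> fr s f -> ~ hp f (W G).
  by move=> hh hG hf hW; apply: NH; exists r, s, h, f, G.
have [a hf0] := F_fr Ff0; have [G [hG _]] := chain_of Ff0.
have [e|[s [f [hf [hW|hW]]]]] := W_region AF cvC hf0 hG; last first.
- have WC q : W G q -> C q by exact: (W_sub AF cvC hG).
  have hsw : fr (s * 1) (f ** swap R) := fr_mul hf (fr_swap R).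
  have hW' := quad_swap hW.
  have LC := outside_flag hf hW WC; have BC := outside_flag hsw hW' WC.
  have fin t k G' s' f' : fr t k -> chain d F k G' -> fr s' f' -> quad f' (W G) ->
      (forall q, W G' (app f' q) <-> q.1 <= 0 /\ 0 <= q.2) ->
      [\/ one_class /\ [\/ C = setT, exists s f, fr s f /\ hp f C | exists s f, fr s f /\ quad f C],
        exists s f, quad_pair s f | C = setT /\ exists s f, half_pair s f].
    move=> hk hG' hf' hWf hW2.
    have [[eC [S [? ? ? ? ?]]]|[hC all]] := two_classes hf0 hG hk hG' hf' hWf hW2.
      by apply: Or33; split=> //; exists s', f', S.
    by apply: Or32; exists s', f', a, t, f0, k, G, G'.
  have zero z : z <= 0 -> ~ z < 0 -> z = 0 :> R.
    by rewrite le_eqVlt => /orP[/eqP //|].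
  have [iL|nL] := pselect (inside C (f ** flagL)); have [iB|nB] := pselect (inside C (f ** swap R ** flagL)).
  + have [w2 [m2 [G2 [hk2 hG2 q2]]]] := next_quadrant NH hf0 hG hf hW iL.
    have [w3 [m3 [G3 [hk3 hG3 q3]]]] := next_quadrant NH hf0 hG hsw hW' iB.
    have sw3 q : W G3 (app f q) <-> W G3 (app (f ** swap R) (q.2, q.1)) by rewrite app_swap; case: q.
    (* A common germ in the opposite right angle at the apex makes the two neighbours equal, but
       only the second one has points with positive first coordinate. *)
    have two k : 0 < k -> (forall t : R, 0 < t -> t < 1 -> W G2 (app f (- (k * t), - (k * t ^+ 2)))) ->
        (forall t : R, 0 < t -> t < 1 -> W G3 (app f (- (k * t), - (k * t ^+ 2)))) -> False.
      move=> k0 h2 h3; pose m : frame R := Frame 0 0 (- k) 0 0 (- k).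
      have hm : fr (s * k) (f ** m) by apply: fr_mul => //; split; rewrite /= //; ring.
      have Em t : app (f ** m) (t, t ^+ 2) = app f (- (k * t), - (k * t ^+ 2)).
        by rewrite app_mul; congr (app f _); congr pair; rewrite /=; ring.
      have e : W G2 = W G3.
        by apply: (W_overlap hk2 hG2 hk3 hG3 hm); apply: inside_lt => t /andP[t0 t1]; rewrite Em; [exact: h2 | exact: h3].
      have [x x0 hx] : exists2 x : R, 0 < x & W G3 (app f (x, - 1)).
        case: q3 => [[c c0 k3]|[c c0 k3]]; [exists 1 | exists c] => //; apply/sw3/k3; rewrite /= ?oppr_le0 ?ler01 //.
        by split=> //; lra.
      by move: hx; rewrite -e; case: q2 => [[c c0 k2]|[c c0 k2]] /k2 [/= h _]; move: x0; rewrite ltNge h.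
    have sq (k t : R) : 0 < k -> 0 < t -> t < 1 -> [/\ 0 < k * t, k * t < k, 0 < k * t ^+ 2 & k * t ^+ 2 < k].
      move=> k0 t0 t1; have t2 : 0 < t ^+ 2 by rewrite exprn_gt0.
      have t3 : t ^+ 2 < 1 by rewrite expr_lt1 // ltW.
      by split; rewrite ?mulr_gt0 // gtr_pMr.
    case: q2 two => [[c c0 k2]|[c c0 k2]] two; case: q3 sw3 two => [[c' c0' k3]|[c' c0' k3]] sw3 two.
    * have [cn|] := pselect (c < 0); last by move=> /(zero _ c0) ez; rewrite ez in k2; exact: fin hk2 hG2 hf hW k2.
      have [cn'|] := pselect (c' < 0); last by move=> /(zero _ c0') ez; rewrite ez in k3; exact: fin hk3 hG3 hsw hW' k3.
      case: (two (Num.min (- c) (- c'))); first by rewrite lt_min; lra.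
        move=> t t0 t1; have [|e1 e2 e3 e4] := sq (Num.min (- c) (- c')) t _ t0 t1; first by rewrite lt_min; lra.
        have m1 : Num.min (- c) (- c') <= - c by rewrite ge_min lexx.
        by apply/k2; rewrite /=; clear c0 c0' e2 e3 k2 k3 sw3 t0 t1; lra.
      move=> t t0 t1; have [|e1 e2 e3 e4] := sq (Num.min (- c) (- c')) t _ t0 t1; first by rewrite lt_min; lra.
      have m1 : Num.min (- c) (- c') <= - c' by rewrite ge_min lexx orbT.
      by apply/sw3/k3; rewrite /=; clear c0 c0' e1 e4 k2 k3 sw3 t0 t1; lra.
    * have [cn|] := pselect (c < 0); last by move=> /(zero _ c0) ez; rewrite ez in k2; exact: fin hk2 hG2 hf hW k2.
      case: (two (- c)); first lra.
        move=> t t0 t1; have [|e1 e2 e3 e4] := sq (- c) t _ t0 t1; first lra.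
        by apply/k2; rewrite /=; lra.
      move=> t t0 t1; have [|e1 e2 e3 e4] := sq (- c) t _ t0 t1; first lra.
      by apply/sw3/k3; rewrite /=; clear c0 e2 e4 k2 k3 sw3 t0 t1; lra.
    * have [cn|] := pselect (c' < 0); last by move=> /(zero _ c0') ez; rewrite ez in k3; exact: fin hk3 hG3 hsw hW' k3.
      case: (two (- c')); first lra.
        move=> t t0 t1; have [|e1 e2 e3 e4] := sq (- c') t _ t0 t1; first lra.
        by apply/k2; rewrite /=; lra.
      move=> t t0 t1; have [|e1 e2 e3 e4] := sq (- c') t _ t0 t1; first lra.
      by apply/sw3/k3; rewrite /=; lra.
    * case: (two 1) => // t t0 t1; have [|e1 e2 e3 e4] := sq 1 t _ t0 t1 => //.
        by apply/k2; rewrite /=; lra.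
      by apply/sw3/k3; rewrite /=; lra.
  + have [w2 [m2 [G2 [hk2 hG2 q2]]]] := next_quadrant NH hf0 hG hf hW iL.
    have up q : C (app f q) -> 0 <= q.2.
      by have := BC nB (q.2, q.1); rewrite app_swap; case: q.
    have up2 q : W G2 (app f q) -> 0 <= q.2 by move=> h; apply: up; exact: (W_sub AF cvC hG2 h).
    case: q2 => [[c c0 k3]|[c c0 k3]].
      have ez : c = 0.
        by apply/le_anti; rewrite c0 /=; apply: (up2 (0, c)); apply/k3.
      by rewrite ez in k3; exact: fin hk2 hG2 hf hW k3.
    have /up2 /= : W G2 (app f (0, -1)) by apply/k3; split=> //=; lra.
    by rewrite oppr_ge0 ler10.
  + have [w2 [m2 [G2 [hk2 hG2 q2]]]] := next_quadrant NH hf0 hG hsw hW' iB.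
    have up2 q : W G2 (app (f ** swap R) q) -> 0 <= q.2.
      by rewrite app_swap => h; apply: (LC nL (q.2, q.1)); exact: (W_sub AF cvC hG2 h).
    case: q2 => [[c c0 k3]|[c c0 k3]].
      have ez : c = 0.
        by apply/le_anti; rewrite c0 /=; apply: (up2 (0, c)); apply/k3.
      by rewrite ez in k3; exact: fin hk2 hG2 hsw hW' k3.
    have /up2 /= : W G2 (app (f ** swap R) (0, -1)) by apply/k3; split=> //=; lra.
    by rewrite oppr_ge0 ler10.
  + apply: Or31; have [|oc e] := one_classP hf0 hG.
      move=> q; rewrite -(appfV q hf) => Cq; apply/hW; split; first exact: LC nL _ Cq.
      by have := BC nB ((app (finv f) q).2, (app (finv f) q).1); rewrite app_swap; apply; case: (app _ _) Cq.
    by split=> //; apply: Or33; exists s, f; split=> //; rewrite -e.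
- by case: (NH _ _ _ _ _ hf0 hG hf hW).
- apply: Or31; have [|oc eW] := one_classP hf0 hG; first by move=> q _; rewrite e.
  by split=> //; apply: Or31; rewrite -eW.
Qed.
End Structure.

(** * The automaton of arrows is determined by its colours *)

Section States.
Variable R : realType.
Local Notation p := (psi R).
Local Notation darrow := (darrow R).
Local Notation arrows := (arrows R).

(* The kind of a tile ([true] for large) and the index of the arrow along which a flag runs. *)
Definition state := (bool * nat)%type.
Definition okst (s : state) : bool := (s.2 < if s.1 then 10 else 8)%N.
Definition colour (s : state) : nat :=
  nth 0%N (if s.1 then [:: 4; 4; 6; 5; 3; 6; 4; 5; 4; 3] else [:: 5; 3; 6; 4; 3; 6; 5; 4])%N s.2.
Definition ostate (l : bool) (o : option nat) : seq state := if o is Some j then [:: (l, j)] else [::].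
(** For a large tile both ways to climb are listed, since the colours alone are to decide between
    them. *)
Definition trans (s : state) : seq state :=
  if s.1 then ostate true (nsig s.2) ++ ostate false (nsame s.2) else ostate true (ndel s.2).

Fixpoint agree (n : nat) (s t : state) : bool := (colour s == colour t) &&
  (if n is m.+1 then has (fun s' => has (agree m s') (trans t)) (trans s) else true).

(** Checked by computation over all pairs of states: eight further steps suffice to tell different
    states apart by colour. This is what lets the colours along a line determine the tiles on both
    sides. *)
Lemma agree_eq s t : okst s -> okst t -> agree 8 s t -> s = t.
Proof.
pose all := [seq (true, i) | i <- iota 0 10] ++ [seq (false, i) | i <- iota 0 8].
have inall u : okst u -> u \in all.
  case: u => -[] i hi; rewrite mem_cat; apply/orP; [left | right];
    by apply/mapP; exists i => //; rewrite mem_iota.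
have : allrel (fun s t => agree 8 s t ==> (s == t)) all all by vm_compute.
by move=> /allrelP k /inall hs /inall ht hA; apply/eqP; move: (k _ _ hs ht); rewrite hA.
Qed.

Lemma agree_seq (st tt : nat -> state) : (forall n, colour (st n) = colour (tt n)) ->
  (forall n, st n.+1 \in trans (st n)) -> (forall n, tt n.+1 \in trans (tt n)) ->
  forall m n, agree m (st n) (tt n).
Proof.
move=> hc hs ht; elim=> [|m IH] n; rewrite /= hc eqxx //=.
by apply/hasP; exists (st n.+1) => //; apply/hasP; exists (tt n.+1).
Qed.

Lemma colourE l i : (i < size (arrows l))%N -> (nth darrow (arrows l) i).2 = colour (l, i).
Proof. by case: l; do 10?[case: i => [|i]]. Qed.
End States.

(** * The state sequence of a boundary flag *)

Section ChainStates.
Variable R : realType.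
Local Notation p := (psi R).
Local Notation darrow := (darrow R).
Local Notation arrows := (arrows R).
Implicit Types (f g h : frame R) (q : plane R) (r : R) (G : nat -> frame R).
Variables (d : R) (F : set (frame R)) (C : set (plane R)).
Hypotheses (AF : A2F d F C) (cvC : convexC C).

Definition on_state n g h (s : state) : Prop :=
  fr (tsize s.1 (d / p ^+ n)) g /\ onarrow s.1 s.2 (finv g ** h).

Lemma chain_states r h G : fr r h -> chain d F h G -> (forall n, ~~ D (G n) (h ** mirY R)) ->
  exists st : nat -> state, forall n, on_state n (G n) h (st n) /\ st n.+1 \in trans (st n).
Proof.
move=> hh hG nD.
have Hb n : bdry (finv (G n) ** h) by split; [exact: (hG n).2 | rewrite -fmulA; exact: nD].
have step n s : exists s', on_state n (G n) h s -> on_state n.+1 (G n.+1) h s' /\ s' \in trans s.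
  have [hs|ns] := pselect (on_state n (G n) h s); last by exists s.
  have [h1 h2] := hs; have [l [k [_ hl ok e]]] := chain_kid AF cvC hh hG n.
  have ek : s.1 = klarge k.
    have hk := fr_kid (d := d / p ^+ n) _ ok; rewrite -dpS in hk; have {}hk := hk _ hl.
    by rewrite -e in hk; exact: tsize_inj (lev_pos AF cvC n) h1 hk.
  have E : finv (G n.+1) ** h = kfr R k ** (finv (G n) ** h) by exact: finv_step h1 hl e.
  rewrite ek in h2; have nb : ~~ hdir (kfr R k ** (finv (G n) ** h) ** mirY R) by rewrite -E; have [] := Hb n.+1.
  have [j ej oj] := onarrow_next (fr_mul (fr_inv h1) hh) ok h2 nb.
  exists (l, j) => _; split; first by split=> //=; rewrite E.
  clear h2 nb; rewrite /trans ek; case: k ok ej {e ek E oj} => /=; case: l {hl} => //= _ -> /=; rewrite ?inE ?mem_cat ?inE ?eqxx ?orbT //.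
have [nx hnx] : exists nx : nat -> state -> state, forall n s, on_state n (G n) h s ->
    on_state n.+1 (G n.+1) h (nx n s) /\ nx n s \in trans s.
  have [nx hnx] := choice (fun ns : nat * state => step ns.1 ns.2).
  by exists (fun n s => nx (n, s)) => n s; exact: (hnx (n, s)).
have [s0 hs0] : exists s, on_state 0 (G 0%N) h s.
  have [l hl] := lev_size AF cvC (hG 0%N).1; have [i hi] := onarrow_ex l (fr_mul (fr_inv hl) hh) (Hb 0%N).
  by exists (l, i).
pose st := fix st n := if n is m.+1 then nx m (st m) else s0.
have ok n : on_state n (G n) h (st n) by elim: n => //= n IH; exact: (hnx _ _ IH).1.
by exists st => n; split=> //; exact: (hnx _ _ (ok n)).2.
Qed.

Lemma segment_ptx f x y t : between x y -> (x <= t <= y) || (y <= t <= x) ->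
  segment (app f (ptx x)) (app f (ptx y)) (app f (ptx t)).
Proof.
move=> hb ht; apply: segment_app; have n0 : y - x != 0.
  by rewrite subr_eq0; apply/eqP => e; move: hb; rewrite e /between; lra.
exists ((t - x) / (y - x)); last first.
  by rewrite /ptx; congr pair; rewrite /= /GRing.scale /=; [field | ring].
have : x < y \/ y < x by case: (ltgtP x y) n0 => //; [left | right | move=> ->; rewrite subrr eqxx].
case=> xy.
  by rewrite divr_ge0 ?ler_pdivrMr; move: hb ht; rewrite /between; lra.
by rewrite -mulrNN -invrN !opprB divr_ge0 ?ler_pdivrMr; move: hb ht; rewrite /between; lra.
Qed.

(** Both tiles have an arrow that covers the axis just after the base point of the flag, so the two
    arrows overlap. *)
Lemma common_arrow n g g' h r s t : arrF (d / p ^+ n) (lev d F n) -> lev d F n g -> lev d F n g' -> g <> g' ->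
  fr r h -> on_state n g h s -> on_state n g' (h ** mirY R) t ->
  map_arrow (app g) (nth darrow (arrows s.1) s.2) = map_arrow (app g') (nth darrow (arrows t.1) t.2).
Proof.
move=> HA Lg Lg' gg hh [h1 [i1 [x [y [b1 e1 e2]]]]] [h2 [i2 [x' [y' [b2 e1' e2']]]]].
apply: (HA _ _ _ _ Lg Lg' gg (farr_nth h1 i1) (farr_nth h2 i2)).
have my z : app (mirY R) (ptx z) = ptx z by rewrite /ptx; congr pair; rewrite /=; ring.
have E1 : arrow_segment (map_arrow (app g) (nth darrow (arrows s.1) s.2)) = segment (app h (ptx x)) (app h (ptx y)).
  by rewrite /arrow_segment /= e1 e2 !app_mul !(appfV _ h1).
have E2 : arrow_segment (map_arrow (app g') (nth darrow (arrows t.1) t.2)) = segment (app h (ptx x')) (app h (ptx y')).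
  by rewrite /arrow_segment /= e1' e2' !app_mul !(appfV _ h2) !my.
(* The nearer of the forward ends of the two arrows. *)
pose m := Num.min (Num.max x y) (Num.max x' y').
have m0 : 0 < m by rewrite lt_min !lt_max; move: b1 b2; rewrite /between; clear; lra.
exists (app h (ptx 0)), (app h (ptx m)); rewrite E1 E2; split.
  by move=> /(app_inj hh) [e]; rewrite -e ltxx in m0.
have k1 : m <= Num.max x y by rewrite ge_min lexx.
have k2 : m <= Num.max x' y' by rewrite ge_min lexx orbT.
have k1' : (m <= x) || (m <= y) by rewrite le_max in k1.
have k2' : (m <= x') || (m <= y') by rewrite le_max in k2.
clear -b1 b2 k1' k2' m0; rewrite /between in b1 b2.
by split; split; apply: segment_ptx => //; lra.
Qed.

End ChainStates.

(** * Two tilings on the two sides of a line *)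

Section Mirror.
Variable R : realType.
Local Notation p := (psi R).
Local Notation darrow := (darrow R).
Local Notation arrows := (arrows R).
Implicit Types (f g h : frame R) (q : plane R) (r : R) (G : nat -> frame R).

(** Agreement at two points of the axis leaves only [h' = h ** mirY R] as an alternative, and that
    flag does not enter the bee. *)
Lemma flag_same r r' h h' (x y : R) : fr r h -> fr r' h' -> bdry h -> hdir h' -> x != y ->
  app h (ptx x) = app h' (ptx x) -> app h (ptx y) = app h' (ptx y) -> h = h'.
Proof.
move=> hh hh' [h1 h2] h3 xy [e1 e2] [e3 e4].
have n0 : x - y != 0 by rewrite subr_eq0.
have eu : ux h = ux h' by apply: (mulIf n0); lra.
have ev : uy h = uy h' by apply: (mulIf n0); lra.
have ex : ox h = ox h' by rewrite eu in e1; lra.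
have ey : oy h = oy h' by rewrite ev in e2; lra.
clear e1 e2 e3 e4 xy n0; case: (fr_orient hh) => -[k1 k2]; case: (fr_orient hh') => -[k1' k2'].
- by move: ex ey eu ev k1 k2 k1' k2'; clear; case: h h' => a b c e f g [a' b' c' e' f' g'] /= -> -> -> -> -> -> -> ->.
- move: h3 h2; have -> : h' = h ** mirY R; last by move=> ->.
  move: ex ey eu ev k1 k2 k1' k2'; clear; case: h h' => a b c e f g [a' b' c' e' f' g'] /= -> -> -> -> -> -> -> ->.
  by congr Frame; rewrite /=; ring.
- move: h3 h2; have -> : h' = h ** mirY R; last by move=> ->.
  move: ex ey eu ev k1 k2 k1' k2'; clear; case: h h' => a b c e f g [a' b' c' e' f' g'] /= -> -> -> -> -> -> -> ->.
  by congr Frame; rewrite /=; ring.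
- by move: ex ey eu ev k1 k2 k1' k2'; clear; case: h h' => a b c e f g [a' b' c' e' f' g'] /= -> -> -> -> -> -> -> ->.
Qed.

(** Three vertices of the cut between son and daughter would lie on the line, but they are not
    collinear. *)
Lemma not_separated r s f g : fr s f -> fr r g -> (forall q, tile (g ** sig R) (app f q) -> 0 <= q.2) ->
  (forall q, tile (g ** del R) (app f q) -> q.2 <= 0) -> False.
Proof.
have [/andP[a1 a2] /andP[b1 b2] /andP[c1 c2] e4] := psi_bounds R.
have e5 : p ^+ 5 = p - p ^+ 3 by ring: e4.
move=> hf hg up dn; pose m := finv f ** g.
have hm : fr (s^-1 * r) m := fr_mul (fr_inv hf) hg.
have E q : app g q = app f (app m q) by rewrite app_mul (appfV _ hf).
have z q : bee_son q -> bee_daughter q -> (app m q).2 = 0.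
  rewrite -son_tile -daughter_tile in up dn * => h1 h2; apply/le_anti/andP; split.
    by apply: dn; exists q.
  by apply: up; exists q.
have z0 := z (0, p ^+ 4); have z1 := z (p ^+ 5, p ^+ 4); have z2 := z (p ^+ 5, p ^+ 2).
have [_ n0] := fr_neq0 hm.
move: m {hm E z} n0 z0 z1 z2 => m n0; rewrite /bee_son /bee_daughter /rect /setU /= e4 e5 => z0 z1 z2.
have {}z0 := z0 ltac:(clear -a1 a2 b1 b2 c1 c2; lra) ltac:(clear -a1 a2 b1 b2 c1 c2; lra).
have {}z1 := z1 ltac:(clear -a1 a2 b1 b2 c1 c2; lra) ltac:(clear -a1 a2 b1 b2 c1 c2; lra).
have {}z2 := z2 ltac:(clear -a1 a2 b1 b2 c1 c2; lra) ltac:(clear -a1 a2 b1 b2 c1 c2; lra).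
have u0 : uy m = 0.
  have n : p - p ^+ 3 != 0 by rewrite gt_eqF //; lra.
  by apply: (mulIf n); lra.
have v0 : vy m = 0.
  have n : (1 - p ^+ 2) - p ^+ 2 != 0 by rewrite lt_eqF //; lra.
  by apply: (mulIf n); lra.
by rewrite u0 v0 eqxx in n0.
Qed.

Definition separated s f (C1 C2 : set (plane R)) : Prop :=
  [/\ fr s f, forall q, C1 (app f q) -> 0 <= q.2 & forall q, C2 (app f q) -> q.2 <= 0].

Lemma app_mirY f q : app (f ** mirY R) q = app f (q.1, - q.2).
Proof. by rewrite app_mul; congr (app f _); congr pair; rewrite /=; ring. Qed.

Lemma separated_sym s f C1 C2 : separated s f C1 C2 -> separated (s * 1) (f ** mirY R) C2 C1.
Proof.
move=> [hf h1 h2]; split=> [|q|q]; first exact: fr_mul hf (fr_mirY R).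
  by rewrite app_mirY => /h2; rewrite /= oppr_le0.
by rewrite app_mirY => /h1; rewrite /= oppr_ge0.
Qed.

(** The point is that a large tile of [F1] that persists as a small one still persists in the union:
    a matching daughter from [F2] would lie across the line from its brother. *)
Lemma separated_compose d F1 F2 C1 C2 s f : A2F d F1 C1 -> A2F d F2 C2 -> separated s f C1 C2 ->
  compose d F1 `<=` compose d (F1 `|` F2).
Proof.
move=> AF1 AF2 sep g [l [hg kids nsib]]; exists l; split=> //; first by move=> k ok; left; exact: kids.
move=> el; move=> [h|h]; first exact: nsib h.
have [hf h1 h2] := sep; have [LF1 _ _ cov1] := AF1; have [_ _ _ cov2] := AF2.
have hg' : fr (tsize l (d / p) * p^-1) (g ** finv (sig R)) := fr_mul hg (fr_inv (fr_sig R)).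
apply: (not_separated hf hg') => q hq.
  apply: h1; apply/cov1; exists g; last by move: hq; rewrite -fmulA (finvK (fr_sig R)) fmulf1.
  by have := kids Ksame; rewrite el /= fmulf1; apply.
by apply: h2; apply/cov2; exists (g ** (finv (sig R) ** del R)) => //; rewrite fmulA.
Qed.

Lemma compose_union d F1 F2 C C1 C2 s f : A2F d (F1 `|` F2) C -> convexC C -> A2F d F1 C1 -> convexC C1 ->
  A2F d F2 C2 -> convexC C2 -> separated s f C1 C2 ->
  compose d (F1 `|` F2) = compose d F1 `|` compose d F2.
Proof.
move=> AF cvC AF1 cv1 AF2 cv2 sep.
have S1 := separated_compose AF1 AF2 sep.
have S2 := separated_compose AF2 AF1 (separated_sym sep); rewrite setUC in S2.
apply/seteqP; split=> [g cg|g []]; [|exact: S1|exact: S2].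
have [[_ gs gd] _ _ cov] := compose_A2F AF cvC.
have [a ha] : exists a, fr a g by case: (gs _ cg) => h; [exists (d / p) | exists (p * (d / p))].
have [q hq] := stile_nonempty ha; have [_ _ _ covF] := AF.
have : C q by apply/cov; exists g => //; exact: stile_tile ha hq.
move=> /covF [g1 [h|h] hq1].
  have [[_ gs1 _] _ _ cov1] := compose_A2F AF1 cv1.
  have /cov1 [g2 cg2 hq2] : C1 q by have [_ _ _ c1] := AF1; apply/c1; exists g1.
  have [b hb] : exists a, fr a g2 by case: (gs1 _ cg2) => hb; [exists (d / p) | exists (p * (d / p))].
  by left; rewrite -(gd _ _ (S1 _ cg2) cg (ov_tile hb hq2 hq)).
have [[_ gs1 _] _ _ cov1] := compose_A2F AF2 cv2.
have /cov1 [g2 cg2 hq2] : C2 q by have [_ _ _ c1] := AF2; apply/c1; exists g1.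
have [b hb] : exists a, fr a g2 by case: (gs1 _ cg2) => hb; [exists (d / p) | exists (p * (d / p))].
by right; rewrite -(gd _ _ (S2 _ cg2) cg (ov_tile hb hq2 hq)).
Qed.

Section Pair.
Variables (d : R) (F1 F2 : set (frame R)) (C C1 C2 : set (plane R)) (s0 : R) (f0 : frame R).
Hypotheses (AF : A2F d (F1 `|` F2) C) (cvC : convexC C) (AF1 : A2F d F1 C1) (cv1 : convexC C1)
  (AF2 : A2F d F2 C2) (cv2 : convexC C2) (sep : separated s0 f0 C1 C2).

Lemma lev_union n : lev d (F1 `|` F2) n = lev d F1 n `|` lev d F2 n.
Proof.
elim: n => // n IH; rewrite /= -/(lev d (F1 `|` F2) n) IH.
apply: (compose_union (C := C) (C1 := C1) (C2 := C2) (s := s0) (f := f0)) => //.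
- by rewrite -IH; exact: lev_A2F AF cvC n.
- exact: lev_A2F AF1 cv1 n.
- exact: lev_A2F AF2 cv2 n.
Qed.

Lemma lev_disj n g : lev d F1 n g -> lev d F2 n g -> False.
Proof.
move=> L1 L2; have [r hr] := lev_fr AF1 cv1 L1; have [hf h1 h2] := sep.
apply: (not_separated hf hr) => q hq.
  apply: h1; apply/(lev_cover AF1 cv1 n); exists g => //.
  by apply/(tile_split _ hr); left.
apply: h2; apply/(lev_cover AF2 cv2 n); exists g => //.
by apply/(tile_split _ hr); right.
Qed.

(** On every level the two tiles share an arrow on the line, so both state sequences have the same
    colours and are equal by [agree_eq]. Tiles of the same kind with the same arrow in the same
    place, one on each side, are mirror images. *)
Lemma mirror_chain r h G G' : fr r h -> chain d F1 h G -> chain d F2 (h ** mirY R) G' ->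
  (forall n, ~~ D (G n) (h ** mirY R)) -> (forall n, ~~ D (G' n) h) ->
  forall n, G' n = h ** mirY R ** finv h ** G n.
Proof.
move=> hh hG hG' nD nD'; have hm : fr (r * 1) (h ** mirY R) := fr_mul hh (fr_mirY R).
have mm : h ** mirY R ** mirY R = h.
  by rewrite -fmulA -[RHS]fmulf1; congr (h ** _); congr Frame; rewrite /=; ring.
have [st hst] := chain_states AF1 cv1 hh hG nD.
have [|tt htt] := chain_states AF2 cv2 hm hG'; first by move=> n; rewrite mm.
have key n : map_arrow (app (G n)) (nth darrow (arrows (st n).1) (st n).2) =
    map_arrow (app (G' n)) (nth darrow (arrows (tt n).1) (tt n).2).
  have [_ HA _ _] := lev_A2F AF cvC n.
  apply: (common_arrow HA _ _ _ hh (hst n).1 (htt n).1).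
  - by rewrite lev_union; left; exact: (hG n).1.
  - by rewrite lev_union; right; exact: (hG' n).1.
  - by move=> e; apply: (lev_disj (hG n).1); rewrite e; exact: (hG' n).1.
have col n : colour (st n) = colour (tt n).
  have := congr1 snd (key n); rewrite /=.
  have [[_ [i1 _]] _] := hst n; have [[_ [i2 _]] _] := htt n.
  by rewrite !(colourE (R := R)) // -!surjective_pairing.
have E n : st n = tt n.
  have [[_ [i1 _]] _] := hst n; have [[_ [i2 _]] _] := htt n.
  apply: agree_eq; [by move: i1; clear; rewrite /okst; case: (st n) => -[] | by move: i2; clear; rewrite /okst; case: (tt n) => -[] |].
  by apply: agree_seq => // k; [have [] := hst k | have [] := htt k].
move=> n; have := key n; rewrite -E; have [[h1 [_ [x [y [b1 e1 e2]]]]] _] := hst n.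
have [[h2 [_ [x' [y' [b2 e1' e2']]]]] _] := htt n; rewrite -E in h2 e1' e2'.
move: (nth _ _ _) e1 e2 e1' e2' => -[[P Q] c] e1 e2 e1' e2' K.
have k1 : app (G n) P = app (G' n) P := congr1 (fun a : arrow R => a.1.1) K.
have k2 : app (G n) Q = app (G' n) Q := congr1 (fun a : arrow R => a.1.2) K.
change (P = app (finv (G n) ** h) (ptx x)) in e1; change (Q = app (finv (G n) ** h) (ptx y)) in e2.
change (P = app (finv (G' n) ** (h ** mirY R)) (ptx x')) in e1'.
change (Q = app (finv (G' n) ** (h ** mirY R)) (ptx y')) in e2'.
have my z : app (mirY R) (ptx z) = ptx z by rewrite /ptx; congr pair; rewrite /=; ring.
rewrite [in X in X = _]e1 [in X in _ = X]e1' !app_mul (appfV _ h1) (appfV _ h2) my in k1.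
rewrite [in X in X = _]e2 [in X in _ = X]e2' !app_mul (appfV _ h1) (appfV _ h2) my in k2.
have [ex] := app_inj hh k1; have [ey] := app_inj hh k2.
have H : finv (G n) ** h = finv (G' n) ** (h ** mirY R).
  apply: (flag_same (x := x) (y := y) (fr_mul (fr_inv h1) hh) (fr_mul (fr_inv h2) hm)).
  - by split; [exact: (hG n).2 | rewrite -fmulA; exact: nD].
  - exact: (hG' n).2.
  - by apply/eqP => e; move: b1; rewrite /between e; lra.
  - by rewrite -e1 e1' ex.
  - by rewrite -e2 e2' ey.
apply: (fmulIf (fr_mul (fr_inv h1) hh)); transitivity (h ** mirY R).
  by rewrite H (fmulfV _ h2).
by rewrite -(fmulA _ (G n)) (fmulfV _ h1) -(fmulA _ (finv h)) (finvK hh) fmulf1.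
Qed.

(** A coarse tile determines its descendants, so an isometry that carries it into the other family
    carries them along. *)
Lemma lev_transfer t m n f g : fr t m -> t = 1 -> F1 f -> lev d F1 n g -> part f g -> lev d F2 n (m ** g) -> F2 (m ** f).
Proof.
move=> hm t1 Ff; have [r hr] := lev_fr (n := 0) AF1 cv1 Ff.
elim: n g => [|n IH] g Lg fg Lm.
  by rewrite (part_uniq (n := 0) AF1 cv1 hr Ff Lg).
have [g1 L1 fg1] := anc_ex AF1 cv1 n Ff.
have [g2 hg2] := lev_parent AF1 cv1 L1; have [l [k [L2 h2 ok e]]] := hg2.
have eg : g2 = g.
  by apply: (part_uniq AF1 cv1 hr L2 Lg _ fg); exact: part_trans fg1 (kid_at_part hg2).
apply: (IH g1 L1 fg1); rewrite e eg fmulA; apply: (lev_kid AF2 cv2 Lm _ ok).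
by rewrite -eg -[X in fr X _]mul1r -t1; exact: fr_mul.
Qed.
End Pair.
End Mirror.

(** * From mirrored chains to mirrored tilings *)

Section MirrorFamilies.
Variable R : realType.
Local Notation p := (psi R).
Implicit Types (f g h : frame R) (q z : plane R) (r : R) (G : nat -> frame R) (A : set (plane R)).

(** The reflection in the first axis of [f]. *)
Definition axial f : frame R := f ** mirY R ** finv f.

Lemma fr_axial r f : fr r f -> fr 1 (axial f).
Proof.
move=> hf; have [r0 _ _ _] := hf; have := fr_mul (fr_mul hf (fr_mirY R)) (fr_inv hf).
by rewrite mulr1 divff // gt_eqF.
Qed.

Lemma axialK r f : fr r f -> axial f ** axial f = fone R.
Proof.
move=> hf; rewrite /axial !fmulA -(fmulA _ (finv f) f) (finvK hf) fmulf1 -(fmulA f) .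
have -> : mirY R ** mirY R = fone R by congr Frame; rewrite /=; ring.
by rewrite fmulf1 (finvKr hf).
Qed.

Lemma app_axial r f q : fr r f -> app (axial f) (app f q) = app f (q.1, - q.2).
Proof. by move=> hf; rewrite /axial app_mul (appVf _ hf) app_mirY. Qed.

Section Families.
Variables (d : R) (F1 F2 : set (frame R)) (C C1 C2 : set (plane R)) (s : R) (f0 : frame R).
Hypotheses (AF : A2F d (F1 `|` F2) C) (cvC : convexC C) (AF1 : A2F d F1 C1) (cv1 : convexC C1)
  (AF2 : A2F d F2 C2) (cv2 : convexC C2) (sep : separated s f0 C1 C2).
Hypothesis HC : forall q, C2 q <-> C1 (app (axial f0) q).
Hypothesis flags : forall f, F1 f -> exists r h G, [/\ fr r h, chain d F1 h G, inW G f,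
  ~ inside C1 (h ** mirY R) & h ** mirY R = axial f0 ** h].

(** One inclusion suffices: the images of the tiles of [F1] already cover [C2], so a tile of [F2]
    overlaps one of them and equals it. *)
Lemma mirror_families g : F2 g <-> exists2 f, F1 f & g = axial f0 ** f.
Proof.
have [hf0 _ _] := sep; have ha := fr_axial hf0; have aK := axialK hf0.
have sub f : F1 f -> F2 (axial f0 ** f).
  move=> Ff; have [r [h [G [hh hG [n fn] nin E]]]] := flags Ff.
  have hm : fr (r * 1) (h ** mirY R) := fr_mul hh (fr_mirY R).
  have in2 k : inside C1 k -> inside C2 (axial f0 ** k).
    by apply: filterS => t ht; apply/HC; rewrite app_mul -[X in C1 X]app_mul aK app_one.
  have in1 k : inside C2 (axial f0 ** k) -> inside C1 k.
    by apply: filterS => t /HC; rewrite app_mul -[X in C1 X]app_mul aK app_one.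
  have inh : inside C1 h := D_inside AF1 cv1 (hG 0%N).1 hh (hG 0%N).2.
  have [|G' hG'] := chain_ex AF2 cv2 hm; first by rewrite E; exact: in2.
  have nD k : ~~ D (G k) (h ** mirY R).
    by apply/negP => Dk; apply: nin; exact: (D_inside AF1 cv1 (hG k).1 hm Dk).
  have nD' k : ~~ D (G' k) h.
    apply/negP => Dk; apply: nin; apply: in1; rewrite E fmulA aK fmul1f.
    exact: (D_inside AF2 cv2 (hG' k).1 hh Dk).
  have eG := mirror_chain AF cvC AF1 cv1 AF2 cv2 sep hh hG hG' nD nD' n.
  rewrite E -(fmulA (axial f0) h (finv h)) (finvKr hh) fmulf1 in eG.
  apply: (lev_transfer AF1 cv1 AF2 cv2 ha erefl Ff (hG n).1 fn).
  by rewrite -eG; exact: (hG' n).1.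
split=> [Fg|[f Ff ->]]; last exact: sub.
have [r hr] := F_fr AF2 cv2 Fg; have [q hq] := stile_nonempty hr.
have [_ _ _ cov1] := AF1; have [_ _ _ cov2] := AF2.
have /HC /cov1 [f Ff hf] : C2 q by apply/cov2; exists g => //; exact: stile_tile hr hq.
exists f => //; apply/esym/(F_eq AF2 cv2 (sub _ Ff) Fg).
have [t ht] := F_fr AF1 cv1 Ff; have ht' := fr_mul ha ht.
apply: (ov_tile ht' _ hq); rewrite -[q]app_one -aK app_mul.
by case: hf => z hz <-; exists z => //; rewrite app_mul.
Qed.

Lemma mirror_tilings : covered (tset F1) = C1 -> covered (tset F2) = C2 -> mirror_images (tset F1) (tset F2).
Proof.
move=> e1 e2; have [hf0 up dn] := sep; have [s0 hu hv huv] := hf0.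
pose n : plane R := (vx f0, vy f0); pose c := dot n (ox f0, oy f0).
have En q : dot n (app f0 q) = c + s ^+ 2 * q.2.
  rewrite /dot /c /dot /n /app /= -hv.
  have -> : vx f0 * (ox f0 + ux f0 * q.1 + vx f0 * q.2) + vy f0 * (oy f0 + uy f0 * q.1 + vy f0 * q.2) =
    vx f0 * ox f0 + vy f0 * oy f0 + (vx f0 ^+ 2 + vy f0 ^+ 2) * q.2 + (ux f0 * vx f0 + uy f0 * vy f0) * q.1 by ring.
  by rewrite huv mul0r addr0.
have s2 : 0 < s ^+ 2 by rewrite exprn_gt0.
have nn : dot n n = s ^+ 2 by rewrite /dot /n /= -hv; ring.
exists n, c; split.
- by apply/eqP => n0; move: nn; rewrite n0 /dot /= !mulr0 addr0 => e; rewrite -e ltxx in s2.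
- by rewrite e1 => q; rewrite -(appfV q hf0) => /up q2; rewrite /= En lerDl pmulr_rge0.
- by rewrite e2 => q; rewrite -(appfV q hf0) => /dn q2; rewrite /= En gerDl pmulr_rle0.
have refl : reflection n c = app (axial f0).
  apply/funext => q; rewrite -(appfV q hf0); move: (app (finv f0) q) => {}q.
  rewrite (app_axial _ hf0) /reflection En nn addrAC subrr add0r.
  have -> : 2 * (s ^+ 2 * q.2) / s ^+ 2 = 2 * q.2 by field; rewrite gt_eqF.
  by congr pair; rewrite /= /GRing.scale /=; ring.
have tm f : app (axial f0) @` tile f = tile (axial f0 ** f).
  by rewrite /tile image_comp; congr (_ @` _); apply/funext => q; rewrite app_mul.
rewrite refl; apply/seteqP; split=> H.
  by move=> [g /mirror_families [f Ff ->] <-]; exists (tile f); [exists f | exact: tm].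
move=> [_ [f Ff <-] <-]; exists (axial f0 ** f); last by rewrite tm.
by apply/mirror_families; exists f.
Qed.
End Families.

Lemma half_planeP A : half_plane A <-> exists s f, fr s f /\ hp f A.
Proof.
split=> [[n [c [n0 ->]]]|[s [f [hf hA]]]].
  have nn : 0 < n.1 ^+ 2 + n.2 ^+ 2.
    rewrite lt_neqAle eq_sym addr_ge0 ?sqr_ge0 // andbT paddr_eq0 ?sqr_ge0 // !expf_eq0 /=.
    by apply: contra n0 => /andP[/eqP e1 /eqP e2]; case: (n) e1 e2 => a b /= -> ->.
  pose s := Num.sqrt (n.1 ^+ 2 + n.2 ^+ 2).
  have ss : s ^+ 2 = n.1 ^+ 2 + n.2 ^+ 2 by rewrite sqr_sqrtr // ltW.
  pose k := c / (n.1 ^+ 2 + n.2 ^+ 2).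
  have kE : k * (n.1 ^+ 2 + n.2 ^+ 2) = c by rewrite divfK // gt_eqF.
  exists s, (Frame (k * n.1) (k * n.2) n.2 (- n.1) n.1 n.2); split.
    by split; rewrite /= ?ss ?sqrtr_gt0 //; ring.
  move=> q; rewrite /= /dot /app /=; have -> : n.1 * (k * n.1 + n.2 * q.1 + n.1 * q.2) +
    n.2 * (k * n.2 + - n.1 * q.1 + n.2 * q.2) = c + (n.1 ^+ 2 + n.2 ^+ 2) * q.2 by rewrite -kE; ring.
  by rewrite lerDl pmulr_rge0.
have [s0 hu hv huv] := hf; pose n : plane R := (vx f, vy f); pose c := dot n (ox f, oy f).
have En q : dot n (app f q) = c + s ^+ 2 * q.2.
  rewrite /dot /c /dot /n /app /= -hv.
  have -> : vx f * (ox f + ux f * q.1 + vx f * q.2) + vy f * (oy f + uy f * q.1 + vy f * q.2) =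
    vx f * ox f + vy f * oy f + (vx f ^+ 2 + vy f ^+ 2) * q.2 + (ux f * vx f + uy f * vy f) * q.1 by ring.
  by rewrite huv mul0r addr0.
have s2 : 0 < s ^+ 2 by rewrite exprn_gt0.
exists n, c; split.
  apply/eqP => n0; move: hv; rewrite -[vx f]/(n.1) -[vy f]/(n.2) n0 /= expr0n addr0 => e.
  by rewrite -e ltxx in s2.
apply/seteqP; split=> q; rewrite -(appfV q hf); first by move=> /hA q2; rewrite /= En lerDl pmulr_rge0.
by rewrite /= En lerDl pmulr_rge0 // => q2; apply/hA.
Qed.

Lemma quadrantP A : quadrant A <-> exists s f, fr s f /\ quad f A.
Proof.
split=> [[c0 [u [v [u0 v0 huv ->]]]]|[s [f [hf hA]]]].
  have nz (n : plane R) : n != 0 -> 0 < n.1 ^+ 2 + n.2 ^+ 2.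
    move=> n0; rewrite lt_neqAle eq_sym addr_ge0 ?sqr_ge0 // andbT paddr_eq0 ?sqr_ge0 // !expf_eq0 /=.
    by apply: contra n0 => /andP[/eqP e1 /eqP e2]; case: (n) e1 e2 => a b /= -> ->.
  pose a := Num.sqrt (u.1 ^+ 2 + u.2 ^+ 2); pose b := Num.sqrt (v.1 ^+ 2 + v.2 ^+ 2).
  have a2 : a ^+ 2 = u.1 ^+ 2 + u.2 ^+ 2 by rewrite sqr_sqrtr // ltW // nz.
  have b2 : b ^+ 2 = v.1 ^+ 2 + v.2 ^+ 2 by rewrite sqr_sqrtr // ltW // nz.
  have a0 : 0 < a by rewrite sqrtr_gt0 nz.
  have b0 : 0 < b by rewrite sqrtr_gt0 nz.
  have an : a != 0 by rewrite gt_eqF.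
  have bn : b != 0 by rewrite gt_eqF.
  pose f : frame R := Frame c0.1 c0.2 (u.1 / a) (u.2 / a) (v.1 / b) (v.2 / b).
  have hf : fr 1 f.
    split=> //=.
    - by rewrite !expr_div_n -mulrDl -a2 divff ?expr1n // expf_neq0.
    - by rewrite !expr_div_n -mulrDl -b2 divff ?expr1n // expf_neq0.
    - have -> : u.1 / a * (v.1 / b) + u.2 / a * (v.2 / b) = dot u v / (a * b) by rewrite /dot; field; rewrite an bn.
      by rewrite huv mul0r.
  exists 1, f; split=> // q.
  have K (z t c : R) : c != 0 -> z / c * (t * c) = t * z by move=> n; field.
  have E (x y : R) : app f (x * a, y * b) = c0 + x *: u + y *: v.
    by rewrite /app /f; congr pair; rewrite /= /GRing.scale /= (K _ _ _ an) (K _ _ _ bn).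
  split=> [[x [y [x0 y0]]]|[q1 q2]].
    by rewrite -E => /(app_inj hf) ->; rewrite /= !mulr_ge0 // ltW.
  exists (q.1 / a), (q.2 / b); split; [exact: divr_ge0 q1 (ltW a0) | exact: divr_ge0 q2 (ltW b0) |].
  by rewrite -E !divfK //; case: (q).
have [s0 hu hv huv] := hf.
have s2 : 0 < s ^+ 2 by rewrite exprn_gt0.
have E x y : app f (x, y) = ((ox f, oy f) : plane R) + x *: ((ux f, uy f) : plane R) + y *: ((vx f, vy f) : plane R).
  by rewrite /app; congr pair; rewrite /= /GRing.scale /=; ring.
exists (ox f, oy f), (ux f, uy f), (vx f, vy f); split=> //.
- apply/eqP => -[e1 e2]; move: hu; rewrite e1 e2 expr0n addr0 => e.
  by rewrite -e ltxx in s2.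
- apply/eqP => -[e1 e2]; move: hv; rewrite e1 e2 expr0n addr0 => e.
  by rewrite -e ltxx in s2.
- apply/seteqP; split=> q.
    rewrite -(appfV q hf) => /hA; case: (app (finv f) q) => x y [/= x0 y0].
    by exists x, y; split=> //; exact: E.
  by move=> [x [y [x0 y0 ->]]]; rewrite -E; apply/hA.
Qed.
End MirrorFamilies.

(** * The plane, half-planes and quadrants are convex and distinct *)

Section Shapes.
Variable R : realType.
Local Notation p := (psi R).
Implicit Types (f g h : frame R) (q z : plane R) (r : R) (G : nat -> frame R) (A C : set (plane R)).

Lemma convex_convexC A : convex_set A -> convexC A.
Proof.
move=> h a b Aa Ab t /andP[t0 t1].
have := h b a (Itv01 t0 t1) (mem_set Ab) (mem_set Aa); move/set_mem.
congr (A _); rewrite /conv /=; congr pair; rewrite /= /GRing.scale /= /unstable.onem; ring.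
Qed.

Lemma convexC_finv r f C : fr r f -> convexC (fun q => C (app f q)) -> convexC C.
Proof.
move=> hf cv; have := convexC_app (f := finv f) cv.
by congr convexC; apply/funext => q; rewrite (appfV _ hf).
Qed.

Lemma convexC_hp r f C : fr r f -> hp f C -> convexC C.
Proof.
move=> hf hC; apply: (convexC_finv hf) => a b /hC a2 /hC b2 t /andP[t0 t1]; apply/hC => /=.
have := mulr_ge0 t0 b2; have h : 0 <= 1 - t by rewrite subr_ge0.
have := mulr_ge0 h a2; lra.
Qed.

Lemma convexC_quad r f C : fr r f -> quad f C -> convexC C.
Proof.
move=> hf hC; apply: (convexC_finv hf) => a b /hC [a1 a2] /hC [b1 b2] t /andP[t0 t1]; apply/hC => /=.
have h : 0 <= 1 - t by rewrite subr_ge0.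
have := mulr_ge0 h a1; have := mulr_ge0 h a2; have := mulr_ge0 t0 b1; have := mulr_ge0 t0 b2; lra.
Qed.

Lemma linear_ge0 (a b : R) : (forall x, 0 <= a + b * x) -> b = 0.
Proof.
move=> h; apply/eqP; apply: contrapT => /negP b0; have := h ((- a - 1) / b).
by rewrite mulrC divfK //; lra.
Qed.

Lemma hp_quad r s f g C : fr r f -> fr s g -> hp f C -> quad g C -> False.
Proof.
move=> hf hg h1 h2; pose m := finv g ** f; have hm : fr (s^-1 * r) m := fr_mul (fr_inv hg) hf.
have k x : 0 <= ox m + ux m * x + vx m * 0 /\ 0 <= oy m + uy m * x + vy m * 0.
  have E : app f (x, 0) = app g (app m (x, 0)) by rewrite app_mul (appfV _ hg).
  have : C (app f (x, 0)) by apply/h1.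
  by rewrite E => /h2.
have u0 : ux m = 0 by apply: (linear_ge0 (a := ox m)) => x; have [+ _] := k x; rewrite mulr0 addr0.
have v0 : uy m = 0 by apply: (linear_ge0 (a := oy m)) => x; have [_ +] := k x; rewrite mulr0 addr0.
have [m0 hu _ _] := hm; move: hu; rewrite u0 v0 expr0n addr0 => e.
by have : 0 < (s^-1 * r) ^+ 2 by [rewrite exprn_gt0]; rewrite -e ltxx.
Qed.

Lemma hp_setT f : ~ hp f setT.
Proof. by move=> /(_ (0, -1)) [/(_ I)]; rewrite /= oppr_ge0 ler10. Qed.

Lemma quad_setT f : ~ quad f setT.
Proof. by move=> /(_ (0, -1)) [/(_ I) []]; rewrite /= oppr_ge0 ler10. Qed.
End Shapes.

(** * The alternatives for the plane, half-planes and quadrants *)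

Section Parts.
Variable R : realType.
Local Notation p := (psi R).
Implicit Types (f g h : frame R) (q z : plane R) (r : R) (G : nat -> frame R) (A C : set (plane R)) (T : tileset R).

Lemma sub_A2 d T T' : A2_d_tiling d T -> T' `<=` T -> T' !=set0 -> A2_d_tiling d T'.
Proof.
move=> [[d0 _ Ts Td] TA] sub ne; split; first split=> //.
- by move=> H /sub; exact: Ts.
- by move=> H K /sub TH /sub TK; exact: Td.
- by move=> H K e e' /sub TH /sub TK; exact: TA.
Qed.

Lemma covered_tset (S : set (frame R)) : covered (tset S) = [set q | exists2 g, S g & tile g q].
Proof.
apply/seteqP; split=> q; first by move=> [_ [g Sg <-] hq]; exists g.
by move=> [g Sg hq]; exists (tile g) => //; exists g.
Qed.

Lemma one_class_any d F C r h G : A2F d F C -> convexC C -> one_class d F -> fr r h -> chain d F h G ->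
  forall f, F f -> inW G f.
Proof.
move=> AF cvC [r0 [h0 [G0 [hh0 hG0 all]]]] hh hG f Ff.
have F0 : F (G 0%N) := (hG 0%N).1.
have w0 : inW G (G 0%N) by exists 0%N.
have e := inW_W_eq AF cvC hh0 hh hG0 hG F0 (all _ F0) w0.
exact: (W_eq_inW AF cvC hh0 hG0 hh hG e Ff (all _ Ff)).
Qed.

Lemma one_class_infinite d F C : A2F d F C -> convexC C -> one_class d F -> infinite_supertile (tset F).
Proof. by move=> AF cvC [r [h [G [hh hG all]]]]; exact: (infinite_of_chain AF cvC hh hG all). Qed.

Lemma shape_of d T : A2_d_tiling d T -> convexC (covered T) ->
  [\/ covered T = setT, half_plane (covered T) | quadrant (covered T)].
Proof.
move=> /A2_frames [AF _] cvC; case: (structure AF cvC) => [[_ [e|[s [f hC]]|[s [f hC]]]]|[s [f hC]]|[e _]].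
- exact: Or31.
- by apply: Or32; apply/half_planeP; exists s, f.
- by apply: Or33; apply/quadrantP; exists s, f.
- by apply: Or32; apply/half_planeP; exists s, f; case: hC => ? [? [? [? [? [? []]]]]].
- exact: Or31.
Qed.

Lemma decomposition P d T (S : set (frame R)) : A2_d_tiling d T -> S `<=` frames d T -> (exists g, S g) ->
  (exists g, frames d T g /\ ~ S g) -> P (covered (tset S)) -> P (covered (tset (frames d T `\` S))) ->
  exists T1 T2, A2_decomposition P T T1 T2.
Proof.
move=> AT SF [g1 Sg1] [g2 [Fg2 Sg2]] P1 P2; have [AF eT] := A2_frames AT.
have fF g : frames d T g -> exists r, fr r g by move=> [[h|h] _]; [exists d | exists (p * d)].
exists (tset S), (tset (frames d T `\` S)); split.
- split=> //; exists d; apply: (sub_A2 AT); last by exists (tile g1), g1.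
  by move=> _ [g /SF [_ Tg] <-].
- split=> //; exists d; apply: (sub_A2 AT); last by exists (tile g2), g2.
  by move=> _ [g [[_ Tg] _] <-].
- apply/seteqP; split=> // _ [[g Sg <-] [g' [Fg' Sg']]].
  have [a ha] := fF _ (SF _ Sg); have [b hb] := fF _ Fg'.
  by move=> /(tile_inj hb ha) e; apply: Sg'; rewrite e.
- rewrite {1}eT; apply/seteqP; split=> [_ [g Fg <-]|_ [[g /SF Fg <-]|[g [Fg _] <-]]]; [|by exists g|by exists g].
  by have [Sg|nSg] := pselect (S g); [left | right]; exists g.
Qed.

Lemma plane_split d T : A2_d_tiling d T -> covered T = setT ->
  infinite_supertile T \/ exists T1 T2, A2_decomposition (@half_plane R) T T1 T2.
Proof.
move=> AT eC; have [AF eT] := A2_frames AT; have cvC : convexC (covered T) by rewrite eC.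
case: (structure AF cvC) => [[oc _]|[s [f [? [? [? [? [? [? [_ _ [hf hC] _ _]]]]]]]]]|[_ [s [f [S [[hf SF] ne1 ne2 h1 h2]]]]]].
- by left; rewrite eT; exact: one_class_infinite AF cvC oc.
- by rewrite eC in hC; case: (hp_setT hC).
right; apply: (decomposition AT SF ne1 ne2); rewrite covered_tset; apply/half_planeP; first by exists s, f.
exists (s * 1), (f ** mirY R); split; first exact: fr_mul hf (fr_mirY R).
by move=> q; rewrite app_mirY; have := h2 (q.1, - q.2); rewrite oppr_le0.
Qed.

Lemma half_plane_split d T : A2_d_tiling d T -> half_plane (covered T) ->
  infinite_supertile T \/ exists T1 T2, A2_decomposition (@quadrant R) T T1 T2.
Proof.
move=> AT /half_planeP [s [f [hf hC]]]; have [AF eT] := A2_frames AT; have cvC := convexC_hp hf hC.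
case: (structure AF cvC) => [[oc _]|[t [k hp]]|[e _]]; last first.
- by rewrite e in hC; case: (hp_setT hC).
- have [r1 [r2 [h1 [h2 [G1 [G2 [[hh1 hG1] [hh2 hG2] [hk hC'] [q1 q2] all]]]]]]] := hp.
  pose S := [set g | frames d T g /\ inW G1 g].
  have F1 : frames d T (G1 0%N) := (hG1 0%N).1; have F2 : frames d T (G2 0%N) := (hG2 0%N).1.
  have disj g : frames d T g -> inW G1 g -> inW G2 g -> False.
    move=> Fg w1 w2; have e := inW_W_eq AF cvC hh1 hh2 hG1 hG2 Fg w1 w2.
    have : W G1 (app k (1, 0)) by apply/q1.
    by rewrite e => /q2 [/=]; rewrite ler10.
  have in1 : inW G1 (G1 0%N) by exists 0%N.
  have in2 : inW G2 (G2 0%N) by exists 0%N.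
  right; apply: (decomposition (S := S) AT).
  + by move=> g [].
  + by exists (G1 0%N).
  + by exists (G2 0%N); split=> // -[_ w]; exact: disj F2 w in2.
  + apply/quadrantP; exists t, k; split=> // q; rewrite covered_tset -(q1 q); split=> [[g [Fg gW] hq]|].
      exact: inW_tile gW hq.
    by move=> /(W_desc AF cvC hG1) [g [? ? ?]]; exists g.
  apply/quadrantP; exists (t * 1), (k ** mirX R); split=> [|q]; first exact: fr_mul hk (fr_mirX R).
  have -> : app (k ** mirX R) q = app k (- q.1, q.2).
    by rewrite app_mul; congr (app k _); congr pair; rewrite /=; ring.
  have E : 0 <= q.1 /\ 0 <= q.2 <-> W G2 (app k (- q.1, q.2)) by rewrite q2 /= oppr_le0.
  rewrite covered_tset E; split=> [[g [Fg nS] hq]|].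
    case: (all _ Fg) => gW; last exact: inW_tile gW hq.
    by case: nS.
  move=> /(W_desc AF cvC hG2) [g [Fg gW ?]]; exists g => //; split=> // -[_ w].
  exact: disj Fg w gW.
- by left; rewrite eT; exact: one_class_infinite AF cvC oc.
Qed.

Lemma quadrant_infinite d T : A2_d_tiling d T -> quadrant (covered T) ->
  one_class d (frames d T) /\ infinite_supertile T.
Proof.
move=> AT /quadrantP [s [f [hf hC]]]; have [AF eT] := A2_frames AT; have cvC := convexC_quad hf hC.
suff oc : one_class d (frames d T) by split=> //; rewrite eT; exact: one_class_infinite AF cvC oc.
case: (structure AF cvC) => [[]//|[t [k [? [? [? [? [? [? [_ _ [hk hC'] _ _]]]]]]]]]|[e _]].
  by case: (hp_quad hk hf hC' hC).
by rewrite e in hC; case: (quad_setT hC).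
Qed.
End Parts.

(** * The mirror symmetry of arbitrary decompositions *)

Section Sides.
Variable R : realType.
Local Notation p := (psi R).
Implicit Types (f g h : frame R) (q z : plane R) (r : R) (G : nat -> frame R) (A C : set (plane R)) (T : tileset R).

Lemma open_fst f : open [set z | 0 < (app (finv f) z).1].
Proof.
apply: (@open_comp _ _ (app (finv f)) [set z | 0 < z.1]); first by move=> ? _; exact: continuous_app.
by apply: (@open_comp _ _ fst [set x : R | 0 < x]); [move=> ? _; exact: cvg_fst | exact: open_gt].
Qed.

Lemma open_snd f : open [set z | 0 < (app (finv f) z).2].
Proof.
apply: (@open_comp _ _ (app (finv f)) [set z | 0 < z.2]); first by move=> ? _; exact: continuous_app.
by apply: (@open_comp _ _ snd [set x : R | 0 < x]); [move=> ? _; exact: cvg_snd | exact: open_gt].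
Qed.

(** A tile of [F2] through a point of [U] has interior points in [U], and these are covered by tiles
    of [F1]. *)
Lemma avoid d F1 F2 C C1 C2 U q : A2F d (F1 `|` F2) C -> convexC C -> A2F d F1 C1 -> A2F d F2 C2 ->
  (forall g, F1 g -> F2 g -> False) -> open U -> (forall z, U z -> C z -> C1 z) -> C2 q -> ~ U q.
Proof.
move=> AF cvC [_ _ _ cov1] [_ _ _ cov2] disj oU hU /cov2 [g Fg hq] Uq.
have F12 h : F1 h \/ F2 h -> (F1 `|` F2) h by [].
have [a ha] := F_fr AF cvC (F12 _ (or_intror Fg)).
have [z [Uz hz]] := tile_regular ha oU Uq hq; have [_ _ _ cov] := AF.
have /(hU z Uz) /cov1 [g1 Fg1 hz1] : C z.
  by apply/cov; exists g; [right | exact: stile_tile ha hz].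
have [b hb] := F_fr AF cvC (F12 _ (or_introl Fg1)).
have e := F_eq AF cvC (F12 _ (or_introl Fg1)) (F12 _ (or_intror Fg)) (ov_tile hb hz1 hz).
by apply: (disj g1) => //; rewrite e.
Qed.

Lemma A2F_limit d F C s f q : A2F d F C -> fr s f -> (forall t, 0 < t -> C (app f (q.1, q.2 - t))) -> C (app f q).
Proof.
move=> [LF _ _ cov] hf hq; apply/cov; apply: (cover_closed LF) => // e e0; have [s0 _ _ _] := hf.
pose t := e / (2 * s); have t0 : 0 < t by apply: divr_gt0 => //; lra.
have tE : t * s = e / 2 by rewrite /t; field; rewrite gt_eqF.
exists (app f (q.1, q.2 - t)); have [_ _ h1 h2] := fr_le hf.
have B (v : R) : `|v| <= s -> `|v * t| < e.
  by move=> hv; rewrite normrM (gtr0_norm t0); have := ler_wpM2r (ltW t0) hv; lra.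
split; last by apply/cov; exact: hq.
  by rewrite [X in `|X|](_ : _ = vx f * t); [apply: B | rewrite /app /=; ring].
by rewrite [X in `|X|](_ : _ = vy f * t); [apply: B | rewrite /app /=; ring].
Qed.

Lemma axial_flag r f : fr r f -> f ** mirY R = axial f ** f.
Proof. by move=> hf; rewrite /axial -fmulA (finvK hf) fmulf1. Qed.

Lemma axial_flagX r f : fr r f -> f ** mirX R ** mirY R = axial f ** (f ** mirX R).
Proof.
move=> hf; rewrite /axial -(fmulA _ (finv f)) (fmulVf _ hf) -!fmulA; congr (f ** _).
by congr Frame; rewrite /=; ring.
Qed.

Lemma app_mirX f q : app (f ** mirX R) q = app f (- q.1, q.2).
Proof. by rewrite app_mul; congr (app f _); congr pair; rewrite /=; ring. Qed.

Lemma not_inside_below A f : (forall q, A (app f q) -> 0 <= q.2) -> ~ inside A (f ** mirY R).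
Proof.
move=> up hi; have [t [ht [t0 _]]] := filter_ex (filterI hi (near0_small (ltr01 : (0 : R) < 1))).
have : 0 < t ^+ 2 by rewrite exprn_gt0.
by move: ht; rewrite app_mirY => /up /=; lra.
Qed.

(** If one chain fills the half-plane, a single flag along the boundary serves all tiles. If two
    quadrants do, two flags leave their common apex in opposite directions along the same line. *)
Lemma half_flags d F C : A2F d F C -> convexC C -> half_plane C -> exists s f, [/\ fr s f, hp f C &
  forall g, F g -> exists r h G, [/\ fr r h, chain d F h G, inW G g,
    ~ inside C (h ** mirY R) & h ** mirY R = axial f ** h]].
Proof.
move=> AF cvC /half_planeP [s [f [hf hC]]].
case: (structure AF cvC) => [[oc _]|[t [k hp]]|[e _]]; last first.
- by rewrite e in hC; case: (hp_setT hC).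
- have [r1 [r2 [h1 [h2 [G1 [G2 [[hh1 hG1] [hh2 hG2] [hk hC'] [q1 q2] all]]]]]]] := hp.
  exists t, k; split=> // g Fg.
  have up q : C (app k q) -> 0 <= q.2 by move/hC'.
  have upX q : C (app (k ** mirX R) q) -> 0 <= q.2 by rewrite app_mirX => /hC'.
  have hX : fr (t * 1) (k ** mirX R) := fr_mul hk (fr_mirX R).
  have flag u m G r' h' : fr u m -> fr r' h' -> chain d F h' G -> inside (W G) m -> inW G g ->
      ~ inside C (m ** mirY R) -> m ** mirY R = axial k ** m ->
      exists r h G, [/\ fr r h, chain d F h G, inW G g, ~ inside C (h ** mirY R) & h ** mirY R = axial k ** h].
    move=> hm hh' hG iW gW nin E.
    have inC : inside C m by apply: filterS iW => x; exact: (W_sub AF cvC hG).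
    have [G' hG'] := chain_ex AF cvC hm inC; exists u, m, G'; split=> //.
    have [a ha] := lev_fr AF cvC (hG' 0%N).1.
    have i2 : inside (W G') m.
      by apply: filterS ((DtileP ha hm).1 (hG' 0%N).2) => x hx; exists 0%N.
    have e := W_overlap AF cvC hh' hG hm hG' hm iW i2.
    exact: (W_eq_inW AF cvC hh' hG hm hG' e Fg gW).
  case: (all _ Fg) => gW.
    apply: (flag _ k _ _ _ hk hh1 hG1 _ gW _ (axial_flag hk)); last exact: not_inside_below.
    by apply: inside_lt => x /andP[x0 x1]; apply/q1; rewrite /= exprn_ge0 ltW.
  apply: (flag _ (k ** mirX R) _ _ _ hX hh2 hG2 _ gW _ (axial_flagX hk)); last exact: not_inside_below.
  apply: inside_lt => x /andP[x0 x1]; rewrite app_mirX; apply/q2.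
  by rewrite /= oppr_le0 exprn_ge0 ltW.
exists s, f; split=> // g Fg.
have inC : inside C f by apply: inside_lt => x /andP[x0 x1]; apply/hC; rewrite /= exprn_ge0 // ltW.
have [G hG] := chain_ex AF cvC hf inC; exists s, f, G; split=> //.
- exact: (one_class_any AF cvC oc hf hG).
- by apply: not_inside_below => q /hC.
- exact: axial_flag hf.
Qed.

(** The two parts come with scales of their own; as nonempty subsets of [T] they are A2 tilings at
    the scale [d]. *)
Lemma decomposition_A2F P d T T1 T2 : A2_d_tiling d T -> A2_decomposition P T T1 T2 ->
  [/\ A2F d (frames d T1 `|` frames d T2) (covered T),
      A2F d (frames d T1) (covered T1) /\ T1 = tset (frames d T1),
      A2F d (frames d T2) (covered T2) /\ T2 = tset (frames d T2),
      forall g, frames d T1 g -> frames d T2 g -> False &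
      forall q, covered T q -> covered T1 q \/ covered T2 q].
Proof.
move=> AT [[A1 _] [A2 _] T12 eT]; have [AF _] := A2_frames AT.
have sub1 : T1 `<=` T by rewrite eT; exact: subsetUl.
have sub2 : T2 `<=` T by rewrite eT; exact: subsetUr.
have ne1 : T1 !=set0 by have [d1 [[_ ? _ _] _]] := A1.
have ne2 : T2 !=set0 by have [d2 [[_ ? _ _] _]] := A2.
split.
- have <- // : frames d T = frames d T1 `|` frames d T2.
  apply/seteqP; split=> g; first by move=> [hg]; rewrite eT => -[h|h]; [left | right].
  by move=> [[hg h]|[hg h]]; split=> //; [exact: sub1 | exact: sub2].
- exact: A2_frames (sub_A2 AT sub1 ne1).
- exact: A2_frames (sub_A2 AT sub2 ne2).
- move=> g [_ h1] [_ h2]; have : (T1 `&` T2) (tile g) by [].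
  by rewrite T12.
- by move=> q [H]; rewrite {1}eT => -[h|h] hq; [left | right]; exists H.
Qed.

Lemma plane_mirror d T T1 T2 : A2_d_tiling d T -> covered T = setT ->
  A2_decomposition (@half_plane R) T T1 T2 -> mirror_images T1 T2.
Proof.
move=> AT eC dec; have [AF [AF1 e1] [AF2 e2] disj un] := decomposition_A2F AT dec.
have [[_ P1] [_ P2] _ _] := dec.
have cv0 : convexC (covered T) by rewrite eC.
have [s1 [k1 [hk1 hC1]]] := (half_planeP _).1 P1; have cv1 := convexC_hp hk1 hC1.
have [s2 [k2 [hk2 hC2]]] := (half_planeP _).1 P2; have cv2 := convexC_hp hk2 hC2.
have [s [f [hf hC flags]]] := half_flags AF1 cv1 P1.
have dn q : covered T2 (app f q) -> q.2 <= 0.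
  move=> hq; rewrite leNgt; apply/negP => q0.
  apply: (avoid AF cv0 AF1 AF2 disj (open_snd (f := f)) _ hq); last by have : 0 < (app (finv f) (app f q)).2 by rewrite (appVf _ hf).
  by move=> z z0 _; rewrite -(appfV z hf); apply/hC/ltW.
have E2 q : covered T2 (app f q) <-> q.2 <= 0.
  split=> [|q0]; first exact: dn.
  apply: (A2F_limit AF2 hf) => t t0; have [||//] := un (app f (q.1, q.2 - t)); first by rewrite eC.
  by move=> /hC /=; lra.
have sep : separated s f (covered T1) (covered T2) by split=> // q /hC.
rewrite e1 e2; apply: (mirror_tilings AF cv0 AF1 cv1 AF2 cv2 sep) => //; rewrite -?e1 -?e2 //.
by move=> q; rewrite -(appfV q hf) (app_axial _ hf) E2 hC /= oppr_ge0.
Qed.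

Lemma linear_pos (a b : R) : (forall x, 0 <= x -> 0 <= a + b * x) -> 0 <= b.
Proof.
move=> k; rewrite leNgt; apply/negP => b0; have a0 := normr_ge0 a.
have x0 : 0 <= (`|a| + 1) / - b by apply: divr_ge0; lra.
have := k _ x0.
have -> : b * ((`|a| + 1) / - b) = - (`|a| + 1) by field; rewrite lt_eqF.
by have := ler_norm a; rewrite leNgt => h1 /negP; apply; lra.
Qed.

(** In the coordinates of the quadrant the half-plane is [0 <= a + b * x + c * y] with nonnegative
    coefficients. Unless [a = 0] and exactly one of [b] and [c] vanishes, it has two points outside
    the quadrant whose midpoint is inside the open quadrant. Both belong to the convex set [C2],
    which avoids that open set. *)
Lemma quad_in_half r s g f C C1 C2 : fr r g -> fr s f -> hp g C -> quad f C1 -> convexC C2 ->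
  (forall q, C q <-> C1 q \/ C2 q) -> (forall q, C2 (app f q) -> ~ (0 < q.1 /\ 0 < q.2)) ->
  exists t k, [/\ fr t k, quad k C1 & forall q, C (app k q) <-> 0 <= q.1].
Proof.
move=> hg hf hC hC1 cv2 un av; pose m := finv g ** f.
have hm : fr (r^-1 * s) m := fr_mul (fr_inv hg) hf.
have CE q : C (app f q) <-> 0 <= oy m + uy m * q.1 + vy m * q.2.
  have E : app f q = app g (app m q) by rewrite app_mul (appfV _ hg).
  by rewrite E hC.
have [_ n0] := fr_neq0 hm; move: (oy m) (uy m) (vy m) n0 CE => a b c n0 CE {m hm}.
have pos (x y : R) : 0 <= x -> 0 <= y -> 0 <= a + b * x + c * y.
  by move=> x0 y0; have := (CE (x, y)).1; apply; apply/un; left; apply/hC1.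
have a0 : 0 <= a by have := pos 0 0; rewrite !mulr0 !addr0; apply.
have b0 : 0 <= b by apply: (@linear_pos a) => x x0; have := pos x 0 x0 (lexx _); rewrite mulr0 addr0.
have c0 : 0 <= c by apply: (@linear_pos a) => x x0; have := pos 0 x (lexx _) x0; rewrite mulr0 addr0.
have key (x y x' y' : R) : 0 <= a + b * x + c * y -> 0 <= a + b * x' + c * y' -> x < 0 \/ y < 0 ->
    x' < 0 \/ y' < 0 -> 0 < x + x' -> 0 < y + y' -> False.
  move=> h h' n n' px py.
  have inC2 u v : 0 <= a + b * u + c * v -> u < 0 \/ v < 0 -> C2 (app f (u, v)).
    move=> h1 h2; have /un [/hC1 [/= h3 h4]|//] : C (app f (u, v)) by apply/CE.
    by move: h2; rewrite !ltNge h3 h4 => -[].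
  have half : 0 <= (1 / 2 : R) <= 1 by lra.
  have := convexC_app (f := f) cv2 (inC2 _ _ h n) (inC2 _ _ h' n') half.
  by move=> /av; apply => /=; lra.
have fin (a' b' : R) t k : 0 <= a' -> 0 < b' -> fr t k -> quad k C1 -> (forall q, C (app k q) <-> 0 <= a' + b' * q.1) ->
    (a' != 0 -> False) -> exists t k, [/\ fr t k, quad k C1 & forall q, C (app k q) <-> 0 <= q.1].
  move=> a0' b0' hk hkC1 hkC na; exists t, k; split=> // q; rewrite hkC.
  have -> : a' = 0 by apply/eqP; apply: contrapT => /negP.
  by rewrite add0r pmulr_rge0.
case: (ltrgtP b 0) b0 => // [b1 _|b1 _]; case: (ltrgtP c 0) c0 => // [c1 _|c1 _].
- have bc : 0 <= b / c by apply: divr_ge0; lra.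
  have cb : 0 <= c / b by apply: divr_ge0; lra.
  have E1 : c * (b / c) = b by rewrite mulrC divfK // gt_eqF.
  have E2 : b * (c / b) = c by rewrite mulrC divfK // gt_eqF.
  case: (key (-1) (2 + b / c) (2 + c / b) (-1)); try lra.
- apply: (fin a b _ _ a0 b1 hf hC1) => [q|an]; first by rewrite CE c1 mul0r addr0.
  have ab : 0 < a / b by apply: divr_gt0 => //; rewrite lt_neqAle eq_sym an.
  have E : b * (a / b) = a by rewrite mulrC divfK // gt_eqF.
  case: (key (- (a / b)) 3 (3 + a / b) (-1)); rewrite ?c1; try lra.
- apply: (fin a c _ _ a0 c1 (fr_mul hf (fr_swap R)) (quad_swap hC1)) => [q|an].
    by rewrite app_swap CE b1 mul0r addr0.
  have ac : 0 < a / c by apply: divr_gt0 => //; rewrite lt_neqAle eq_sym an.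
  have E : c * (a / c) = a by rewrite mulrC divfK // gt_eqF.
  case: (key 3 (- (a / c)) (-1) (3 + a / c)); rewrite ?b1; try lra.
- by move: n0; rewrite b1 c1 eqxx.
Qed.

Lemma half_mirror d T T1 T2 : A2_d_tiling d T -> half_plane (covered T) ->
  A2_decomposition (@quadrant R) T T1 T2 -> mirror_images T1 T2.
Proof.
move=> AT P0 dec; have [AF [AF1 e1] [AF2 e2] disj un] := decomposition_A2F AT dec.
have [[_ P1] [_ P2] _ _] := dec.
have [s0 [k0 [hk0 hC0]]] := (half_planeP _).1 P0; have cv0 := convexC_hp hk0 hC0.
have [s1 [k1 [hk1 hC1]]] := (quadrantP _).1 P1; have cv1 := convexC_quad hk1 hC1.
have [s2 [k2 [hk2 hC2]]] := (quadrantP _).1 P2; have cv2 := convexC_quad hk2 hC2.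
have sub1 q : covered T1 q -> covered T q.
  by have [_ _ _ c1] := AF1; have [_ _ _ c0] := AF => /c1 [g Fg hg]; apply/c0; exists g => //; left.
have sub2 q : covered T2 q -> covered T q.
  by have [_ _ _ c2] := AF2; have [_ _ _ c0] := AF => /c2 [g Fg hg]; apply/c0; exists g => //; right.
have [||s [f [hf hC hC']]] := quad_in_half (C2 := covered T2) hk0 hk1 hC0 hC1 cv2.
- by move=> q; split=> [/un//|[/sub1|/sub2]].
- move=> q hq [q1 q2]; pose U := [set z | 0 < (app (finv k1) z).1] `&` [set z | 0 < (app (finv k1) z).2].
  have oU : open U by apply: openI; [exact: open_fst | exact: open_snd].
  apply: (avoid AF cv0 AF1 AF2 disj oU _ hq).
    by move=> z [z1 z2] _; rewrite -(appfV z hk1); apply/hC1; rewrite !ltW.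
  by have : 0 < (app (finv k1) (app k1 q)).1 /\ 0 < (app (finv k1) (app k1 q)).2 by rewrite (appVf _ hk1).
have E1 q : covered T1 (app f q) <-> 0 <= q.1 /\ 0 <= q.2 by exact: hC.
have dn q : covered T2 (app f q) -> q.2 <= 0.
  move=> hq; rewrite leNgt; apply/negP => q0.
  apply: (avoid AF cv0 AF1 AF2 disj (open_snd (f := f)) _ hq); last by have : 0 < (app (finv f) (app f q)).2 by rewrite (appVf _ hf).
  by move=> z z0; rewrite -(appfV z hf) => /hC' z1; apply/hC; split=> //; exact: ltW.
have E2 q : covered T2 (app f q) <-> 0 <= q.1 /\ q.2 <= 0.
  split=> [hq|[q1 q0]]; first by split; [apply/hC'; exact: sub2 | exact: dn].
  apply: (A2F_limit AF2 hf) => t t0; have [||//] := un (app f (q.1, q.2 - t)); first by apply/hC'.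
  by move=> /hC /= [_]; lra.
have sep : separated s f (covered T1) (covered T2) by split=> // q /hC [].
have [AT1 _] := frames_A2 AF1; rewrite -e1 in AT1; have [oc _] := quadrant_infinite AT1 P1.
have flags g : frames d T1 g -> exists r h G, [/\ fr r h, chain d (frames d T1) h G, inW G g,
    ~ inside (covered T1) (h ** mirY R) & h ** mirY R = axial f ** h].
  move=> Fg; have inC : inside (covered T1) f.
    by apply: inside_lt => x /andP[x0 x1]; apply/hC; rewrite /= exprn_ge0 ltW.
  have [G hG] := chain_ex AF1 cv1 hf inC; exists s, f, G; split=> //.
  - exact: (one_class_any AF1 cv1 oc hf hG).
  - by apply: not_inside_below => q /hC [].
  - exact: axial_flag hf.
rewrite e1 e2; apply: (mirror_tilings AF cv0 AF1 cv1 AF2 cv2 sep) => //; rewrite -?e1 -?e2 //.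
move=> q; rewrite -(appfV q hf) (app_axial _ hf) E2.
by rewrite hC /= oppr_ge0.
Qed.
End Sides.

(** * Arrows on and off the cut between son and daughter *)

Section ArrowGeometry.
Variable R : realType.
Local Notation p := (psi R).
Local Notation darrow := (darrow R).
Local Notation arrows := (arrows R).
Local Notation karrow := (karrow R).
Implicit Types (f g h : frame R) (q z : plane R) (r : R) (e : arrow R).

Definition btw (a b x : R) : bool := (a <= x <= b) || (b <= x <= a).

Lemma segment_box (P Q z : plane R) : segment P Q z -> btw P.1 Q.1 z.1 /\ btw P.2 Q.2 z.2.
Proof.
have K (a b t : R) : 0 <= t <= 1 -> btw a b (a + t * (b - a)).
  move=> /andP[t0 t1]; have [h|h] := leP a b; apply/orP; [left | right].
    have := mulr_ge0 t0 (_ : 0 <= b - a); rewrite subr_ge0 h => /(_ isT) h1.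
    have : 0 <= (1 - t) * (b - a) by apply: mulr_ge0; lra.
    lra.
  have : 0 <= t * (a - b) by apply: mulr_ge0; lra.
  have : 0 <= (1 - t) * (a - b) by apply: mulr_ge0; lra.
  lra.
by move=> [t ht ->]; split; exact: K.
Qed.

Lemma arrow_bee_sub large i z : (i < size (arrows large))%N -> arrow_segment (nth darrow (arrows large) i) z -> bee z.
Proof.
have [/andP[a1 a2] /andP[b1 b2] /andP[c1 c2] e4] := psi_bounds R.
move=> hi /segment_box; case: z => x y; rewrite /bee /setU /rect /=.
by case: large hi; do 10?[case: i => [|i]] => //= _; rewrite /btw; lra.
Qed.

(* The arrows of the two parts that are not on the boundary of the whole. *)
Definition internal (k : kidk) (i : nat) : bool :=
  match k with Ksame => false | Ksig => i \in [:: 5; 7; 8]%N | Kdel => i \in [:: 5; 6; 7]%N end.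

Lemma boundary_dec large k i : kok large k -> (i < size (arrows (klarge k)))%N -> ~~ internal k i ->
  exists2 j, (j < size (arrows large))%N & karrow (k, i) \in dec (nth darrow (arrows large) j).
Proof.
have K j : (j < size (arrows large))%N -> List.In (k, i) (dtab large j) ->
    exists2 j, (j < size (arrows large))%N & karrow (k, i) \in dec (nth darrow (arrows large) j).
  by move=> hj hk; exists j => //; have [-> _] := dec_table hj; elim: (dtab large j) hk => //= x s IH [->|/IH]; rewrite inE ?eqxx // => ->; rewrite orbT.
case: k K; case: large => //= K _; do 10?[case: i K => [|i] //= K] => _ _;
 first [apply: (K 0%N) => //=; tauto | apply: (K 1%N) => //=; tauto | apply: (K 2%N) => //=; tauto | apply: (K 3%N) => //=; tauto
   | apply: (K 4%N) => //=; tauto | apply: (K 5%N) => //=; tauto | apply: (K 6%N) => //=; tauto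
   | apply: (K 7%N) => //=; tauto | apply: (K 8%N) => //=; tauto | apply: (K 9%N) => //=; tauto].
Qed.

(** The three arrows along the cut, indexed by their colours; son and daughter induce them with the
    same directions. *)
Definition inner (j : nat) : arrow R :=
  if j == 6%N then mk_arrow (p - p ^+ 3) (p ^+ 2) (p ^+ 3) (p ^+ 2) 6
  else if j == 5%N then mk_arrow (p - p ^+ 3) (1 - p ^+ 2) (p - p ^+ 3) (p ^+ 2) 5
  else mk_arrow 0 (1 - p ^+ 2) (p - p ^+ 3) (1 - p ^+ 2) 4.

Lemma internal_inner k i : internal k i -> exists2 j, j \in [:: 4; 5; 6]%N & karrow (k, i) = inner j.
Proof.
have e4 := psi4 R.
case: k => //=; rewrite !inE => /or3P[] /eqP ->; [exists 6%N | exists 5%N | exists 4%N | exists 6%N | exists 5%N | exists 4%N] => //;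
 rewrite /karrow /inner /= /map_arrow /mk_arrow /app /=; congr (((_, _), (_, _)), _); ring: e4.
Qed.

Lemma inner_box j z : j \in [:: 4; 5; 6]%N -> arrow_segment (inner j) z ->
  [\/ [/\ j = 6%N, p - p ^+ 3 <= z.1, z.1 <= p ^+ 3 & z.2 = p ^+ 2],
   [/\ j = 5%N, z.1 = p - p ^+ 3, 1 - p ^+ 2 <= z.2 & z.2 <= p ^+ 2] |
   [/\ j = 4%N, 0 <= z.1, z.1 <= p - p ^+ 3 & z.2 = 1 - p ^+ 2]].
Proof.
have [/andP[a1 a2] /andP[b1 b2] /andP[c1 c2] e4] := psi_bounds R.
rewrite !inE => /or3P[] /eqP -> /segment_box; case: z => x y; rewrite /inner /btw /= => h.
- by apply: Or33; split=> //; clear a2 b1 b2 c1 e4; lra.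
- by apply: Or32; split=> //; clear a1 a2 b2 c1 c2 e4; lra.
- by apply: Or31; split=> //; clear a1 b1 b2 c2 e4; lra.
Qed.

Lemma inner_meet j j' z : j \in [:: 4; 5; 6]%N -> j' \in [:: 4; 5; 6]%N -> j != j' ->
  arrow_segment (inner j) z -> arrow_segment (inner j') z ->
  z.1 = p - p ^+ 3 /\ z.2 = if (j == 4%N) || (j' == 4%N) then 1 - p ^+ 2 else p ^+ 2.
Proof.
have [/andP[a1 a2] /andP[b1 b2] /andP[c1 c2] e4] := psi_bounds R.
move=> hj hj' jj /(inner_box hj) h /(inner_box hj') h'; clear hj hj'; case: z h h' => x y /=.
case=> -[ej h1 h2 h3]; case=> -[ej' h1' h2' h3']; move: jj; rewrite ej ej' //= => _; clear ej ej'; split;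
    clear a1 a2 b1 b2 c1 c2 e4; lra.
Qed.

Lemma box_neq (z w : plane R) : z <> w -> [\/ z.1 < w.1, w.1 < z.1, z.2 < w.2 | w.2 < z.2].
Proof.
case: z w => [x y] [x' y'] /= n; case: (ltgtP x x') n => [?|?|->] n; [exact: Or41 | exact: Or42 |].
by case: (ltgtP y y') n => [?|?|-> //] n; [exact: Or43 | exact: Or44].
Qed.

(** This keeps other coarse tiles away: an arrow with two points in common with an inner one would
    contain an interior point of the whole tile. *)
Lemma internal_mid k i z w : internal k i ->
  z <> w -> arrow_segment (karrow (k, i)) z -> arrow_segment (karrow (k, i)) w ->
  sbee (((z.1 + w.1) / 2, (z.2 + w.2) / 2) : plane R).
Proof.
have [/andP[a1 a2] /andP[b1 b2] /andP[c1 c2] e4] := psi_bounds R.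
move=> /internal_inner [j hj ->] /box_neq n /(inner_box hj) hz /(inner_box hj) hw.
move: z w n hz hw => [x y] [x' y'] /= n hz hw; rewrite /sbee /=; clear hj.
case: hz => -[ej z1 z2 z3]; case: hw => -[]; rewrite ej // => _ w1 w2 w3;
  clear -a1 a2 b1 b2 c1 c2 z1 z2 z3 w1 w2 w3 n; case: n => n; lra.
Qed.

Lemma sig_contact z : bee_daughter (app (sig R) z) -> bee z ->
  (p ^+ 2 <= z.2 /\ p ^+ 3 <= z.1) \/ (1 - p ^+ 2 <= z.2 /\ p <= z.1).
Proof.
have [/andP[a1 a2] /andP[b1 b2] /andP[c1 c2] e4] := psi_bounds R.
have e5 : p ^+ 5 = p - p * p ^+ 2 by ring: e4.
have e6 : p ^+ 4 = p * p ^+ 3 by ring.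
have e7 : p ^+ 3 = p - p * (1 - p ^+ 2) by ring.
have p0 : 0 < p by lra.
have div (x y : R) : p * x <= p * y -> x <= y by rewrite ler_pM2l.
case: z => x y; rewrite /bee_daughter /setU /rect /= => -[[/andP[h1 h2] /andP[h3 h4]]|[/andP[h1 h2] /andP[h3 h4]]] _.
  by left; split; apply: div; [rewrite e5 in h2 | rewrite e6 in h3]; clear a1 a2 b1 b2 c1 c2 e4 e5 e6 e7 h1 h4 p0; lra.
right; split; apply: div; first by rewrite e7 in h2; lra.
by move: h3; rewrite expr2; lra.
Qed.

Lemma del_contact z : bee_son (app (del R) z) -> bee z -> 1 <= z.2 \/ (p ^+ 2 <= z.2 /\ p ^+ 3 <= z.1).
Proof.
have [/andP[a1 a2] /andP[b1 b2] /andP[c1 c2] e4] := psi_bounds R.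
have e5 : p ^+ 5 = p ^+ 2 * p ^+ 3 by ring.
have e6 : p ^+ 2 = 1 - p ^+ 2 * p ^+ 2 by ring: e4.
have p0 : 0 < p ^+ 2 by lra.
have div (x y : R) : p ^+ 2 * x <= p ^+ 2 * y -> x <= y by rewrite ler_pM2l.
case: z => x y; rewrite /bee_son /setU /rect /= => -[[/andP[h1 h2] /andP[h3 h4]]|[/andP[h1 h2] /andP[h3 h4]]] _.
  by left; apply: div; rewrite e4 in h4; lra.
right; split; apply: div; last by rewrite e5 in h1; lra.
by rewrite {2}e6 in h4; lra.
Qed.

(** Son and daughter meet only along the cut. An arrow that is not internal has at most one point in
    common with the sibling, and two different inner arrows have at most one common point. *)
Lemma sibling_arrows i i' : (i < 10)%N -> (i' < 8)%N -> overlap (karrow (Ksig, i)) (karrow (Kdel, i')) ->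
  karrow (Ksig, i) = karrow (Kdel, i').
Proof.
have [/andP[a1 a2] /andP[b1 b2] /andP[c1 c2] e4] := psi_bounds R.
move=> hi hi' [z [w [n [[z1 z2] [w1 w2]]]]].
have pre k j q : arrow_segment (karrow (k, j)) q -> exists2 u, arrow_segment (nth darrow (arrows (klarge k)) j) u & q = app (kfr R k) u.
  move=> [t ht ->]; rewrite /karrow /=; move: (nth _ _ _) => [[P Q] c] /=.
  exists (P + t *: (Q - P)); first by exists t.
  by congr pair; rewrite /= /GRing.scale /=; ring.
have son j q : (j < 10)%N -> arrow_segment (karrow (Ksig, j)) q -> bee_son q.
  by move=> hj /pre [u hu ->]; rewrite -app_sig_son; exists u => //; exact: (@arrow_bee_sub true j).
have dau j q : (j < 8)%N -> arrow_segment (karrow (Kdel, j)) q -> bee_daughter q.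
  by move=> hj /pre [u hu ->]; rewrite -app_del_daughter; exists u => //; exact: (@arrow_bee_sub false j).
have [isig|nsig] := boolP (internal Ksig i); last first.
  case: n; have [u hu eu] := pre _ _ _ z1; have [v hv ev] := pre _ _ _ w1.
  have du := dau _ _ hi' z2; have dv := dau _ _ hi' w2; rewrite eu ev in du dv *; congr (app _ _).
  have cu := sig_contact du (@arrow_bee_sub true i u hi hu); have cv := sig_contact dv (@arrow_bee_sub true i v hi hv).
  move: hu hv => /segment_box + /segment_box; clear du dv eu ev z1 z2 w1 w2; move: u v cu cv => [x y] [x' y'] /= cu cv.
  move: hi nsig; do 10?[case: i => [|i]] => //= _ _; rewrite /btw => hu hv; clear -a1 a2 b1 b2 c1 c2 e4 cu cv hu hv;
   congr pair; lra.
have [idel|ndel] := boolP (internal Kdel i'); last first.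
  case: n; have [u hu eu] := pre _ _ _ z2; have [v hv ev] := pre _ _ _ w2.
  have du := son _ _ hi z1; have dv := son _ _ hi w1; rewrite eu ev in du dv *; congr (app _ _).
  have cu := del_contact du (@arrow_bee_sub false i' u hi' hu); have cv := del_contact dv (@arrow_bee_sub false i' v hi' hv).
  move: hu hv => /segment_box + /segment_box; clear du dv eu ev z1 z2 w1 w2; move: u v cu cv => [x y] [x' y'] /= cu cv.
  move: hi' ndel; do 8?[case: i' => [|i']] => //= _ _; rewrite /btw => hu hv; clear -a1 a2 b1 b2 c1 c2 e4 cu cv hu hv;
   congr pair; clear a1 a2 c2; lra.
have [j hj e] := internal_inner isig; have [j' hj' e'] := internal_inner idel.
rewrite e e' in z1 w1 z2 w2 *.
have [//|jj] := eqVneq j j'; first by move=> ->.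
case: n; have [x1 x2] := inner_meet hj hj' jj z1 z2; have [y1 y2] := inner_meet hj hj' jj w1 w2.
by case: (z) (w) x1 x2 y1 y2 => [? ?] [? ?] /= -> -> -> ->.
Qed.
End ArrowGeometry.

(** * Substitution preserves the arrow rule *)

Section Expand.
Variable R : realType.
Local Notation p := (psi R).
Local Notation darrow := (darrow R).
Local Notation arrows := (arrows R).
Local Notation karrow := (karrow R).
Implicit Types (f g h : frame R) (q z : plane R) (r : R) (e : arrow R) (F : set (frame R)) (C : set (plane R)).

Lemma dec_segment e b z : b \in dec e -> arrow_segment b z -> arrow_segment e z.
Proof.
have [/andP[a1 a2] /andP[b1 b2] _ e4] := psi_bounds R.
move: e => [[P Q] c]; rewrite /dec /=; case: ifP => _; last by rewrite inE => /eqP ->.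
have EM : midpt P Q = P + (1 - p ^+ 4) *: (Q - P).
  by rewrite /midpt; congr pair; rewrite /= /GRing.scale /=; ring.
rewrite !inE => /orP[] /eqP -> [t /andP[t0 t1] /=]; rewrite EM => ->.
- exists (1 - t * p ^+ 4); last by rewrite /=; congr pair; rewrite /= /GRing.scale /=; ring.
  have : 0 <= t * p ^+ 4 by rewrite mulr_ge0 // e4; lra.
  have : t * p ^+ 4 <= 1 * 1 by apply: ler_pM => //; rewrite e4; lra.
  by lra.
- exists ((1 - t) * (1 - p ^+ 4)); last by rewrite /=; congr pair; rewrite /= /GRing.scale /=; ring.
  have : 0 <= (1 - t) * (1 - p ^+ 4) by rewrite mulr_ge0 // ?e4; lra.
  have : (1 - t) * (1 - p ^+ 4) <= 1 * 1 by apply: ler_pM => //; rewrite ?e4; clear a1 a2 e4; lra.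
  by lra.
Qed.

Lemma overlap_dec_sub e e' b b' : b \in dec e -> b' \in dec e' -> overlap b b' -> overlap e e'.
Proof.
move=> hb hb' [z [w [n [[? ?] [? ?]]]]]; exists z, w; split=> //.
by split; split; [apply: dec_segment hb _ | apply: dec_segment hb' _ | apply: dec_segment hb _ | apply: dec_segment hb' _].
Qed.

Lemma dec_overlap e b b' : b \in dec e -> b' \in dec e -> overlap b b' -> b = b'.
Proof.
have [/andP[a1 a2] /andP[b1 b2] _ e4] := psi_bounds R.
move: e => [[P Q] c]; rewrite /dec /=; case: ifP => _; last by rewrite !inE => /eqP -> /eqP ->.
have coord (x y t s u : R) : 0 <= t <= 1 -> 0 <= s <= 1 ->
    u = x + t * (x + p ^+ 4 * (y - x) - x) ->
    u = (x + p ^+ 4 * (y - x)) + s * (y - (x + p ^+ 4 * (y - x))) -> u = x + p ^+ 4 * (y - x).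
  move=> /andP[t0 t1] /andP[s0 s1] e1 e2.
  have m0 : 0 < p ^+ 4 by rewrite e4; lra.
  have m1 : p ^+ 4 < 1 by rewrite e4; lra.
  move: (p ^+ 4) m0 m1 e1 e2 => m m0 m1 e1 e2.
  have /eqP : (y - x) * (m * (1 - t) + s * (1 - m)) = 0 by lra.
  rewrite mulf_eq0 => /orP[/eqP h|/eqP h]; first by rewrite e1; nra.
  have h1 : 0 <= m * (1 - t) by apply: mulr_ge0; clear a1 a2 b1 b2 e1 e2 e4 h m1 s0 s1 t0; lra.
  have h2 : 0 <= s * (1 - m) by apply: mulr_ge0; clear a1 a2 b1 b2 e1 e2 e4 h h1 m0 s1 t0 t1; lra.
  have h3 : m * (1 - t) = 0 by lra.
  have /eqP := h3; rewrite mulf_eq0 (gt_eqF m0) /= => /eqP h4.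
  have -> : x + m * (y - x) = x + (1 - t + t) * (m * (y - x)) by rewrite subrK mul1r.
  by rewrite h4 e1; ring.
have meet z : arrow_segment ((Q, midpt P Q), 6%N) z -> arrow_segment ((midpt P Q, P), 4%N) z -> z = midpt P Q.
  move=> [t ht ez] [s hs ez']; have e1 := congr1 fst ez; have e2 := congr1 snd ez.
  have e1' := congr1 fst ez'; have e2' := congr1 snd ez'.
  rewrite /= /GRing.scale /= in e1 e2 e1' e2'.
  rewrite [z]surjective_pairing /midpt; congr pair; [exact: (coord _ _ _ _ _ ht hs e1 e1') | exact: (coord _ _ _ _ _ ht hs e2 e2')].
rewrite !inE => /orP[] /eqP -> /orP[] /eqP -> // [z [w [n [[z1 z2] [w1 w2]]]]]; case: n.
  by rewrite (meet _ z1 z2) (meet _ w1 w2).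
by rewrite (meet _ z2 z1) (meet _ w2 w1).
Qed.

Lemma app_half h z w : (((app h z).1 + (app h w).1) / 2, ((app h z).2 + (app h w).2) / 2) =
  app h ((z.1 + w.1) / 2, (z.2 + w.2) / 2).
Proof. by rewrite /app; congr pair; rewrite /=; field. Qed.

Definition expand d F : set (frame R) := [set h | exists f l k, [/\ F f, fr (tsize l (d / p)) f, kok l k & h = f ** kfr R k]].

Section One.
Variables (d : R) (F : set (frame R)) (C : set (plane R)).
Hypothesis AF : A2F (d / p) F C.

Let dp0 : 0 < d / p. Proof. by have [[]] := AF. Qed.
Let d0 : 0 < d. Proof. by move: dp0; rewrite pmulr_lgt0 // invr_gt0 psi_gt0. Qed.

Lemma size_ex f : F f -> exists l, fr (tsize l (d / p)) f.
Proof. by have [LF _ _ _] := AF; exact: fr_tsize. Qed.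

Lemma expand_eq f f' l l' k k' : F f -> F f' -> fr (tsize l (d / p)) f -> fr (tsize l' (d / p)) f' ->
  kok l k -> kok l' k' -> ov (f ** kfr R k) (f' ** kfr R k') -> f = f' /\ k = k'.
Proof.
move=> Ff Ff' hf hf' ok ok' [z [hz hz']]; have [[_ _ Fd] _ _ _] := AF.
have e : f = f'.
  by apply: Fd => //; exists z; split; [apply: kid_stile hf hz | apply: kid_stile hf' hz'].
split=> //; rewrite -{f' Ff'}e in hf' hz'.
have el := tsize_inj dp0 hf hf'; rewrite -{l'}el in hf' ok'.
move: hf ok ok' hz hz'; clear; case: l => /=; case: k => // hf _; case: k' => // _ hz hz'.
- by case: (son_daughter_disj hf); exists z.
- by case: (son_daughter_disj hf); exists z.
Qed.

Lemma expand_arrow f l k e : fr (tsize l (d / p)) f -> kok l k -> farr d (f ** kfr R k) e ->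
  exists2 i, (i < size (arrows (klarge k)))%N & e = map_arrow (app f) (karrow (k, i)).
Proof.
move=> hf ok /farr_nthP [l2 [i [h2 hi ->]]]; have hk := fr_kid hf ok.
have el := tsize_inj d0 h2 hk; rewrite el in hi *.
by exists i => //; rewrite /karrow -map_arrow_mul.
Qed.

Lemma overlap_map r f a b : fr r f -> overlap (map_arrow (app f) a) (map_arrow (app f) b) -> overlap a b.
Proof.
move=> hf [z [w [n [[z1 z2] [w1 w2]]]]]; exists (app (finv f) z), (app (finv f) w).
have S c u : arrow_segment (map_arrow (app f) c) u -> arrow_segment c (app (finv f) u).
  by move/(segment_app (finv f)); rewrite /= !(appVf _ hf).
split; last by split; split; exact: S.
by move=> e; apply: n; rewrite -(appfV z hf) e (appfV _ hf).
Qed.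

Lemma arrow_tile r f k i z : fr r f -> (i < size (arrows (klarge k)))%N ->
  arrow_segment (map_arrow (app f) (karrow (k, i))) z -> tile f z.
Proof.
move=> hf hi hz; have [a ha] := fr_kfr R k.
rewrite /karrow -map_arrow_mul /= in hz; apply: (kid_sub (k := k) hf).
have hfk := fr_mul hf ha; rewrite (tileP _ hfk); apply: (arrow_bee_sub hi).
by have := segment_app (finv (f ** kfr R k)) hz; rewrite /= !(appVf _ hfk).
Qed.

(** Within one coarse tile the arrow rule is that of siblings. For arrows in different coarse tiles,
    an inner arrow cannot take part in an overlap; the others are parts of coarse arrows, which
    overlap and hence coincide, and two overlapping parts of one arrow are equal. *)
Lemma expand_A2F : A2F d (expand d F) C.
Proof.
have [[_ Fs Fd] HA [f1 Ff1] cov] := AF.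
split.
- split=> // [_ [f [l [k [Ff hf ok ->]]]]|_ _ [f [l [k [Ff hf ok ->]]]] [f' [l' [k' [Ff' hf' ok' ->]]]] hov].
    by have := fr_kid hf ok; case: (klarge k); [left | right].
  by have [-> ->] := expand_eq Ff Ff' hf hf' ok ok' hov.
- move=> _ _ e e' [f [l [k [Ff hf ok ->]]]] [f' [l' [k' [Ff' hf' ok' ->]]]] n he he' ho.
  have [i hi ee] := expand_arrow hf ok he; have [i' hi' ee'] := expand_arrow hf' ok' he'.
  rewrite {he he'}ee {}ee' in ho *.
  have [eqf|nf] := pselect (f = f').
    rewrite -{f' Ff'}eqf in hf' n ho *; have el := tsize_inj dp0 hf hf'; rewrite -{l'}el in hf' ok'.
    have ho' := overlap_map hf ho; congr map_arrow.
    move: ok ok' n hi hi' ho'; case: l {hf hf'}; case: k {ho} => //= _; case: k' => //= _ n hi hi' ho'.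
    + exact: sibling_arrows.
    + have [z [w [nz [[? ?] [? ?]]]]] := ho'; apply/esym/sibling_arrows => //; exists z, w; split=> //.
  have inner2 g g' lg lg' kg kg' j j' : F g -> F g' -> g <> g' -> fr (tsize lg (d / p)) g -> fr (tsize lg' (d / p)) g' ->
      (j < size (arrows (klarge kg)))%N -> (j' < size (arrows (klarge kg')))%N ->
      overlap (map_arrow (app g) (karrow (kg, j))) (map_arrow (app g') (karrow (kg', j'))) -> internal kg j -> False.
    move=> Fg Fg' ng hg hg' hj hj' [z [w [nz [[z1 z2] [w1 w2]]]]] it.
    have S u : arrow_segment (map_arrow (app g) (karrow (kg, j))) u -> arrow_segment (karrow (kg, j)) (app (finv g) u).
      by move/(segment_app (finv g)); rewrite /= !(appVf _ hg).
    have nz' : app (finv g) z <> app (finv g) w.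
      by move=> eq; apply: nz; rewrite -(appfV z hg) eq (appfV _ hg).
    have := internal_mid it nz' (S _ z1) (S _ w1).
    rewrite app_half.
    move=> st; apply: ng; apply: Fd => //.
    have tm : tile g' ((z.1 + w.1) / 2, (z.2 + w.2) / 2).
      apply: (arrow_tile (k := kg') (i := j') hg' hj').
      apply: (segment_conv z2 w2 (l := 1 / 2)); first lra.
      by congr pair; field.
    by have [u [u1 u2]] := ov_tile hg' tm st; exists u.
  have [it|nt] := boolP (internal k i); first by case: (inner2 f f' l l' k k' i i').
  have [it'|nt'] := boolP (internal k' i').
    case: (inner2 f' f l' l k' k i' i) => //; first exact: nesym.
    exact: overlap_sym.
  have [j hj dj] := boundary_dec ok hi nt; have [j' hj' dj'] := boundary_dec ok' hi' nt'.
  have dE : map_arrow (app f) (karrow (k, i)) \in dec (map_arrow (app f) (nth darrow (arrows l) j)).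
    by rewrite dec_map; exact: map_f.
  have dE' : map_arrow (app f') (karrow (k', i')) \in dec (map_arrow (app f') (nth darrow (arrows l') j')).
    by rewrite dec_map; exact: map_f.
  have eE := HA _ _ _ _ Ff Ff' nf (farr_nth hf hj) (farr_nth hf' hj') (overlap_dec_sub dE dE' ho).
  by rewrite -eE in dE'; exact: dec_overlap dE dE' ho.
- have [l hl] := size_ex Ff1; have [k ok] : exists k, kok l k by case: (l); [exists Ksig | exists Ksame].
  by exists (f1 ** kfr R k), f1, l, k.
- move=> q; rewrite cov; split=> [[f Ff hq]|[_ [f [l [k [Ff hf ok ->]]]] hq]].
    have [l hl] := size_ex Ff; have [k ok hk] := kid_tile hl hq.
    by exists (f ** kfr R k) => //; exists f, l, k.
  by exists f => //; exact: kid_sub hf hq.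
Qed.

Lemma substitution_expand : substitution (d / p) (tset F) = tset (expand d F).
Proof.
have [[_ Fs Fd] HA [f1 Ff1] cov] := AF.
apply/seteqP; split=> K.
  case=> [[[g Gg <-] sm]|[_ [[g Gg <-] lg]]]; have [l hl] := size_ex Gg.
    have hs : fr (tsize false (d / p)) g by exact: (is_tile_frame hl sm).
    by exists g => //; exists g, false, Ksame; rewrite /= fmulf1.
  have hs : fr (tsize true (d / p)) g by exact: (is_tile_frame hl lg).
  case=> [/(is_sonP _ hl)|/(is_daughterP _ hl)] ->.
    by exists (g ** sig R) => //; exists g, true, Ksig.
  by exists (g ** del R) => //; exists g, true, Kdel.
move=> [_ [f [l [k [Ff hf ok ->]]]] <-].
case: k ok; case: l hf => //= hf _.
- by left; split; [exists f; rewrite // fmulf1 | apply/is_tileP; exists f; rewrite // fmulf1].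
- right; exists (tile f); split; [by exists f | by apply/is_tileP; exists f |].
  by left; apply/(is_sonP _ hf).
- right; exists (tile f); split; [by exists f | by apply/is_tileP; exists f |].
  by right; apply/(is_daughterP _ hf).
Qed.
End One.
End Expand.

(** * Tilings built from growing supertiles *)

Section Iterate.
Variable R : realType.
Local Notation p := (psi R).
Implicit Types (f g h m : frame R) (q z : plane R) (r d : R) (F : set (frame R)) (C : set (plane R)).

Fixpoint exps d n F : set (frame R) := if n is m.+1 then exps d m (expand (d / p ^+ m) F) else F.

Lemma exps_A2F d n F C : A2F (d / p ^+ n) F C -> A2F d (exps d n F) C.
Proof.
elim: n F => [|n IH] F; first by rewrite expr0 divr1.
by rewrite dpS => AF; apply: IH; exact: expand_A2F.
Qed.

Lemma exps_iter d n F C : A2F (d / p ^+ n) F C ->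
  iter_substitution n (d / p ^+ n) (tset F) = tset (exps d n F).
Proof.
elim: n F => [//|n IH] F AF /=; have AF' := AF; rewrite dpS in AF'.
rewrite dpM {1}dpS (substitution_expand AF'); apply: IH; exact: expand_A2F AF'.
Qed.

Lemma exps_mono d n F F' : F `<=` F' -> exps d n F `<=` exps d n F'.
Proof.
elim: n F F' => // n IH F F' sub; apply: IH => h [f [l [k [Ff hf ok ->]]]].
by exists f, l, k; split=> //; exact: sub.
Qed.

Lemma expand_mul d m F : fr 1 m -> expand d (fmul m @` F) = fmul m @` expand d F.
Proof.
move=> hm; apply/seteqP; split=> h.
  move=> [_ [l [k [[f Ff <-] hf ok ->]]]]; exists (f ** kfr R k); last by rewrite fmulA.
  exists f, l, k; split=> //; have := fr_mul (fr_inv hm) hf.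
  by rewrite (fmulVf _ hm) invr1 mul1r.
move=> [_ [f [l [k [Ff hf ok ->]]]] <-]; exists (m ** f), l, k; split; rewrite ?fmulA //.
by rewrite -[X in fr X]mul1r; exact: fr_mul.
Qed.

Lemma exps_mul d n m F : fr 1 m -> exps d n (fmul m @` F) = fmul m @` exps d n F.
Proof. by move=> hm; elim: n F => // n IH F /=; rewrite expand_mul // IH. Qed.

Lemma single_A2F d f : 0 < d -> fr d f \/ fr (p * d) f -> A2F d [set f] (tile f).
Proof.
move=> d0 hf; split; [split=> //| | by exists f |].
- by move=> _ ->.
- by move=> _ _ -> ->.
- by move=> _ _ e e' -> ->.
- by move=> q; split=> [hq|[_ -> //]]; exists f.
Qed.

(** The union of the supertiles of the [G n], defined from above and without reference to an
    existing tiling. *)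
Definition tower d (G : nat -> frame R) : set (frame R) := [set f | exists n, exps d n [set G n] f].

Section Tower.
Variables (d : R) (g : nat -> frame R) (l : nat -> bool) (k : nat -> kidk).
Hypotheses (d0 : 0 < d) (hg : forall n, fr (tsize (l n) (d / p ^+ n)) (g n))
  (ok : forall n, kok (l n.+1) (k n)) (gS : forall n, g n = g n.+1 ** kfr R (k n)).

Lemma tower_step n : exps d n [set g n] `<=` exps d n.+1 [set g n.+1].
Proof.
apply: exps_mono => _ ->; exists (g n.+1), (l n.+1), (k n); split=> //.
by rewrite -dpS; exact: hg.
Qed.

Lemma tower_le (m n : nat) : (m <= n)%N -> exps d m [set g m] `<=` exps d n [set g n].
Proof.
elim: n => [|n IH]; first by rewrite leqn0 => /eqP ->.
rewrite leq_eqVlt => /orP[/eqP -> //|]; rewrite ltnS => /IH h f /h; exact: tower_step.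
Qed.

(** The supertiles are nested, so a condition on two tiles can be checked in one supertile that
    contains both. *)
Lemma tower_A2F : A2F d (tower d g) [set q | exists n, tile (g n) q].
Proof.
have A n : A2F d (exps d n [set g n]) (tile (g n)).
  apply/exps_A2F/single_A2F; first by rewrite divr_gt0 // exprn_gt0 // psi_gt0.
  by have := hg n; case: (l n); [left | right].
split.
- split=> // [f [n hf]|f f' [n hf] [n' hf']].
    by have [[_ Fs _] _ _ _] := A n; exact: Fs.
  have [[_ _ Fd] _ _ _] := A (maxn n n'); apply: Fd.
    exact: tower_le (leq_maxl _ _) _ hf.
  exact: tower_le (leq_maxr _ _) _ hf'.
- move=> f f' e e' [n hf] [n' hf']; have [_ HA _ _] := A (maxn n n'); apply: HA.
    exact: tower_le (leq_maxl _ _) _ hf.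
  exact: tower_le (leq_maxr _ _) _ hf'.
- by exists (g 0%N), 0%N.
- move=> q; split=> [[n hq]|[f [n hf] hq]].
    by have [_ _ _ /(_ q)[/(_ hq) [f hf hfq] _]] := A n; exists f => //; exists n.
  by exists n; have [_ _ _ cov] := A n; apply/cov; exists f.
Qed.
End Tower.

Lemma tower_mul d m (g : nat -> frame R) : fr 1 m -> tower d (fun n => m ** g n) = fmul m @` tower d g.
Proof.
move=> hm; have E n : [set m ** g n] = fmul m @` [set g n] by rewrite image_set1.
apply/seteqP; split=> f.
  by move=> [n]; rewrite E exps_mul // => -[f' hf' <-]; exists f' => //; exists n.
by move=> [f' [n hf'] <-]; exists n; rewrite E exps_mul //; exists f'.
Qed.

(** A tiling exhausted by one chain is recovered from the chain alone, so such tilings can be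
    compared through their chains. *)
Lemma tower_chain d F C r h G : A2F d F C -> convexC C -> fr r h -> chain d F h G ->
  (forall f, F f -> inW G f) -> F = tower d G.
Proof.
move=> AF cvC hh hG all.
have [[d0 _ _] _ _ _] := AF.
have E n f : exps d n [set G n] f <-> F f /\ part f (G n).
  have [l hl] := lev_size AF cvC (hG n).1.
  have A1 : A2F (d / p ^+ n) [set G n] (tile (G n)).
    apply: single_A2F; first by rewrite divr_gt0 // exprn_gt0 // psi_gt0.
    by move: hl; case: (l); [left | right].
  have [[_ Fs _] _ _ _] := exps_A2F A1.
  have fre f' : exps d n [set G n] f' -> exists s, fr s f'.
    by move=> /Fs [?|?]; [exists d | exists (p * d)].
  have eT := exps_iter A1; rewrite (iter_frames AF cvC) in eT; last by move=> _ ->; exact: (hG n).1.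
  split=> [hf|[Ff fp]].
    have [s hs] := fre _ hf.
    have : tset (exps d n [set G n]) (tile f) by exists f.
    rewrite -eT => -[f' [Ff' [_ -> fp]] e]; have [s' hs'] := F_fr AF cvC Ff'.
    by rewrite -(tile_inj hs' hs e).
  have [s hs] := F_fr AF cvC Ff.
  have : tset [set f0 | F f0 /\ exists2 g, [set G n] g & part f0 g] (tile f) by exists f; rewrite //; split=> //; exists (G n).
  rewrite eT => -[f' hf' e]; have [s' hs'] := fre _ hf'.
  by rewrite -(tile_inj hs' hs e).
apply/seteqP; split=> f; first by move=> Ff; have [n fn] := all _ Ff; exists n; apply/E.
by move=> [n /E []].
Qed.
End Iterate.

(** * The three canonical corner chains *)

Section Corners.
Variable R : realType.
Local Notation p := (psi R).
Local Notation sig := (sig R).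
Local Notation del := (del R).
Implicit Types (f g h : frame R) (q z : plane R) (r d : R) (c : corner).

Lemma finv_finv r h : fr r h -> finv (finv h) = h.
Proof. by move=> hh; apply: (fmulfI (fr_inv hh)); rewrite (finvK hh) (finvKr (fr_inv hh)). Qed.

Lemma fr_cframe st c r : 0 < r -> fr r (cframe st c r).
Proof.
by move=> r0; case: st; case: c; split=> //; rewrite /cframe /sgb /=; ring.
Qed.

Lemma cframe_swap st c r : cframe st c r ** swap R = cframe (~~ st) c r.
Proof. by case: st; congr Frame; rewrite /cframe /=; ring. Qed.

Lemma germ_corner c : [/\ germ (csx c) (csy c) (cx R c) (cy R c), ~~ germ (csx c) (~~ csy c) (cx R c) (cy R c),
  ~~ germ (~~ csx c) (csy c) (cx R c) (cy R c) & ~~ germ (~~ csx c) (~~ csy c) (cx R c) (cy R c)].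
Proof.
have [/andP[a1 a2] /andP[b1 b2] /andP[c1 c2] e4] := psi_bounds R.
by rewrite /germ /inq; case: c => /=; clear e4; split; lra.
Qed.

Lemma cframe_hdir st c r : 0 < r -> [/\ hdir (cframe st c r), ~~ hdir (cframe st c r ** mirY R),
  ~~ hdir (cframe st c r ** mirX R) & ~~ hdir (cframe st c r ** mirXY R)].
Proof.
move=> r0; have [g1 g2 g3 g4] := germ_corner c.
have n1 := sgb_neq0 (csx c) r0; have n2 := sgb_neq0 (csy c) r0.
rewrite /hdir; case: st; rewrite /cframe /= !(mulr0, mul0r, addr0, mulr1, mulrN1, add0r) ?oppr0 ?lexpos0 ?lexposn0 ?oppr_eq0 //
  ?sgbN ?sgb_gt0 // ?sgb_neq0 //.
Qed.

(* The three possible corner tiles of a quadrant, encoded by [t < 3]: a large tile with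
   corner F, a large one with corner A, a small one with corner A. Composition runs
   through them cyclically. *)
Definition cty (t : nat) : corner := if t is 0%N then cF else cA.
Definition lty (t : nat) : bool := (t < 2)%N.
Definition kty (t : nat) : kidk := match t with 0%N => Ksig | 1%N => Ksame | _ => Kdel end.
Definition nty (t : nat) : nat := match t with 0%N => 1%N | 1%N => 2%N | _ => 0%N end.
Definition tys t n := iter n nty t.

(** The standard flag of the quadrant in the coordinates of the corner tile of level [n], so that
    climbing multiplies on the left; its inverse [gcan] is that tile itself. *)
Fixpoint hcan d t n : frame R :=
  if n is m.+1 then kfr R (kty (tys t m)) ** hcan d t m else cframe true (cty t) (tsize (lty t) d)^-1.

Lemma tys_lt t n : (t < 3)%N -> (tys t n < 3)%N.
Proof. by move=> h; elim: n => //= n; case: (tys t n) => [|[|[|]]]. Qed.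

Lemma tsize_gt0 l d : 0 < d -> 0 < tsize l d.
Proof. by case: l => // d0; rewrite mulr_gt0 // psi_gt0. Qed.

(** The son is turned by a right angle, so in phase 0 the horizontal and the vertical side change
    roles. *)
Lemma kfr_corner d t st : (t < 3)%N -> kfr R (kty t) ** cframe st (cty t) (tsize (lty t) d)^-1 =
  cframe (if t is 0%N then ~~ st else st) (cty (nty t)) (tsize (lty (nty t)) (d / p))^-1.
Proof.
have p0 := psi_neq0 R.
case: t => [|[|[|//]]] _ /=; rewrite /tsize /= ?fmul1f ?invfM ?invrK.
- by case: st; congr Frame; rewrite /cframe /sgb /=; ring.
- by rewrite mulrCA mulVf // mulr1.
- by move: (d^-1) => x; case: st; congr Frame; rewrite /cframe /sgb /=; field.
Qed.

Lemma hcan_form d t n : (t < 3)%N -> exists st, hcan d t n = cframe st (cty (tys t n)) (tsize (lty (tys t n)) (d / p ^+ n))^-1.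
Proof.
move=> t3; elim: n => [|n [st IH]]; first by exists true; rewrite /= expr0 divr1.
by rewrite /= IH kfr_corner ?tys_lt // -dpS; eexists.
Qed.

Lemma fr_hcan d t n : 0 < d -> (t < 3)%N -> fr (tsize (lty (tys t n)) (d / p ^+ n))^-1 (hcan d t n).
Proof.
move=> d0 t3; have [st ->] := hcan_form d n t3; apply: fr_cframe.
by rewrite invr_gt0 tsize_gt0 // divr_gt0 // exprn_gt0 // psi_gt0.
Qed.

Definition gcan d t n : frame R := finv (hcan d t n).

Section Canonical.
Variables (d : R) (t : nat).
Hypotheses (d0 : 0 < d) (t3 : (t < 3)%N).

Lemma gcan_size n : fr (tsize (lty (tys t n)) (d / p ^+ n)) (gcan d t n).
Proof. by rewrite -[X in fr X]invrK; exact: fr_inv (fr_hcan n d0 t3). Qed.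

Lemma gcan_ok n : kok (lty (tys t n.+1)) (kty (tys t n)).
Proof. by have := tys_lt n t3; rewrite /=; case: (tys t n) => [|[|[|]]]. Qed.

Lemma gcan_step n : gcan d t n = gcan d t n.+1 ** kfr R (kty (tys t n)).
Proof.
have h1 := fr_hcan n d0 t3; have h2 := fr_hcan n.+1 d0 t3.
by apply: (fmulIf h1); rewrite (finvK h1) -fmulA -[kfr _ _ ** _]/(hcan d t n.+1) (finvK h2).
Qed.

Lemma hcan_quadrant n q : bee (app (hcan d t n) q) -> 0 <= q.1 /\ 0 <= q.2.
Proof.
have [/andP[a1 a2] /andP[b1 b2] /andP[c1 c2] e4] := psi_bounds R.
have [st ->] := hcan_form d n t3.
have k0 : 0 < (tsize (lty (tys t n)) (d / p ^+ n))^-1.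
  by rewrite invr_gt0 tsize_gt0 // divr_gt0 // exprn_gt0 // psi_gt0.
move: (_^-1) k0 => k k0; case: q => x y /= hb.
suff : 0 <= k * x /\ 0 <= k * y by rewrite !pmulr_rge0.
move: hb; rewrite /cty /cframe /bee /setU /rect /app /sgb /=.
by case: (tys t n) => [|?]; case: st => /=; clear a1 a2 b1 c1 c2 d0 e4 k0 t3; lra.
Qed.

Lemma bee_hcan m n q : (m <= n)%N -> bee (app (hcan d t m) q) -> bee (app (hcan d t n) q).
Proof.
elim: n => [|n IH]; first by rewrite leqn0 => /eqP ->.
rewrite leq_eqVlt => /orP[/eqP -> //|]; rewrite ltnS => /IH h /h /=; rewrite app_mul.
case: (kty _) => /= hb; first by rewrite app_one.
  exact: (bee_kid true).
exact: (bee_kid false).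
Qed.

Lemma first_large : exists n0, tys t n0 = 0%N.
Proof. by case: t t3 => [|[|[|//]]] _; [exists 0%N | exists 2%N | exists 1%N]. Qed.

(** The corner flag runs along a side of every tile, so [boundary_region] applies. All tiles lie in
    the first quadrant, which leaves only the quadrant with apex 0 among its three shapes. *)
Lemma gcan_cover : quad (fone R) [set q | exists n, tile (gcan d t n) q].
Proof.
have [n0 hn0] := first_large.
(* From phase 0 on, son steps alternate with daughter steps, the latter including the level on which
   the large tile persists. *)
pose w k := ~~ odd k.
pose H := fix H k := if k is j.+1 then (if w j then sig else del) ** H j else hcan d t n0.
have HE k : exists m, [/\ (k <= m)%N, H k = hcan d t m & tys t m = odd k].
  elim: k => [|k [m [km e ht]]]; first by exists n0.
  rewrite /= e /w; case: (odd k) ht => /= ht.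
    by exists m.+2; split; [exact: leqW | rewrite /= ht /= fmul1f | rewrite /= ht].
  by exists m.+1; rewrite /= ht; split.
have Hb k : bdry (H k).
  have [m [_ -> _]] := HE k; have [st ->] := hcan_form d m t3.
  have k0 : 0 < (tsize (lty (tys t m)) (d / p ^+ m))^-1.
    by rewrite invr_gt0 tsize_gt0 // divr_gt0 // exprn_gt0 // psi_gt0.
  by have [h1 h2 _ _] := cframe_hdir st (cty (tys t m)) k0; split.
have H0 : exists r, fr r (H 0%N) by exists (tsize (lty (tys t n0)) (d / p ^+ n0))^-1; exact: fr_hcan.
have HS k : H k.+1 = (if w k then sig else del) ** H k by [].
have E q : (exists n, tile (gcan d t n) q) <-> seqW H q.
  have T n : tile (gcan d t n) q <-> bee (app (hcan d t n) q).
    by rewrite (tileP _ (gcan_size n)) /gcan (finv_finv (fr_hcan n d0 t3)).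
  split=> [[n /T hn]|[k]]; last by have [m [_ -> _]] := HE k => hm; exists m; apply/T.
  by have [m [nm e _]] := HE n; exists n; rewrite e; exact: bee_hcan nm hn.
have sub q : seqW H q -> 0 <= q.1 /\ 0 <= q.2.
  by move=> [k]; have [m [_ -> _]] := HE k; exact: hcan_quadrant.
move=> q; rewrite app_one /= E.
case: (boundary_region HS H0 Hb) => [e|[[a a0 e]|[b b0 e]]].
- have /sub /= : seqW H (-1, 0) by rewrite e /=.
  by rewrite oppr_ge0 ler10 => -[].
- have ez : a = 0.
    have /sub /= [h _] : seqW H (a, 0) by rewrite e /=.
    by apply/le_anti; rewrite a0.
  by rewrite e ez.
- have /sub /= : seqW H (-1, 0) by rewrite e /=; split=> //; lra.
  by rewrite oppr_ge0 ler10 => -[].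
Qed.
End Canonical.
End Corners.

(** * Every quadrant tiling is congruent to a canonical one *)

Section QuadrantTilings.
Variable R : realType.
Local Notation p := (psi R).
Implicit Types (f g h : frame R) (q z : plane R) (r d : R) (c : corner) (T : tileset R).

Lemma quad_unit s f A : fr s f -> quad f A -> exists2 g, fr 1 g & quad g A.
Proof.
move=> hf hA; have [s0 _ _ _] := hf; have s1 : 0 < s^-1 by rewrite invr_gt0.
have hk : fr s^-1 (Frame 0 0 s^-1 0 0 s^-1 : frame R) by split; rewrite /= //; ring.
exists (f ** Frame 0 0 s^-1 0 0 s^-1).
  by have := fr_mul hf hk; rewrite divff // gt_eqF.
move=> q; rewrite app_mul hA /= !mul0r !addr0 !add0r.
by rewrite !pmulr_rge0.
Qed.

(** The convex corner of the parent at the place of the corner [c] of its child of kind [k]; [None]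
    if there is no convex corner there. *)
Definition cnext (k : kidk) c : option corner :=
  match k, c with
  | Ksame, _ => Some c
  | Ksig, cA => Some cB | Ksig, cB => Some cC | Ksig, cF => Some cA
  | Kdel, cA => Some cF | Kdel, cB => Some cE
  | _, _ => None end.

Lemma kfr_cframe k st c r st' c' r' : kfr R k ** cframe st c r = cframe st' c' r' -> cnext k c = Some c'.
Proof.
have [/andP[a1 a2] /andP[b1 b2] /andP[c1 c2] e4] := psi_bounds R.
have e5 : p ^+ 5 = p - p ^+ 3 by ring: e4.
move=> e; have ex := congr1 (@ox R) e; have ey := congr1 (@oy R) e; clear e; move: ex ey.
have -> : ox (kfr R k ** cframe st c r) = ox (kfr R k) + ux (kfr R k) * cx R c + vx (kfr R k) * cy R c by case: st.
have -> : oy (kfr R k ** cframe st c r) = oy (kfr R k) + uy (kfr R k) * cx R c + vy (kfr R k) * cy R c by case: st.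
have -> : ox (cframe st' c' r') = cx R c' by case: st'.
have -> : oy (cframe st' c' r') = cy R c' by case: st'.
clear -a1 a2 b1 b2 c1 c2 e4 e5; case: k.
- by case: c; case: c' => //=; rewrite ?(mul0r, mulr0, addr0, add0r, mulr1, mul1r) => ex ey; exfalso; clear e4 e5;
    clear a2 c2; lra.
- case: c => /=; rewrite ?(mul0r, mulr0, addr0, add0r, mulr1, mul1r).
  + by case: c' => //= ex ey; exfalso; clear e4 e5; clear a2 b2 c1 c2; lra.
  + by case: c' => //= ex ey; exfalso; clear e4 e5; clear a1 a2 c1 c2 ex; lra.
  + by case: c' => //= ex ey; exfalso; clear a1 a2 c2 e4 e5; lra.
  + by case: c' => //= ex ey; exfalso; clear a1 a2 c2 e5; lra.
  + by rewrite subrr; case: c' => //= ex ey; exfalso; clear e4 e5; move: ex ey; clear -a1 b1 c1; lra.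
- case: c => /=; rewrite ?(mul0r, mulr0, addr0, add0r, mulr1, mul1r).
  + by case: c' => //= ex ey; exfalso; clear e4 e5; clear a1 a2 b1 c2; lra.
  + by case: c' => //= ex ey; exfalso; clear e4 e5; clear a1 a2 b1 c2; lra.
  + by case: c' => //= ex ey; exfalso; clear a2 e5; lra.
  + by case: c' => //= ex ey; exfalso; clear a1 a2 c2 e4; lra.
  + by case: c' => //= ex ey; exfalso; clear e4 e5; clear a1 a2 c2; lra.
Qed.

(** A finite check: five climbing steps eliminate every combination of kind and corner outside the
    cycle of length three. *)
Lemma corner_alive (k1 k2 k3 k4 k5 : kidk) c0 c1 c2 c3 c4 c5 :
  cnext k1 c0 = Some c1 -> cnext k2 c1 = Some c2 -> cnext k3 c2 = Some c3 -> cnext k4 c3 = Some c4 ->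
  cnext k5 c4 = Some c5 -> kok (klarge k2) k1 -> kok (klarge k3) k2 -> kok (klarge k4) k3 -> kok (klarge k5) k4 ->
  exists t, [/\ (t < 3)%N, klarge k1 = lty t, c0 = cty t & k1 = kty t].
Proof.
case: k1; case: c0 => //= -[<-]; case: k2 => //= -[<-]; case: k3 => //= -[<-]; case: k4 => //= -[<-];
 case: k5 => //= _ _ _ _ _; first [by exists 0%N | by exists 1%N | by exists 2%N].
Qed.

Lemma nty_uniq t t' : (t < 3)%N -> (t' < 3)%N -> kok (lty t') (kty t) -> cnext (kty t) (cty t) = Some (cty t') -> t' = nty t.
Proof. by case: t => [|[|[|//]]] _; case: t' => [|[|[|//]]] _. Qed.

Definition canonical d t : tileset R := tset (tower d (gcan d t)).

Lemma canonical_A2F d t : 0 < d -> (t < 3)%N ->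
  exists C, [/\ A2F d (tower d (gcan d t)) C, quad (fone R) C & covered (canonical d t) = C].
Proof.
move=> d0 t3; exists [set q | exists n, tile (gcan d t n) q].
have AF := tower_A2F d0 (gcan_size d0 t3) (gcan_ok t3) (gcan_step d0 t3).
by split=> //; [exact: gcan_cover | exact: (frames_A2 AF).2].
Qed.

Lemma canonical_quadrant d t : 0 < d -> (t < 3)%N -> A2_d_tiling d (canonical d t) /\ quadrant (covered (canonical d t)).
Proof.
move=> d0 t3; have [C [AF hC eC]] := canonical_A2F d0 t3; rewrite eC; split; first exact: (frames_A2 AF).1.
by apply/quadrantP; exists 1, (fone R); split=> //; exact: fr_one.
Qed.

Lemma image_tset g (F : set (frame R)) : image_tiling (app g) (tset F) = tset (fmul g @` F).
Proof.
have tm f : app g @` tile f = tile (g ** f).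
  by rewrite /tile image_comp; congr (_ @` _); apply/funext => q; rewrite app_mul.
apply/seteqP; split=> H.
  by move=> [_ [f Ff <-] <-]; exists (g ** f); [exists f | rewrite tm].
by move=> [_ [f Ff <-] <-]; exists (tile f); [exists f | rewrite tm].
Qed.

Lemma isometry_frame g : fr 1 g -> Defs.isometry (app g).
Proof. by move=> /similarity_frame [_ h] q z; rewrite h mul1r. Qed.

(** The other three right angles at the apex are outside the quadrant, so on every level a convex
    corner of a tile sits at the apex. By [corner_alive] its kinds follow the cycle, which
    determines the whole chain up to the isometry [f']. *)
Lemma quadrant_canonical d T : A2_d_tiling d T -> quadrant (covered T) ->
  exists2 t, (t < 3)%N & congruent T (canonical d t).
Proof.
move=> AT QT; have [oc _] := quadrant_infinite AT QT; have [AF eT] := A2_frames AT.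
have [s0 [f0 [hf0 hC0]]] := (quadrantP _).1 QT; have cvC := convexC_quad hf0 hC0.
have [f hf hC] := quad_unit hf0 hC0.
have d0 : 0 < d by have [[]] := AF.
have inC : inside (covered T) f.
  by apply: inside_lt => x /andP[x0 x1]; apply/hC; rewrite /= exprn_ge0 ltW.
have [G hG] := chain_ex AF cvC hf inC; have all := one_class_any AF cvC oc hf hG.
have out m : fr 1 m -> (forall t : R, 0 < t -> (app m (t, t ^+ 2)).1 < 0 \/ (app m (t, t ^+ 2)).2 < 0) ->
    forall n, ~~ D (G n) (f ** m).
  move=> hm neg n; apply/negP => Dn; have hfm := fr_mul hf hm.
  have [t [ht [t0 _]]] := filter_ex (filterI (D_inside AF cvC (hG n).1 hfm Dn) (near0_small (ltr01 : (0 : R) < 1))).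
  move: ht; rewrite app_mul => /hC [h1 h2]; have := neg t t0.
  by rewrite !ltNge h1 h2 => -[].
have nY n : ~~ D (G n) (f ** mirY R).
  apply: (out _ (fr_mirY R)) => t t0; right; rewrite /= !mul0r !add0r mulN1r oppr_lt0 exprn_gt0 //.
have nX n : ~~ D (G n) (f ** mirX R).
  by apply: (out _ (fr_mirX R)) => t t0; left; rewrite /= !mul0r !addr0 add0r mulN1r oppr_lt0.
have nXY n : ~~ D (G n) (f ** mirXY R).
  by apply: (out _ (fr_mirXY R)) => t t0; left; rewrite /= !mul0r !addr0 add0r mulN1r oppr_lt0.
have form n r : fr r (G n) -> exists st c, finv (G n) ** f = cframe st c (r^-1 * 1).
  move=> hr; have hh := fr_mul (fr_inv hr) hf.
  by apply: (corner_form hh (hG n).2); rewrite -fmulA; [exact: nY | exact: nX | exact: nXY].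
have [K hK] : exists K : nat -> kidk, forall n, exists l,
    [/\ fr (tsize l (d / p ^+ n.+1)) (G n.+1), kok l (K n) & G n = G n.+1 ** kfr R (K n)].
  have ex n : exists k, exists l, [/\ fr (tsize l (d / p ^+ n.+1)) (G n.+1), kok l k & G n = G n.+1 ** kfr R k].
    by have [l [k [_ ? ? ?]]] := chain_kid AF cvC hf hG n; exists k, l.
  by have [K hK] := choice ex; exists K.
have sz n : fr (tsize (klarge (K n)) (d / p ^+ n)) (G n).
  have [l [hl ok e]] := hK n; have hk := fr_kid (d := d / p ^+ n) _ ok; rewrite -dpS in hk; have {}hk := hk _ hl.
  by rewrite -e in hk.
have ok n : kok (klarge (K n.+1)) (K n).
  by have [l [hl ok e]] := hK n; rewrite (tsize_inj (lev_pos AF cvC n.+1) (sz n.+1) hl).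
have HS n : finv (G n.+1) ** f = kfr R (K n) ** (finv (G n) ** f).
  by have [l [hl _ e]] := hK n; exact: finv_step (sz n) hl e.
have [st hst] := choice (fun n => form n _ (sz n)).
have [c hc] := choice hst.
have cn n : cnext (K n) (c n) = Some (c n.+1).
  by apply: (kfr_cframe (st := st n) (r := (tsize (klarge (K n)) (d / p ^+ n))^-1 * 1)); rewrite -hc -HS hc.
have ty n : exists t, [/\ (t < 3)%N, klarge (K n) = lty t, c n = cty t & K n = kty t].
  by apply: (corner_alive (cn n) (cn n.+1) (cn n.+2) (cn n.+3) (cn n.+4)).
have [t [t3 l0 c0 k0]] := ty 0%N.
have tyn n : [/\ klarge (K n) = lty (tys t n), c n = cty (tys t n) & K n = kty (tys t n)].
  elim: n => [|n [e1 e2 e3]]; first by split.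
  have [t' [t3' e1' e2' e3']] := ty n.+1.
  suff -> : tys t n.+1 = t' by split.
  apply/esym/nty_uniq => //; first exact: tys_lt.
    by rewrite -e1' -e3; exact: ok.
  by rewrite -e3 -e2 -e2'; exact: cn.
exists t => //.
(* The canonical flag starts along the horizontal side of the corner tile; [swap] normalises the
   other position. *)
pose f' := if st 0%N then f else f ** swap R.
have hf' : fr 1 f' by rewrite /f'; case: (st 0%N) => //; have := fr_mul hf (fr_swap R); rewrite mulr1.
have H n : finv (G n) ** f' = hcan d t n.
  elim: n => [|n IH].
    have e : finv (G 0%N) ** f = cframe (st 0%N) (cty t) (tsize (lty t) d)^-1.
      by rewrite hc l0 c0 mulr1 expr0 divr1.
    rewrite /f' /=; case: (st 0%N) e => e; first exact: e.
    by rewrite fmulA e cframe_swap.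
  have [_ _ e3] := tyn n; have [l [hl _ e]] := hK n.
  rewrite [RHS]/= -e3 -IH; exact: finv_step (sz n) hl e.
have EG : G = fun n => f' ** gcan d t n.
  apply/funext => n; have hh := fr_mul (fr_inv (sz n)) hf'.
  by apply: (fmulIf hh); rewrite (fmulfV _ (sz n)) /gcan -(H n) -fmulA (finvK hh) fmulf1.
exists (app f'); first exact: isometry_frame.
rewrite /canonical image_tset -(tower_mul _ _ hf') -EG {1}eT.
by rewrite {1}(tower_chain AF cvC hf hG all).
Qed.
End QuadrantTilings.

(** * The canonical tilings are pairwise not congruent *)

Section Distinct.
Variable R : realType.
Local Notation p := (psi R).
Implicit Types (f g h : frame R) (q z : plane R) (r d : R) (T : tileset R).

Lemma quad_frames h A : fr 1 h -> quad (fone R) A -> quad h A -> h = fone R \/ h = swap R.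
Proof.
move=> hh h1 h2.
have E q : 0 <= q.1 /\ 0 <= q.2 <-> 0 <= (app h q).1 /\ 0 <= (app h q).2.
  by rewrite -h2 -(h1 (app h q)) app_one.
have k (x y : R) : 0 <= x -> 0 <= y -> 0 <= ox h + ux h * x + vx h * y /\ 0 <= oy h + uy h * x + vy h * y.
  by move=> x0 y0; exact: ((E (x, y)).1 (conj x0 y0)).
have u1 : 0 <= ux h by apply: (@linear_pos _ (ox h)) => x x0; have [+ _] := k x 0 x0 (lexx _); rewrite mulr0 addr0.
have u2 : 0 <= uy h by apply: (@linear_pos _ (oy h)) => x x0; have [_ +] := k x 0 x0 (lexx _); rewrite mulr0 addr0.
have v1 : 0 <= vx h by apply: (@linear_pos _ (ox h)) => x x0; have [+ _] := k 0 x (lexx _) x0; rewrite mulr0 addr0.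
have v2 : 0 <= vy h by apply: (@linear_pos _ (oy h)) => x x0; have [_ +] := k 0 x (lexx _) x0; rewrite mulr0 addr0.
have [x1 x2] := k 0 0 (lexx _) (lexx _); rewrite !mulr0 !addr0 in x1 x2.
have inv q : 0 <= (app h q).1 -> 0 <= (app h q).2 -> 0 <= q.1 /\ 0 <= q.2.
  by move=> q1 q2; apply/E.
have [_ hu hv huv] := hh; rewrite expr1n in hu hv; have o := fr_orient hh.
move: h {E k hh h2} u1 u2 v1 v2 x1 x2 inv hu hv huv o => [a b c e s t] /= u1 u2 v1 v2 x1 x2 inv hu hv huv o.
have cs0 := mulr_ge0 u1 v1; have et0 := mulr_ge0 u2 v2.
have one (x : R) : 0 <= x -> x ^+ 2 = 1 -> x = 1.
  by move=> x0 /eqP; rewrite sqrf_eq1 => /orP[/eqP //|/eqP e1]; move: x0; rewrite e1 oppr_ge0 ler10.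
case: o => -[es et].
  have e0 : e = 0 by lra.
  rewrite e0 expr0n addr0 in hu; rewrite es e0 et in inv *; rewrite (one _ u1 hu) in inv *; left.
  have [] := inv (- a, - b); rewrite ?oppr0 /=; [lra | lra |].
  by rewrite !oppr_ge0 => a0 b0; congr Frame; clear cs0 e0 es et et0 hu huv hv one u1 u2 v1 v2; lra.
have c0 : c = 0 by lra.
rewrite c0 expr0n add0r in hu; rewrite es et c0 in inv *; rewrite (one _ u2 hu) in inv *; right.
have [] := inv (- b, - a); rewrite ?oppr0 /=; [lra | lra |].
by rewrite !oppr_ge0 => a0 b0; congr Frame; clear c0 cs0 es et et0 hu huv hv one u1 u2 v1 v2; lra.
Qed.

(** A congruence preserves the quadrant, so it is the identity or [swap], and it carries one apex
    tile to the other. [swap] would exchange the horizontal and vertical sides at the apex. For the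
    identity, the size and the corner of the apex tile give the phase. *)
Lemma canonical_distinct d t t' : 0 < d -> (t < 3)%N -> (t' < 3)%N -> congruent (canonical d t) (canonical d t') -> t = t'.
Proof.
have [/andP[a1 a2] _ _ _] := psi_bounds R.
move=> d0 t3 t3' [f hf e].
have [C [AF hC eC]] := canonical_A2F d0 t3; have [C' [AF' hC' eC']] := canonical_A2F d0 t3'.
have cv := convexC_quad (fr_one R) hC; have cv' := convexC_quad (fr_one R) hC'.
have [|m [hm em]] := frame_similarity (r := 1) (f := f); first by split=> // q z; rewrite mul1r; exact: hf.
rewrite em /canonical image_tset in e.
set F := tower d (gcan d t) in AF e; set F' := tower d (gcan d t') in AF' e.
have sub g : F' g -> F (m ** g).
  move=> Fg; have : tset F (tile (m ** g)) by rewrite e; exists (m ** g) => //; exists g.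
  move=> [g2 Fg2 e2]; have [r hr] := F_fr AF cv Fg2; have [s hs] := F_fr AF' cv' Fg.
  by rewrite -(tile_inj hr (fr_mul hm hs) e2).
have EC q : C (app m q) <-> C' q.
  have [_ _ _ cov] := AF; have [_ _ _ cov'] := AF'; rewrite cov cov'; split=> [[g Fg hq]|[g Fg [z hz <-]]]; last first.
    by exists (m ** g); [exact: sub | exists z; rewrite // app_mul].
  have : tset (fmul m @` F') (tile g) by rewrite -e; exists g.
  move=> [_ [g2 Fg2 <-] e2]; exists g2 => //; move: hq; rewrite -e2 => -[z hz].
  by rewrite app_mul => /(app_inj hm) <-; exists z.
have hCm : quad m C.
  by move=> q; rewrite EC -[q in C' q]app_one; exact: hC'.
have F0 : F (gcan d t 0) by exists 0%N.
have F0' : F' (gcan d t' 0) by exists 0%N.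
have hH := fr_hcan 0 d0 t3; have hH' := fr_hcan 0 d0 t3'.
have k0 u : 0 < (tsize (lty u) d)^-1 by rewrite invr_gt0 tsize_gt0.
have D0 : D (gcan d t 0) (fone R).
  by rewrite /D /gcan (finv_finv hH) fmulf1; have [] := cframe_hdir true (cty t) (k0 t).
have D0' : D (m ** gcan d t' 0) m.
  have hg := gcan_size d0 t3' 0; have -> : D (m ** gcan d t' 0) m = hdir (hcan d t' 0); last first.
    by have [] := cframe_hdir true (cty t') (k0 t').
  rewrite /D; congr hdir; apply: (fmulfI (fr_mul hm hg)); rewrite (fmulfV _ (fr_mul hm hg)).
  by rewrite -fmulA /gcan (finvK hH') fmulf1.
have hg := gcan_size d0 t3 0; have hg' := gcan_size d0 t3' 0.
have i1 := fr_one R.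
have eq0 : gcan d t 0 = m ** gcan d t' 0.
  apply: (F_eq AF cv F0 (sub _ F0')).
  case: (quad_frames hm hC hCm) => em'; rewrite em' in D0' *.
    by rewrite em' in hm; exact: (D_ov hg (fr_mul hm hg') i1 D0 D0').
  rewrite em' in hm; apply: (D_ov hg (fr_mul hm hg') hm _ D0').
  rewrite /D /gcan (finv_finv hH) (hdir_swap hH); first by have [] := cframe_hdir true (cty t) (k0 t).
  by left; rewrite /= /cframe /=.
have eH : hcan d t 0 ** m = hcan d t' 0.
  apply: (fmulfI hg); rewrite fmulA /gcan (finvK hH) fmul1f -/(gcan d t 0) eq0.
  by rewrite -fmulA /gcan (finvK hH') fmulf1.
move: eH; rewrite -[hcan d t 0]/(cframe true (cty t) (tsize (lty t) d)^-1) -[hcan d t' 0]/(cframe true (cty t') (tsize (lty t') d)^-1).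
case: (quad_frames hm hC hCm) => em''; rewrite em''; last first.
  rewrite cframe_swap => eH; have := congr1 (@ux R) eH; rewrite /cframe /= => /esym/eqP.
  by rewrite mulf_eq0 (gt_eqF (k0 t')) /=; case: (cty t') => /=; rewrite /sgb ?oppr_eq0 oner_eq0.
rewrite fmulf1 => eH.
have ey : cy R (cty t) = cy R (cty t') := congr1 (@oy R) eH.
have ex : csx (cty t) = true /\ csx (cty t') = true by case: (t) (t') => [|?] [|?].
have er : (tsize (lty t) d)^-1 = (tsize (lty t') d)^-1.
  by have := congr1 (@ux R) eH; rewrite /cframe /= ex.1 ex.2 /sgb !mulr1.
have el : tsize (lty t) d = tsize (lty t') d by rewrite -[LHS]invrK er invrK.
have pd : p * d < d by rewrite gtr_pMl //; lra.
move: t3 t3' ey el; clear -pd; case: t => [|[|[|//]]] _; case: t' => [|[|[|//]]] _ //= ey el; exfalso; rewrite /tsize /= in el; lra.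
Qed.
End Distinct.

Theorem theorem3 (R : realType) :
  (forall T : tileset R, A2_tiling T -> convex_set (covered T) ->
     [\/ covered T = setT, half_plane (covered T) | quadrant (covered T)])
  /\
  (forall T : tileset R, A2_tiling T -> covered T = setT ->
     (infinite_supertile T \/
      exists T1 T2, A2_decomposition (@half_plane R) T T1 T2) /\
     (forall T1 T2, A2_decomposition (@half_plane R) T T1 T2 ->
        mirror_images T1 T2))
  /\
  (forall T : tileset R, A2_tiling T -> half_plane (covered T) ->
     (infinite_supertile T \/
      exists T1 T2, A2_decomposition (@quadrant R) T T1 T2) /\
     (forall T1 T2, A2_decomposition (@quadrant R) T T1 T2 ->
        mirror_images T1 T2))
  /\
  (forall d : R, 0 < d ->
     (exists Q : 'I_3 -> tileset R,
        [/\ forall i, A2_d_tiling d (Q i) /\ quadrant (covered (Q i)),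
            forall i j, congruent (Q i) (Q j) -> i = j &
            forall T : tileset R, A2_d_tiling d T -> quadrant (covered T) ->
              exists i, congruent T (Q i)]) /\
     (forall T : tileset R, A2_d_tiling d T -> quadrant (covered T) ->
        infinite_supertile T)).
Proof.
split; first by move=> T [d AT] cv; exact: (shape_of AT (convex_convexC cv)).
split; first by move=> T [d AT] full; split=> [|T1 T2]; [exact: (plane_split AT full) | exact: (plane_mirror AT full)].
split; first by move=> T [d AT] hp; split=> [|T1 T2]; [exact: (half_plane_split AT hp) | exact: (half_mirror AT hp)].
move=> d d0; split=> [|T AT qT]; last by have [] := quadrant_infinite AT qT.
exists (fun i => canonical d (val i)); split=> [i|i j e|T AT qT].
- exact: (canonical_quadrant d0 (ltn_ord i)).
- by apply: val_inj; exact: (canonical_distinct d0 (ltn_ord i) (ltn_ord j) e).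
- by have [t t3 e] := quadrant_canonical AT qT; exists (Ordinal t3).
Qed.
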